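(* Let $\omega_1\in H^1(\Omega)$ with $\omega_1=0$ on $S_2$, and let $\psi_1$ be a weak solution to the problem $$-\Delta\psi_1-\frac{2}{r}\psi_{1,r}=\omega_1\ \text{ in }\Omega,\qquad \psi_1=0\ \text{ on }S.$$ Let $K=K(r)$, $r\ge0$, be a smooth function with compact support such that $\lim_{r\to0^+}K(r)/r^2=c_0<\infty$, and define $$\eta(r,z)=-\int_0^r(r-\tau)\Big(\frac{3}{\tau}\psi_{1,\tau}(\tau,z)+\psi_{1,zz}(\tau,z)+\omega_1(\tau,z)\Big)(1+K(\tau))\,d\tau .$$ Then $$\int_{-a}^{a}\|\psi_1-\psi_1(0)-\eta\|_{H^3_0(0,R)}^2\,dz+\int_{-a}^{a}\int_0^R\big(|\psi_{1,zzz}|^2+|\psi_{1,zzr}|^2+|\psi_{1,zz}|^2\big)\,r\,dr\,dz\le c\,\|\omega_1\|_{H^1(\Omega)}^2,$$ where $\psi_1(0)=\psi_1|_{r=0}$ (a function of $z$) and $c$ is a constant independent of $\psi_1$ and $\omega_1$.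
   Context: Let $a,R>0$. $\Omega=\{x\in\mathbb{R}^3: r<R,\ |z|<a\}$ is a bounded cylinder in cylindrical coordinates $(r,\varphi,z)$, with boundary $S=S_1\cup S_2$, $S_1=\{r=R,\ |z|<a\}$, $S_2=\{r<R,\ z\in\{-a,a\}\}$. All functions are real-valued and axially symmetric, i.e. functions of $(r,z)$ only, so $\Omega$ is identified with $(0,R)\times(-a,a)$ and $dx=r\,dr\,dz$. Subscripts after a comma denote partial derivatives ($\psi_{1,\tau}(\tau,z)$ is the derivative in the radial variable), and $\Delta=\partial_r^2+\frac1r\partial_r+\partial_z^2$. $H^1(\Omega)$ is the usual Sobolev space: $u,u_{,r},u_{,z}\in L_2$ with respect to $r\,dr\,dz$. A weak solution is a function $\psi_1\in H^1(\Omega)$ with zero trace on $S$ for which the equation holds in the sense of distributions in the open rectangle $(0,R)\times(-a,a)$. $H^3_0(0,R)$ is a weighted Sobolev space with weight exponent $\mu=0$ (not a space of functions with zero traces): $$\|v\|_{H^3_0(0,R)}^2=\sum_{i=0}^3\int_0^R|\partial_r^i v|^2\,r^{2(i-3)}\,r\,dr.$$ *)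

(* Defs.v *)
From HB Require Import structures.
From mathcomp Require Import all_boot all_order all_algebra.
From mathcomp Require Import all_classical all_reals all_analysis.

Set Implicit Arguments.
Unset Strict Implicit.
Unset Printing Implicit Defensive.

Import Order.TTheory GRing.Theory Num.Theory.
Import numFieldNormedType.Exports.

Local Open Scope classical_set_scope.
Local Open Scope ring_scope.

(* Axially symmetric functions are functions [u : R * R -> R] of x = (r, z).
   [rad] and [a] are the radius and the half-height of the cylinder. *)

Section Smooth.
Context {R : realType} {V : normedModType R}.

Definition iter_deriv (s : seq V) (f : V -> R) : V -> R :=
  foldr (fun v g => fun x => 'D_v g x) f s.

Definition smooth (f : V -> R) : Prop :=
  forall (s : seq V) (x : V), differentiable (iter_deriv s f) x.

Definition test_fun (U : set V) (phi : V -> R) : Prop :=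
  smooth phi /\
  exists C : set V, [/\ compact C, C `<=` U & forall x, ~ C x -> phi x = 0].

End Smooth.

(* C^infinity on the closed half-line, through interior derivatives that have
   finite limits at 0; the values of [K] on the negative axis are irrelevant. *)
Definition smooth_halfline {R : realType} (K : R -> R) : Prop :=
  (K r @[r --> 0^'+] --> K 0) /\
  forall k : nat,
    (forall r : R, 0 < r -> derivable (derive1n k K) r 1) /\
    (exists l : R, derive1n k K r @[r --> 0^'+] --> l).

Section WeakDerivatives.
Context {R : realType}.

Definition mu1 : {measure set (measurableTypeR R) -> \bar R} :=
  @lebesgue_measure R.

Definition mu2 : {measure set (measurableTypeR R * measurableTypeR R) -> \bar R}
  := (@lebesgue_measure R \x @lebesgue_measure R)%E.

Definition weak_deriv1 (I : set R) (n : nat) (u v : R -> R) : Prop :=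
  [/\ locally_integrable I u, locally_integrable I v &
      forall phi : R -> R, test_fun I phi ->
        \int[mu1]_(x in I) (u x * iter_deriv (nseq n (1 : R)) phi (x : R)) =
        (-1) ^+ n * \int[mu1]_(x in I) (v x * phi x)].

(* Two-dimensional counterpart of the library's [locally_integrable]. *)
Definition locally_integrable2 (U : set (R * R)) (u : R * R -> R) : Prop :=
  [/\ measurable_fun U u, open U &
      forall C : set (R * R), C `<=` U -> compact C ->
        (\int[mu2]_(x in C) `|u x|%:E < +oo)%E].

Definition er : R * R := (1, 0).
Definition ez : R * R := (0, 1).

(* [v] is the weak derivative of [u] in [U] along the directions listed in
   [s], with respect to dr dz. *)
Definition weak_deriv2 (U : set (R * R)) (s : seq (R * R))
    (u v : R * R -> R) : Prop :=
  [/\ locally_integrable2 U u, locally_integrable2 U v &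
      forall phi : R * R -> R, test_fun U phi ->
        \int[mu2]_(x in U) (u x * iter_deriv s phi x) =
        (-1) ^+ size s * \int[mu2]_(x in U) (v x * phi x)].

End WeakDerivatives.

Section Cylinder.
Context {R : realType}.
Variables (rad a : R).

Definition rect : set (R * R) := `]0, rad[%classic `*` `](- a), a[%classic.

Definition L2sq (u : R * R -> R) : \bar R :=
  \int[mu2]_(x in rect) ((u x) ^+ 2 * x.1)%:E.

Definition in_L2 (u : R * R -> R) : Prop :=
  measurable_fun rect u /\ (L2sq u < +oo)%E.

(* [ur] and [uz] are the weak derivatives of [u] in r and z. *)
Definition in_H1 (u ur uz : R * R -> R) : Prop :=
  [/\ in_L2 u, in_L2 ur, in_L2 uz,
      weak_deriv2 rect [:: er] u ur & weak_deriv2 rect [:: ez] u uz].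

Definition H1sq (u ur uz : R * R -> R) : \bar R :=
  (L2sq u + L2sq ur + L2sq uz)%E.

(* Squared L2 norms on the lateral surface S1 and on the two bases S2; the
   surface measures are rad dz and r dr, up to the factor 2 pi. *)
Definition L2sq_S1 (g : R * R -> R) : \bar R :=
  \int[mu1]_(z in `](- a), a[) ((g (rad, z)) ^+ 2 * rad)%:E.

Definition L2sq_S2 (g : R * R -> R) : \bar R :=
  (\int[mu1]_(r in `]0%R, rad[) ((g (r, (- a)%R)) ^+ 2 * r)%:E +
   \int[mu1]_(r in `]0%R, rad[) ((g (r, a)) ^+ 2 * r)%:E)%E.

Definition L2sq_S (g : R * R -> R) : \bar R := (L2sq_S1 g + L2sq_S2 g)%E.

(* The trace of an H^1 function is the boundary L2 limit of the restrictions of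
   smooth functions converging to it in H^1; [bsq] is the squared norm on the
   part of the boundary under consideration. *)
Definition is_trace (bsq : (R * R -> R) -> \bar R)
    (u ur uz g : R * R -> R) : Prop :=
  exists w : nat -> R * R -> R,
    [/\ forall n, smooth (w n),
        H1sq (w n \- u) (iter_deriv [:: er] (w n) \- ur)
          (iter_deriv [:: ez] (w n) \- uz) @[n --> \oo] --> 0%E &
        bsq (w n \- g) @[n --> \oo] --> 0%E].

Definition zero_trace (bsq : (R * R -> R) -> \bar R)
    (u ur uz : R * R -> R) : Prop := is_trace bsq u ur uz (cst 0).

(* - Delta psi - (2 / r) psi_r = omega in the sense of distributions; the
   second derivatives are moved onto the test function, the first-order terms
   use the weak derivative [psir]. *)
Definition distr_eq (omega psi psir : R * R -> R) : Prop :=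
  forall phi : R * R -> R, test_fun rect phi ->
    \int[mu2]_(x in rect)
      (- (psi x * iter_deriv [:: er; er] phi x
          + x.1^-1 * psir x * phi x
          + psi x * iter_deriv [:: ez; ez] phi x)
       - 2 / x.1 * psir x * phi x)
    = \int[mu2]_(x in rect) (omega x * phi x).

Definition weak_solution (omega psi psir psiz : R * R -> R) : Prop :=
  [/\ in_H1 psi psir psiz, zero_trace L2sq_S psi psir psiz &
      distr_eq omega psi psir].

(* [g] is the restriction of [u] to r = 0: for a.e. z, [g z] is the value at
   r = 0 of the representative of [u (., z)] continuous on [0, rad). *)
Definition axis_restriction (u : R * R -> R) (g : R -> R) : Prop :=
  {ae mu1, forall z : R, `](- a), a[%classic z ->
    exists w : R -> R,
      [/\ {within `[0, rad[%classic, continuous w},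
          {ae mu1, forall r : R, `]0, rad[%classic r -> w r = u (r, z)} &
          w 0 = g z]}.

Definition eta_integrand (K : R -> R) (omega psir psizz : R * R -> R)
    (r z tau : R) : R :=
  (r - tau) * (3 / tau * psir (tau, z) + psizz (tau, z) + omega (tau, z))
  * (1 + K tau).

Definition eta_fun (K : R -> R) (omega psir psizz : R * R -> R)
    (x : R * R) : R :=
  - \int[mu1]_(tau in `]0, x.1[) eta_integrand K omega psir psizz x.1 x.2 tau.

Definition eta_well_defined (K : R -> R) (omega psir psizz : R * R -> R) :
    Prop :=
  {ae mu1, forall z : R, `](- a), a[%classic z ->
    forall r : R, 0 < r < rad ->
      mu1.-integrable `]0, r[%classic
        (EFin \o eta_integrand K omega psir psizz r z)}.

(* Squared norm of H^3_0(0, rad) of a function whose i-th weak derivative is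
   [w i] for i <= 3. *)
Definition H30sq (w : nat -> R -> R) : \bar R :=
  (\sum_(i < 4) \int[mu1]_(r in `]0%R, rad[)
    ((w i r) ^+ 2 * r ^ (2 * (i%:Z - 3)) * r)%:E)%E.

(* [V i] is a jointly measurable version of the i-th weak r-derivative of the
   slices [v (., z)], i <= 3. *)
Definition weak_r_derivs3 (v : R * R -> R) (V : nat -> R * R -> R) : Prop :=
  (forall i, (i <= 3)%N -> measurable_fun rect (V i)) /\
  {ae mu1, forall z : R, `](- a), a[%classic z ->
    forall i, (i <= 3)%N ->
      weak_deriv1 `]0, rad[%classic i
        (fun r => v (r, z)) (fun r => V i (r, z))}.

End Cylinder.

(* Main.v *)
Require Import Defs.
From HB Require Import structures.
From mathcomp Require Import all_boot all_order all_algebra.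
From mathcomp Require Import all_classical all_reals all_analysis.
From mathcomp Require Import measurable_realfun ring lra.

(* Since psi and omega vanish on the bases, expanding in the sines of
   k pi (z + a) / (2 a) turns the equation into
     r^3 p_k = int_0^r s^3 (lam_k^2 psi_k - omega_k) ds
   for the sine coefficients p_k of psi_r. Testing this against psi_k gives
     2 lam_k^2 |p_k|^2 + lam_k^4 |psi_k|^2 <= |omega_k|^2
   in L2(r dr), and Bessel and Riesz-Fischer sum these bounds, also multiplied
   by lam_k^2, to psi_zz, psi_zzz, psi_zzr in L2 controlled by omega and
   omega_z.

   On almost every line z = const, G = psi_zz + omega is then the primitive of
   G_r with r |G_r|^2 integrable, and r^3 psi_r = - int_0^r s^3 G. Integrating
   by parts,
     3 psi_r / r + G = G / 4 + 3 / (4 r^4) M,   M(r) = int_0^r s^4 G_r,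
   where |M| <= r^4 |G_r|_{L2} by Cauchy-Schwarz. Twice integrated, this is
   psi(0) - psi, so psi - psi(0) - eta is the double primitive of
   K (G / 4 + 3 / (4 r^4) M). As |K| <= C r^2 and |K'| <= C r, this function
   and its derivatives vanish at r = 0 at the rates which the weights of H^3_0
   require. *)

Set Implicit Arguments.
Unset Strict Implicit.
Unset Printing Implicit Defensive.

Import Order.TTheory GRing.Theory Num.Theory.
Import numFieldNormedType.Exports.

Local Open Scope classical_set_scope.
Local Open Scope ring_scope.

(** * Smooth functions *)

Section SmoothClosure.
Context {R : realType} {V : normedModType R}.
Implicit Types (f g : V -> R) (n : nat).

Fixpoint Ck n f : Prop :=
  if n is m.+1 then
    (forall x, differentiable f x) /\ forall v, Ck m ('D_v f)
  else True.

Lemma Ck_smooth f : (forall n, Ck n f) -> smooth f.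
Proof.
move=> H s; have {H} : Ck (size s).+1 f by [].
elim/last_ind: s f => [|s v IH] f H x; first by case: H.
rewrite /iter_deriv foldr_rcons; apply: IH.
by move: H; rewrite size_rcons => -[_ /(_ v)].
Qed.

Lemma smooth_derive f v : smooth f -> smooth ('D_v f).
Proof.
move=> H s x; move: (H (rcons s v) x).
by rewrite /iter_deriv foldr_rcons.
Qed.

Lemma smooth_Ck n f : smooth f -> Ck n f.
Proof.
elim: n f => [//|n IH] f H; split; first by move=> x; exact: (H [::] x).
by move=> v; apply: IH; exact: smooth_derive.
Qed.

Lemma CkW n f : Ck n.+1 f -> Ck n f.
Proof.
by elim: n f => [//|n IH] f [d H]; split=> // v; apply: IH; apply: H.
Qed.

Lemma Ck_cst n (c : R) : Ck n (fun=> c).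
Proof.
elim: n c => [//|n IH] c; split; first by move=> x; apply: differentiable_cst.
move=> v; rewrite (_ : 'D_v _ = fun=> 0); first exact: IH.
by apply/funext => x; rewrite (derive_cst c).
Qed.

Lemma CkD n f g : Ck n f -> Ck n g -> Ck n (fun x => f x + g x).
Proof.
elim: n f g => [//|n IH] f g [df Hf] [dg Hg]; split.
  by move=> x; apply: differentiableD.
move=> v; rewrite (_ : 'D_v _ = fun x => 'D_v f x + 'D_v g x).
  exact: (IH _ _ (Hf v) (Hg v)).
by apply/funext => x; rewrite deriveD//; apply: diff_derivable.
Qed.

Lemma CkM n f g : Ck n f -> Ck n g -> Ck n (fun x => f x * g x).
Proof.
elim: n f g => [//|n IH] f g Hf Hg; split.
  by move=> x; apply: differentiableM; [case: Hf|case: Hg].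
have Hf' := CkW Hf; have Hg' := CkW Hg; case: Hf Hg => df Hf [dg Hg].
move=> v; rewrite (_ : 'D_v _ =
    fun x => f x * 'D_v g x + g x * 'D_v f x).
  exact: (CkD (IH _ _ Hf' (Hg v)) (IH _ _ Hg' (Hf v))).
by apply/funext => x; rewrite deriveM//; apply: diff_derivable.
Qed.

Lemma deriveVr f v x : differentiable f x -> f x != 0 ->
  'D_v (fun y => (f y)^-1) x = - ((f x)^-1 * (f x)^-1) * 'D_v f x.
Proof.
move=> df f0; rewrite !deriveE//; last exact: differentiableV.
by rewrite diffV//= expr2 invfM.
Qed.

Lemma CkV n f : (forall x, f x != 0) -> Ck n f -> Ck n (fun x => (f x)^-1).
Proof.
move=> f0; elim: n f f0 => [//|n IH] f f0 Hf; split.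
  by move=> x; apply: differentiableV => //; case: Hf.
have Hf' := CkW Hf; case: Hf => df Hf v.
rewrite (_ : 'D_v _ = fun x => (-1 * ((f x)^-1 * (f x)^-1)) * 'D_v f x).
  apply: CkM; last exact: Hf.
  by apply: CkM; [exact: Ck_cst|apply: CkM; exact: IH].
by apply/funext => x; rewrite deriveVr// mulN1r.
Qed.

Lemma CkB n f g : Ck n f -> Ck n g -> Ck n (fun x => f x - g x).
Proof.
move=> Hf Hg; rewrite (_ : (fun x => _) = fun x => f x + (-1) * g x).
  by apply: CkD => //; apply: CkM => //; exact: Ck_cst.
by apply/funext => x; rewrite mulN1r.
Qed.

End SmoothClosure.

Section SmoothComposition.
Context {R : realType}.

Lemma derive_real (f : R -> R) (v x : R) : differentiable f x ->
  'D_v f x = v * derive1 f x.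
Proof.
by move=> df; rewrite derive1E !deriveE// -[in LHS](mulr1 v) linearZ.
Qed.

Lemma derive_comp {V : normedModType R} (f : R -> R) (l : V -> R) (v x : V) :
  differentiable f (l x) -> differentiable l x ->
  'D_v (fun y => f (l y)) x = derive1 f (l x) * 'D_v l x.
Proof.
move=> df dl; rewrite deriveE; last exact: differentiable_comp.
by rewrite diff_comp//= -!deriveE// derive_real// mulrC.
Qed.

Lemma Ck_comp_affine {V : normedModType R} n (f : R -> R) (l : V -> R)
    (c : V -> R) :
  (forall x, differentiable l x) -> (forall v x, 'D_v l x = c v) ->
  Ck n f -> Ck n (fun x => f (l x)).
Proof.
move=> dl Dl; elim: n f => [//|n IH] f [df Hf]; split.
  by move=> x; apply: differentiable_comp.
move=> v; rewrite (_ : 'D_v _ = fun x => 'D_1 f (l x) * c v).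
  apply: CkM; [exact: (IH _ (Hf 1))|exact: Ck_cst].
by apply/funext => x; rewrite (derive_comp _ (df _) (dl _)) Dl derive1E.
Qed.

Lemma Ck_id n : Ck n (id : R -> R).
Proof.
case: n => [//|n]; split; first by move=> x; exact/derivable1_diffP.
move=> v; rewrite (_ : 'D_v _ = fun=> v); first exact: Ck_cst.
by apply/funext => x; rewrite derive_id.
Qed.

Lemma smooth_derivable (f : R -> R) (x : R) : smooth f -> derivable f x 1.
Proof. by move=> /(_ [::] x)/derivable1_diffP. Qed.

Lemma smooth_continuous {V : normedModType R} (f : V -> R) :
  smooth f -> continuous f.
Proof. by move=> sf x; apply: differentiable_continuous; exact: (sf [::] x). Qed.

Lemma smooth_derive1 (f : R -> R) : smooth f -> smooth (derive1 f).
Proof.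
move=> /(@smooth_derive _ R^o _ (1 : R)); congr (smooth _).
by apply/funext => x; rewrite derive1E.
Qed.

Lemma smoothM {V : normedModType R} (f g : V -> R) :
  smooth f -> smooth g -> smooth (fun x => f x * g x).
Proof.
by move=> sf sg; apply: Ck_smooth => n; apply: CkM; exact: smooth_Ck.
Qed.

Lemma differentiable_fst (x : R * R) : differentiable fst x.
Proof. by apply: linear_differentiable; move=> -[? ?]; exact: cvg_fst. Qed.

Lemma differentiable_snd (x : R * R) : differentiable snd x.
Proof. by apply: linear_differentiable; move=> -[? ?]; exact: cvg_snd. Qed.

Lemma derive_fst (v x : R * R) : 'D_v fst x = v.1.
Proof.
by rewrite deriveE ?diff_lin//; [move=> -[? ?]; exact: cvg_fst|exact: differentiable_fst].
Qed.

Lemma derive_snd (v x : R * R) : 'D_v snd x = v.2.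
Proof.
by rewrite deriveE ?diff_lin//; [move=> -[? ?]; exact: cvg_snd|exact: differentiable_snd].
Qed.

Lemma smooth_fst (f : R -> R) : smooth f -> smooth (fun x : R * R => f x.1).
Proof.
move=> sf; apply: Ck_smooth => n.
by apply: (Ck_comp_affine differentiable_fst derive_fst); exact: smooth_Ck.
Qed.

Lemma smooth_snd (f : R -> R) : smooth f -> smooth (fun x : R * R => f x.2).
Proof.
move=> sf; apply: Ck_smooth => n.
by apply: (Ck_comp_affine differentiable_snd derive_snd); exact: smooth_Ck.
Qed.

Lemma derive_tensor (f g : R -> R) (v x : R * R) : smooth f -> smooth g ->
  'D_v (fun y : R * R => f y.1 * g y.2) x =
  v.1 * (derive1 f x.1 * g x.2) + v.2 * (f x.1 * derive1 g x.2).
Proof.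
move=> sf sg.
have df : differentiable (fun y : R * R => f y.1) x.
  exact: (smooth_fst sf [::] x).
have dg : differentiable (fun y : R * R => g y.2) x.
  exact: (smooth_snd sg [::] x).
rewrite deriveM; [|exact: diff_derivable..].
rewrite (@derive_comp _ f fst)//; [|exact: (sf [::])|exact: differentiable_fst].
rewrite (@derive_comp _ g snd)//; [|exact: (sg [::])|exact: differentiable_snd].
by rewrite derive_fst derive_snd /GRing.scale/=; ring.
Qed.

Lemma derive_tensor_er (f g : R -> R) : smooth f -> smooth g ->
  'D_er (fun y : R * R => f y.1 * g y.2) = fun y => derive1 f y.1 * g y.2.
Proof.
move=> sf sg; apply/funext => x.
by rewrite derive_tensor//= mul1r mul0r addr0.
Qed.

Lemma derive_tensor_ez (f g : R -> R) : smooth f -> smooth g ->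
  'D_ez (fun y : R * R => f y.1 * g y.2) = fun y => f y.1 * derive1 g y.2.
Proof.
move=> sf sg; apply/funext => x.
by rewrite derive_tensor//= mul1r mul0r add0r.
Qed.

Lemma smooth_tensor (f g : R -> R) : smooth f -> smooth g ->
  smooth (fun y : R * R => f y.1 * g y.2).
Proof.
by move=> sf sg; apply: smoothM; [exact: smooth_fst|exact: smooth_snd].
Qed.

Lemma test_fun_tensor (A B : set R) (f g : R -> R) :
  test_fun A f -> test_fun B g ->
  test_fun (A `*` B) (fun y : R * R => f y.1 * g y.2).
Proof.
move=> [sf [C [cC CA fC]]] [sg [C' [cC' CB gC']]].
split; first exact: smooth_tensor.
exists (C `*` C'); split; first exact: compact_setX.
  by move=> [x y] [/= /CA ? /CB].
move=> [x y] /= /not_andP[/fC ->|/gC' ->]; by rewrite ?mul0r ?mulr0.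
Qed.

Lemma test_fun_derive1 (A : set R) (f : R -> R) :
  open A -> test_fun A f -> test_fun A (derive1 f).
Proof.
move=> oA [sf [C [cC CA fC]]]; split; first exact: smooth_derive1.
exists C; split => // x Cx.
have cl : closed C by apply: compact_closed => //; exact: norm_hausdorff.
have : \forall y \near x, (fun y => f y) y = (cst 0 : R -> R) y.
  have : nbhs x (~` C) by apply: open_nbhs_nbhs; split => //; exact: closed_openC.
  by apply: filterS => y /fC.
rewrite derive1E => /near_eq_derive => -> //; first by rewrite derive_cst.
Qed.

End SmoothComposition.

Section FlatFunction.
Context {R : realType}.

Definition flat (p : {poly R}) (x : R) : R :=
  if 0 < x then p.[x^-1] * expR (- x^-1) else 0.

Lemma exprM_expRN (n : nat) (y : R) : 0 <= y ->
  y ^+ n * expR (- y) <= n`!%:R.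
Proof.
move=> y0; rewrite expRN ler_pdivrMr ?expR_gt0//.
case: n => [|n].
  by rewrite expr0 mul1r (le_trans _ (expR_ge1Dx _))// lerDl.
rewrite mulrC -ler_pdivrMr ?ltr0n ?fact_gt0//.
by rewrite (le_trans _ (expR_ge1Dxn n y0))// lerDr.
Qed.

Lemma poly_expRN_bound (p : {poly R}) :
  exists C, forall y, 0 < y -> `|p.[y] * expR (- y)| * y <= C.
Proof.
exists (\sum_(i < size p) `|p`_i| * (i.+1)`!%:R) => y y0.
rewrite horner_coef mulr_suml.
apply: (@le_trans _ _ (\sum_(i < size p) `|p`_i * y ^+ i * expR (- y)| * y)).
  rewrite -[leRHS]mulr_suml; apply: ler_wpM2r; first exact: ltW.
  exact: ler_norm_sum.
apply: ler_sum => i _.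
rewrite !normrM (gtr0_norm (expR_gt0 _)) normrX (gtr0_norm y0).
rewrite -!mulrA ler_wpM2l// [_ * y]mulrC mulrA -exprSr.
by apply: exprM_expRN; exact: ltW.
Qed.

Lemma flat_bound (p : {poly R}) : exists C, forall x, `|flat p x| <= C * `|x|.
Proof.
have [C HC] := poly_expRN_bound p.
have C0 : 0 <= C by apply: le_trans (HC 1 ltr01); rewrite mulr1.
exists C => x; rewrite /flat; case: ifPn => x0; last first.
  by rewrite normr0 mulr_ge0.
have /HC : 0 < x^-1 by rewrite invr_gt0.
by rewrite ler_pdivrMr// (gtr0_norm x0).
Qed.

Lemma is_derive_flat (p : {poly R}) (x : R) :
  is_derive x 1 (flat p) (flat ('X^2 * (p - deriv p)) x).
Proof.
have [x0|x0|->] := ltgtP x 0.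
- rewrite [X in is_derive _ _ _ X]/flat ifF ?le_gtF ?ltW//.
  apply: near_eq_is_derive (is_derive_cst 0 _ _).
  near=> y; rewrite /flat ifF//; apply/negbTE; rewrite -leNgt.
  by apply: ltW; near: y; exact: lt_nbhsl.
- have xn0 : x != 0 by rewrite gt_eqF.
  have DV : is_derive x 1 (fun y : R => y^-1) (- x ^- 2).
    apply: DeriveDef; first exact: (@derivableV _ _ id x 1 xn0 (@derivable_id _ _ x 1)).
    by rewrite (@deriveV _ _ id x 1 xn0 (@derivable_id _ _ x 1)) derive_id /GRing.scale/= mulr1.
  have Dp : is_derive x 1 (fun y => p.[y^-1]) ((deriv p).[x^-1] * (- x ^- 2)).
    by apply: (@is_derive1_comp _ (horner p) _ x).
  have De : is_derive x 1 (expR \o (fun y => - y^-1)) (expR (- x^-1) * (x ^- 2)).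
    by apply: is_derive1_comp; rewrite -[x ^- 2]opprK; exact: is_deriveN.
  have D := is_deriveM Dp De.
  rewrite [X in is_derive _ _ _ X]/flat x0 !hornerE.
  apply: near_eq_is_derive (is_derive_eq D _).
    by near=> y; rewrite /flat ifT//; near: y; exact: lt_nbhsr.
  rewrite /GRing.scale/= -!exprVn; ring.
- rewrite [X in is_derive _ _ _ X]/flat ltxx.
  have [C HC] := flat_bound (p * 'X).
  have H : h^-1 *: (flat p (h + 0) - flat p 0) @[h --> 0^'] --> (0 : R).
    apply/cvgrPdist_le => e e0; near=> h.
    rewrite add0r {2}/flat ltxx subr0 addr0 normrN.
    have -> : h^-1 *: flat p h = flat (p * 'X) h.
      rewrite /flat /GRing.scale/=; case: ifPn; last by rewrite mulr0.
      by rewrite hornerM hornerX => _; ring.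
    apply: (le_trans (HC h)).
    have C1 : 0 < `|C| + 1 by rewrite ltr_wpDl.
    apply: (@le_trans _ _ ((`|C| + 1) * `|h|)).
      by rewrite ler_wpM2r// (le_trans (ler_norm _))// lerDl.
    rewrite mulrC -ler_pdivlMr//; near: h.
    by apply: dnbhs0_le; rewrite divr_gt0.
  apply: DeriveDef.
    by apply/cvg_ex; exists 0; under eq_fun do rewrite /GRing.scale/= mulr1.
  by rewrite /derive; under eq_fun do rewrite /GRing.scale/= mulr1; apply/cvg_lim.
Unshelve. all: by end_near. Qed.

Lemma Ck_flat n (p : {poly R}) : Ck n (flat p).
Proof.
elim: n p => [//|n IH] p; split.
  by move=> x; apply/derivable1_diffP; case: (is_derive_flat p x).
move=> v; rewrite (_ : 'D_v _ = fun x => v * flat ('X^2 * (p - deriv p)) x).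
  by apply: CkM => //; exact: Ck_cst.
apply/funext => x; have D := is_derive_flat p x.
rewrite derive_real; last by apply/derivable1_diffP; case: D.
by rewrite derive1E derive_val.
Qed.

Definition expflat (x : R) : R := flat 1 x.

Lemma expflat_gt0 x : 0 < x -> 0 < expflat x.
Proof. by move=> x0; rewrite /expflat /flat x0 hornerC mul1r expR_gt0. Qed.

Lemma expflat_eq0 x : x <= 0 -> expflat x = 0.
Proof. by move=> x0; rewrite /expflat /flat ltNge x0. Qed.

Lemma expflat_ge0 x : 0 <= expflat x.
Proof.
by have [/expflat_gt0/ltW//|/expflat_eq0 ->] := ltP 0 x.
Qed.

Definition smoothstep (x : R) : R :=
  expflat x / (expflat x + expflat (1 - x)).

Lemma smooth_comp_affine (f : R -> R) (c d : R) : smooth f ->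
  smooth (fun x : R => f (c * x + d)).
Proof.
move=> sf; apply: Ck_smooth => n.
have D (x : R) : is_derive x 1 (fun x : R => c * x + d) c.
  apply: is_derive_eq; rewrite /GRing.scale/= mulr1; ring.
have dl (x : R) : differentiable (fun x : R => c * x + d) x.
  by apply/derivable1_diffP; case: (D x).
apply: (@Ck_comp_affine _ _ _ _ _ (fun v : R^o => v * c) dl); last exact: smooth_Ck.
by move=> v x; rewrite derive_real// derive1E derive_val.
Qed.

Lemma smooth_expflat : smooth expflat.
Proof. by apply: Ck_smooth => n; exact: Ck_flat. Qed.

Lemma smooth_smoothstep : smooth smoothstep.
Proof.
have sf := smooth_expflat.
have sg : smooth (fun x : R => expflat (1 - x)).
  rewrite (_ : (fun x => _) = fun x : R => expflat ((-1) * x + 1)).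
    exact: smooth_comp_affine.
  by apply/funext => x; congr expflat; ring.
apply: Ck_smooth => n; apply: CkM; first exact: smooth_Ck.
apply: CkV; last by apply: CkD; exact: smooth_Ck.
move=> x; rewrite gt_eqF//; have [x0|x0] := ltP 0 x.
  by rewrite ltr_pwDl ?expflat_gt0 ?expflat_ge0.
by rewrite expflat_eq0// add0r expflat_gt0// subr_gt0 (le_lt_trans x0).
Qed.

Lemma smoothstep0 x : x <= 0 -> smoothstep x = 0.
Proof. by move=> x0; rewrite /smoothstep expflat_eq0// mul0r. Qed.

Lemma smoothstep1 x : 1 <= x -> smoothstep x = 1.
Proof.
move=> x1; rewrite /smoothstep [expflat (1 - x)]expflat_eq0 ?subr_le0//.
by rewrite addr0 divff// gt_eqF// expflat_gt0// (lt_le_trans ltr01).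
Qed.

End FlatFunction.

(** * Integrability and Fubini's theorem *)

Lemma quadratic_ge0_discr {R : realFieldType} (A B I : R) : 0 <= A ->
  (forall t, 0 <= t ^+ 2 * A - 2 * t * I + B) -> I ^+ 2 <= A * B.
Proof.
rewrite le_eqVlt => /predU1P[<-|A0] H; last first.
- have := H (I / A); rewrite -(ler_pM2l A0).
  have -> : A * ((I / A) ^+ 2 * A - 2 * (I / A) * I + B) = A * B - I ^+ 2.
    by field; rewrite gt_eqF.
  by rewrite mulr0 subr_ge0.
have [->|I0] := eqVneq I 0; first by rewrite mul0r expr0n.
have := H ((B + 1) / (2 * I)); rewrite mulr0 add0r.
have -> : - (2 * ((B + 1) / (2 * I)) * I) + B = -1 by field.
by rewrite leNgt ltrN10.
Qed.

Section Integrability.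
Context d (T : measurableType d) (R : realType).
Variable mu : {measure set T -> \bar R}.
Implicit Types (D : set T) (f g w : T -> R).
Local Notation integ D f := (mu.-integrable D (EFin \o f)).

Lemma ae_impl (P Q : T -> Prop) : (forall x, P x -> Q x) ->
  {ae mu, forall x, P x} -> {ae mu, forall x, Q x}.
Proof. by move=> PQ; apply: filterS. Qed.

Lemma ae_impl2 (P Q S : T -> Prop) : (forall x, P x -> Q x -> S x) ->
  {ae mu, forall x, P x} -> {ae mu, forall x, Q x} -> {ae mu, forall x, S x}.
Proof. by move=> PQ; apply: filterS2. Qed.

Lemma ae_impl3 (P Q S U : T -> Prop) : (forall x, P x -> Q x -> S x -> U x) ->
  {ae mu, forall x, P x} -> {ae mu, forall x, Q x} -> {ae mu, forall x, S x} ->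
  {ae mu, forall x, U x}.
Proof. by move=> PQ; apply: filterS3. Qed.

Lemma integ_measurable D f : integ D f -> measurable_fun D f.
Proof. by move=> /measurable_int/measurable_EFinP. Qed.

Lemma integ_le D f g : measurable D -> measurable_fun D f ->
  (forall x, D x -> `|f x| <= g x) -> integ D g -> integ D f.
Proof.
move=> mD mf fg ig; apply: (le_integrable mD _ _ ig).
  exact/measurable_EFinP.
by move=> x Dx /=; rewrite lee_fin (le_trans (fg _ Dx))// ler_norm.
Qed.

Lemma integ_norm D f : measurable D -> integ D f -> integ D (fun x => `|f x|).
Proof. by move=> mD /integrable_norm. Qed.

Lemma integD D f g : measurable D -> integ D f -> integ D g ->
  integ D (fun x => f x + g x).
Proof. by move=> mD; exact: integrableD. Qed.

Lemma integB D f g : measurable D -> integ D f -> integ D g ->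
  integ D (fun x => f x - g x).
Proof. by move=> mD; exact: integrableB. Qed.

Lemma integZ D f (c : R) : measurable D -> integ D f ->
  integ D (fun x => c * f x).
Proof. by move=> mD; exact: integrableZl. Qed.

Lemma integN D f : measurable D -> integ D f -> integ D (fun x => - f x).
Proof. by move=> mD; exact: integrableN. Qed.

Lemma integM_bounded D f g (C : R) : measurable D -> integ D f ->
  measurable_fun D g -> (forall x, D x -> `|g x| <= C) ->
  integ D (fun x => f x * g x).
Proof.
move=> mD fi mg gC; apply: (@integ_le _ _ (fun x => C * `|f x|)) => //.
- by apply: measurable_funM => //; exact: integ_measurable fi.
- by move=> x Dx; rewrite normrM mulrC ler_wpM2r// gC.
- by apply: integZ => //; exact: integ_norm.
Qed.

Lemma eq_integ D f g : {in D, f =1 g} -> measurable D -> integ D f -> integ D g.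
Proof.
by move=> fg mD; apply: eq_integrable => // x Dx /=; rewrite fg.
Qed.

Lemma integ_lty D f : measurable D -> measurable_fun D f ->
  (forall x, D x -> 0 <= f x) ->
  (\int[mu]_(x in D) (f x)%:E < +oo)%E -> integ D f.
Proof.
move=> mD mf f0 fi; apply/integrableP; split; first exact/measurable_EFinP.
rewrite (le_lt_trans _ fi)// le_eqVlt; apply/orP; left; apply/eqP.
by apply: eq_integral => x /set_mem Dx /=; rewrite ger0_norm// f0.
Qed.

Lemma EFin_Rint D f : measurable D -> integ D f ->
  (\int[mu]_(x in D) f x)%R%:E = (\int[mu]_(x in D) (f x)%:E)%E.
Proof. by move=> mD fi; rewrite /Rintegral fineK//; exact: integrable_fin_num. Qed.

Lemma weighted_mul_integ D f g w : measurable D -> (forall x, D x -> 0 < w x) ->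
  measurable_fun D f -> measurable_fun D g ->
  integ D (fun x => f x ^+ 2 * w x) -> integ D (fun x => g x ^+ 2 / w x) ->
  integ D (fun x => f x * g x).
Proof.
move=> mD w0 mf mg fi gi.
apply: (integ_le mD _ _ (integD mD fi gi)); first exact: measurable_funM.
move=> x Dx; have wx := w0 _ Dx; rewrite normrM.
rewrite -[f x ^+ 2]real_normK ?num_real// -[g x ^+ 2]real_normK ?num_real//.
have : 0 <= w x * (`|f x| - `|g x| / w x) ^+ 2 by rewrite mulr_ge0 ?sqr_ge0// ltW.
have -> : w x * (`|f x| - `|g x| / w x) ^+ 2 =
   (`|f x| ^+ 2 * w x + `|g x| ^+ 2 / w x) - 2 * (`|f x| * `|g x|).
  by field; rewrite gt_eqF.
have := mulr_ge0 (normr_ge0 (f x)) (normr_ge0 (g x)); lra.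
Qed.

Lemma weighted_CS D f g w : measurable D -> (forall x, D x -> 0 < w x) ->
  measurable_fun D f -> measurable_fun D g ->
  integ D (fun x => f x ^+ 2 * w x) -> integ D (fun x => g x ^+ 2 / w x) ->
  (\int[mu]_(x in D) (f x * g x)) ^+ 2 <=
  (\int[mu]_(x in D) (f x ^+ 2 * w x)) * (\int[mu]_(x in D) (g x ^+ 2 / w x)).
Proof.
move=> mD w0 mf mg fi gi; have fgi := weighted_mul_integ mD w0 mf mg fi gi.
apply: quadratic_ge0_discr => [|t].
  by apply: Rintegral_ge0 => x Dx; rewrite mulr_ge0 ?sqr_ge0// ltW// w0.
have i1 := integZ (t ^+ 2) mD fi; have i2 := integZ (2 * t) mD fgi.
rewrite -!RintegralZl// -RintegralB// -RintegralD//; last exact: integB.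
apply: Rintegral_ge0 => x Dx; have wx := w0 _ Dx.
rewrite (_ : _ + _ = w x * (t * f x - g x / w x) ^+ 2).
  by rewrite mulr_ge0 ?sqr_ge0// ltW.
by field; rewrite gt_eqF.
Qed.

Lemma ae_eq_Rint D f g : measurable D -> measurable_fun D f ->
  measurable_fun D g -> {ae mu, forall x, D x -> f x = g x} ->
  \int[mu]_(x in D) f x = \int[mu]_(x in D) g x.
Proof.
move=> mD mf mg fg; congr fine; apply: ae_eq_integral => //.
- exact/measurable_EFinP.
- exact/measurable_EFinP.
- by apply: filterS fg => x + Dx => /(_ Dx) ->.
Qed.

Lemma ae_eq_integ D f g : measurable D -> measurable_fun D g ->
  {ae mu, forall x, D x -> f x = g x} -> integ D f -> integ D g.
Proof.
move=> mD mg fg /integrableP[mf fi]; apply/integrableP; split.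
  exact/measurable_EFinP.
rewrite (le_lt_trans _ fi)// le_eqVlt; apply/orP; left; apply/eqP.
apply: ae_eq_integral => //.
- by apply: measurableT_comp => //; exact/measurable_EFinP.
- exact: measurableT_comp.
- by apply: filterS fg => x + Dx => /(_ Dx) /= ->.
Qed.

Lemma ge0_int0_ae D f : measurable D -> measurable_fun D f ->
  (forall x, D x -> 0 <= f x) -> (\int[mu]_(x in D) (f x)%:E = 0)%E ->
  {ae mu, forall x, D x -> f x = 0}.
Proof.
move=> mD mf f0 I0.
have /ae_eq_integral_abs : measurable_fun D (EFin \o f) by exact/measurable_EFinP.
move=> /(_ mu mD)[+ _].
have -> : (\int[mu]_(x in D) `|(EFin \o f) x| = \int[mu]_(x in D) (f x)%:E)%E.
  by apply: eq_integral => x /set_mem Dx /=; rewrite ger0_norm// f0.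
move=> /(_ I0); apply: filterS => x /= H Dx.
by have := H Dx; case.
Qed.

Lemma Rint_not_integ D f : measurable D -> measurable_fun D f ->
  ~ integ D f -> \int[mu]_(x in D) f x = 0.
Proof.
move=> mD mf nf; rewrite /Rintegral integralE.
have mE : measurable_fun D (EFin \o f) by exact/measurable_EFinP.
have : (\int[mu]_(x in D) (EFin \o f)^\+ x +
        \int[mu]_(x in D) (EFin \o f)^\- x = +oo)%E.
  rewrite -ge0_integralD//; last 2 first.
    exact: measurable_funepos.
    exact: measurable_funeneg.
  apply/eqP; rewrite -leye_eq leNgt; apply/negP => lty; apply: nf.
  apply/integrableP; split=> //; apply: le_lt_trans lty.
  rewrite le_eqVlt; apply/orP; left; apply/eqP; apply: eq_integral => x _.
  by rewrite -/((abse \o (EFin \o f)) x) fune_abse.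
have := @integral_ge0 _ _ _ mu D _ (fun x _ => funepos_ge0 (EFin \o f) x).
have := @integral_ge0 _ _ _ mu D _ (fun x _ => funeneg_ge0 (EFin \o f) x).
by case: (integral _ _ _) => [x| |] //; case: (integral _ _ _) => [y| |].
Qed.

Lemma RintZl D f (c : R) : measurable D -> measurable_fun D f ->
  \int[mu]_(x in D) (c * f x) = c * \int[mu]_(x in D) f x.
Proof.
move=> mD mf; have [fi|nf] := pselect (integ D f); first exact: RintegralZl.
rewrite (Rint_not_integ mD mf nf) mulr0; have [->|c0] := eqVneq c 0.
  by under eq_Rintegral do rewrite mul0r; rewrite Rintegral_cst ?mul0r.
apply: Rint_not_integ => //; first exact: measurable_funM.
move=> cf; apply: nf; apply: eq_integ mD (integZ c^-1 mD cf) => x _ /=.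
by rewrite mulKf.
Qed.

End Integrability.

Section ProductMeasure.
Context {R : realType}.
Local Notation mu := (@lebesgue_measure R).
Local Notation leb2 := (mu \x mu)%E.
Implicit Types (A B : set (measurableTypeR R)).
Local Notation integ m D f := (m.-integrable D (EFin \o f)).

Lemma measurable_slice_r A B (u : R * R -> R) (r : R) :
  measurable A -> measurable B -> measurable_fun (A `*` B) u -> A r ->
  measurable_fun B (fun z => u (r, z)).
Proof.
move=> mA mB mu Ar.
apply/measurable_restrictT => //.
move/measurable_restrictT : mu => /(_ (measurableX mA mB)) mu.
rewrite (_ : _ \_ _ = fun z => (u \_ (A `*` B)) (r, z)).
  exact: measurable_fun_pair2.
apply/funext => z; rewrite !patchE; congr (if _ then _ else _).
by apply/idP/idP => /set_mem Bz; apply/mem_set; [split|case: Bz].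
Qed.

Lemma measurable_slice_z A B (u : R * R -> R) (z : R) :
  measurable A -> measurable B -> measurable_fun (A `*` B) u -> B z ->
  measurable_fun A (fun r => u (r, z)).
Proof.
move=> mA mB mu Bz.
apply/measurable_restrictT => //.
move/measurable_restrictT : mu => /(_ (measurableX mA mB)) mu.
rewrite (_ : _ \_ _ = fun r => (u \_ (A `*` B)) (r, z)).
  exact: measurable_fun_pair1.
apply/funext => r; rewrite !patchE; congr (if _ then _ else _).
by apply/idP/idP => /set_mem Ar; apply/mem_set; [split|case: Ar].
Qed.

Lemma patch_setX_slice {V : pointedType} A B (f : R * R -> V) (g0 : V) r z :
  patch (fun=> g0) (A `*` B) f (r, z) =
  patch (fun=> g0) A (fun r => patch (fun=> g0) B (fun z => f (r, z)) z) r.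
Proof.
rewrite /patch; case: ifPn => [/set_mem[/= Ar Bz]|]; first by rewrite !mem_set.
move=> /negP H; case: ifPn => [/set_mem Ar|//]; case: ifPn => [/set_mem Bz|//].
by case: H; apply/mem_set.
Qed.

Lemma integral_setX_patch_r A B (f : R * R -> \bar R) :
  (\int[mu]_r \int[mu]_z (f \_ (A `*` B)) (r, z) =
   \int[mu]_(r in A) \int[mu]_(z in B) f (r, z))%E.
Proof.
rewrite [RHS]integral_mkcond; apply: eq_integral => r _.
rewrite patchE; case: ifPn => Ar.
  rewrite [RHS]integral_mkcond; apply: eq_integral => z _.
  by rewrite patch_setX_slice patchE Ar.
by apply: integral0_eq => z _; rewrite patch_setX_slice patchE (negbTE Ar).
Qed.

Lemma integral_setX_patch_z A B (f : R * R -> \bar R) :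
  (\int[mu]_z \int[mu]_r (f \_ (A `*` B)) (r, z) =
   \int[mu]_(z in B) \int[mu]_(r in A) f (r, z))%E.
Proof.
rewrite [RHS]integral_mkcond; apply: eq_integral => z _.
rewrite patchE; case: ifPn => Bz.
  rewrite [RHS]integral_mkcond; apply: eq_integral => r _.
  by rewrite patch_setX_slice !patchE Bz.
apply: integral0_eq => r _; rewrite patch_setX_slice !patchE (negbTE Bz).
by case: ifP.
Qed.

Lemma tonelli_setX_r A B (f : R * R -> \bar R) :
  measurable A -> measurable B -> measurable_fun (A `*` B) f ->
  (forall x, (A `*` B) x -> (0 <= f x)%E) ->
  (\int[leb2]_(x in A `*` B) f x =
   \int[mu]_(r in A) \int[mu]_(z in B) f (r, z))%E.
Proof.
move=> mA mB mf f0; rewrite integral_mkcond fubini_tonelli1.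
- exact: integral_setX_patch_r.
- by apply/(measurable_restrictT _ (measurableX mA mB)).
- by move=> x; rewrite patchE; case: ifPn => // /set_mem /f0.
Qed.

Lemma tonelli_setX_z A B (f : R * R -> \bar R) :
  measurable A -> measurable B -> measurable_fun (A `*` B) f ->
  (forall x, (A `*` B) x -> (0 <= f x)%E) ->
  (\int[leb2]_(x in A `*` B) f x =
   \int[mu]_(z in B) \int[mu]_(r in A) f (r, z))%E.
Proof.
move=> mA mB mf f0; rewrite integral_mkcond fubini_tonelli2.
- exact: integral_setX_patch_z.
- by apply/(measurable_restrictT _ (measurableX mA mB)).
- by move=> x; rewrite patchE; case: ifPn => // /set_mem /f0.
Qed.

Lemma fubini_setX_r A B (f : R * R -> R) : measurable A -> measurable B ->
  integ leb2 (A `*` B) f ->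
  [/\ {ae mu, forall r, A r -> integ mu B (fun z => f (r, z))},
      integ mu A (fun r => \int[mu]_(z in B) f (r, z))%R &
      \int[leb2]_(x in A `*` B) f x =
      \int[mu]_(r in A) \int[mu]_(z in B) f (r, z)].
Proof.
move=> mA mB fi; have mAB := measurableX mA mB.
have := fi => /(integrable_mkcond _ mAB) fiT.
have ae : {ae mu, forall r, A r -> integ mu B (fun z => f (r, z))}.
  have := ae_integrable1 fiT; apply: filterS => r H Ar.
  apply/(integrable_mkcond _ mB); apply: eq_integrable H => // z _.
  by rewrite patch_setX_slice patchE mem_set.
have iA : mu.-integrable A (fun r => \int[mu]_(z in B) (f (r, z))%:E)%E.
  have := integrable_fubini_F fiT.
  move=> H; apply/(integrable_mkcond _ mA); apply: eq_integrable H => // r _.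
  rewrite /fubini_F !patchE; case: ifPn => Ar.
    rewrite [RHS]integral_mkcond; apply: eq_integral => z _.
    by rewrite patch_setX_slice patchE Ar.
  by apply: integral0_eq => z _; rewrite patch_setX_slice patchE (negbTE Ar).
have E : {ae mu, forall r, A r ->
    (\int[mu]_(z in B) f (r, z))%R%:E = (\int[mu]_(z in B) (f (r, z))%:E)%E}.
  by apply: filterS ae => r H /H ?; rewrite EFin_Rint.
have mF : measurable_fun A (fun r => \int[mu]_(z in B) f (r, z))%R.
  apply: measurableT_comp; first exact: fine_measurable.
  exact: measurable_int iA.
have iF : integ mu A (fun r => \int[mu]_(z in B) f (r, z))%R.
  move/integrableP : iA => [mi iA]; apply/integrableP; split.
    exact/measurable_EFinP.
  rewrite (le_lt_trans _ iA)// le_eqVlt; apply/orP; left; apply/eqP.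
  apply: ae_eq_integral => //.
  - by apply: measurableT_comp => //; exact/measurable_EFinP.
  - exact: measurableT_comp.
  - apply: filterS E => x + Dx => /(_ Dx) H.
    by congr (`|_|%E); exact: H.
split => //; apply: EFin_inj; rewrite EFin_Rint// EFin_Rint//.
rewrite [LHS]integral_mkcond -(integral12_prod_meas1 fiT).
rewrite -/(fubini_F _ _) (integral_setX_patch_r A B (EFin \o f)).
apply: ae_eq_integral => //; first exact: measurable_int iA.
  exact/measurable_EFinP.
by apply: filterS E => x + Dx => /(_ Dx) H /=; rewrite H.
Qed.

Lemma fubini_setX_z A B (f : R * R -> R) : measurable A -> measurable B ->
  integ leb2 (A `*` B) f ->
  [/\ {ae mu, forall z, B z -> integ mu A (fun r => f (r, z))},
      integ mu B (fun z => \int[mu]_(r in A) f (r, z))%R &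
      \int[leb2]_(x in A `*` B) f x =
      \int[mu]_(z in B) \int[mu]_(r in A) f (r, z)].
Proof.
move=> mA mB fi; have mAB := measurableX mA mB.
have := fi => /(integrable_mkcond _ mAB) fiT.
have ae : {ae mu, forall z, B z -> integ mu A (fun r => f (r, z))}.
  have := ae_integrable2 fiT; apply: filterS => z H Bz.
  apply/(integrable_mkcond _ mA); apply: eq_integrable H => // r _.
  by rewrite patch_setX_slice !patchE (mem_set Bz).
have iA : mu.-integrable B (fun z => \int[mu]_(r in A) (f (r, z))%:E)%E.
  have : mu.-integrable setT (fubini_G mu ((EFin \o f) \_ (A `*` B))).
    have mfT := measurable_int _ fiT.
    apply/integrableP; split; first exact: measurable_fubini_G fiT.
    apply: le_lt_trans ((integrable21ltyP _ _ mfT).1 fiT).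
    apply: ge0_le_integral => //.
    - by apply: measurableT_comp => //; exact: measurable_fubini_G fiT.
    - apply: (measurable_fun_fubini_tonelli_G (fun x => `|((EFin \o f) \_ (A `*` B)) x|%E)) => //.
      exact: measurableT_comp.
    - move=> z _; apply: le_abse_integral => //.
      exact: measurable_fun_pair1.
  move=> H; apply/(integrable_mkcond _ mB); apply: eq_integrable H => // z _.
  rewrite /fubini_G [RHS]patchE; case: ifPn => Bz.
    rewrite [RHS]integral_mkcond; apply: eq_integral => r _.
    by rewrite patch_setX_slice !patchE Bz.
  apply: integral0_eq => r _; rewrite patch_setX_slice !patchE (negbTE Bz).
  by case: ifP.
have E : {ae mu, forall z, B z ->
    (\int[mu]_(r in A) f (r, z))%R%:E = (\int[mu]_(r in A) (f (r, z))%:E)%E}.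
  by apply: filterS ae => r H /H ?; rewrite EFin_Rint.
have mF : measurable_fun B (fun z => \int[mu]_(r in A) f (r, z))%R.
  apply: measurableT_comp; first exact: fine_measurable.
  exact: measurable_int iA.
have iF : integ mu B (fun z => \int[mu]_(r in A) f (r, z))%R.
  move/integrableP : iA => [mi iA]; apply/integrableP; split.
    exact/measurable_EFinP.
  rewrite (le_lt_trans _ iA)// le_eqVlt; apply/orP; left; apply/eqP.
  apply: ae_eq_integral => //.
  - by apply: measurableT_comp => //; exact/measurable_EFinP.
  - exact: measurableT_comp.
  - apply: filterS E => x + Dx => /(_ Dx) H.
    by congr (`|_|%E); exact: H.
split => //; apply: EFin_inj; rewrite EFin_Rint// EFin_Rint//.
rewrite [LHS]integral_mkcond -(integral21_prod_meas1 fiT).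
rewrite -/(fubini_G _ _) (integral_setX_patch_z A B (EFin \o f)).
apply: ae_eq_integral => //; first exact: measurable_int iA.
  exact/measurable_EFinP.
by apply: filterS E => x + Dx => /(_ Dx) H /=; rewrite H.
Qed.

Lemma integ_setX_lty A B (f : R * R -> R) : measurable A -> measurable B ->
  measurable_fun (A `*` B) f ->
  (\int[mu]_(r in A) \int[mu]_(z in B) `|f (r, z)|%:E < +oo)%E ->
  integ leb2 (A `*` B) f.
Proof.
move=> mA mB mf fi; apply/integrableP; split; first exact/measurable_EFinP.
rewrite tonelli_setX_r//; first by apply: measurableT_comp => //; exact/measurable_EFinP.
Qed.

Lemma integ_setX_lty_z A B (f : R * R -> R) : measurable A -> measurable B ->
  measurable_fun (A `*` B) f ->
  (\int[mu]_(z in B) \int[mu]_(r in A) `|f (r, z)|%:E < +oo)%E ->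
  integ leb2 (A `*` B) f.
Proof.
move=> mA mB mf fi; apply/integrableP; split; first exact/measurable_EFinP.
rewrite tonelli_setX_z//; first by apply: measurableT_comp => //; exact/measurable_EFinP.
Qed.

Lemma measurable_Rint_param d (T : measurableType d) (f : T * measurableTypeR R -> R) :
  measurable_fun setT f ->
  measurable_fun setT (fun x => \int[mu]_y f (x, y)).
Proof.
move=> mf; apply: measurableT_comp; first exact: fine_measurable.
under eq_fun do rewrite integralE.
apply: emeasurable_funB.
- have H : measurable_fun setT ((EFin \o f)^\+)%E.
    by apply: measurable_funepos; exact/measurable_EFinP.
  have K := @measurable_fun_fubini_tonelli_F _ _ T _ R mu _ H (funepos_ge0 _).
  apply: (eq_measurable_fun _ _ K) => x _; rewrite /fubini_F.
  by apply: eq_integral => y _; rewrite !funeposE.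
- have H : measurable_fun setT ((EFin \o f)^\-)%E.
    by apply: measurable_funeneg; exact/measurable_EFinP.
  have K := @measurable_fun_fubini_tonelli_F _ _ T _ R mu _ H (funeneg_ge0 _).
  apply: (eq_measurable_fun _ _ K) => x _; rewrite /fubini_F.
  by apply: eq_integral => y _; rewrite !funenegE.
Qed.

Lemma measurable_primitive (f : R * R -> R) : measurable_fun setT f ->
  measurable_fun setT (fun x : R * R => \int[mu]_(s in `]0, x.1[) f (s, x.2)).
Proof.
move=> mf.
pose F (y : (R * R) * R) : R := if (0 < y.2) && (y.2 < y.1.1) then f (y.2, y.1.2) else 0.
rewrite (_ : (fun x => _) = fun x => \int[mu]_s F (x, s)); last first.
  apply/funext => x; rewrite Rintegral_mkcond; apply: eq_Rintegral => s _.
  rewrite /F /= patchE; congr (if _ then _ else _).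
  by apply/idP/idP => [/set_mem|H]; [rewrite /= in_itv|apply/mem_set; rewrite /= in_itv].
apply: measurable_Rint_param; apply: measurable_fun_ifT.
- apply: measurable_and; apply: measurable_fun_ltr => //.
  by apply: measurableT_comp => //; exact: measurable_fst.
- apply: measurableT_comp => //; apply: measurable_fun_pair => //.
  by apply: measurableT_comp => //; exact: measurable_snd.
- by [].
Qed.

Lemma continuous2_measurable (F : R * R -> R) :
  continuous F -> measurable_fun setT F.
Proof.
move=> cF.
pose q (n : nat) (r : R) : R := (Num.floor (r * n.+1%:R))%:~R / n.+1%:R.
have qcvg r : q n r @[n --> \oo] --> r.
  apply/cvgrPdist_le => e e0; near=> n.
  rewrite /q; have n0 : 0 < n.+1%:R :> R by rewrite ltr0n.
  rewrite -[X in `|X - _|](mulfK (lt0r_neq0 n0)) -mulrBl normrM.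
  rewrite ger0_norm ?subr_ge0 ?floor_le//.
  rewrite gtr0_norm ?invr_gt0// ler_pdivrMr// (@le_trans _ _ 1)//.
    by rewrite lerBlDr addrC -intrD1 ltW// floorD1_gt.
  rewrite mulrC -ler_pdivrMr// mul1r (@le_trans _ _ n%:R)//; last by rewrite ler_nat.
  near: n; exact: nbhs_infty_ger.
pose Fn n (x : R * R) := F (q n x.1, x.2).
apply: (@measurable_fun_cvg _ _ _ _ Fn); last first.
  move=> [r z] _; rewrite /Fn /=.
  apply: (@cvg_comp _ _ _ (fun n => (q n r, z)) F _ (nbhs (r, z))); last exact: cF.
  exact: (cvg_pair (qcvg r) (cvg_cst z)).
move=> n _ Y mY; rewrite setTI.
rewrite (_ : _ @^-1` _ = \bigcup_(k : int)
   (`[k%:~R / n.+1%:R, (k + 1)%:~R / n.+1%:R[%classic `*`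
    ((fun z => F (k%:~R / n.+1%:R, z)) @^-1` Y))); last first.
  apply/seteqP; split => [[r z] /= H|[r z] [k _] /= [E H]].
    exists (Num.floor (r * n.+1%:R)) => //; split => //=.
    by rewrite in_itv/= ler_pdivrMr// ltr_pdivlMr// floor_itv.
  move: E; rewrite in_itv/= ler_pdivrMr// ltr_pdivlMr// -floor_eq => /eqP E.
  by rewrite /Fn /q/= E.
apply: countable_bigcupT_measurable => // k; apply: measurableX.
- exact: measurable_itv.
- have mz : measurable_fun setT (fun z : R => F (k%:~R / n.+1%:R, z)).
    apply: continuous_measurable_fun => z.
    apply: (@cvg_comp _ _ _ (fun z => (k%:~R / n.+1%:R, z)) F _ _); last exact: cF.
    exact: (cvg_pair (cvg_cst _) cvg_id).
  rewrite -[X in measurable X]setTI; exact: mz.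
Unshelve. all: by end_near. Qed.

Lemma triangle_fubini (c d : R) (u v B : R -> R) :
  measurable_fun `]c, d[ u -> measurable_fun `]c, d[ v ->
  integ mu `]c, d[ B ->
  (forall t, c < t < d ->
    (`|v t|%:E * \int[mu]_(r in `]c, t[) `|u r|%:E <= (B t)%:E)%E) ->
  [/\ integ mu `]c, d[ (fun r => u r * \int[mu]_(t in `]r, d[) v t),
      integ mu `]c, d[ (fun t => v t * \int[mu]_(r in `]c, t[) u r) &
      \int[mu]_(r in `]c, d[) (u r * \int[mu]_(t in `]r, d[) v t) =
      \int[mu]_(t in `]c, d[) (v t * \int[mu]_(r in `]c, t[) u r)].
Proof.
move=> mfu mfv iB vuB; set I : set (measurableTypeR R) := `]c, d[%classic.
have mI : measurable I by exact: measurable_itv.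
pose F (x : R * R) : R := if x.1 < x.2 then (u \_ I) x.1 * (v \_ I) x.2 else 0.
have mF : measurable_fun setT F.
  apply: measurable_fun_ifT => //.
    by apply: measurable_fun_ltr; [exact: measurable_fst|exact: measurable_snd].
  apply: measurable_funM.
    apply: measurableT_comp; last exact: measurable_fst.
    exact/(measurable_restrictT _ mI).
  apply: measurableT_comp; last exact: measurable_snd.
  exact/(measurable_restrictT _ mI).
have Er r : I r -> \int[mu]_(t in I) F (r, t) = u r * \int[mu]_(t in `]r, d[) v t.
  move=> Ir; rewrite -RintZl//; last first.
    apply: measurable_funS mfv => //; move: Ir; rewrite /I /= in_itv/= => /andP[cr rd].
    by apply: subset_itvr; rewrite bnd_simp ltW.
  rewrite Rintegral_mkcond [RHS]Rintegral_mkcond; apply: eq_Rintegral => t _.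
  rewrite !patchE /F /= !patchE (mem_set Ir).
  case: ifPn => [It|/negP It]; case: ifPn => [|/negP] rt.
  + by rewrite ifT// mem_set//= in_itv/= rt; move/set_mem: It; rewrite /I/= in_itv/= => /andP[].
  + by rewrite ifF//; apply/negP => /set_mem; rewrite /= in_itv/= => /andP[].
  + exfalso; apply: It; apply/mem_set; move/set_mem : rt; move: Ir.
    by rewrite /I /= !in_itv/= => /andP[cr _] /andP[rt ->]; rewrite (lt_trans cr).
  + by [].
have Et t : I t -> \int[mu]_(r in I) F (r, t) = v t * \int[mu]_(r in `]c, t[) u r.
  move=> It; rewrite -RintZl//; last first.
    apply: measurable_funS mfu => //; move: It; rewrite /I /= in_itv/= => /andP[cr rd].
    by apply: subset_itvl; rewrite bnd_simp ltW.
  rewrite Rintegral_mkcond [RHS]Rintegral_mkcond; apply: eq_Rintegral => r _.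
  rewrite !patchE /F /= !patchE (mem_set It).
  case: ifPn => [Ir|/negP Ir]; case: ifPn => [|/negP] rt.
  + have -> : r \in `]c, t[%classic.
      apply/mem_set; rewrite /= in_itv/= rt.
      by move/set_mem: Ir; rewrite /I/= in_itv/= => /andP[->].
    by rewrite Ir; exact: mulrC.
  + by rewrite ifF//; apply/negP => /set_mem; rewrite /= in_itv/= => /andP[].
  + exfalso; apply: Ir; apply/mem_set; move/set_mem : rt; move: It.
    by rewrite /I /= !in_itv/= => /andP[_ td] /andP[-> rt]; rewrite (lt_trans rt).
  + by [].
have iF : integ leb2 (I `*` I) F.
  apply: integ_setX_lty_z => //; first exact: measurable_funTS.
  move/integrableP : iB => [mB]; apply: le_lt_trans; apply: ge0_le_integral => //.
  - by move=> t It; apply: integral_ge0 => r _; rewrite lee_fin.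
  - have K := @measurable_fun_fubini_tonelli_G _ _ _ _ R mu
        (fun x => `|F x|%:E) _ (fun x => normr_ge0 (F x)).
    apply: (eq_measurable_fun (fubini_G mu (fun x => `|F x|%:E))).
      move=> t _; rewrite /fubini_G [RHS]integral_mkcond; apply: eq_integral => r _.
      rewrite patchE; case: ifPn => // /negbTE nr.
      by rewrite /F /= !patchE nr /point/= mul0r if_same normr0.
    apply: measurable_funTS; apply: K; apply/measurable_EFinP.
    exact: measurableT_comp.
  - exact: measurableT_comp.
  move=> t It; apply: le_trans (_ : (B t)%:E <= _)%E; last by rewrite lee_fin ler_norm.
  apply: le_trans (vuB t _); last by move: It; rewrite /I/= in_itv.
  rewrite le_eqVlt; apply/orP; left; apply/eqP.
  rewrite -ge0_integralZl//; last first.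
    apply: measurableT_comp => //; apply: measurableT_comp => //.
    apply: measurable_funS mfu => //; move: It; rewrite /I /= in_itv/= => /andP[cr rd].
    by apply: subset_itvl; rewrite bnd_simp ltW.
  rewrite [LHS]integral_mkcond [RHS]integral_mkcond; apply: eq_integral => r _.
  rewrite !patchE /F /= !patchE (mem_set It).
  case: ifPn => [Ir|/negP Ir]; case: ifPn => [|/negP] rt.
  + have -> : r \in `]c, t[%classic.
      apply/mem_set; rewrite /= in_itv/= rt.
      by move/set_mem: Ir; rewrite /I/= in_itv/= => /andP[->].
    by rewrite Ir normrM EFinM muleC.
  + by rewrite ifF ?normr0//; apply/negP => /set_mem; rewrite /= in_itv/= => /andP[].
  + exfalso; apply: Ir; apply/mem_set; move/set_mem : rt; move: It.
    by rewrite /I /= !in_itv/= => /andP[_ td] /andP[-> rt]; rewrite (lt_trans rt).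
  + by [].
have [_ i1 e1] := fubini_setX_r mI mI iF.
have [_ i2 e2] := fubini_setX_z mI mI iF.
split.
- by apply: eq_integ mI i1 => r /set_mem Ir; rewrite Er.
- by apply: eq_integ mI i2 => t /set_mem It; rewrite Et.
- transitivity (\int[mu]_(r in I) \int[mu]_(t in I) F (r, t)).
    by apply: eq_Rintegral => r /set_mem Ir; rewrite Er.
  rewrite -e1 e2.
  by apply: eq_Rintegral => t /set_mem It; rewrite Et.
Qed.

Lemma le_integral_sub_abs (c d t : R) (u : R -> R) : measurable_fun `]c, d[ u ->
  t <= d -> (\int[mu]_(r in `]c, t[) `|u r|%:E <= \int[mu]_(r in `]c, d[) `|u r|%:E)%E.
Proof.
move=> mu' td; apply: ge0_subset_integral => //.
- by apply/measurable_EFinP; exact: measurableT_comp.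
- by apply: subset_itvl; rewrite bnd_simp.
Qed.

Lemma triangle_fubini_integ (c d : R) (u v : R -> R) :
  integ mu `]c, d[ u -> integ mu `]c, d[ v ->
  [/\ integ mu `]c, d[ (fun r => u r * \int[mu]_(t in `]r, d[) v t),
      integ mu `]c, d[ (fun t => v t * \int[mu]_(r in `]c, t[) u r) &
      \int[mu]_(r in `]c, d[) (u r * \int[mu]_(t in `]r, d[) v t) =
      \int[mu]_(t in `]c, d[) (v t * \int[mu]_(r in `]c, t[) u r)].
Proof.
move=> iu iv.
have mI : measurable (`]c, d[%classic : set (measurableTypeR R)) by exact: measurable_itv.
have iu' := integ_norm mI iu; have iv' := integ_norm mI iv.
apply: (@triangle_fubini _ _ _ _ (fun t => (\int[mu]_(r in `]c, d[) `|u r|) * `|v t|)).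
- exact: integ_measurable iu.
- exact: integ_measurable iv.
- exact: integZ.
- move=> t /andP[ct td]; rewrite EFinM muleC lee_wpmul2r ?lee_fin// EFin_Rint//.
  by apply: le_integral_sub_abs; [exact: integ_measurable iu|exact: ltW].
Qed.

End ProductMeasure.

(** * Completeness of weighted L2 spaces *)

Lemma ge0_ecvg0 {R : realType} (u : nat -> \bar R) :
  (forall n, 0 <= u n)%E ->
  (forall e : R, 0 < e -> exists N, forall n, (N <= n)%N -> (u n <= e%:E)%E) ->
  u n @[n --> \oo] --> 0%E.
Proof.
move=> u0 H; apply/fine_cvgP; split.
  have [N HN] := H 1 ltr01; near=> n.
  rewrite ge0_fin_numE//; apply: (le_lt_trans (HN n _)); last exact: ltry.
  by near: n; exact: nbhs_infty_ge.
apply/cvgrPdist_le => e e0; have [N HN] := H e e0; near=> n.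
rewrite sub0r normrN /= ger0_norm ?fine_ge0// -lee_fin.
have Nn : (N <= n)%N by near: n; exact: nbhs_infty_ge.
rewrite fineK ?HN// ge0_fin_numE//.
by apply: (le_lt_trans (HN n Nn)); exact: ltry.
Unshelve. all: by end_near. Qed.

Lemma ecvg0_le {R : realType} (u : nat -> \bar R) (e : R) :
  u n @[n --> \oo] --> 0%E -> 0 < e ->
  exists N, forall n, (N <= n)%N -> (u n <= e%:E)%E.
Proof.
move=> /fine_cvgP[ufin /cvgrPdist_le ucvg] e0.
have [N _ HN] : \forall n \near \oo, (u n <= e%:E)%E.
  near=> n; have fu : u n \is a fin_num by near: n.
  rewrite -(fineK fu) lee_fin (le_trans (ler_norm _))//.
  by rewrite -normrN -sub0r; near: n; exact: ucvg.
by exists N.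
Unshelve. all: by end_near. Qed.

Lemma geometric_increments_cvg {R : realType} (u : nat -> R) (C : R) :
  (forall k, (u k.+1 - u k) ^+ 2 <= C * (2^-1 ^+ k) ^+ 2) -> cvgn u.
Proof.
move=> H; rewrite (_ : u = fun n => u 0%N + series (telescope u) n); last first.
  by apply/funext => n; rewrite -eq_sum_telescope.
apply: is_cvgD; first exact: is_cvg_cst.
apply: normed_cvg.
have C0 : 0 <= C.
  by have := H 0%N; rewrite expr0 expr1n mulr1; apply: le_trans; exact: sqr_ge0.
apply: (@series_le_cvg _ _ (geometric (Num.sqrt C) 2^-1)).
- by move=> n; exact: normr_ge0.
- by move=> n; rewrite /geometric /= mulr_ge0 ?sqrtr_ge0// exprn_ge0.
- move=> n; rewrite /= /telescope.
  rewrite -(@ler_pXn2r _ 2)// ?nnegrE ?mulr_ge0 ?sqrtr_ge0 ?exprn_ge0//.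
  by rewrite real_normK ?num_real// exprMn sqr_sqrtr//; exact: H.
- by apply: is_cvg_geometric_series; rewrite ger0_norm// invf_lt1// ltr1n.
Qed.

Section RieszFischer.
Context d (T : measurableType d) (R : realType).
Variable mu : {measure set T -> \bar R}.
Variables (D : set T) (mD : measurable D) (w : T -> R) (f_ : nat -> T -> R).
Hypotheses (mw : measurable_fun D w) (w0 : forall x, D x -> 0 < w x).
Hypothesis mf : forall n, measurable_fun D (f_ n).

Let dist n (g : T -> R) := (\int[mu]_(x in D) ((f_ n x - g x) ^+ 2 * w x)%:E)%E.

Hypothesis cauchy_f : forall e : R, 0 < e ->
  exists N, forall n m, (N <= n)%N -> (N <= m)%N -> (dist n (f_ m) <= e%:E)%E.

Lemma riesz_fischer : exists2 f, measurable_fun D f & dist n f @[n --> \oo] --> 0%E.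
Proof.
have mdist n m : measurable_fun D (fun x => (f_ n x - f_ m x) ^+ 2 * w x).
  by apply: measurable_funM => //; apply: measurable_funX; exact: measurable_funB.
pose eps (k : nat) : R := (4 ^+ k * 2 ^+ k.+1)^-1.
have eps0 k : 0 < eps k by rewrite invr_gt0 mulr_gt0// exprn_gt0.
have [N HN] := choice (fun k => cauchy_f (eps0 k)).
pose phi k := (\sum_(i < k.+1) N i)%N.
have Nphi k : (N k <= phi k)%N by rewrite /phi big_ord_recr leq_addl.
have phiS k : (phi k <= phi k.+1)%N by rewrite /phi [leqRHS]big_ord_recr leq_addr.
have phi_mono : {homo phi : x y / (x <= y)%N} by apply: homo_leq => //; exact: leq_trans.
pose g k := f_ (phi k).
pose a k x := (g k.+1 x - g k x) ^+ 2 * w x.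
have a0 k x : D x -> 0 <= a k x by move=> Dx; rewrite mulr_ge0 ?sqr_ge0// ltW// w0.
pose S x := (\sum_(k <oo) (4 ^+ k * a k x)%:E)%E.
have S0 k x : D x -> (0 <= (4 ^+ k * a k x)%:E)%E.
  by move=> Dx; rewrite lee_fin mulr_ge0 ?exprn_ge0// a0.
have mS k : measurable_fun D (fun x => (4 ^+ k * a k x)%:E).
  by apply/measurable_EFinP; apply: measurable_funM => //; exact: mdist.
have mSS : measurable_fun D S.
  apply: ge0_emeasurable_sum => k; first by move=> x Dx _; exact: S0.
  by move=> _; exact: mS.
have intS : (\int[mu]_(x in D) S x < +oo)%E.
  rewrite integral_nneseries//.
  apply: (@le_lt_trans _ _ (\sum_(k <oo) (0 + (1 / (2 ^ k.+1)%:R)%:E))%E).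
    apply: lee_nneseries => [k _ _|k _]; first by apply: integral_ge0 => x; exact: S0.
    under eq_integral do rewrite EFinM.
    rewrite ge0_integralZl//; first last.
    + by move=> x Dx; rewrite lee_fin a0.
    + by apply/measurable_EFinP; exact: mdist.
    apply: (@le_trans _ _ ((4 ^+ k)%:E * (eps k)%:E)%E).
      rewrite lee_wpmul2l ?lee_fin ?exprn_ge0//.
      by apply: HN => //; rewrite (leq_trans (Nphi k)).
    rewrite -EFinM add0e lee_fin /eps natrX invfM mulrA divff ?mul1r//.
  apply: le_lt_trans (@epsilon_trick _ (fun=> 0%E) 1 xpredT _ _) _ => //.
  by rewrite eseries0// add0e ltry.
have aeS : {ae mu, forall x, D x -> (S x < +oo)%E}.
  have iS : mu.-integrable D S.
    apply/integrableP; split => //; apply: le_lt_trans intS.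
    rewrite le_eqVlt; apply/orP; left; apply/eqP; apply: eq_integral => x /set_mem Dx.
    by rewrite gee0_abs// nneseries_ge0// => k _ _; exact: S0.
  apply: filterS (integrable_ae mD iS) => x H Dx.
  by have := H Dx; rewrite ge0_fin_numE// nneseries_ge0// => k _ _; exact: S0.
pose C : set T := D `&` [set x | (S x < +oo)%E].
have mC : measurable C.
  exact: emeasurable_fun_infty_o.
have cg x : C x -> cvgn (g ^~ x).
  move=> [Dx]; have Sx0 : (0 <= S x)%E by apply: nneseries_ge0 => k _ _; exact: S0.
  rewrite /= -ge0_fin_numE// => /fineK SE.
  apply: (@geometric_increments_cvg _ _ (fine (S x) / w x)) => k.
  have : ((4 ^+ k * a k x)%:E <= S x)%E.
    apply: le_trans (nneseries_lim_ge k.+1 (fun i _ _ => S0 i x Dx)).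
    by rewrite big_nat_recr//= leeDr// sume_ge0// => i _; exact: S0.
  rewrite -SE lee_fin /a mulrA -ler_pdivlMr ?w0//.
  rewrite mulrC -ler_pdivlMr ?exprn_gt0// => /le_trans; apply.
  rewrite le_eqVlt; apply/orP; left; apply/eqP; congr (_ * _).
  by rewrite -exprM mulnC exprM -exprVn; congr (_ ^+ _); rewrite expr2; field.
pose f x := if x \in C then limn (g ^~ x) else 0.
have gf x : D x -> (if x \in C then g k x else 0) @[k --> \oo] --> f x.
  move=> Dx; rewrite /f; case: ifPn => [/set_mem Cx|_]; first exact: cg.
  exact: cvg_cst.
have mfD : measurable_fun D f.
  apply: (measurable_fun_cvg (h := fun k x => if x \in C then g k x else 0)) => // k.
  have -> : (fun x => if x \in C then g k x else 0) = (fun x => g k x * \1_C x).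
    by apply/funext => x; rewrite indicE; case: (_ \in _); rewrite ?mulr1 ?mulr0.
  by apply: measurable_funM; [exact: mf|exact: measurable_indic].
exists f => //.
have Hle j n : (N j <= n)%N -> (dist n f <= (eps j)%:E)%E.
  move=> Nn.
  pose h k x := ((f_ n x - g k x) ^+ 2 * w x * \1_C x)%:E.
  have mh k : measurable_fun D (h k).
    apply/measurable_EFinP; apply: measurable_funM; last exact: measurable_indic.
    exact: mdist.
  have h0 k x : D x -> (0 <= h k x)%E.
    by move=> Dx; rewrite lee_fin mulr_ge0// mulr_ge0 ?sqr_ge0// ltW// w0.
  have hE x : D x -> limn_einf (h ^~ x) = ((f_ n x - f x) ^+ 2 * w x * \1_C x)%:E.
    move=> Dx; rewrite limn_einf_lim; apply/cvg_lim => //; apply: cvg_einfs.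
    apply: cvg_EFin; first by near=> k.
    rewrite /comp /h /=; rewrite /f; case: ifPn => Cx; last first.
      by rewrite indicE (negbTE Cx); under eq_fun do rewrite mulr0; rewrite mulr0; exact: cvg_cst.
    apply: cvgMl; apply: cvgMl; rewrite expr2; under eq_fun do rewrite expr2.
    have := cg x (set_mem Cx) => H.
    by apply: cvgM; apply: cvgB => //; exact: cvg_cst.
  have -> : dist n f = (\int[mu]_(x in D) limn_einf (h ^~ x))%E.
    apply: ae_eq_integral => //.
    - apply/measurable_EFinP; apply: measurable_funM => //.
      by apply: measurable_funX; exact: measurable_funB.
    - apply: (eq_measurable_fun (fun x => ((f_ n x - f x) ^+ 2 * w x * \1_C x)%:E)).
        by move=> x /set_mem Dx; rewrite hE.
      apply/measurable_EFinP; apply: measurable_funM; last exact: measurable_indic.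
      apply: measurable_funM => //.
      by apply: measurable_funX; exact: measurable_funB.
    - apply: filterS aeS => x H Dx; rewrite hE// indicE mem_set ?mulr1//.
      by split => //; exact: H.
  apply: le_trans (fatou mu mD mh h0) _.
  rewrite limn_einf_lim; apply: lime_le; first exact: is_cvg_einfs.
  near=> k; apply: (@le_trans _ _ (\int[mu]_(x in D) h k x)%E).
    by apply: ereal_inf_lbound; exists k => //=.
  apply: (@le_trans _ _ (dist n (g k))).
    apply: ge0_le_integral => //.
    - by move=> x Dx; exact: h0.
    - by apply/measurable_EFinP; exact: mdist.
    - move=> x Dx; rewrite lee_fin ler_piMr//.
        by rewrite mulr_ge0 ?sqr_ge0// ltW// w0.
  apply: HN => //; rewrite (leq_trans (Nphi j))//; apply: phi_mono.
  by near: k; exact: nbhs_infty_ge.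
apply: ge0_ecvg0 => [n|e e0].
  by apply: integral_ge0 => x Dx; rewrite lee_fin mulr_ge0 ?sqr_ge0// ltW// w0.
have [j je] : exists j, eps j <= e.
  have [j _ H] := near_infty_natSinv_lt (PosNum e0).
  exists j; apply: le_trans (ltW (H j (leqnn j))); rewrite /eps.
  rewrite lef_pV2 ?posrE ?ltr0n ?mulr_gt0 ?exprn_gt0//.
  rewrite (@le_trans _ _ (2 ^+ j.+1))//.
    by rewrite -natrX ler_nat ltnW// ltn_expl.
  by rewrite ler_peMl ?exprn_ge0// exprn_ege1// ler1n.
by exists (N j) => n /Hle /le_trans; apply; rewrite lee_fin.
Unshelve. all: by end_near. Qed.

End RieszFischer.

(** * Weak primitives on an interval *)

Section WeakPrimitive.
Context {R : realType}.
Local Notation mu := (@lebesgue_measure R).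
Local Notation integ m D f := (m.-integrable D (EFin \o f)).

Lemma integ_cst_oo (c d k : R) : integ mu `]c, d[ (fun=> k).
Proof.
apply/integrableP; split; first exact/measurable_EFinP.
rewrite integral_cst//= lebesgue_measure_itv/=.
by case: ifP => _; rewrite ?mule0// -EFinD -EFinM ltry.
Qed.

Lemma Rint_oo_cc (c d : R) (f : R -> R) : measurable_fun `]c, d[ f ->
  \int[mu]_(t in `]c, d[) f t = \int[mu]_(t in `[c, d]) f t.
Proof.
move=> mf; have [cd|dc] := ltP c d; last first.
  rewrite set_itv_ge ?bnd_simp -?leNgt// Rintegral_set0.
  move: dc; rewrite le_eqVlt => /predU1P[->|dc].
    by rewrite set_itv1 Rintegral_set1.
  by rewrite set_itv_ge ?bnd_simp -?ltNge// Rintegral_set0.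
have mI : measurable (`]c, d[%classic : set (measurableTypeR R)) by exact: measurable_itv.
have mE : measurable_fun `]c, d[ (EFin \o f) by exact/measurable_EFinP.
rewrite /Rintegral integral_itv_bndo_bndc// integral_itv_obnd_cbnd//.
rewrite -(@setUitv1 _ _ (BRight c) d true)//.
apply/measurable_funU => //; split => //.
by apply: measurable_fun_set1.
Qed.

Lemma smooth_FTC (chi : R -> R) (c d : R) : smooth chi -> c <= d ->
  \int[mu]_(t in `]c, d[) derive1 chi t = chi d - chi c.
Proof.
move=> sc; have cd1 := smooth_continuous (smooth_derive1 sc).
rewrite le_eqVlt => /predU1P[->|cd].
  by rewrite set_itv_ge ?bnd_simp ?ltxx// Rintegral_set0 subrr.
rewrite Rint_oo_cc; last by apply: measurable_funTS; exact: continuous_measurable_fun.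
rewrite /Rintegral (@continuous_FTC2 _ _ chi)//.
- by apply: continuous_subspaceT.
- split.
  + by move=> x _; exact: smooth_derivable.
  + by apply: cvg_at_right_filter; exact: smooth_continuous.
  + by apply: cvg_at_left_filter; exact: smooth_continuous.
Qed.

Lemma smooth_bounded (chi : R -> R) (c d : R) : smooth chi ->
  exists C, forall t, c <= t <= d -> `|chi t| <= C.
Proof.
move=> sc; have [cd|dc] := leP c d; last first.
  by exists 0 => t /andP[ct td]; move: (le_trans ct td); rewrite leNgt dc.
have cn : {within `[c, d], continuous (fun t => `|chi t|)}.
  apply: continuous_subspaceT => x; apply: continuous_comp.
    exact: smooth_continuous.
  exact: norm_continuous.
have [m _ Hm] := EVT_max cd cn.
by exists `|chi m| => t tcd; apply: Hm; rewrite in_itv.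
Qed.

Lemma ibp_primitive (c d : R) (h chi : R -> R) : integ mu `]c, d[ h ->
  smooth chi -> chi d = 0 ->
  integ mu `]c, d[ (fun t => derive1 chi t * \int[mu]_(r in `]c, t[) h r) /\
  \int[mu]_(t in `]c, d[) (derive1 chi t * \int[mu]_(r in `]c, t[) h r) =
  - \int[mu]_(t in `]c, d[) (h t * chi t).
Proof.
move=> ih sc chid.
have mI : measurable (`]c, d[%classic : set (measurableTypeR R)) by exact: measurable_itv.
have mc1 : measurable_fun `]c, d[ (derive1 chi).
  apply: measurable_funTS; apply: continuous_measurable_fun.
  exact: smooth_continuous (smooth_derive1 sc).
have mc : measurable_fun `]c, d[ chi.
  by apply: measurable_funTS; apply: continuous_measurable_fun; exact: smooth_continuous.
have mh := integ_measurable ih.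
have [C HC] := smooth_bounded c d (smooth_derive1 sc).
have ic1 : integ mu `]c, d[ (derive1 chi).
  apply: (integ_le (g := fun=> C)) => //; last exact: integ_cst_oo.
  by move=> x; rewrite /= in_itv/= => /andP[? ?]; apply: HC; rewrite !ltW.
have [i1 i2 <-] := triangle_fubini_integ ih ic1.
split; first by [].
have -> : - (\int[mu]_(t in `]c, d[) (h t * chi t)) =
    \int[mu]_(t in `]c, d[) (-1 * (h t * chi t)).
  by rewrite RintZl ?mulN1r//; exact: measurable_funM.
apply: eq_Rintegral => r /set_mem; rewrite /= in_itv/= => /andP[cr rd].
by rewrite smooth_FTC ?ltW// chid sub0r mulrN mulN1r.
Qed.

Definition scaled_step (n : nat) (x t : R) : R :=
  smoothstep (n.+1%:R * t + - (n.+1%:R * x)).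

Lemma smooth_scaled_step n x : smooth (scaled_step n x).
Proof. exact: smooth_comp_affine smooth_smoothstep. Qed.

Lemma derive1_smoothstep_out (t : R) : (t < 0) || (1 < t) ->
  derive1 smoothstep t = 0.
Proof.
move=> /orP[t0|t1]; rewrite derive1E.
- rewrite (near_eq_derive _ (g := cst (0 : R))) ?derive_cst//.
  by near=> y; apply: smoothstep0; apply: ltW; near: y; exact: lt_nbhsl.
- rewrite (near_eq_derive _ (g := cst (1 : R))) ?derive_cst//.
  by near=> y; apply: smoothstep1; apply: ltW; near: y; exact: lt_nbhsr.
Unshelve. all: by end_near. Qed.

Lemma derive1_smoothstep_bounded :
  exists2 C, 0 <= C & forall t : R, `|derive1 smoothstep t| <= C.
Proof.
have [C HC] := smooth_bounded 0 1 (smooth_derive1 (@smooth_smoothstep R)).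
have C0 : 0 <= C by apply: le_trans (HC 0 _) => //; rewrite lexx ler01.
exists C => // t; have [t01|] := boolP (0 <= t <= 1); first exact: HC.
by rewrite negb_and -!ltNge => /derive1_smoothstep_out ->; rewrite normr0.
Qed.

Lemma derive1_scaled_step n x t :
  derive1 (scaled_step n x) t = n.+1%:R * derive1 smoothstep (n.+1%:R * t + - (n.+1%:R * x)).
Proof.
have D : is_derive t 1 (fun t : R => n.+1%:R * t + - (n.+1%:R * x)) n.+1%:R.
  by apply: is_derive_eq; rewrite /GRing.scale/= mulr1; ring.
rewrite derive1E /scaled_step derive_comp.
- by rewrite derive_val mulrC.
- exact: (@smooth_smoothstep R [::]).
- by apply/derivable1_diffP; case: D.
Qed.

Lemma scaled_step_out n x t : t <= x -> scaled_step n x t = 0.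
Proof.
move=> tx; apply: smoothstep0.
by rewrite subr_le0 ler_pM2l ?ltr0n.
Qed.

Lemma scaled_step_in n x t : x + n.+1%:R^-1 <= t -> scaled_step n x t = 1.
Proof.
move=> tx; apply: smoothstep1; rewrite -mulrBr mulrC -ler_pdivrMr ?ltr0n// div1r.
by rewrite lerBrDl.
Qed.

Lemma scaled_step_cvg (c d : R) (u : R -> R) (x : R) :
  integ mu `]c, d[ u -> c < x < d -> lebesgue_pt (u \_ `]c, d[) x ->
  \int[mu]_(t in `]c, d[) (u t * derive1 (scaled_step n x) t) @[n --> \oo] --> u x.
Proof.
move=> iu /andP[cx xd] Lx; set I : set (measurableTypeR R) := `]c, d[%classic.
have mI : measurable I by exact: measurable_itv.
have [C C0 HC] := derive1_smoothstep_bounded.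
pose U := u \_ (`]c, d[%classic : set R); rewrite -/U in Lx.
have Ux : U x = u x by rewrite /U patchE mem_set//= in_itv/= cx xd.
have mU : measurable_fun setT U.
  by apply/(measurable_restrictT _ mI); exact: integ_measurable iu.
apply/cvgrPdist_le => e e0.
have e1 : 0 < e / (4 * C + 1) by rewrite divr_gt0// ltr_wpDl// mulr_ge0.
have [r0 /= r00 Hr] : \forall r \near 0^'+, (davg U x r <= (e / (4 * C + 1))%:E)%E.
  have /fine_cvgP[dfin /cvgrPdist_le dc] := Lx.
  near=> r; have fr : davg U x r \is a fin_num by near: r.
  rewrite -(fineK fr) lee_fin (le_trans (ler_norm _))//.
  by rewrite -normrN -sub0r; near: r; exact: dc.
near=> n.
have n0 : 0 < n.+1%:R :> R by rewrite ltr0n.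
have nr : 2 / n.+1%:R < r0.
  have : n.+1%:R^-1 < r0 / 2.
    by near: n; apply: (near_infty_natSinv_lt (PosNum (_ : 0 < r0 / 2))); rewrite divr_gt0.
  by rewrite ltr_pdivlMr// mulrC.
have nd : x + n.+1%:R^-1 < d.
  rewrite -ltrBrDl; near: n.
  by apply: (near_infty_natSinv_lt (PosNum (_ : 0 < d - x))); rewrite subr_gt0.
pose tau := derive1 (scaled_step n x).
have stau : smooth tau by exact: smooth_derive1 (smooth_scaled_step n x).
have mtau : measurable_fun setT tau.
  by apply: continuous_measurable_fun; exact: smooth_continuous.
have tauC t : `|tau t| <= n.+1%:R * C.
  by rewrite /tau derive1_scaled_step normrM gtr0_norm// ler_pM2l.
have tau0 (t : R) : ~ ball x (2 / n.+1%:R) t -> tau t = 0.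
  move=> nb; rewrite /tau derive1_scaled_step derive1_smoothstep_out ?mulr0//.
  rewrite -mulrBr; apply/negPn/negP; rewrite negb_or -!leNgt => /andP[t0 t1].
  apply: nb; rewrite /ball/= ltr_distlC.
  have xt : x <= t by rewrite -subr_ge0 -(pmulr_rge0 _ n0).
  have tx : t - x <= n.+1%:R^-1 by rewrite -(ler_pM2l n0) divff// gt_eqF.
  have w0 : 0 < n.+1%:R^-1 :> R by rewrite invr_gt0.
  apply/andP; split.
    by apply: lt_le_trans xt; rewrite ltrBlDr ltrDl mulr_gt0.
  by rewrite -ltrBlDl (le_lt_trans tx)// mulr_natl mulr2n ltrDl.
have mtauI : measurable_fun I tau := measurable_funTS mtau.
have i1 : integ mu I (fun t => u t * tau t) := integM_bounded mI iu mtauI (fun t _ => tauC t).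
have i2 : integ mu I (fun t => u x * tau t) :=
  integM_bounded mI (integ_cst_oo c d (u x)) mtauI (fun t _ => tauC t).
have -> : u x = \int[mu]_(t in I) (u x * tau t).
  rewrite RintZl//.
  rewrite /tau smooth_FTC//; [|exact: smooth_scaled_step|by rewrite ltW// (lt_trans cx)].
  by rewrite scaled_step_in ?ltW// scaled_step_out ?ltW// subr0 mulr1.
rewrite -RintegralB// -lee_fin.
apply: (@le_trans _ _ (\int[mu]_(t in I) `|u x * tau t - u t * tau t|%:E)%E).
  rewrite -EFin_Rint//; last by apply: integ_norm => //; exact: integB.
  by rewrite lee_fin; apply: le_normr_Rintegral => //; exact: integB.
have davgE : davg U x (2 / n.+1%:R) =
    (((2 / n.+1%:R * 2)^-1)%:E *
     \int[mu]_(t in ball x (2 / n.+1%:R)%R) `|U t - U x|%:E)%E.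
  rewrite /davg /iavg lebesgue_measure_ball ?divr_ge0//.
  rewrite inver mulr_natr; case: ifPn => [/eqP H|_ //].
  by move/eqP : H; rewrite mulrn_eq0/= gt_eqF// divr_gt0.
apply: (@le_trans _ _ ((n.+1%:R * C)%:E *
    \int[mu]_(t in ball x (2 / n.+1%:R)%R) `|U t - U x|%:E)%E).
  rewrite -ge0_integralZl//; last 3 first.
  - exact: measurable_ball.
  - apply/measurable_EFinP; apply: measurableT_comp => //; apply: measurable_funB => //.
    exact: measurable_funTS.
  - by rewrite lee_fin mulr_ge0.
  rewrite [leLHS]integral_mkcond [leRHS]integral_mkcond; apply: ge0_le_integral => //.
  - by move=> t _; rewrite patchE; case: ifP.
  - apply/(measurable_restrictT _ mI); apply/measurable_EFinP; apply: measurableT_comp => //.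
    by apply: measurable_funB; [exact: integ_measurable i2|exact: integ_measurable i1].
  - apply/(measurable_restrictT _ (measurable_ball _ _)).
    apply/measurable_EFinP; apply: measurable_funM => //; apply: measurableT_comp => //.
    by apply: measurable_funB => //; exact: measurable_funTS.
  move=> t _; rewrite !patchE; case: ifPn => It; last first.
    by case: ifPn => _//; rewrite -EFinM lee_fin mulr_ge0// mulr_ge0.
  case: ifPn => [tb|/negP tb]; last first.
    by rewrite tau0 ?mulr0 ?subrr ?normr0// => tb'; apply: tb; apply/mem_set.
  rewrite -EFinM lee_fin -mulrBl normrM mulrC distrC.
  rewrite [U t]patchE (It : t \in `]c, d[%classic) Ux.
  by rewrite ler_wpM2r.
have {}Hr := Hr (2 / n.+1%:R) _ _.
have : (davg U x (2 / n.+1%:R) <= (e / (4 * C + 1))%:E)%E.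
  apply: Hr; last by rewrite divr_gt0.
  by rewrite /ball_/= sub0r normrN gtr0_norm ?divr_gt0.
rewrite davgE lee_pdivrMl; last by rewrite !mulr_gt0// invr_gt0.
move=> H; apply: le_trans (lee_wpmul2l _ H) _; first by rewrite lee_fin mulr_ge0.
rewrite -!EFinM lee_fin.
have -> : n.+1%:R * C * (2 / n.+1%:R * 2 * (e / (4 * C + 1))) = e * (4 * C / (4 * C + 1)).
  have c1 : 4 * C + 1 != 0 by rewrite gt_eqF// ltr_wpDl// mulr_ge0.
  by move: (n.+1%:R : R) n0 => m m0; field; rewrite c1 gt_eqF.
have c2 : 4 * C / (4 * C + 1) <= 1.
  have c0 : 0 <= 4 * C by rewrite mulr_ge0.
  by rewrite ler_pdivrMr ?mul1r ?lerDl// ltr_wpDl.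
by rewrite -[leRHS]mulr1 ler_wpM2l// ltW.
Unshelve. all: by end_near. Qed.

Lemma weak_primitive (c d : R) (f h : R -> R) :
  integ mu `]c, d[ f -> integ mu `]c, d[ h ->
  (forall chi, test_fun `]c, d[ chi ->
     \int[mu]_(t in `]c, d[) (f t * derive1 chi t + h t * chi t) = 0) ->
  exists C, {ae mu, forall x, c < x < d -> f x = C + \int[mu]_(t in `]c, x[) h t}.
Proof.
move=> fi hi H; have mI : measurable (`]c, d[%classic : set (measurableTypeR R)).
  exact: measurable_itv.
pose u x := f x - \int[mu]_(t in `]c, x[) h t.
have iu : integ mu `]c, d[ u.
  apply: integB => //.
  have [_ + _] := triangle_fubini_integ hi (integ_cst_oo c d 1).
  by apply: eq_integ => // t _; rewrite mul1r.
have Hu chi : test_fun `]c, d[ chi -> \int[mu]_(t in `]c, d[) (u t * derive1 chi t) = 0.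
  move=> tchi; have [sc [A [cA AI chi0]]] := tchi.
  have chid : chi d = 0 by apply: chi0 => /AI; rewrite /= in_itv/= ltxx andbF.
  have [C1 HC1] := smooth_bounded c d (smooth_derive1 sc).
  have [C2 HC2] := smooth_bounded c d sc.
  have mc1 : measurable_fun `]c, d[ (derive1 chi).
    apply: measurable_funTS; apply: continuous_measurable_fun.
    exact: smooth_continuous (smooth_derive1 sc).
  have mc : measurable_fun `]c, d[ chi.
    by apply: measurable_funTS; apply: continuous_measurable_fun; exact: smooth_continuous.
  have i1 : integ mu `]c, d[ (fun t => f t * derive1 chi t).
    apply: (@integM_bounded _ _ _ _ _ _ _ C1) => // t.
    by rewrite /= in_itv/= => /andP[? ?]; apply: HC1; rewrite !ltW.
  have i2 : integ mu `]c, d[ (fun t => h t * chi t).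
    apply: (@integM_bounded _ _ _ _ _ _ _ C2) => // t.
    by rewrite /= in_itv/= => /andP[? ?]; apply: HC2; rewrite !ltW.
  have [i3 e3] := ibp_primitive hi sc chid.
  have := H _ tchi; rewrite RintegralD// => H1.
  under eq_Rintegral do rewrite /u mulrBl [_ * derive1 chi _]mulrC [_ * derive1 chi _]mulrC.
  rewrite RintegralB//; last by apply: eq_integ i1 => // t _; rewrite mulrC.
  rewrite e3 opprK -[RHS]H1; congr (_ + _).
  by apply: eq_Rintegral => t _; rewrite mulrC.
have aeL : {ae mu, forall x, lebesgue_pt (u \_ `]c, d[) x}.
  by apply: lebesgue_differentiation; exact: integrable_locally.
have [[y [cyd Ly]]|ny] := pselect (exists y, c < y < d /\ lebesgue_pt (u \_ `]c, d[) y); last first.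
  exists 0; apply: ae_impl aeL => x Lx cxd.
  by exfalso; apply: ny; exists x.
exists (u y); apply: ae_impl aeL => x Lx cxd.
suff -> : u y = u x by rewrite subrK.
have Cx := scaled_step_cvg iu cxd Lx; have Cy := scaled_step_cvg iu cyd Ly.
apply: (@cvg_unique _ (@norm_hausdorff _ _) _ _ _ _ Cy).
apply: cvg_trans Cx; apply: near_eq_cvg.
have [/andP[cx xd] /andP[cy yd]] := (cxd, cyd).
near=> n; apply/eqP; rewrite -subr_eq0; apply/eqP.
have nx : n.+1%:R^-1 < d - x.
  by near: n; apply: (near_infty_natSinv_lt (PosNum (_ : 0 < d - x))); rewrite subr_gt0.
have ny : n.+1%:R^-1 < d - y.
  by near: n; apply: (near_infty_natSinv_lt (PosNum (_ : 0 < d - y))); rewrite subr_gt0.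
have sx := smooth_scaled_step n x; have sy := smooth_scaled_step n y.
have [Bx HBx] := smooth_bounded c d (smooth_derive1 sx).
have [By HBy] := smooth_bounded c d (smooth_derive1 sy).
rewrite -RintegralB//; last 2 first.
- apply: (@integM_bounded _ _ _ _ _ _ _ Bx) => //.
    by apply: measurable_funTS; apply: continuous_measurable_fun; exact: smooth_continuous (smooth_derive1 sx).
  by move=> t; rewrite /= in_itv/= => /andP[? ?]; apply: HBx; rewrite !ltW.
- apply: (@integM_bounded _ _ _ _ _ _ _ By) => //.
    by apply: measurable_funTS; apply: continuous_measurable_fun; exact: smooth_continuous (smooth_derive1 sy).
  by move=> t; rewrite /= in_itv/= => /andP[? ?]; apply: HBy; rewrite !ltW.
pose chi t := scaled_step n x t - scaled_step n y t.
rewrite -[RHS](Hu chi).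
  apply: eq_Rintegral => t _; rewrite -mulrBr; congr (_ * _).
  rewrite !derive1E deriveB//; exact: smooth_derivable.
split; first by apply: Ck_smooth => k; apply: CkB; exact: smooth_Ck.
exists `[Num.min x y, Num.max x y + n.+1%:R^-1]%classic; split.
- exact: segment_compact.
- move=> t; rewrite /= !in_itv/= => /andP[t1 t2]; apply/andP; split.
    by apply: lt_le_trans t1; rewrite lt_min cx.
  by apply: le_lt_trans t2 _; rewrite -ltrBrDr gt_max !ltrBrDr -!ltrBrDl nx ny.
- move=> t; rewrite /= in_itv/= => /negP; rewrite negb_and -!ltNge => /orP[].
    by rewrite lt_min /chi => /andP[/ltW tx /ltW ty]; rewrite !scaled_step_out// subrr.
  rewrite -ltrBrDr gt_max => /andP[tx ty].
  by rewrite /chi !scaled_step_in ?subrr// -lerBrDr ltW.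
Unshelve. all: by end_near. Qed.

End WeakPrimitive.

(** * The sine system *)

Lemma tail_integrals_ae0 {R : realType} (c d : R) (h : R -> R) :
  (@lebesgue_measure R).-integrable `]c, d[ (EFin \o h) ->
  (forall y, c < y < d -> \int[@lebesgue_measure R]_(t in `]y, d[) h t = 0) ->
  {ae @lebesgue_measure R, forall x, c < x < d -> h x = 0}.
Proof.
move=> ih h0; have [cd|dc] := ltP c d; last first.
  apply: aeW => x /andP[cx xd]; move: (lt_trans cx xd).
  by rewrite ltNge dc.
have H chi : test_fun `]c, d[ chi ->
    \int[lebesgue_measure]_(t in `]c, d[) (h t * derive1 chi t + 0 * chi t) = 0.
  move=> tchi; have [stau [A [cA AI tau0]]] := test_fun_derive1 (itv_open _ _) tchi.
  set tau := derive1 chi in stau tau0.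
  have [C HC] := smooth_bounded c d (smooth_derive1 stau).
  have it : (@lebesgue_measure R).-integrable `]c, d[ (EFin \o derive1 tau).
    apply: (integ_le (g := fun=> C)) => //; last exact: integ_cst_oo.
    - apply: measurable_funTS; apply: continuous_measurable_fun.
      exact: smooth_continuous (smooth_derive1 stau).
    - by move=> x; rewrite /= in_itv/= => /andP[? ?]; apply: HC; rewrite !ltW.
  have [_ _ E] := triangle_fubini_integ it ih.
  transitivity (\int[lebesgue_measure]_(t in `]c, d[)
     (h t * \int[lebesgue_measure]_(r in `]c, t[) derive1 tau r)).
    apply: eq_Rintegral => t /set_mem; rewrite /= in_itv/= => /andP[ct td].
    rewrite smooth_FTC ?ltW// (tau0 c) ?subr0 ?mul0r ?addr0//.
    by move=> /AI; rewrite /= in_itv/= ltxx.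
  rewrite -E; under eq_Rintegral => r /set_mem.
    rewrite /= in_itv/= => rcd; rewrite h0// mulr0.
    over.
  by rewrite Rintegral_cst// mul0r.
have i0 : (@lebesgue_measure R).-integrable `]c, d[ (EFin \o (fun=> 0)).
  exact: integ_cst_oo.
have [C HC] := weak_primitive ih i0 H.
have {}HC : {ae @lebesgue_measure R, forall x, c < x < d -> h x = C}.
  apply: ae_impl HC => x HC /HC ->.
  by rewrite Rintegral_cst// mul0r addr0.
have m0 : c < (c + d) / 2 < d by apply/andP; split; lra.
have := h0 _ m0.
suff -> : \int[lebesgue_measure]_(t in `]((c + d) / 2), d[) h t = C * (d - (c + d) / 2).
  move/eqP; rewrite mulf_eq0 => /orP[/eqP C0|].
    by apply: ae_impl HC => x HC /HC ->.
  by rewrite subr_eq0 => /eqP E; move: m0; rewrite -E ltxx andbF.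
have sub : `]((c + d) / 2), d[ `<=` (`]c, d[ : set R).
  by apply: subset_itvr; rewrite bnd_simp ltW//; case/andP: m0.
transitivity (\int[lebesgue_measure]_(t in `]((c + d) / 2), d[) C).
  apply: ae_eq_Rint => //.
    by apply: measurable_funS sub _ => //; exact: integ_measurable ih.
  by apply: ae_impl HC => x HC /sub; rewrite /= in_itv/= => /HC.
rewrite Rintegral_cst//= lebesgue_measure_itv/= lte_fin.
by case/andP: m0 => _ ->.
Qed.

Section Bernoulli.
Context {R : realType}.

Lemma bernoulli_ineq (x : R) m : -1 <= x -> 1 + m%:R * x <= (1 + x) ^+ m.
Proof.
move=> x1; elim: m => [|m IH]; first by rewrite mul0r addr0 expr0.
have x1' : 0 <= 1 + x by lra.
rewrite exprS; apply: le_trans (ler_wpM2l x1' IH).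
rewrite -natr1; have : 0 <= m%:R * x ^+ 2 by rewrite mulr_ge0// sqr_ge0.
rewrite expr2; nra.
Qed.

Lemma step_poly_cvg1 (p : R) : 0 <= p -> p < 2^-1 ->
  (1 - p ^+ n) ^+ (2 ^ n) @[n --> \oo] --> (1 : R).
Proof.
move=> p0 p2; apply: (@squeeze_cvgr _ _ _ _ (fun n => 1 - (2 * p) ^+ n) (fun=> 1)).
- near=> n; have pn1 : p ^+ n <= 1 by rewrite exprn_ile1//; lra.
  rewrite exprn_ile1 ?andbT ?subr_ge0 ?lerBlDr ?lerDl ?exprn_ge0//.
  have := @bernoulli_ineq (- p ^+ n) (2 ^ n)%N; rewrite lerN2 => /(_ pn1).
  by rewrite mulrN natrX -exprMn lerBlDr.
- rewrite -[X in _ --> X]subr0; apply: cvgB; first exact: cvg_cst.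
  by apply: cvg_expr; rewrite ger0_norm ?mulr_ge0//; lra.
- exact: cvg_cst.
Unshelve. all: by end_near. Qed.

Lemma step_poly_cvg0 (p : R) : 2^-1 < p -> p <= 1 ->
  (1 - p ^+ n) ^+ (2 ^ n) @[n --> \oo] --> (0 : R).
Proof.
move=> p2 p1; have p0 : 0 < p by lra.
apply: (@squeeze_cvgr _ _ _ _ (fun=> 0) (fun n => ((2 * p)^-1) ^+ n)).
- near=> n; have pn1 : p ^+ n <= 1 by rewrite exprn_ile1// ltW.
  have pn0 : 0 <= p ^+ n by rewrite exprn_ge0// ltW.
  rewrite exprn_ge0 ?subr_ge0//=.
  have b : 1 + (2 ^ n)%:R * p ^+ n <= (1 + p ^+ n) ^+ (2 ^ n).
    by apply: bernoulli_ineq; lra.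
  have b1 : (2 * p) ^+ n <= (1 + p ^+ n) ^+ (2 ^ n).
    by apply: le_trans b; rewrite natrX -exprMn lerDr.
  have q0 : 0 < (2 * p) ^+ n by rewrite exprn_gt0// mulr_gt0.
  rewrite exprVn -[leRHS]mul1r ler_pdivlMr//.
  apply: le_trans (ler_wpM2l _ b1) _; first by rewrite exprn_ge0// subr_ge0.
  rewrite -exprMn exprn_ile1//; nra.
- exact: cvg_cst.
- apply: cvg_expr; rewrite ger0_norm ?invr_ge0 ?mulr_ge0 ?ltW// invf_lt1; lra.
Unshelve. all: by end_near. Qed.

End Bernoulli.

Section SineSystem.
Context {R : realType}.
Variable (a : R).
Hypothesis a0 : 0 < a.
Local Notation mu := (@lebesgue_measure R).
Local Notation integ m D f := (m.-integrable D (EFin \o f)).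
Local Notation E := (`](- a), a[%classic : set (measurableTypeR R)).

Definition freq (k : nat) : R := k%:R * (pi / (2 * a)).
Definition sine (k : nat) (z : R) : R := sin (freq k * (z + a)).
Definition cosine (k : nat) (z : R) : R := cos (freq k * (z + a)).

Lemma freq_gt0 k : (0 < k)%N -> 0 < freq k.
Proof. by move=> k0; rewrite mulr_gt0 ?ltr0n// divr_gt0 ?pi_gt0// mulr_gt0. Qed.

Lemma is_derive_phase k (z : R) : is_derive z 1 (fun z => freq k * (z + a)) (freq k).
Proof. by apply: is_derive_eq; rewrite /GRing.scale/=; ring. Qed.

Lemma is_derive_sine (k : nat) (z : R) : is_derive z 1 (sine k) (freq k * cosine k z).
Proof.
have D := is_derive_phase k z; have := is_derive_sin (freq k * (z + a)) => Ds.
by have := @is_derive1_comp _ sin (fun z => freq k * (z + a)) z _ _ Ds D; rewrite mulrC.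
Qed.

Lemma is_derive_cosine (k : nat) (z : R) : is_derive z 1 (cosine k) (- freq k * sine k z).
Proof.
have D := is_derive_phase k z; have := is_derive_cos (freq k * (z + a)) => Ds.
by have := @is_derive1_comp _ cos (fun z => freq k * (z + a)) z _ _ Ds D; rewrite mulrC mulrN -mulNr.
Qed.

Lemma derive1_sine k : derive1 (sine k) = fun z => freq k * cosine k z.
Proof.
by apply/funext => z; have D := is_derive_sine k z; rewrite derive1E derive_val.
Qed.

Lemma derive1_cosine k : derive1 (cosine k) = fun z => - freq k * sine k z.
Proof.
by apply/funext => z; have D := is_derive_cosine k z; rewrite derive1E derive_val.
Qed.

Lemma Ck_trig n k (c d : R) : Ck n (fun z => c * sine k z + d * cosine k z).
Proof.
elim: n c d => [//|n IH] c d.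
have dsn z : differentiable (sine k) z.
  by apply/derivable1_diffP; case: (is_derive_sine k z).
have dcn z : differentiable (cosine k) z.
  by apply/derivable1_diffP; case: (is_derive_cosine k z).
have D (z : R) : is_derive z 1 (fun z => c * sine k z + d * cosine k z)
    (- (d * freq k) * sine k z + c * freq k * cosine k z).
  have Ds := is_derive_sine k z; have Dc := is_derive_cosine k z.
  by apply: is_derive_eq; rewrite /GRing.scale/=; ring.
have df z : differentiable (fun z => c * sine k z + d * cosine k z) z.
  by apply/derivable1_diffP; case: (D z).
split=> // v; rewrite (_ : 'D_v _ =
    fun z => - (v * d * freq k) * sine k z + v * c * freq k * cosine k z).
  exact: IH.
by apply/funext => z; rewrite derive_real// derive1E (@derive_val _ _ _ _ _ _ _ (D z)); ring.
Qed.

Lemma smooth_sine k : smooth (sine k).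
Proof.
apply: Ck_smooth => n; rewrite (_ : sine k = fun z => 1 * sine k z + 0 * cosine k z).
  exact: Ck_trig.
by apply/funext => z; rewrite mul1r mul0r addr0.
Qed.

Lemma smooth_cosine k : smooth (cosine k).
Proof.
apply: Ck_smooth => n; rewrite (_ : cosine k = fun z => 0 * sine k z + 1 * cosine k z).
  exact: Ck_trig.
by apply/funext => z; rewrite mul1r mul0r add0r.
Qed.

Lemma sin_natpi k : sin (k%:R * pi) = 0 :> R.
Proof.
elim: k => [|k IH]; first by rewrite mul0r sin0.
by rewrite -natr1 mulrDl mul1r sinDpi IH oppr0.
Qed.

Lemma freq_2a k : freq k * (a + a) = k%:R * pi.
Proof. by rewrite /freq; field; rewrite gt_eqF. Qed.

Lemma sine_left k : sine k (- a) = 0.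
Proof. by rewrite /sine addNr mulr0 sin0. Qed.

Lemma sine_right k : sine k a = 0.
Proof. by rewrite /sine freq_2a sin_natpi. Qed.

Lemma sine_le1 k z : `|sine k z| <= 1.
Proof. by rewrite ler_norml sin_geN1 sin_le1. Qed.

Lemma cosine_le1 k z : `|cosine k z| <= 1.
Proof. by rewrite ler_norml cos_geN1 cos_le1. Qed.

Lemma measurable_sine k D : measurable_fun D (sine k).
Proof.
apply: measurable_funTS; apply: continuous_measurable_fun.
exact: smooth_continuous (smooth_sine k).
Qed.

Lemma measurable_cosine k D : measurable_fun D (cosine k).
Proof.
apply: measurable_funTS; apply: continuous_measurable_fun.
exact: smooth_continuous (smooth_cosine k).
Qed.

Let NaLa : - a <= a. Proof. by rewrite lerNl ltW// (lt_trans _ a0)// oppr_lt0. Qed.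

Lemma integ_cosine k : integ mu E (cosine k).
Proof.
apply: (integ_le (g := fun=> 1)) => //; last exact: integ_cst_oo.
- exact: measurable_cosine.
- by move=> z _; exact: cosine_le1.
Qed.

Lemma int_cosine k : (0 < k)%N -> \int[mu]_(z in E) cosine k z = 0.
Proof.
move=> k0; have := smooth_FTC (smooth_sine k) NaLa.
rewrite derive1_sine sine_left sine_right subrr RintZl//; last exact: measurable_cosine.
by move/eqP; rewrite mulf_eq0 gt_eqF ?freq_gt0//= => /eqP.
Qed.

Lemma int_cosine0 : \int[mu]_(z in E) cosine 0 z = 2 * a.
Proof.
transitivity (\int[mu]_(z in E) 1).
  by apply: eq_Rintegral => z _; rewrite /cosine /freq !mul0r cos0.
rewrite Rintegral_cst//= lebesgue_measure_itv/= lte_fin.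
by rewrite -subr_gt0 opprK ltr_wpDl ?ltW//= mul1r -mulr2n mulr_natl.
Qed.

Lemma sine_mul j k z : (j <= k)%N ->
  sine j z * sine k z = 2^-1 * (cosine (k - j) z - cosine (k + j) z).
Proof.
move=> jk; rewrite /sine /cosine /freq natrB// natrD !mulrBl !mulrDl.
by rewrite cosB cosD; field.
Qed.

Lemma cosine_mul j k z : (j <= k)%N ->
  cosine j z * cosine k z = 2^-1 * (cosine (k - j) z + cosine (k + j) z).
Proof.
move=> jk; rewrite /cosine /freq natrB// natrD !mulrBl !mulrDl.
by rewrite cosB cosD; field.
Qed.

Lemma sine_orth j k : (0 < j)%N -> (0 < k)%N ->
  \int[mu]_(z in E) (sine j z * sine k z) = a * (j == k)%:R.
Proof.
wlog jk : j k / (j <= k)%N => [H|] j0 k0.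
  have [/H|/ltnW kj] := leqP j k; first exact.
  by rewrite eq_sym -H//; apply: eq_Rintegral => z _; rewrite mulrC.
under eq_Rintegral do rewrite sine_mul//.
rewrite RintZl//; last by apply: measurable_funB; exact: measurable_cosine.
rewrite RintegralB//; [|exact: integ_cosine..].
rewrite (@int_cosine (k + j)) ?addn_gt0 ?k0// subr0.
have [->|jk'] := eqVneq j k; first by rewrite subnn int_cosine0 /=; field.
by rewrite int_cosine ?subn_gt0 ?ltn_neqAle ?jk'//= !mulr0.
Qed.

Lemma cosine_orth j k : (0 < j)%N -> (0 < k)%N ->
  \int[mu]_(z in E) (cosine j z * cosine k z) = a * (j == k)%:R.
Proof.
wlog jk : j k / (j <= k)%N => [H|] j0 k0.
  have [/H|/ltnW kj] := leqP j k; first exact.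
  by rewrite eq_sym -H//; apply: eq_Rintegral => z _; rewrite mulrC.
under eq_Rintegral do rewrite cosine_mul//.
rewrite RintZl//; last by apply: measurable_funD; exact: measurable_cosine.
rewrite RintegralD//; [|exact: integ_cosine..].
rewrite (@int_cosine (k + j)) ?addn_gt0 ?k0// addr0.
have [->|jk'] := eqVneq j k; first by rewrite subnn int_cosine0 /=; field.
by rewrite int_cosine ?subn_gt0 ?ltn_neqAle ?jk'//= !mulr0.
Qed.

Lemma sine_recl k z : sine k.+1 z * cosine 1 z = 2^-1 * (sine k.+2 z + sine k z).
Proof.
have aux (X Y S C : R) : S ^+ 2 + C ^+ 2 = 1 ->
    (X * C + Y * S) * C = 2^-1 * ((X * C + Y * S) * C + (Y * C - X * S) * S + X).
  move=> H; have -> : 2^-1 * ((X * C + Y * S) * C + (Y * C - X * S) * S + X) =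
      (X * C + Y * S) * C + 2^-1 * X * (1 - (S ^+ 2 + C ^+ 2)) by field.
  by rewrite H subrr mulr0 addr0.
rewrite /sine /cosine /freq -[k.+2]addn1 -[k.+1]addn1 !natrD !mulrDl !sinD !cosD.
by apply: aux; rewrite addrC cos2Dsin2.
Qed.

Lemma sine_cosine_pow (f : R -> R) : integ mu E f ->
  (forall k, (0 < k)%N -> \int[mu]_(z in E) (f z * sine k z) = 0) ->
  forall j k, \int[mu]_(z in E) (f z * sine k z * cosine 1 z ^+ j) = 0.
Proof.
move=> fi H; elim=> [|j IH] k.
  under eq_Rintegral do rewrite expr0 mulr1.
  case: k => [|k]; last exact: H.
  under eq_Rintegral do rewrite /sine /freq !mul0r sin0 mulr0.
  by rewrite Rintegral_cst// mul0r.
have fi' k' : integ mu E (fun z => f z * sine k' z * cosine 1 z ^+ j).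
  apply: (@integM_bounded _ _ _ _ _ _ _ 1) => //.
  - apply: (@integM_bounded _ _ _ _ _ _ _ 1) => //; first exact: measurable_sine.
    by move=> z _; exact: sine_le1.
  - by apply: measurable_funX; exact: measurable_cosine.
  - by move=> z _; rewrite normrX exprn_ile1// cosine_le1.
case: k => [|k].
  under eq_Rintegral do rewrite /sine /freq !mul0r sin0 mulr0 mul0r.
  by rewrite Rintegral_cst// mul0r.
transitivity (\int[mu]_(z in E) (2^-1 * (f z * sine k.+2 z * cosine 1 z ^+ j +
    f z * sine k z * cosine 1 z ^+ j))).
  apply: eq_Rintegral => z _; rewrite exprS mulrA -[f z * _ * _]mulrA sine_recl.
  by ring.
rewrite RintZl//; last by apply: measurable_funD; exact: integ_measurable (fi' _).
by rewrite RintegralD// !IH addr0 mulr0.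
Qed.

Lemma sine_cosine_poly (f : R -> R) (P : {poly R}) : integ mu E f ->
  (forall k, (0 < k)%N -> \int[mu]_(z in E) (f z * sine k z) = 0) ->
  \int[mu]_(z in E) (f z * sine 1 z * P.[cosine 1 z]) = 0.
Proof.
move=> fi H; have E0 := sine_cosine_pow fi H.
suff: forall j, \int[mu]_(z in E) (f z * sine 1 z * cosine 1 z ^+ j * P.[cosine 1 z]) = 0.
  by move=> /(_ 0%N); under eq_Rintegral do rewrite expr0 mulr1.
have fi' j : integ mu E (fun z => f z * sine 1 z * cosine 1 z ^+ j).
  apply: (@integM_bounded _ _ _ _ _ _ _ 1) => //.
  - apply: (@integM_bounded _ _ _ _ _ _ _ 1) => //; first exact: measurable_sine.
    by move=> z _; exact: sine_le1.
  - by apply: measurable_funX; exact: measurable_cosine.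
  - by move=> z _; rewrite normrX exprn_ile1// cosine_le1.
have mP (Q : {poly R}) : measurable_fun E (fun z => Q.[cosine 1 z]).
  apply: measurableT_comp; last exact: measurable_cosine.
  by apply: continuous_measurable_fun; exact: continuous_horner.
elim/poly_ind: P => [|P c IH] j.
  under eq_Rintegral do rewrite horner0 mulr0.
  by rewrite Rintegral_cst// mul0r.
have [B HB] : exists B, forall z, `|P.[cosine 1 z]| <= B.
  exists (\sum_(i < size P) `|P`_i|) => z; rewrite horner_coef.
  apply: le_trans (ler_norm_sum _ _ _) _; apply: ler_sum => i _.
  by rewrite normrM ler_piMr// normrX exprn_ile1// cosine_le1.
transitivity (\int[mu]_(z in E) (f z * sine 1 z * cosine 1 z ^+ j.+1 * P.[cosine 1 z] +
    c * (f z * sine 1 z * cosine 1 z ^+ j))).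
  by apply: eq_Rintegral => z _; rewrite hornerD hornerMX hornerC exprS; ring.
rewrite RintegralD//; last 2 first.
- by apply: (@integM_bounded _ _ _ _ _ _ _ B).
- exact: integZ.
rewrite IH add0r RintZl//; last exact: integ_measurable (fi' j).
by rewrite E0 mulr0.
Qed.

Lemma sine_complete (f : R -> R) : integ mu E f ->
  (forall k, (0 < k)%N -> \int[mu]_(z in E) (f z * sine k z) = 0) ->
  {ae mu, forall z, - a < z < a -> f z = 0}.
Proof.
move=> fi H.
have if1 : integ mu E (fun z => f z * sine 1 z).
  apply: (@integM_bounded _ _ _ _ _ _ _ 1) => //; first exact: measurable_sine.
  by move=> z _; exact: sine_le1.
suff : {ae mu, forall z, - a < z < a -> f z * sine 1 z = 0}.
  apply: ae_impl => z Hz az; have /eqP := Hz az; rewrite mulf_eq0 => /orP[/eqP//|].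
  rewrite gt_eqF// /sine /freq mul1r sin_gt0_pi//.
  have zp : 0 < z + a by case/andP: az; rewrite -subr_gt0 opprK.
  rewrite mulr_gt0 ?divr_gt0 ?pi_gt0 ?mulr_gt0//=.
  rewrite mulrAC ltr_pdivrMr ?mulr_gt0// ltr_pM2l ?pi_gt0//.
  by case/andP: az => _ za; rewrite mulr_natl mulr2n ltrD2r.
apply: tail_integrals_ae0 => // y /andP[ay ya].
pose c := cosine 1 y.
pose p : {poly R} := (2^-1)%:P + (4^-1)%:P * ('X - c%:P).
pose q n := (1 - p ^+ n) ^+ (2 ^ n).
have qE n z : (q n).[cosine 1 z] = (1 - (2^-1 + 4^-1 * (cosine 1 z - c)) ^+ n) ^+ (2 ^ n).
  by rewrite /q /p !(hornerE, horner_exp).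
have p01 z : 0 <= 2^-1 + 4^-1 * (cosine 1 z - c) <= 1.
  have := cosine_le1 1 z; have := cosine_le1 1 y; rewrite -/c !ler_norml => /andP[? ?] /andP[? ?].
  by apply/andP; split; lra.
have q01 n z : `|(q n).[cosine 1 z]| <= 1.
  have /andP[p0 p1] := p01 z.
  rewrite qE normrX exprn_ile1// ger0_norm ?subr_ge0 ?exprn_ile1//.
  by rewrite lerBlDr lerDl exprn_ge0.
pose h z := f z * sine 1 z.
have mq n : measurable_fun E (fun z => (q n).[cosine 1 z]).
  apply: measurableT_comp; last exact: measurable_cosine.
  by apply: continuous_measurable_fun; exact: continuous_horner.
have phase z : - a < z < a -> 0 <= freq 1 * (z + a) <= pi.
  move=> /andP[az za]; have zp : 0 <= z + a by rewrite ltW// -[a]opprK subr_gt0.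
  rewrite (mulr_ge0 (ltW (freq_gt0 _)))//= -[leRHS]mul1r -(freq_2a 1).
  by rewrite ler_wpM2l ?lerD2r// ltW// freq_gt0.
have f1 : 0 < freq 1 by exact: freq_gt0.
have cosy z : - a < z < a -> (cosine 1 z < c) = (y < z).
  move=> az; rewrite /c /cosine ltr_cos ?in_itv/= ?phase ?ay ?ya//.
  by rewrite ltr_pM2l// ltrD2r.
have coszy z : - a < z < a -> (c < cosine 1 z) = (z < y).
  move=> az; rewrite /c /cosine ltr_cos ?in_itv/= ?phase ?ay ?ya//.
  by rewrite ltr_pM2l// ltrD2r.
have mh := integ_measurable if1.
have subE : `]y, a[ `<=` (E : set R) by apply: subset_itvr; rewrite bnd_simp ltW.
pose g := h \_ (`]y, a[%classic : set R).
have mg : measurable_fun E g.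
  apply: measurable_funTS; apply/(measurable_restrictT _ (measurable_itv _)).
  exact: measurable_funS mh.
have Hn n : (\int[mu]_(z in E) (h z * (q n).[cosine 1 z])%:E = 0)%E.
  rewrite -EFin_Rint//; first by rewrite sine_cosine_poly.
  by apply: (@integM_bounded _ _ _ _ _ _ _ 1).
have <- : \int[mu]_(z in E) g z = \int[mu]_(t in `]y, a[) (f t * sine 1 t).
  rewrite Rintegral_mkcond [RHS]Rintegral_mkcond; apply: eq_Rintegral => z _.
  rewrite /g !patchE; case: ifPn => Ez//; case: ifPn => // /set_mem/subE yz.
  by move: Ez; rewrite mem_set.
have [| | | | |_ _ Hcv] := @dominated_convergence _ _ _ mu E (measurable_itv _)
  (fun n z => (h z * (q n).[cosine 1 z])%:E) (EFin \o g) (fun z => `|h z|%:E).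
- by move=> n; apply/measurable_EFinP; exact: measurable_funM.
- exact/measurable_EFinP.
- have aeny : {ae mu, forall z, z != y}.
    exists [set y]; split => //; first exact: lebesgue_measure_set1.
    by move=> z /= /negP; rewrite negbK => /eqP.
  apply: ae_impl aeny => z zy; rewrite /= in_itv/= => az.
  apply: cvg_EFin; first by near=> n.
  rewrite /comp/= /g patchE; under eq_fun do rewrite qE.
  case: ifPn => [/set_mem|]; rewrite ?/= ?in_itv/=.
  + case/andP=> yz _.
    suff H1 : (1 - (2^-1 + 4^-1 * (cosine 1 z - c)) ^+ n) ^+ (2 ^ n) @[n --> \oo] --> (1 : R).
      have H2 := cvgMl_tmp (a := h z) H1.
      by rewrite mulr1 in H2; exact: H2.
    apply: step_poly_cvg1; first by case/andP: (p01 z).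
    by have := cosy z az; rewrite yz => ?; lra.
  + move=> nz; have zly : z < y.
      rewrite lt_neqAle zy leNgt; apply/negP => yz.
      by move/negP : nz; apply; apply/mem_set; rewrite /= in_itv/= yz; case/andP: az.
    suff H1 : (1 - (2^-1 + 4^-1 * (cosine 1 z - c)) ^+ n) ^+ (2 ^ n) @[n --> \oo] --> (0 : R).
      have H2 := cvgMl_tmp (a := h z) H1.
      by rewrite mulr0 in H2; exact: H2.
    apply: step_poly_cvg0; last by case/andP: (p01 z).
    by have := coszy z az; rewrite zly => ?; lra.
- by apply: integ_norm.
- apply: aeW => z n _ /=; rewrite lee_fin normrM.
  by rewrite ler_piMr.
have {}Hcv : (0%E : \bar R) @[n --> \oo] --> (\int[mu]_(z in E) (EFin \o g) z)%E.
  by apply: cvg_trans Hcv; apply: near_eq_cvg; near=> n; rewrite /= Hn.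
by rewrite /Rintegral -(cvg_lim (@ereal_hausdorff R) Hcv) lim_cst.
Unshelve. all: by end_near. Qed.

End SineSystem.

(** * Weighted L2 functions on the rectangle *)

Section AlmostEverywhere.
Context d (T : measurableType d) (R : realType).
Variable mu : {measure set T -> \bar R}.
Implicit Types (D : set T) (f g : T -> R).
Local Notation integ D f := (mu.-integrable D (EFin \o f)).

Lemma ae_le_Rint D f g : measurable D -> integ D f -> integ D g ->
  {ae mu, forall x, D x -> f x <= g x} ->
  \int[mu]_(x in D) f x <= \int[mu]_(x in D) g x.
Proof.
move=> mD fi gi fg; rewrite -subr_ge0 -RintegralB//.
rewrite (@ae_eq_Rint _ _ _ mu D _ (fun x => `|g x - f x|))//.
- exact: Rintegral_ge0.
- by apply: measurable_funB; [exact: integ_measurable gi|exact: integ_measurable fi].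
- by apply: measurableT_comp => //; apply: measurable_funB; [exact: integ_measurable gi|exact: integ_measurable fi].
- by apply: ae_impl fg => x H Dx; rewrite ger0_norm// subr_ge0 H.
Qed.

Lemma ae_integ_le D f g : measurable D -> measurable_fun D f -> integ D g ->
  {ae mu, forall x, D x -> `|f x| <= g x} -> integ D f.
Proof.
move=> mD mf gi fg; apply/integrableP; split; first exact/measurable_EFinP.
have [mg] := integrableP _ _ _ gi; apply: le_lt_trans.
apply: ae_ge0_le_integral => //.
- by apply: measurableT_comp => //; exact/measurable_EFinP.
- exact: measurableT_comp.
- by apply: ae_impl fg => x H Dx; rewrite lee_fin (le_trans (H Dx))// ler_norm.
Qed.

Lemma ge0_Rint0_ae D f : measurable D -> integ D f ->
  (forall x, D x -> 0 <= f x) -> \int[mu]_(x in D) f x = 0 ->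
  {ae mu, forall x, D x -> f x = 0}.
Proof.
move=> mD fi f0 I0; apply: ge0_int0_ae => //; first exact: integ_measurable fi.
by rewrite -EFin_Rint// I0.
Qed.

End AlmostEverywhere.

Section SliceMeasurability.
Context {R : realType}.
Local Notation mu := (@lebesgue_measure R).
Implicit Types (A B : set (measurableTypeR R)).

Lemma measurable_Rint_z A B (f : R * R -> R) : measurable A -> measurable B ->
  measurable_fun (A `*` B) f ->
  measurable_fun A (fun r => \int[mu]_(z in B) f (r, z)).
Proof.
move=> mA mB /(measurable_restrictT _ (measurableX mA mB)) mf.
have H := measurable_Rint_param mf.
apply: eq_measurable_fun (measurable_funTS H) => r Ar.
rewrite [RHS]Rintegral_mkcond; apply: eq_Rintegral => z _.
by rewrite patch_setX_slice patchE Ar.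
Qed.

Lemma measurable_swap (f : R * R -> R) : measurable_fun setT f ->
  measurable_fun setT (fun x : R * R => f (x.2, x.1)).
Proof.
move=> mf; apply: measurableT_comp => //; apply: measurable_fun_pair.
- exact: measurable_snd.
- exact: measurable_fst.
Qed.

Lemma measurable_Rint_r A B (f : R * R -> R) : measurable A -> measurable B ->
  measurable_fun (A `*` B) f ->
  measurable_fun B (fun z => \int[mu]_(r in A) f (r, z)).
Proof.
move=> mA mB /(measurable_restrictT _ (measurableX mA mB)) mf.
have H := measurable_Rint_param (measurable_swap mf).
apply: eq_measurable_fun (measurable_funTS H) => z Bz.
rewrite [RHS]Rintegral_mkcond; apply: eq_Rintegral => r _.
by rewrite /= patch_setX_slice !patchE Bz.
Qed.

End SliceMeasurability.

Section WeightedL2.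
Context {R : realType}.
Variables (rad a : R).
Hypotheses (a0 : 0 < a) (rad0 : 0 < rad).
Local Notation mu := (@lebesgue_measure R).
Local Notation leb2 := (mu \x mu)%E.
Local Notation integ m D f := (m.-integrable D (EFin \o f)).
Local Notation D := (`]0, rad[%classic : set (measurableTypeR R)).
Local Notation E := (`](- a), a[%classic : set (measurableTypeR R)).
Implicit Types u v : R * R -> R.

Let mD : measurable D. Proof. exact: measurable_itv. Qed.
Let mE : measurable E. Proof. exact: measurable_itv. Qed.

Lemma measurable_rect : measurable (D `*` E).
Proof. exact: measurableX. Qed.

Lemma rect_r0 x : rect rad a x -> 0 < x.1.
Proof. by move=> [/=]; rewrite in_itv/= => /andP[]. Qed.

Lemma in_L2_integ u : in_L2 rad a u ->
  integ leb2 (D `*` E) (fun x => u x ^+ 2 * x.1).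
Proof.
move=> [mu' fin]; apply: integ_lty => //.
- exact: measurable_rect.
- by apply: measurable_funM; [exact: measurable_funX|apply: measurable_funTS; exact: measurable_fst].
- by move=> x /rect_r0/ltW x0; rewrite mulr_ge0// sqr_ge0.
Qed.

Lemma integ_in_L2 u : measurable_fun (D `*` E) u ->
  integ leb2 (D `*` E) (fun x => u x ^+ 2 * x.1) -> in_L2 rad a u.
Proof.
move=> mu' iu; split => //; rewrite /L2sq -[X in (X < _)%E]/(\int[leb2]_(x in D `*` E) (u x ^+ 2 * x.1)%:E)%E.
by rewrite -EFin_Rint ?ltry//; exact: measurable_rect.
Qed.

Definition nrm2 u : R := \int[leb2]_(x in D `*` E) (u x ^+ 2 * x.1).

Lemma L2sqE u : in_L2 rad a u -> L2sq rad a u = (nrm2 u)%:E.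
Proof. by move=> /in_L2_integ iu; rewrite /nrm2 EFin_Rint//; exact: measurable_rect. Qed.

Lemma nrm2_ge0 u : 0 <= nrm2 u.
Proof.
by apply: Rintegral_ge0 => x /rect_r0/ltW x0; rewrite mulr_ge0// sqr_ge0.
Qed.

Lemma sqrD_le (x y : R) : (x + y) ^+ 2 <= 2 * x ^+ 2 + 2 * y ^+ 2.
Proof. have := sqr_ge0 (x - y); rewrite !expr2; nra. Qed.

Lemma nrm2_lin (c d : R) u v : in_L2 rad a u -> in_L2 rad a v ->
  in_L2 rad a (fun x => c * u x + d * v x) /\
  nrm2 (fun x => c * u x + d * v x) <= 2 * c ^+ 2 * nrm2 u + 2 * d ^+ 2 * nrm2 v.
Proof.
move=> Lu Lv; have iu := in_L2_integ Lu; have iv := in_L2_integ Lv.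
have mR := measurable_rect.
have mw : measurable_fun (D `*` E) (fun x => c * u x + d * v x).
  by apply: measurable_funD; apply: measurable_funM => //; [case: Lu|case: Lv].
have bnd x : rect rad a x -> (c * u x + d * v x) ^+ 2 * x.1 <=
    2 * c ^+ 2 * (u x ^+ 2 * x.1) + 2 * d ^+ 2 * (v x ^+ 2 * x.1).
  move=> Dx; have x0 := ltW (rect_r0 Dx); rewrite !mulrA -mulrDl ler_wpM2r//.
  by apply: le_trans (sqrD_le _ _) _; rewrite !exprMn !mulrA.
have ib : integ leb2 (D `*` E) (fun x => 2 * c ^+ 2 * (u x ^+ 2 * x.1) + 2 * d ^+ 2 * (v x ^+ 2 * x.1)).
  by apply: integD => //; exact: integZ.
have iw : integ leb2 (D `*` E) (fun x => (c * u x + d * v x) ^+ 2 * x.1).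
  apply: (integ_le mR _ _ ib).
    by apply: measurable_funM; [exact: measurable_funX|apply: measurable_funTS; exact: measurable_fst].
  move=> x Dx; rewrite ger0_norm; first exact: bnd.
  by rewrite mulr_ge0 ?sqr_ge0// ltW// (rect_r0 Dx).
split; first exact: integ_in_L2.
rewrite /nrm2 -!RintegralZl// -RintegralD//; [|exact: integZ..].
by apply: le_Rintegral => //; move=> x; exact: bnd.
Qed.

Lemma in_L2_slice_z u : in_L2 rad a u ->
  {ae mu, forall z, E z -> integ mu D (fun r => u (r, z) ^+ 2 * r)}.
Proof.
move=> /in_L2_integ iu.
by have [H _ _] := fubini_setX_z mD mE iu.
Qed.

Lemma integ_oo_sub (c d c' d' : R) (f : R -> R) : c <= c' -> d' <= d ->
  integ mu `]c, d[ f -> integ mu `]c', d'[ f.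
Proof.
move=> cc dd; apply: integrableS => //.
by apply: subset_itv; rewrite bnd_simp.
Qed.

Lemma in_L2_slice_r u : in_L2 rad a u ->
  {ae mu, forall r, D r -> integ mu E (fun z => u (r, z) ^+ 2) /\
                           integ mu E (fun z => u (r, z))}.
Proof.
move=> Lu; have iu := in_L2_integ Lu.
have [H _ _] := fubini_setX_r mD mE iu.
apply: ae_impl H => r H Dr; have {}H := H Dr.
have r0 : 0 < r by move: Dr; rewrite /= in_itv/= => /andP[].
have i2 : integ mu E (fun z => u (r, z) ^+ 2).
  have := integZ r^-1 mE H; apply: eq_integ => // z _.
  by rewrite mulrC mulfK// gt_eqF.
split=> //.
have mus : measurable_fun E (fun z => u (r, z)).
  by apply: (@measurable_slice_r _ D E) => //; case: Lu.
apply: (integ_le _ _ _ (integD mE i2 (integ_cst_oo (- a) a 1))) => //.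
move=> z _; rewrite -[u _ ^+ 2]real_normK ?num_real//.
have := sqr_ge0 (`|u (r, z)| - 1); have := normr_ge0 (u (r, z)); rewrite !expr2; nra.
Qed.

Definition coef (e : R -> R) u (r : R) : R := \int[mu]_(z in E) (u (r, z) * e z).

Lemma measurable_coef (e : R -> R) u : measurable_fun E e ->
  measurable_fun (D `*` E) u -> measurable_fun D (coef e u).
Proof.
move=> me mu'; rewrite /coef; apply: (measurable_Rint_z (f := fun x => u x * e x.2) mD mE).
apply: measurable_funM => //.
have := (measurable_restrictT _ mE).1 me => meT.
have meT2 : measurable_fun setT (fun x : R * R => (e \_ E) x.2).
  by apply: measurableT_comp => //; exact: measurable_snd.
apply: eq_measurable_fun (measurable_funTS meT2) => x /set_mem[_ Ex] /=.
by rewrite patchE mem_set.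
Qed.

Lemma coef_sqr_le (e : R -> R) u (r : R) : measurable_fun E e ->
  (forall z, `|e z| <= 1) -> measurable_fun (D `*` E) u -> D r ->
  integ mu E (fun z => u (r, z) ^+ 2) ->
  coef e u r ^+ 2 <= (2 * a) * \int[mu]_(z in E) (u (r, z) ^+ 2).
Proof.
move=> me e1 mu' Dr i2.
have mus : measurable_fun E (fun z => u (r, z)) by apply: (@measurable_slice_r _ D E).
have ie : integ mu E (fun z => e z ^+ 2 / 1).
  apply: (integ_le (g := fun=> 1)) => //; last exact: integ_cst_oo.
    by apply: measurable_funM => //; exact: measurable_funX.
  by move=> z _; rewrite divr1 normrX exprn_ile1.
have := @weighted_CS _ _ _ mu E (fun z => u (r, z)) e (fun=> 1) _ _ mus me _ ie.
have -> : \int[mu]_(z in E) (u (r, z) ^+ 2 * 1) = \int[mu]_(z in E) (u (r, z) ^+ 2).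
  by apply: eq_Rintegral => z _; rewrite mulr1.
move=> H; apply: le_trans (H _ _ _) _ => //.
  by apply: eq_integ i2 => // z _; rewrite mulr1.
rewrite mulrC ler_wpM2r//; first by apply: Rintegral_ge0 => z _; exact: sqr_ge0.
apply: (@le_trans _ _ (\int[mu]_(z in E) 1)).
  apply: le_Rintegral => //; first exact: integ_cst_oo.
  by move=> z _; rewrite divr1 -real_normK ?num_real// exprn_ile1.
rewrite Rintegral_cst//= lebesgue_measure_itv/= lte_fin.
by rewrite ifT ?opprK ?mul1r -?mulr2n ?mulr_natl// -subr_gt0 opprK addr_gt0.
Qed.

Lemma coef_L2 (e : R -> R) u : measurable_fun E e -> (forall z, `|e z| <= 1) ->
  in_L2 rad a u -> integ mu D (fun r => coef e u r ^+ 2 * r) /\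
  \int[mu]_(r in D) (coef e u r ^+ 2 * r) <= 2 * a * nrm2 u.
Proof.
move=> me e1 Lu; have iu := in_L2_integ Lu.
have [_ i2 E2] := fubini_setX_r mD mE iu.
have [mu' _] := Lu.
have mc : measurable_fun D (fun r => coef e u r ^+ 2 * r).
  by apply: measurable_funM => //; apply: measurable_funX; exact: measurable_coef.
have bnd : {ae mu, forall r, D r -> coef e u r ^+ 2 * r <=
    2 * a * \int[mu]_(z in E) (u (r, z) ^+ 2 * r)}.
  apply: ae_impl (in_L2_slice_r Lu) => r H Dr; have [H2 _] := H Dr.
  have r0 : 0 < r by move: Dr; rewrite /= in_itv/= => /andP[].
  have -> : \int[mu]_(z in E) (u (r, z) ^+ 2 * r) = r * \int[mu]_(z in E) (u (r, z) ^+ 2).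
    rewrite -RintZl//; last exact: integ_measurable H2.
    by apply: eq_Rintegral => z _; rewrite mulrC.
  rewrite [r * _]mulrC mulrA; apply: ler_wpM2r; first exact: ltW.
  exact: coef_sqr_le.
have i2' := integZ (2 * a) mD i2.
have ic : integ mu D (fun r => coef e u r ^+ 2 * r).
  apply: (ae_integ_le mD mc i2'); apply: ae_impl bnd => r H Dr.
  rewrite ger0_norm; first exact: H.
  by move: Dr; rewrite /= in_itv/= => /andP[/ltW r0 _]; rewrite mulr_ge0 ?sqr_ge0.
split=> //; rewrite /nrm2 E2 -RintegralZl//.
exact: ae_le_Rint.
Qed.

Definition tail_int v (x : R * R) : R := \int[mu]_(t in `]x.1, rad[) v (t, x.2).

Lemma measurable_tail_int v : measurable_fun (D `*` E) v ->
  measurable_fun (D `*` E) (tail_int v).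
Proof.
move=> mv; have mvT := (measurable_restrictT _ measurable_rect).1 mv.
have m0 : measurable_fun (D `*` E) (fun x : R * R =>
    \int[mu]_(t in D) v (t, x.2)).
  have H := measurable_Rint_r mD mE mv.
  have H' := (measurable_restrictT _ mE).1 H.
  have H2 : measurable_fun setT (fun x : R * R =>
      ((fun z => \int[mu]_(t in D) v (t, z)) \_ E) x.2).
    by apply: measurableT_comp => //; exact: measurable_snd.
  apply: eq_measurable_fun (measurable_funTS H2) => x /set_mem[_ Ex] /=.
  by rewrite patchE mem_set.
pose w (y : (R * R) * R) : R :=
  if y.1.1 < y.2 then (v \_ (D `*` E)) (y.2, y.1.2) else 0.
have mw : measurable_fun setT w.
  apply: measurable_fun_ifT => //.
  - apply: measurable_fun_ltr => //; apply: measurableT_comp => //; exact: measurable_fst.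
  - apply: measurableT_comp => //; apply: measurable_fun_pair => //.
    by apply: measurableT_comp => //; exact: measurable_snd.
have H := measurable_Rint_param mw.
apply: eq_measurable_fun (measurable_funTS H) => x /set_mem[Dx Ex].
rewrite /tail_int [RHS]Rintegral_mkcond; apply: eq_Rintegral => t _.
rewrite /w/= !patchE; case: ifPn => xt; case: ifPn => [/set_mem|].
- move=> [Dt _]; rewrite ifT//; apply/mem_set; rewrite /= in_itv/= xt.
  by move: Dt; rewrite /= in_itv/= => /andP[].
- move=> nt; rewrite ifF//; apply/negP => /set_mem; rewrite /= in_itv/= => /andP[_ td].
  move/negP : nt; apply; apply/mem_set; split => //=; rewrite in_itv/= td andbT.
  by apply: lt_trans xt; move: Dx; rewrite /= in_itv/= => /andP[].
- by rewrite /= in_itv/= (negbTE xt).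
- by [].
Qed.

Lemma Rint_cst_oo (c d k : R) : c <= d -> \int[mu]_(t in `]c, d[) k = k * (d - c).
Proof.
move=> cd; rewrite Rintegral_cst//= lebesgue_measure_itv/= lte_fin.
by case: ltgtP cd => //= ->; rewrite subrr.
Qed.

Lemma tail_int_slice v (z : R) : measurable_fun D (fun t => v (t, z)) ->
  integ mu D (fun t => v (t, z) ^+ 2 * t) -> forall r, D r ->
  integ mu `]r, rad[ (fun t => v (t, z)) /\
  tail_int v (r, z) ^+ 2 * r ^+ 3 <=
    rad ^+ 3 * \int[mu]_(t in D) (v (t, z) ^+ 2 * t).
Proof.
move=> mv iv r; rewrite /= in_itv/= => /andP[r0 rR].
have mI : measurable (`]r, rad[%classic : set (measurableTypeR R)) by exact: measurable_itv.
have sub : `]r, rad[ `<=` D by apply: subset_itvr; rewrite bnd_simp ltW.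
have mvI : measurable_fun `]r, rad[ (fun t => v (t, z)) by exact: measurable_funS mv.
have ivI : integ mu `]r, rad[ (fun t => v (t, z) ^+ 2 * t).
  by apply: integ_oo_sub iv => //; exact: ltW.
have t0 t : `]r, rad[%classic t -> 0 < t.
  by rewrite /= in_itv/= => /andP[rt _]; exact: lt_trans rt.
have i1 : integ mu `]r, rad[ (fun t => 1 ^+ 2 / t).
  apply: (integ_le _ _ _ (integ_cst_oo r rad r^-1)) => //.
    apply: measurable_funM => //; apply: (@measurable_funS _ _ _ _ `]0, rad[) => //.
    apply: open_continuous_measurable_fun => // x; rewrite inE /= in_itv/= => /andP[x0 _].
    by apply: cvgV; [exact: lt0r_neq0|exact: cvg_id].
  move=> t It; have tp := t0 _ It.
  rewrite expr1n div1r ger0_norm; last by rewrite invr_ge0 ltW.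
  rewrite lef_pV2 ?posrE// ltW//.
  by move: It; rewrite /= in_itv/= => /andP[].
have m1 : measurable_fun `]r, rad[ (fun=> 1 : R) by exact: measurable_cst.
have itv := weighted_mul_integ mI t0 mvI m1 ivI i1.
have itv1 : integ mu `]r, rad[ (fun t => v (t, z)).
  by apply: eq_integ mI itv => t _; rewrite mulr1.
split=> //.
have := weighted_CS mI t0 mvI m1 ivI i1.
under eq_Rintegral do rewrite mulr1.
rewrite -/(tail_int v (r, z)) => H.
have r3 : 0 <= r ^+ 3 by rewrite exprn_ge0// ltW.
have N0 : 0 <= \int[mu]_(t in D) (v (t, z) ^+ 2 * t).
  apply: Rintegral_ge0 => t; rewrite /= in_itv/= => /andP[/ltW ? _].
  by rewrite mulr_ge0// sqr_ge0.
have H1 : \int[mu]_(t in `]r, rad[) (v (t, z) ^+ 2 * t) <= \int[mu]_(t in D) (v (t, z) ^+ 2 * t).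
  rewrite -lee_fin !EFin_Rint//; apply: ge0_subset_integral => //.
    by apply/measurable_EFinP; exact: integ_measurable iv.
  move=> t; rewrite /= in_itv/= => /andP[/ltW ? _].
  by rewrite lee_fin mulr_ge0// sqr_ge0.
have H2 : \int[mu]_(t in `]r, rad[) (1 ^+ 2 / t) <= r^-1 * (rad - r).
  rewrite -(Rint_cst_oo _ (ltW rR)); apply: le_Rintegral => //; first exact: integ_cst_oo.
  move=> t It; have tp := t0 _ It; rewrite expr1n div1r lef_pV2 ?posrE//.
  by move: It; rewrite /= in_itv/= => /andP[/ltW].
have H20 : 0 <= \int[mu]_(t in `]r, rad[) (1 ^+ 2 / t).
  by apply: Rintegral_ge0 => t It; rewrite expr1n div1r invr_ge0 ltW// t0.
have N10 : 0 <= \int[mu]_(t in `]r, rad[) (v (t, z) ^+ 2 * t).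
  by apply: Rintegral_ge0 => t It; rewrite mulr_ge0 ?sqr_ge0// ltW// t0.
apply: le_trans (ler_wpM2r r3 H) _.
apply: le_trans (ler_wpM2r r3 (ler_pM N10 H20 H1 H2)) _.
rewrite -mulrA [leRHS]mulrC ler_wpM2l//.
have -> : r^-1 * (rad - r) * r ^+ 3 = (rad - r) * r ^+ 2.
  by field; rewrite gt_eqF.
have r0' := ltW r0; have rR' := ltW rR; have R0' := ltW rad0.
rewrite [rad ^+ 3]exprS; apply: ler_pM.
- by rewrite subr_ge0.
- exact: exprn_ge0.
- by rewrite lerBlDr lerDl.
- by rewrite ler_pXn2r.
Qed.

End WeightedL2.

(** * Traces *)

Section SmoothSlices.
Context {R : realType}.
Implicit Types w : R * R -> R.

Let quotient_r w (v r z : R) :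
  (fun h : R => h^-1 *: (((fun r => w (r, z)) \o shift r) (h *: v) - w (r, z))) =
  (fun h : R => h^-1 *: ((w \o shift (r, z)) (h *: ((v, 0) : R * R)) - w (r, z))).
Proof.
apply/funext => h /=; congr (_ *: (w _ - _)).
by rewrite -[RHS]/(h *: v + r, h *: (0 : R) + z) scaler0 add0r.
Qed.

Lemma derive_slice_r w (r v z : R) :
  'D_v (fun r => w (r, z)) r = 'D_(v, 0) w (r, z).
Proof. exact: (congr1 (fun f : R -> R => lim (f @ 0^')) (quotient_r w v r z)). Qed.

Lemma derivable_slice_r w (r z : R) : derivable w (r, z) (1, 0) ->
  derivable (fun r => w (r, z)) r 1.
Proof.
by rewrite /derivable => H; move: (quotient_r w 1 r z) H => <-.
Qed.

Let quotient_z w (v r z : R) :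
  (fun h : R => h^-1 *: (((fun z => w (r, z)) \o shift z) (h *: v) - w (r, z))) =
  (fun h : R => h^-1 *: ((w \o shift (r, z)) (h *: ((0, v) : R * R)) - w (r, z))).
Proof.
apply/funext => h /=; congr (_ *: (w _ - _)).
by rewrite -[RHS]/(h *: (0 : R) + r, h *: v + z) scaler0 add0r.
Qed.

Lemma derive_slice_z w (r v z : R) :
  'D_v (fun z => w (r, z)) z = 'D_(0, v) w (r, z).
Proof. exact: (congr1 (fun f : R -> R => lim (f @ 0^')) (quotient_z w v r z)). Qed.

Lemma derivable_slice_z w (r z : R) : derivable w (r, z) (0, 1) ->
  derivable (fun z => w (r, z)) z 1.
Proof.
by rewrite /derivable => H; move: (quotient_z w 1 r z) H => <-.
Qed.

Lemma smooth_slice_r w (z : R) : smooth w -> smooth (fun r => w (r, z)).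
Proof.
move=> sw; apply: Ck_smooth => n; elim: n w sw => [//|n IH] w sw; split.
  move=> r; apply/derivable1_diffP; apply: derivable_slice_r.
  exact: diff_derivable (sw [::] (r, z)).
move=> v; rewrite (_ : 'D_v _ = fun r => ('D_(v, 0) w) (r, z)).
  exact: (IH ('D_(v, 0) w)) (smooth_derive _ sw).
by apply/funext => r; rewrite derive_slice_r.
Qed.

Lemma smooth_slice_z w (r : R) : smooth w -> smooth (fun z => w (r, z)).
Proof.
move=> sw; apply: Ck_smooth => n; elim: n w sw => [//|n IH] w sw; split.
  move=> z; apply/derivable1_diffP; apply: derivable_slice_z.
  exact: diff_derivable (sw [::] (r, z)).
move=> v; rewrite (_ : 'D_v _ = fun z => ('D_(0, v) w) (r, z)).
  exact: (IH ('D_(0, v) w)) (smooth_derive _ sw).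
by apply/funext => z; rewrite derive_slice_z.
Qed.

Lemma derive1_slice_r w (z : R) : derive1 (fun r => w (r, z)) = fun r => 'D_er w (r, z).
Proof. by apply/funext => r; rewrite derive1E derive_slice_r. Qed.

Lemma derive1_slice_z w (r : R) : derive1 (fun z => w (r, z)) = fun z => 'D_ez w (r, z).
Proof. by apply/funext => z; rewrite derive1E derive_slice_z. Qed.

Lemma smooth_measurable w : smooth w -> measurable_fun setT w.
Proof. by move=> sw; apply: continuous2_measurable; exact: smooth_continuous. Qed.

End SmoothSlices.

Section RadialClosure.
Context {R : realType}.
Variables (rad a : R).
Hypothesis rad0 : 0 < rad.
Local Notation mu := (@lebesgue_measure R).
Local Notation leb2 := (mu \x mu)%E.
Local Notation integ m D f := (m.-integrable D (EFin \o f)).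
Local Notation D := (`]0, rad[%classic : set (measurableTypeR R)).
Local Notation E := (`](- a), a[%classic : set (measurableTypeR R)).
Implicit Types u v : R * R -> R.

Let mD : measurable D. Proof. exact: measurable_itv. Qed.
Let mE : measurable E. Proof. exact: measurable_itv. Qed.
Let mDE : measurable (D `*` E). Proof. exact: measurableX. Qed.

Lemma ae_prod_z (P : R * R -> Prop) :
  {ae leb2, forall x, (D `*` E) x -> P x} ->
  {ae mu, forall z, E z -> {ae mu, forall r, D r -> P (r, z)}}.
Proof.
move=> [N [mN N0 HN]].
have H0 : (\int[mu]_z \int[mu]_r (\1_N (r, z))%:E = 0)%E.
  rewrite -(@fubini_tonelli2 _ _ _ _ _ mu mu (fun x => (\1_N x)%:E)).
  - by rewrite integral_indic// setIT.
  - by apply/measurable_EFinP; exact: measurable_indic.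
  - by move=> x; rewrite lee_fin.
have mG : measurable_fun setT (fun z => \int[mu]_r (\1_N (r, z))%:E)%E.
  apply: (measurable_fun_fubini_tonelli_G (fun x => (\1_N x)%:E)).
  - by apply/measurable_EFinP; exact: measurable_indic.
  - by move=> x; rewrite lee_fin.
have [/(_ _)] := @ae_eq_integral_abs _ _ _ mu setT measurableT _ mG.
case.
  rewrite -[RHS]H0; apply: eq_integral => z _; rewrite gee0_abs//.
  by apply: integral_ge0 => r _; rewrite lee_fin.
move=> M [mM M0 HM] _; exists M; split => // z /= nz; apply: HM => /= Hz; apply: nz => Ez.
have {}Hz := Hz I.
have NE : [set r | N (r, z)] = ysection N z.
  by apply/seteqP; split => r; rewrite ysectionE.
have mN' : measurable [set r | N (r, z)] by rewrite NE; exact: measurable_ysection.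
exists [set r | N (r, z)]; split => //.
- rewrite -Hz.
  have -> : (\int[mu]_r (\1_N (r, z))%:E = \int[mu]_r (\1_[set r | N (r, z)] r)%:E)%E.
    by apply: eq_integral => r _; rewrite !indicE; congr (_%:R%:E); apply/idP/idP => /set_mem H; apply/mem_set.
  by rewrite integral_indic ?setIT.
- move=> r /= nr; apply: HN => /= HP; apply: nr => Dr; exact: HP.
Qed.

Lemma slice_bound (f : R * R -> R) (g : R -> R) : measurable_fun (D `*` E) f ->
  (forall x, (D `*` E) x -> 0 <= f x) -> integ mu E g ->
  {ae mu, forall z, E z -> forall r, D r -> f (r, z) <= g z} ->
  integ leb2 (D `*` E) f /\
  \int[leb2]_(x in D `*` E) f x <= rad * \int[mu]_(z in E) g z.
Proof.
move=> mf f0 ig fg.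
have mfz z : E z -> measurable_fun D (fun r => f (r, z)).
  by move=> Ez; exact: (@measurable_slice_z _ D E).
have g0 : {ae mu, forall z, E z -> 0 <= g z}.
  apply: ae_impl fg => z H Ez.
  have Dh : D (rad / 2).
    by rewrite /= in_itv/= divr_gt0//= ltr_pdivrMr// mulr2n mulrDr mulr1 ltrDl.
  by apply: le_trans (H Ez _ Dh); apply: f0.
have irg := integZ rad mE ig.
have le1 : (\int[mu]_(z in E) \int[mu]_(r in D) `|f (r, z)|%:E <=
    \int[mu]_(z in E) `|rad * g z|%:E)%E.
  apply: ae_ge0_le_integral => //.
  - by move=> z _; apply: integral_ge0 => r _; rewrite lee_fin.
  - have K := (measurable_restrictT _ mDE).1 mf.
    have := @measurable_fun_fubini_tonelli_G _ _ _ _ R mu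
      (fun x => `|(f \_ (D `*` E)) x|%:E) _ (fun x => normr_ge0 _).
    move=> H; apply: eq_measurable_fun (measurable_funTS (H _)) => [z /set_mem Ez|].
      rewrite /fubini_G [RHS]integral_mkcond; apply: eq_integral => r _.
      rewrite patch_setX_slice !patchE; case: ifP => _; last by rewrite normr0.
      by rewrite mem_set.
    by apply/measurable_EFinP; exact: measurableT_comp.
  - by apply: measurableT_comp => //; apply: measurableT_comp => //; exact: integ_measurable irg.
  - apply: ae_impl2 fg g0 => z H g0 Ez.
    apply: (@le_trans _ _ (\int[mu]_(r in D) (g z)%:E)%E).
      apply: ge0_le_integral => //.
      - by apply/measurable_EFinP; apply: measurableT_comp => //; exact: mfz.
      - by move=> r Dr; rewrite lee_fin ger0_norm ?H//; exact: f0.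
    rewrite integral_cst//= lebesgue_measure_itv/= lte_fin rad0 sube0 -EFinM lee_fin.
    by rewrite mulrC ler_norm.
have iF : integ leb2 (D `*` E) f.
  apply: integ_setX_lty_z => //; apply: le_lt_trans le1 _.
  by have [_] := integrableP _ _ _ irg.
split => //; have [_ i2 ->] := fubini_setX_z mD mE iF.
rewrite -RintegralZl//; apply: ae_le_Rint => //.
apply: ae_impl2 fg g0 => z H g0 Ez.
rewrite -[leRHS](_ : \int[mu]_(r in D) g z = _); last first.
  by rewrite Rint_cst_oo ?ltW// subr0 mulrC.
apply: le_Rintegral => //; last by move=> r Dr; exact: H.
- apply: (integ_le (g := fun=> g z)) => //; [exact: mfz| |exact: integ_cst_oo].
  by move=> r Dr; rewrite ger0_norm ?H//; exact: f0.
- exact: integ_cst_oo.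
Qed.

Lemma ae_prod_r (P : R * R -> Prop) :
  {ae leb2, forall x, (D `*` E) x -> P x} ->
  {ae mu, forall r, D r -> {ae mu, forall z, E z -> P (r, z)}}.
Proof.
move=> [N [mN N0 HN]].
have mG : measurable_fun setT (mu \o xsection N).
  exact: measurable_fun_xsection.
have [/(_ _)] := @ae_eq_integral_abs _ _ _ mu setT measurableT _ mG.
case.
  by rewrite -[RHS]N0; apply: eq_integral => r _; rewrite gee0_abs.
move=> M [mM M0 HM] _; exists M; split => // r /= nr; apply: HM => /= Hr; apply: nr => Dr.
exists (xsection N r); split => //; first exact: measurable_xsection.
  exact: Hr.
move=> z /= nz; rewrite xsectionE; apply: HN => /= HP; apply: nz => Ez; exact: HP.
Qed.

Let DE_r x : (D `*` E) x -> 0 < x.1 < rad.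
Proof. by move=> [/=]; rewrite in_itv. Qed.

Let m_pow n : measurable_fun (D `*` E) (fun x : R * R => x.1 ^+ n).
Proof. by apply: measurable_funX; apply: measurable_funTS; exact: measurable_fst. Qed.

Lemma L2_cubed u : in_L2 rad a u ->
  integ leb2 (D `*` E) (fun x => u x ^+ 2 * x.1 ^+ 3) /\
  \int[leb2]_(x in D `*` E) (u x ^+ 2 * x.1 ^+ 3) <= rad ^+ 2 * nrm2 rad a u.
Proof.
move=> Lu; have iu := in_L2_integ Lu; have iu2 := integZ (rad ^+ 2) mDE iu.
have bnd x : (D `*` E) x -> u x ^+ 2 * x.1 ^+ 3 <= rad ^+ 2 * (u x ^+ 2 * x.1).
  move=> /DE_r/andP[r0 rR]; rewrite [x.1 ^+ 3]exprSr mulrA [leRHS]mulrA.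
  rewrite [rad ^+ 2 * _]mulrC; apply: ler_wpM2r; first exact: ltW.
  apply: ler_wpM2l; first exact: sqr_ge0.
  have := ltW r0; have := ltW rR; rewrite !expr2; nra.
have iw : integ leb2 (D `*` E) (fun x => u x ^+ 2 * x.1 ^+ 3).
  apply: (integ_le mDE _ _ iu2).
    by apply: measurable_funM; [apply: measurable_funX; case: Lu|exact: m_pow].
  move=> x Dx; rewrite ger0_norm; first exact: bnd.
  by have /andP[/ltW ? _] := DE_r Dx; rewrite mulr_ge0 ?sqr_ge0// exprn_ge0.
by split => //; rewrite /nrm2 -RintegralZl//; apply: le_Rintegral.
Qed.

Lemma tail_L2 v : in_L2 rad a v ->
  integ leb2 (D `*` E) (fun x => tail_int rad v x ^+ 2 * x.1 ^+ 3) /\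
  \int[leb2]_(x in D `*` E) (tail_int rad v x ^+ 2 * x.1 ^+ 3) <= rad ^+ 4 * nrm2 rad a v.
Proof.
move=> Lv; have iv := in_L2_integ Lv; have [mv _] := Lv.
have [_ i2 E2] := fubini_setX_z mD mE iv.
have := @slice_bound (fun x => tail_int rad v x ^+ 2 * x.1 ^+ 3)
  (fun z => rad ^+ 3 * \int[mu]_(t in D) (v (t, z) ^+ 2 * t)).
have -> : \int[mu]_(z in E) (rad ^+ 3 * \int[mu]_(t in D) (v (t, z) ^+ 2 * t)) =
    rad ^+ 3 * nrm2 rad a v by rewrite RintegralZl// /nrm2 E2.
rewrite mulrA -exprS; apply.
- by apply: measurable_funM; [apply: measurable_funX; exact: measurable_tail_int|exact: m_pow].
- by move=> x /DE_r/andP[/ltW ? _]; rewrite mulr_ge0 ?sqr_ge0// exprn_ge0.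
- exact: integZ.
- apply: ae_impl (in_L2_slice_z Lv) => z H Ez r Dr.
  have mvz : measurable_fun D (fun t => v (t, z)) by exact: (@measurable_slice_z _ D E).
  by have [_] := tail_int_slice rad0 mvz (H Ez) Dr.
Qed.

Lemma sum_tail_L2 u v : in_L2 rad a u -> in_L2 rad a v ->
  integ leb2 (D `*` E) (fun x => (u x + tail_int rad v x) ^+ 2 * x.1 ^+ 3) /\
  \int[leb2]_(x in D `*` E) ((u x + tail_int rad v x) ^+ 2 * x.1 ^+ 3) <=
    2 * (rad ^+ 2 * nrm2 rad a u + rad ^+ 4 * nrm2 rad a v).
Proof.
move=> Lu Lv; have [iu bu] := L2_cubed Lu; have [iv bv] := tail_L2 Lv.
have isum := integZ 2 mDE (integD mDE iu iv).
have bnd x : (D `*` E) x -> (u x + tail_int rad v x) ^+ 2 * x.1 ^+ 3 <=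
    2 * (u x ^+ 2 * x.1 ^+ 3 + tail_int rad v x ^+ 2 * x.1 ^+ 3).
  move=> /DE_r/andP[/ltW r0 _]; rewrite -mulrDl mulrA ler_wpM2r ?exprn_ge0//.
  by rewrite mulrDr; exact: sqrD_le.
have iw : integ leb2 (D `*` E) (fun x => (u x + tail_int rad v x) ^+ 2 * x.1 ^+ 3).
  apply: (integ_le mDE _ _ isum).
    apply: measurable_funM; [apply: measurable_funX; apply: measurable_funD|exact: m_pow].
      by case: Lu.
    by apply: measurable_tail_int => //; case: Lv.
  move=> x Dx; rewrite ger0_norm; first exact: bnd.
  by have /andP[/ltW ? _] := DE_r Dx; rewrite mulr_ge0 ?sqr_ge0// exprn_ge0.
split=> //; apply: le_trans (le_Rintegral _ iw isum bnd) _ => //.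
rewrite RintegralZl ?RintegralD//; last exact: integD.
by rewrite ler_pM2l// lerD.
Qed.

Lemma ge0_small_eq0 (x C : R) : 0 <= x -> (forall e, 0 < e -> x <= C * e) -> x = 0.
Proof.
move=> x0 H; apply/eqP; rewrite eq_le x0 andbT; apply/ler_addgt0Pl => e e0.
rewrite addr0; have C1 : 0 < `|C| + 1 by rewrite ltr_wpDl.
apply: le_trans (H (e / (`|C| + 1)) (divr_gt0 e0 C1)) _.
rewrite mulrA ler_pdivrMr// mulrC ler_wpM2l ?ltW//.
by rewrite (le_lt_trans (ler_norm _))// ltrDl.
Qed.

Let small_bound d1 d2 (e : R) : nrm2 rad a d1 + nrm2 rad a d2 <= e ->
  2 * (rad ^+ 2 * nrm2 rad a d1 + rad ^+ 4 * nrm2 rad a d2) <= 2 * (rad ^+ 2 + rad ^+ 4) * e.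
Proof.
move=> le; rewrite -mulrA ler_pM2l//.
have r2 : 0 <= rad ^+ 2 by rewrite exprn_ge0// ltW.
have r4 : 0 <= rad ^+ 4 by rewrite exprn_ge0// ltW.
have := nrm2_ge0 rad a d1; have := nrm2_ge0 rad a d2; nra.
Qed.

Let cubed_le (r : R) : D r -> 0 <= r ^+ 3 <= rad ^+ 3.
Proof.
rewrite /= in_itv/= => /andP[/ltW r0 /ltW rR].
by rewrite exprn_ge0//= ler_pXn2r// nnegrE ltW.
Qed.

Let integ_cubed : integ mu D (fun r => r ^+ 3).
Proof.
apply: (integ_le (g := fun=> rad ^+ 3)) => //; last exact: integ_cst_oo.
by move=> r /cubed_le/andP[r0 rR]; rewrite ger0_norm.
Qed.

Lemma radial_closure0 u v : in_L2 rad a u -> in_L2 rad a v ->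
  (forall e : R, 0 < e -> exists d1 d2 : R * R -> R, exists b : R -> R,
    [/\ in_L2 rad a d1 /\ in_L2 rad a d2, nrm2 rad a d1 + nrm2 rad a d2 <= e,
      integ mu E (fun z => b z ^+ 2), \int[mu]_(z in E) (b z ^+ 2) <= e &
      {ae mu, forall z, E z -> forall r, D r ->
         u (r, z) + tail_int rad v (r, z) = d1 (r, z) + tail_int rad d2 (r, z) + b z}]) ->
  {ae leb2, forall x, (D `*` E) x -> u x = - tail_int rad v x}.
Proof.
move=> Lu Lv H; have [ih _] := sum_tail_L2 Lu Lv.
pose h x := u x + tail_int rad v x.
have h0 x : (D `*` E) x -> 0 <= h x ^+ 2 * x.1 ^+ 3.
  by move=> /DE_r/andP[/ltW ? _]; rewrite mulr_ge0 ?sqr_ge0// exprn_ge0.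
have [ihz ihI hE] := fubini_setX_z mD mE ih.
have int0 : \int[leb2]_(x in D `*` E) (h x ^+ 2 * x.1 ^+ 3) = 0.
  apply: (@ge0_small_eq0 _ (2 * (2 * (rad ^+ 2 + rad ^+ 4)) + 2 * rad ^+ 4)).
    exact: Rintegral_ge0.
  move=> e e0; have [d1 [d2 [b [[L1 L2] de ib be eqae]]]] := H e e0.
  have [iG bG] := sum_tail_L2 L1 L2; have [iGz iGI GE] := fubini_setX_z mD mE iG.
  have key : {ae mu, forall z, E z -> \int[mu]_(r in D) (h (r, z) ^+ 2 * r ^+ 3) <=
      2 * (\int[mu]_(r in D) ((d1 (r, z) + tail_int rad d2 (r, z)) ^+ 2 * r ^+ 3)) +
      2 * rad ^+ 4 * b z ^+ 2}.
    apply: ae_impl3 eqae ihz iGz => z eqz ihz' iGz' Ez.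
    have iGz := integZ 2 mD (iGz' Ez).
    have ibz := integ_cst_oo 0 rad (2 * (b z ^+ 2 * rad ^+ 3)).
    apply: (@le_trans _ _ (\int[mu]_(r in D) (2 * ((d1 (r, z) + tail_int rad d2 (r, z)) ^+ 2 * r ^+ 3)
        + 2 * (b z ^+ 2 * rad ^+ 3)))).
      apply: le_Rintegral => //; [exact: ihz'|exact: integD|].
      move=> r Dr; rewrite /h eqz//; have /andP[r0 rR] := cubed_le Dr.
      rewrite -mulrDr; apply: le_trans (ler_wpM2r r0 (sqrD_le _ _)) _.
      rewrite -mulrDr -mulrA ler_pM2l// mulrDl lerD2l ler_wpM2l//; exact: sqr_ge0.
    rewrite RintegralD// RintegralZl//; last exact: iGz'.
    rewrite lerD2l Rint_cst_oo; last exact: ltW.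
    by rewrite le_eqVlt; apply/orP; left; apply/eqP; ring.
  have irhs := integD mE (integZ 2 mE iGI) (integZ (2 * rad ^+ 4) mE ib).
  rewrite hE; apply: le_trans (ae_le_Rint mE ihI irhs key) _.
  rewrite RintegralD//; [|exact: integZ..]; rewrite !RintegralZl//.
  rewrite [leRHS]mulrDl; apply: lerD.
    by rewrite -mulrA ler_pM2l// -GE; exact: le_trans bG (small_bound de).
  by rewrite ler_wpM2l// mulr_ge0// exprn_ge0// ltW.
have {}int0 := ge0_Rint0_ae mDE ih h0 int0.
apply: ae_impl int0 => x hx Dx; have /eqP := hx Dx.
rewrite mulf_eq0 sqrf_eq0 => /orP[/eqP/addr0_eq <-|]; first by rewrite opprK.
by rewrite expf_eq0/=; have /andP[/gt_eqF ->] := DE_r Dx.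
Qed.

Let kappa : R := \int[mu]_(r in D) r ^+ 3.

Let kappa_gt0 : 0 < kappa.
Proof.
have k0 : 0 <= kappa by apply: Rintegral_ge0 => r /cubed_le/andP[].
rewrite lt_neqAle k0 andbT; apply/negP => /eqP k0'.
have := ge0_Rint0_ae mD integ_cubed.
rewrite -/kappa -k0' => /(_ _ erefl)[].
  by move=> r /cubed_le/andP[].
move=> N [mN N0 HN]; have : (mu D <= mu N)%E.
  apply: le_measure; rewrite ?inE// => r Dr; apply: HN => /= /(_ Dr)/eqP.
  by rewrite expf_eq0/=; move: Dr; rewrite /= in_itv/= => /andP[/gt_eqF ->].
rewrite [X in (_ <= X)%E]N0 lebesgue_measure_itv/= lte_fin rad0 sube0 lee_fin.
by rewrite leNgt rad0.
Qed.

Lemma radial_closure u v : in_L2 rad a u -> in_L2 rad a v ->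
  (forall e : R, 0 < e -> exists d1 d2 : R * R -> R, exists b : R -> R,
    [/\ in_L2 rad a d1 /\ in_L2 rad a d2, nrm2 rad a d1 + nrm2 rad a d2 <= e &
      {ae mu, forall z, E z -> forall r, D r ->
         u (r, z) + tail_int rad v (r, z) = d1 (r, z) + tail_int rad d2 (r, z) + b z}]) ->
  exists b : R -> R,
  {ae mu, forall z, E z -> {ae mu, forall r, D r -> u (r, z) = b z - tail_int rad v (r, z)}}.
Proof.
move=> Lu Lv H; have [ih _] := sum_tail_L2 Lu Lv.
pose h x := u x + tail_int rad v x.
have mh : measurable_fun (D `*` E) h.
  by apply: measurable_funD; [case: Lu|apply: measurable_tail_int => //; case: Lv].
have [ihz ihI hE] := fubini_setX_z mD mE ih.
pose b z := kappa^-1 * \int[mu]_(r in D) (h (r, z) * r ^+ 3).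
have mhz z : E z -> measurable_fun D (fun r => h (r, z)).
  by move=> Ez; exact: (@measurable_slice_z _ D E).
have m3 : measurable_fun D (fun r => r ^+ 3) by exact: integ_measurable integ_cubed.
have expand z (c : R) : E z -> integ mu D (fun r => h (r, z) ^+ 2 * r ^+ 3) ->
    integ mu D (fun r => (h (r, z) - c) ^+ 2 * r ^+ 3) /\
    \int[mu]_(r in D) ((h (r, z) - c) ^+ 2 * r ^+ 3) =
    \int[mu]_(r in D) (h (r, z) ^+ 2 * r ^+ 3) - 2 * c * (kappa * b z) + c ^+ 2 * kappa.
  move=> Ez i2.
  have i1 : integ mu D (fun r => h (r, z) * r ^+ 3).
    apply: (integ_le mD _ _ (integD mD i2 integ_cubed)).
      by apply: measurable_funM => //; exact: mhz.
    move=> r /cubed_le/andP[r0 _]; rewrite normrM (ger0_norm r0) -{3}[r ^+ 3]mul1r -mulrDl.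
    rewrite ler_wpM2r// -[h _ ^+ 2]real_normK ?num_real//.
    by have := sqr_ge0 (`|h (r, z)| - 1); have := normr_ge0 (h (r, z)); rewrite !expr2; nra.
  have ia := integB mD i2 (integZ (2 * c) mD i1).
  have ic := integZ (c ^+ 2) mD integ_cubed.
  have Ei r : (h (r, z) - c) ^+ 2 * r ^+ 3 =
      h (r, z) ^+ 2 * r ^+ 3 - 2 * c * (h (r, z) * r ^+ 3) + c ^+ 2 * r ^+ 3 by ring.
  split; first by apply: eq_integ mD (integD mD ia ic) => r _; rewrite Ei.
  under eq_Rintegral do rewrite Ei.
  rewrite RintegralD// RintegralB//; last exact: integZ.
  rewrite (RintegralZl _ _ i1)// (RintegralZl _ _ integ_cubed)//.
  by rewrite /b mulVKf// gt_eqF// kappa_gt0.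
have mb : measurable_fun E b.
  apply: measurable_funM => //; apply: (measurable_Rint_r (f := fun x => h x * x.1 ^+ 3) mD mE).
  by apply: measurable_funM => //; exact: m_pow.
have mbT := (measurable_restrictT _ mE).1 mb.
pose F z := \int[mu]_(r in D) ((h (r, z) - b z) ^+ 2 * r ^+ 3).
have F0 z : 0 <= F z.
  by apply: Rintegral_ge0 => r /cubed_le/andP[? _]; rewrite mulr_ge0// sqr_ge0.
have mF : measurable_fun E F.
  apply: (measurable_Rint_r (f := fun x => (h x - b x.2) ^+ 2 * x.1 ^+ 3) mD mE).
  apply: measurable_funM; last exact: m_pow.
  apply: measurable_funX; apply: measurable_funB mh _.
  have m2 : measurable_fun setT (fun x : R * R => (b \_ E) x.2).
    by apply: measurableT_comp => //; exact: measurable_snd.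
  apply: eq_measurable_fun (measurable_funTS m2) => x /set_mem[_ Ex] /=.
  by rewrite patchE mem_set.
have key e : 0 < e -> integ mu E F /\
    \int[mu]_(z in E) F z <= 2 * (rad ^+ 2 + rad ^+ 4) * e.
  move=> e0; have [d1 [d2 [b' [[L1 L2] de eqae]]]] := H e e0.
  have [iG bG] := sum_tail_L2 L1 L2; have [iGz iGI GE] := fubini_setX_z mD mE iG.
  have bnd : {ae mu, forall z, E z -> F z <=
      \int[mu]_(r in D) ((d1 (r, z) + tail_int rad d2 (r, z)) ^+ 2 * r ^+ 3)}.
    apply: ae_impl2 eqae ihz => z eqz ihz' Ez.
    rewrite [leRHS](_ : _ = \int[mu]_(r in D) ((h (r, z) - b' z) ^+ 2 * r ^+ 3)); last first.
      by apply: eq_Rintegral => r /set_mem Dr; rewrite /h eqz// addrK.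
    have [_ E1] := expand z (b z) Ez (ihz' Ez); have [_ E2] := expand z (b' z) Ez (ihz' Ez).
    rewrite /F E1 E2 -subr_ge0; set I0 := Rintegral _ _ _.
    rewrite (_ : _ - _ = kappa * (b z - b' z) ^+ 2); last by ring.
    by rewrite mulr_ge0 ?sqr_ge0// ltW// kappa_gt0.
  have iF : integ mu E F.
    by apply: (ae_integ_le mE mF iGI); apply: ae_impl bnd => z bz Ez; rewrite ger0_norm ?bz.
  split=> //; apply: le_trans (ae_le_Rint mE iF iGI bnd) _.
  by rewrite -GE; exact: le_trans bG (small_bound de).
have [iF _] := key 1 ltr01.
have F00 : \int[mu]_(z in E) F z = 0.
  apply: (@ge0_small_eq0 _ (2 * (rad ^+ 2 + rad ^+ 4))); first exact: Rintegral_ge0.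
  by move=> e /key[].
have Fz := ge0_Rint0_ae mE iF (fun z _ => F0 z) F00.
exists b; apply: ae_impl2 Fz ihz => z Fz ihz' Ez.
have [i1 _] := expand z (b z) Ez (ihz' Ez).
have := ge0_Rint0_ae mD i1; rewrite -/(F z) Fz// => /(_ _ erefl) K.
apply: ae_impl (K _) => [r hr Dr|r /cubed_le/andP[? _]]; last by rewrite mulr_ge0// sqr_ge0.
have /eqP := hr Dr.
rewrite mulf_eq0 sqrf_eq0 subr_eq0 => /orP[/eqP <-|]; first by rewrite addrK.
by rewrite expf_eq0/=; move: Dr; rewrite /= in_itv/= => /andP[/gt_eqF ->].
Qed.

End RadialClosure.

Section Traces.
Context {R : realType}.
Variables (rad a : R).
Hypotheses (a0 : 0 < a) (rad0 : 0 < rad).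
Local Notation mu := (@lebesgue_measure R).
Local Notation leb2 := (mu \x mu)%E.
Local Notation integ m D f := (m.-integrable D (EFin \o f)).
Local Notation D := (`]0, rad[%classic : set (measurableTypeR R)).
Local Notation E := (`](- a), a[%classic : set (measurableTypeR R)).
Implicit Types u v : R * R -> R.

Let mD : measurable D. Proof. exact: measurable_itv. Qed.
Let mE : measurable E. Proof. exact: measurable_itv. Qed.
Let mDE : measurable (D `*` E). Proof. exact: measurableX. Qed.

Lemma smooth_integ (f : R -> R) (c d : R) : smooth f -> integ mu `]c, d[ f.
Proof.
move=> sf; have [C HC] := smooth_bounded c d sf.
apply: (integ_le (g := fun=> C)) => //; last exact: integ_cst_oo.
  by apply: measurable_funTS; apply: continuous_measurable_fun; exact: smooth_continuous.
by move=> t; rewrite /= in_itv/= => /andP[/ltW ct /ltW td]; apply: HC; rewrite ct td.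
Qed.

Lemma L2sq_ge0 u : (0 <= L2sq rad a u)%E.
Proof.
by apply: integral_ge0 => x /rect_r0/ltW x0; rewrite lee_fin mulr_ge0// sqr_ge0.
Qed.

Lemma L2sq_sym u v : L2sq rad a (fun x => u x - v x) = L2sq rad a (fun x => v x - u x).
Proof. by apply: eq_integral => x _; rewrite -sqrrN opprB. Qed.

Lemma L2sq_le_nrm2 u (e : R) : measurable_fun (D `*` E) u ->
  (L2sq rad a u <= e%:E)%E -> in_L2 rad a u /\ nrm2 rad a u <= e.
Proof.
move=> mu' le; have Lu : in_L2 rad a u by split => //; rewrite (le_lt_trans le)// ltry.
by split => //; rewrite -lee_fin -L2sqE.
Qed.

Lemma trace_approx bsq u ur uz (e : R) : (forall g, 0 <= bsq g)%E ->
  in_L2 rad a u -> in_L2 rad a ur -> in_L2 rad a uz ->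
  zero_trace rad a bsq u ur uz -> 0 < e ->
  exists w, [/\ smooth w,
    in_L2 rad a (fun x => u x - w x) /\ nrm2 rad a (fun x => u x - w x) <= e,
    in_L2 rad a (fun x => ur x - 'D_er w x) /\ nrm2 rad a (fun x => ur x - 'D_er w x) <= e,
    in_L2 rad a (fun x => uz x - 'D_ez w x) /\ nrm2 rad a (fun x => uz x - 'D_ez w x) <= e &
    (bsq w <= e%:E)%E].
Proof.
move=> b0 Lu Lr Lz [w [sw cH cb]] e0.
have [N1 H1] := ecvg0_le cH e0; have [N2 H2] := ecvg0_le cb e0.
pose n := maxn N1 N2; exists (w n).
have {}H1 := H1 n (leq_maxl _ _); have {}H2 := H2 n (leq_maxr _ _).
have m0 : measurable_fun (D `*` E) (w n) by apply: measurable_funTS; exact: smooth_measurable.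
have mr : measurable_fun (D `*` E) ('D_er (w n)).
  by apply: measurable_funTS; apply: smooth_measurable; exact: smooth_derive.
have mz : measurable_fun (D `*` E) ('D_ez (w n)).
  by apply: measurable_funTS; apply: smooth_measurable; exact: smooth_derive.
move: H1; rewrite /H1sq /=.
set A := L2sq _ _ _; set B := L2sq _ _ _; set C := L2sq _ _ _ => le.
have A0 : (0 <= A)%E by exact: L2sq_ge0.
have B0 : (0 <= B)%E by exact: L2sq_ge0.
have C0 : (0 <= C)%E by exact: L2sq_ge0.
split=> //.
- apply: L2sq_le_nrm2; first exact: measurable_funB Lu.1 m0.
  rewrite L2sq_sym; apply: le_trans le; rewrite -addeA leeDl//; exact: adde_ge0.
- apply: L2sq_le_nrm2; first exact: measurable_funB Lr.1 mr.
  rewrite L2sq_sym; apply: le_trans le; rewrite addeAC leeDr//; exact: adde_ge0.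
- apply: L2sq_le_nrm2; first exact: measurable_funB Lz.1 mz.
  rewrite L2sq_sym; apply: le_trans le; rewrite leeDr//; exact: adde_ge0.
- by have -> : w n = w n \- cst 0 by apply/funext => x /=; rewrite subr0.
Qed.

Lemma L2sq_S1_ge0 (g : R * R -> R) : (0 <= L2sq_S1 rad a g)%E.
Proof.
by apply: integral_ge0 => z _; rewrite lee_fin mulr_ge0// ?sqr_ge0// ltW.
Qed.

Lemma L2sq_S2_ge0 (g : R * R -> R) : (0 <= L2sq_S2 rad a g)%E.
Proof.
by apply: adde_ge0; apply: integral_ge0 => r; rewrite /= in_itv/= => /andP[/ltW r0 _];
  rewrite lee_fin mulr_ge0// sqr_ge0.
Qed.

Lemma approx_tail u ur w : in_L2 rad a ur -> smooth w ->
  {ae mu, forall z, E z -> forall r, D r ->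
    u (r, z) + tail_int rad ur (r, z) =
    (u (r, z) - w (r, z)) + tail_int rad (fun x => ur x - 'D_er w x) (r, z) + w (rad, z)}.
Proof.
move=> Lr sw; apply: ae_impl (in_L2_slice_z Lr) => z H Ez r Dr.
have mz : measurable_fun D (fun t => ur (t, z)).
  by apply: (@measurable_slice_z _ D E) => //; case: Lr.
have [i1 _] := tail_int_slice rad0 mz (H Ez) Dr.
have s1 := smooth_derive1 (smooth_slice_r z sw); rewrite derive1_slice_r in s1.
rewrite /tail_int /= RintegralB//; last exact: smooth_integ.
have := @smooth_FTC _ (fun r => w (r, z)) r rad (smooth_slice_r z sw).
rewrite derive1_slice_r => ->; first by ring.
by move: Dr; rewrite /= in_itv/= => /andP[_ /ltW].
Qed.

Lemma lateral_trace_tail u ur uz : in_H1 rad a u ur uz ->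
  zero_trace rad a (L2sq_S rad a) u ur uz ->
  {ae leb2, forall x, (D `*` E) x -> u x = - tail_int rad ur x}.
Proof.
move=> [Lu Lr Lz _ _] tr; apply: radial_closure0 => // e e0.
pose e' := Num.min (e / 2) (e * rad).
have e'0 : 0 < e' by rewrite lt_min divr_gt0//= mulr_gt0.
have [] := trace_approx _ Lu Lr Lz tr e'0.
  by move=> g; apply: adde_ge0; [exact: L2sq_S1_ge0|exact: L2sq_S2_ge0].
move=> w [sw [L1 n1] [L2 n2] _ bw].
have le2 : e' <= e / 2 by rewrite ge_min lexx.
exists (fun x => u x - w x), (fun x => ur x - 'D_er w x), (fun z => w (rad, z)).
have ib : integ mu E (fun z => w (rad, z) ^+ 2).
  rewrite (_ : (fun z => _) = fun z => w (rad, z) * w (rad, z)); last by [].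
  by apply: smooth_integ; apply: smoothM; exact: smooth_slice_z.
split => //.
- by rewrite (splitr e) lerD// (le_trans _ le2).
- have : (L2sq_S1 rad a w <= e'%:E)%E.
    by apply: le_trans bw; rewrite leeDl// L2sq_S2_ge0.
  rewrite /L2sq_S1 -[X in (X <= _)%E]/(\int[mu]_(z in E) (w (rad, z) ^+ 2 * rad)%:E)%E.
  have ib' : integ mu E (fun z => w (rad, z) ^+ 2 * rad).
    by have := integZ rad mE ib; apply: eq_integ => // z _; rewrite mulrC.
  rewrite -EFin_Rint// lee_fin => le.
  rewrite -(ler_pM2r rad0) mulrC -RintegralZl//.
  under eq_Rintegral do rewrite mulrC.
  by apply: le_trans le _; rewrite ge_min lexx orbT.
- exact: approx_tail.
Qed.

Lemma H1_radial_tail bsq u ur uz : in_H1 rad a u ur uz ->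
  zero_trace rad a bsq u ur uz -> (forall g, 0 <= bsq g)%E ->
  exists b : R -> R,
  {ae mu, forall z, E z -> {ae mu, forall r, D r -> u (r, z) = b z - tail_int rad ur (r, z)}}.
Proof.
move=> [Lu Lr Lz _ _] tr b0; apply: radial_closure => // e e0.
have e2 : 0 < e / 2 by rewrite divr_gt0.
have [w [sw [L1 n1] [L2 n2] _ bw]] := trace_approx b0 Lu Lr Lz tr e2.
exists (fun x => u x - w x), (fun x => ur x - 'D_er w x), (fun z => w (rad, z)).
split => //; first by rewrite (splitr e) lerD.
exact: approx_tail.
Qed.

Lemma coef_integ (f : R -> R) u : measurable_fun E f -> (forall z, `|f z| <= 1) ->
  in_L2 rad a u -> {ae mu, forall r, D r -> integ mu E (fun z => u (r, z) * f z)}.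
Proof.
move=> mf f1 Lu; apply: ae_impl (in_L2_slice_r Lu) => r H Dr; have [_ i1] := H Dr.
exact: (integM_bounded mE i1 mf (fun z _ => f1 z)).
Qed.

Lemma coef_lin (f : R -> R) (c d : R) u v : measurable_fun E f -> (forall z, `|f z| <= 1) ->
  in_L2 rad a u -> in_L2 rad a v ->
  {ae mu, forall r, D r -> coef a f (fun x => c * u x + d * v x) r =
    c * coef a f u r + d * coef a f v r}.
Proof.
move=> mf f1 Lu Lv.
apply: ae_impl2 (coef_integ mf f1 Lu) (coef_integ mf f1 Lv) => r Hu Hv Dr.
rewrite /coef -!RintegralZl ?Hu ?Hv// -RintegralD//; last 2 first.
- exact: integZ (Hu Dr).
- exact: integZ (Hv Dr).
by apply: eq_Rintegral => z _; rewrite mulrDl !mulrA.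
Qed.

Lemma sqrD3_le (x y z : R) : (x + (y + z)) ^+ 2 <= 3 * x ^+ 2 + (3 * y ^+ 2 + 3 * z ^+ 2).
Proof.
rewrite -subr_ge0 (_ : _ - _ = (x - y) ^+ 2 + (x - z) ^+ 2 + (y - z) ^+ 2); last by ring.
by rewrite !addr_ge0 ?sqr_ge0.
Qed.

Lemma smooth_derive1M (f g : R -> R) : smooth f -> smooth g ->
  derive1 (fun x => f x * g x) = fun x => derive1 f x * g x + f x * derive1 g x.
Proof.
move=> sf sg; apply/funext => x; have df : derivable f x 1 := smooth_derivable sf.
have dg : derivable g x 1 := smooth_derivable sg.
rewrite !derive1E; transitivity ('D_1 (f * g) x); first by [].
by rewrite (deriveM df dg) addrC mulrC.
Qed.

Lemma smooth_coef_derive w k (r : R) : smooth w ->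
  coef a (cosine a k) ('D_ez w) r - freq a k * coef a (sine a k) w r =
  w (r, a) * cosine a k a - w (r, - a) * cosine a k (- a).
Proof.
move=> sw; have swr := smooth_slice_z r sw.
have sc := smooth_cosine a k; have ss := smooth_sine a k.
have i1 : integ mu E (fun z => 'D_ez w (r, z) * cosine a k z).
  by apply: smooth_integ; apply: smoothM => //; rewrite -derive1_slice_z; exact: smooth_derive1.
have i2 : integ mu E (fun z => w (r, z) * sine a k z).
  by apply: smooth_integ; exact: smoothM.
rewrite /coef -RintegralZl// -RintegralB//; last exact: integZ.
have aa : - a <= a by rewrite ge0_cp// ltW.
rewrite -(smooth_FTC (smoothM swr sc) aa); apply: eq_Rintegral => z _.
by rewrite smooth_derive1M// derive1_slice_z derive1_cosine; ring.
Qed.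

Lemma base_trace_coef u ur uz k : in_H1 rad a u ur uz ->
  zero_trace rad a (L2sq_S2 rad a) u ur uz ->
  {ae mu, forall r, D r -> coef a (cosine a k) uz r = freq a k * coef a (sine a k) u r}.
Proof.
move=> [Lu Lr Lz _ _] tr.
set s := sine a k; set c := cosine a k; set l := freq a k.
have ms : measurable_fun E s by exact: measurable_sine.
have mc : measurable_fun E c by exact: measurable_cosine.
have s1 z : `|s z| <= 1 by exact: sine_le1.
have c1 z : `|c z| <= 1 by exact: cosine_le1.
have D0 (r : R) : D r -> 0 <= r by rewrite /= in_itv/= => /andP[/ltW].
have mr : measurable_fun D (id : R -> R) by exact: measurable_id.
pose h r := coef a c uz r - l * coef a s u r.
have mh : measurable_fun D (fun r => h r ^+ 2 * r).
  apply: measurable_funM => //; apply: measurable_funX; apply: measurable_funB.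
    by apply: (@measurable_coef _ rad) => //; case: Lz.
  by apply: measurable_funM => //; apply: (@measurable_coef _ rad) => //; case: Lu.
have key e : 0 < e -> integ mu D (fun r => h r ^+ 2 * r) /\
    \int[mu]_(r in D) (h r ^+ 2 * r) <= (3 * (2 * a + l ^+ 2 * (2 * a) + 2)) * e.
  move=> e0; have [w [sw [L1 n1] _ [L2 n2] bw]] := trace_approx L2sq_S2_ge0 Lu Lr Lz tr e0.
  pose du := coef a s (fun x => u x - w x); pose dz := coef a c (fun x => uz x - 'D_ez w x).
  have [iu bu] := coef_L2 a0 ms s1 L1.
  have [iz bz] := coef_L2 a0 mc c1 L2.
  have iB (z0 : R) : integ mu D (fun r => w (r, z0) ^+ 2 * r).
    apply: smooth_integ; apply: smoothM; first by apply: smoothM; exact: smooth_slice_r.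
    exact: Ck_smooth (@Ck_id R).
  have bB : \int[mu]_(r in D) (w (r, - a) ^+ 2 * r) + \int[mu]_(r in D) (w (r, a) ^+ 2 * r) <= e.
    by rewrite -lee_fin EFinD !EFin_Rint.
  pose rhs r := 3 * (dz r ^+ 2 * r) + (3 * l ^+ 2 * (du r ^+ 2 * r) +
    6 * (w (r, - a) ^+ 2 * r + w (r, a) ^+ 2 * r)).
  have i1 := integZ 3 mD iz; have i2 := integZ (3 * l ^+ 2) mD iu.
  have i3 := integZ 6 mD (integD mD (iB (- a)) (iB a)).
  have irhs : integ mu D rhs by apply: integD => //; exact: integD.
  have bnd : {ae mu, forall r, D r -> h r ^+ 2 * r <= rhs r}.
    apply: ae_impl2 (coef_integ ms s1 Lu) (coef_integ mc c1 Lz) => r Hu Hz Dr.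
    have r0 := D0 _ Dr; have {}Hu := Hu Dr; have {}Hz := Hz Dr.
    have iws : integ mu E (fun z => w (r, z) * s z).
      by apply: smooth_integ; apply: smoothM; [exact: smooth_slice_z|exact: smooth_sine].
    have iwc : integ mu E (fun z => 'D_ez w (r, z) * c z).
      apply: smooth_integ; apply: smoothM; last exact: smooth_cosine.
      by rewrite -derive1_slice_z; apply: smooth_derive1; exact: smooth_slice_z.
    have Edu : du r = coef a s u r - coef a s w r.
      by rewrite /du /coef -RintegralB//; apply: eq_Rintegral => z _; rewrite mulrBl.
    have Edz : dz r = coef a c uz r - coef a c ('D_ez w) r.
      by rewrite /dz /coef -RintegralB//; apply: eq_Rintegral => z _; rewrite mulrBl.
    have -> : h r = dz r + (- (l * du r) + (w (r, a) * c a - w (r, - a) * c (- a))).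
      by rewrite -smooth_coef_derive// -/l -/s -/c Edu Edz /h; ring.
    rewrite /rhs; set A := dz r; set B := du r.
    have HB : (w (r, a) * c a - w (r, - a) * c (- a)) ^+ 2 <= 2 * (w (r, - a) ^+ 2 + w (r, a) ^+ 2).
      have sq z0 : (w (r, z0) * c z0) ^+ 2 <= w (r, z0) ^+ 2.
        rewrite exprMn ler_piMr ?sqr_ge0// -real_normK ?num_real// exprn_ile1//.
      apply: le_trans (sqrD_le _ _) _; rewrite sqrrN mulrDr [leRHS]addrC.
      by apply: lerD; rewrite ler_wpM2l// sq.
    move: HB; set X := _ - _ => HB.
    have -> : 3 * (A ^+ 2 * r) + (3 * l ^+ 2 * (B ^+ 2 * r) +
      6 * (w (r, - a) ^+ 2 * r + w (r, a) ^+ 2 * r)) =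
      (3 * A ^+ 2 + (3 * (l * B) ^+ 2 + 3 * (2 * (w (r, - a) ^+ 2 + w (r, a) ^+ 2)))) * r by ring.
    apply: ler_wpM2r => //.
    apply: le_trans (sqrD3_le _ _ _) _; rewrite sqrrN !lerD2l.
    exact: ler_wpM2l.
  have ih : integ mu D (fun r => h r ^+ 2 * r).
    apply: (ae_integ_le mD mh irhs); apply: ae_impl bnd => r H Dr.
    by rewrite ger0_norm ?H// mulr_ge0 ?sqr_ge0 ?D0.
  split => //; apply: le_trans (ae_le_Rint mD ih irhs bnd) _.
  rewrite /rhs RintegralD//; last exact: integD.
  rewrite RintegralD// (RintegralZl _ _ iz)// (RintegralZl _ _ iu)//.
  rewrite (RintegralZl _ _ (integD mD (iB (- a)) (iB a)))// RintegralD//.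
  have a2 : 0 <= 2 * a by rewrite mulr_ge0// ltW.
  have := le_trans bz (ler_wpM2l a2 n2); have := le_trans bu (ler_wpM2l a2 n1).
  move: bB; rewrite -/du -/dz.
  set I1 := Rintegral _ _ _; set I2 := Rintegral _ _ _; set I3 := Rintegral _ _ _.
  set I4 := Rintegral _ _ _.
  move=> H1 H2 H3; have H4 := ler_wpM2l (sqr_ge0 l) H2.
  clear -H1 H3 H4; lra.
have [ih _] := key 1 ltr01.
have h0 : \int[mu]_(r in D) (h r ^+ 2 * r) = 0.
  apply: (@ge0_small_eq0 _ _ (3 * (2 * a + l ^+ 2 * (2 * a) + 2))).
    by apply: Rintegral_ge0 => r /D0 r0; rewrite mulr_ge0 ?sqr_ge0.
  by move=> e /key[].
have := ge0_Rint0_ae mD ih _ h0.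
have nn r : D r -> 0 <= h r ^+ 2 * r by move=> /D0 r0; rewrite mulr_ge0 ?sqr_ge0.
move=> /(_ nn); apply: ae_impl => r hr Dr; have /eqP := hr Dr.
rewrite mulf_eq0 sqrf_eq0 subr_eq0 => /orP[/eqP //|/eqP r0].
by move: Dr; rewrite /= in_itv/= r0 ltxx.
Qed.
End Traces.

(** * The radial equation of a single mode *)

Lemma RintN d (T : measurableType d) (R : realType) (mu : {measure set T -> \bar R})
    (D : set T) (f : T -> R) : measurable D -> mu.-integrable D (EFin \o f) ->
  \int[mu]_(x in D) (- f x) = - \int[mu]_(x in D) f x.
Proof.
move=> mD fi; rewrite -mulN1r -RintegralZl//.
by apply: eq_Rintegral => x _; rewrite mulN1r.
Qed.

Section Primitives.
Context {R : realType}.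
Local Notation mu := (@lebesgue_measure R).
Local Notation integ m D f := (m.-integrable D (EFin \o f)).

Lemma Rint_split (c x d : R) (f : R -> R) : c <= x -> x <= d -> integ mu `]c, d[ f ->
  \int[mu]_(t in `]c, d[) f t = \int[mu]_(t in `]c, x[) f t + \int[mu]_(t in `]x, d[) f t.
Proof.
move=> cx xd fi; have cx' : (BRight c <= BRight x)%O by rewrite bnd_simp.
move: xd; rewrite le_eqVlt => /predU1P[xd|xd].
  by rewrite xd (@set_itv_ge _ _ (BRight d)) ?bnd_simp ?ltxx// Rintegral_set0 addr0.
have xd' : (BRight x <= BLeft d)%O by rewrite bnd_simp.
have := Rintegral_itvB fi cx' xd' => /eqP; rewrite subr_eq => /eqP ->.
rewrite addrC; congr (_ + _); rewrite Rintegral_itv_bndo_bndc//.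
exact: integ_oo_sub (ltW xd) fi.
Qed.

Lemma FTC_oo (F f : R -> R) (c d : R) : c <= d ->
  {within `[c, d], continuous f} -> derivable_oo_LRcontinuous F c d ->
  (forall x, c < x < d -> derive1 F x = f x) ->
  \int[mu]_(t in `]c, d[) f t = F d - F c.
Proof.
rewrite le_eqVlt => /predU1P[->|cd] cf dF Ff.
  by rewrite set_itv_ge ?bnd_simp ?ltxx// Rintegral_set0 subrr.
rewrite Rint_oo_cc; last first.
  have : measurable_fun `[c, d] f by apply: subspace_continuous_measurable_fun.
  by apply: measurable_funS => //; exact: subset_itvW.
by rewrite /Rintegral (continuous_FTC2 cd cf dF)// => x; rewrite in_itv/=; exact: Ff.
Qed.

Lemma FTC_pos (F f : R -> R) (c d : R) : 0 < c -> c <= d ->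
  (forall x : R, 0 < x -> is_derive x 1 F (f x)) ->
  (forall x : R, 0 < x -> {for x, continuous f}) ->
  \int[mu]_(t in `]c, d[) f t = F d - F c.
Proof.
move=> c0 cd dF cf; have d0 := lt_le_trans c0 cd.
have cF x : 0 < x -> {for x, continuous F}.
  move=> x0; apply: differentiable_continuous; apply/derivable1_diffP.
  by have [] := dF x x0.
apply: FTC_oo => //.
- apply: continuous_in_subspaceT => x; rewrite inE /= in_itv/= => /andP[cx _].
  by apply: cf; exact: lt_le_trans cx.
- split.
  + by move=> x; rewrite in_itv/= => /andP[cx _]; have [] := dF x (lt_trans c0 cx).
  + by apply: cvg_at_right_filter; exact: cF.
  + by apply: cvg_at_left_filter; exact: cF.
- by move=> x /andP[cx _]; have [_] := dF x (lt_trans c0 cx); rewrite derive1E.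
Qed.

Lemma is_derive_invX (n : nat) (x : R) : 0 < x ->
  is_derive x 1 (fun y : R => (y^-1) ^+ n.+1) (- n.+1%:R * (x^-1) ^+ n.+2).
Proof.
move=> x0; have dV : is_derive x 1 (fun y : R => y^-1) (- (x^-1) ^+ 2).
  apply: DeriveDef; first by apply: derivableV; [exact: lt0r_neq0|exact: derivable_id].
  rewrite deriveV; [|exact: lt0r_neq0|exact: derivable_id].
  by rewrite derive_id exprVn; exact: mulr1.
rewrite (_ : (fun y : R => (y^-1) ^+ n.+1) = (fun y : R => y^-1) ^+ n.+1); last first.
  by apply/funext => y; rewrite exprfctE.
have := @is_deriveX _ _ (fun y : R => y^-1) n.+1 x 1 _ dV.
move=> /is_derive_eq; apply.
by rewrite /= /GRing.scale/= !mulNr mulrN -mulrA -exprD addn2.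
Qed.

Lemma continuous_invX (n : nat) (x : R) : 0 < x ->
  {for x, continuous (fun y : R => (y^-1) ^+ n)}.
Proof.
move=> x0; have cV : {for x, continuous (fun y : R => y^-1)}.
  by apply: cvgV; [exact: lt0r_neq0|exact: cvg_id].
exact: (continuous_comp cV (@exprn_continuous _ n _)).
Qed.

Lemma measurable_invX (n : nat) (c d : R) : 0 <= c ->
  measurable_fun `]c, d[ (fun y : R => (y^-1) ^+ n).
Proof.
move=> c0; apply: open_continuous_measurable_fun => // x; rewrite inE /= in_itv/= => /andP[cx _].
by apply: continuous_invX; exact: le_lt_trans cx.
Qed.

Lemma measurable_primitive1 (c d : R) (f : R -> R) : measurable_fun `]c, d[ f ->
  measurable_fun `]c, d[ (fun t => \int[mu]_(s in `]c, t[) f s).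
Proof.
move=> mf.
have mfT : measurable_fun setT (f \_ `]c, d[) by apply/(measurable_restrictT _ _).1.
pose w (x : R * R) := if x.2 < x.1 then (f \_ `]c, d[) x.2 else 0.
have mw : measurable_fun setT w.
  apply: measurable_fun_ifT => //.
  - by apply: measurable_fun_ltr; [exact: measurable_snd|exact: measurable_fst].
  - by apply: measurableT_comp => //; exact: measurable_snd.
have H := measurable_Rint_param mw.
apply: eq_measurable_fun (measurable_funTS H) => t; rewrite inE /= in_itv/= => /andP[ct td].
rewrite [RHS]Rintegral_mkcond; apply: eq_Rintegral => s _.
rewrite /w/= !patchE !mem_setE !in_itv/=; case: ltP => st; rewrite ?andbF// andbT.
by rewrite (lt_trans st td) andbT.
Qed.

Lemma measurable_tail1 (c d : R) (f : R -> R) : measurable_fun `]c, d[ f ->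
  measurable_fun `]c, d[ (fun t => \int[mu]_(s in `]t, d[) f s).
Proof.
move=> mf.
have mfT : measurable_fun setT (f \_ `]c, d[) by apply/(measurable_restrictT _ _).1.
pose w (x : R * R) := if x.1 < x.2 then (f \_ `]c, d[) x.2 else 0.
have mw : measurable_fun setT w.
  apply: measurable_fun_ifT => //.
  - by apply: measurable_fun_ltr; [exact: measurable_fst|exact: measurable_snd].
  - by apply: measurableT_comp => //; exact: measurable_snd.
have H := measurable_Rint_param mw.
apply: eq_measurable_fun (measurable_funTS H) => t; rewrite inE /= in_itv/= => /andP[ct td].
rewrite [RHS]Rintegral_mkcond; apply: eq_Rintegral => s _.
rewrite /w/= !patchE !mem_setE !in_itv/=; case: ltP => st; rewrite ?andbF//=.
by rewrite (lt_trans ct st).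
Qed.

End Primitives.

Section RadialEnergy.
Context {R : realType}.
Variables (rad lam : R).
Hypothesis rad0 : 0 < rad.
Local Notation mu := (@lebesgue_measure R).
Local Notation integ m D f := (m.-integrable D (EFin \o f)).
Local Notation D := (`]0, rad[%classic : set (measurableTypeR R)).

Let mD : measurable D. Proof. exact: measurable_itv. Qed.

Let Dr0 (r : R) : D r -> 0 < r. Proof. by rewrite /= in_itv/= => /andP[]. Qed.

Let m_pow n : measurable_fun D (fun r : R => r ^+ n).
Proof. exact: measurable_funX. Qed.

Lemma integ_sub0 (t : R) (f : R -> R) : t <= rad -> integ mu D f -> integ mu `]0, t[ f.
Proof. by move=> tR; exact: integ_oo_sub. Qed.

Lemma L2_radial_moment (n : nat) (g : R -> R) : measurable_fun D g ->
  integ mu D (fun r => g r ^+ 2 * r) -> integ mu D (fun r => r ^+ n.+1 * g r).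
Proof.
move=> mg ig; have C0 : 0 <= rad ^+ n by rewrite exprn_ge0// ltW.
have i1 : integ mu D (fun r => rad ^+ n * (g r ^+ 2 * r + rad)).
  by apply: integZ => //; apply: integD => //; exact: integ_cst_oo.
apply: (integ_le mD _ _ i1); first by apply: measurable_funM.
move=> r Dr; have r0 := Dr0 Dr; have rR : r <= rad.
  by move: Dr; rewrite /= in_itv/= => /andP[_ /ltW].
have r0' := ltW r0; rewrite normrM (ger0_norm (exprn_ge0 _ r0')) exprSr -mulrA.
have R0' := ltW rad0; apply: ler_pM.
- exact: exprn_ge0.
- exact: mulr_ge0.
- by rewrite lerXn2r.
have := sqr_ge0 (`|g r| - 1); rewrite -[g r ^+ 2]real_normK ?num_real// !expr2.
have := normr_ge0 (g r); nra.
Qed.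

(* Cauchy-Schwarz against [s ^ (2 n - 1)] *)
Lemma moment_bound (n : nat) (g : R -> R) : measurable_fun D g ->
  integ mu D (fun r => g r ^+ 2 * r) ->
  exists2 N, N ^+ 2 = \int[mu]_(r in D) (g r ^+ 2 * r) /\ 0 <= N &
    forall t, D t -> \int[mu]_(s in `]0, t[) `|s ^+ n.+1 * g s| <= N * t ^+ n.+1.
Proof.
move=> mg ig; set I := \int[mu]_(r in D) _.
have I0 : 0 <= I by apply: Rintegral_ge0 => r /Dr0/ltW r0; rewrite mulr_ge0// sqr_ge0.
exists (Num.sqrt I); first by rewrite sqr_sqrtr// sqrtr_ge0.
move=> t Dt; have t0 := Dr0 Dt; have tR : t <= rad.
  by move: Dt; rewrite /= in_itv/= => /andP[_ /ltW].
have mI : measurable (`]0, t[%classic : set (measurableTypeR R)) by exact: measurable_itv.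
have sub : `]0, t[ `<=` D by apply: subset_itvl; rewrite bnd_simp.
have s0 s : `]0, t[%classic s -> 0 < s by rewrite /= in_itv/= => /andP[].
have mgI : measurable_fun `]0, t[ (fun s => `|g s|).
  by apply: measurableT_comp => //; exact: measurable_funS mg.
have igI : integ mu `]0, t[ (fun s => `|g s| ^+ 2 * s).
  have := integ_sub0 tR ig; apply: eq_integ => // s _.
  by rewrite real_normK ?num_real.
have mpI : measurable_fun `]0, t[ (fun s : R => s ^+ n.+1) by exact: measurable_funX.
have ic := integ_cst_oo 0 t (t ^+ (2 * n).+1).
have pb s : `]0, t[%classic s -> 0 <= (s ^+ n.+1) ^+ 2 / s <= t ^+ (2 * n).+1.
  move=> /[dup] /s0 sp; rewrite /= in_itv/= => /andP[_ /ltW st].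
  have -> : (s ^+ n.+1) ^+ 2 / s = s ^+ (2 * n).+1.
    by rewrite -exprM muln2 doubleS -mul2n !exprSr mulfK// gt_eqF.
  have sp' := ltW sp; have t0' := ltW t0; by rewrite exprn_ge0//= ler_pXn2r.
have ip : integ mu `]0, t[ (fun s => (s ^+ n.+1) ^+ 2 / s).
  apply: (integ_le mI _ _ ic).
    apply: measurable_funM; first exact: measurable_funX.
    by have := @measurable_invX R 1 0 t (lexx 0).
  by move=> s /pb/andP[p0 p1]; rewrite ger0_norm.
have := weighted_CS mI s0 mgI mpI igI ip.
set J := Rintegral _ _ _; set J1 := Rintegral _ _ _; set J2 := Rintegral _ _ _ => CS.
have -> : \int[mu]_(s in `]0, t[) `|s ^+ n.+1 * g s| = J.
  apply: eq_Rintegral => s /set_mem/s0/ltW sp.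
  by rewrite normrM mulrC (ger0_norm (exprn_ge0 _ sp)).
have J1I : J1 <= I.
  rewrite /J1 /I; under eq_Rintegral do rewrite real_normK ?num_real//.
  rewrite -lee_fin !EFin_Rint//; last exact: integ_sub0.
  apply: ge0_subset_integral => //; first by apply/measurable_EFinP; exact: integ_measurable ig.
  by move=> r /Dr0/ltW r0; rewrite lee_fin mulr_ge0// sqr_ge0.
have J2t : J2 <= t ^+ (2 * n.+1).
  apply: (@le_trans _ _ (\int[mu]_(s in `]0, t[) t ^+ (2 * n).+1)).
    by apply: le_Rintegral => // s /pb/andP[].
  by rewrite (Rint_cst_oo _ (ltW t0)) subr0 mulnS -exprSr.
have J0 : 0 <= J.
  by apply: Rintegral_ge0 => s /s0/ltW sp; rewrite mulr_ge0// exprn_ge0.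
rewrite -(@ler_pXn2r _ 2) ?nnegrE//; last by rewrite mulr_ge0 ?sqrtr_ge0// exprn_ge0// ltW.
rewrite exprMn sqr_sqrtr// -exprM mulnC; apply: le_trans CS _.
apply: ler_pM => //.
  by apply: Rintegral_ge0 => s /s0/ltW sp; rewrite mulr_ge0// sqr_ge0.
by apply: Rintegral_ge0 => s /pb/andP[].
Qed.

Lemma energy_identity (G psi ph : R -> R) (N : R) :
  measurable_fun D psi -> measurable_fun D ph -> integ mu D ph ->
  (forall r, D r -> `|ph r| <= N) -> integ mu D G ->
  (forall t, D t -> \int[mu]_(s in `]0, t[) G s = t * ph t + 2 * \int[mu]_(s in `]0, t[) ph s) ->
  {ae mu, forall r, D r -> psi r = - \int[mu]_(t in `]r, rad[) ph t} ->
  integ mu D (fun r => G r * psi r) /\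
  \int[mu]_(r in D) (G r * psi r) =
  - (\int[mu]_(r in D) (ph r ^+ 2 * r) + (\int[mu]_(r in D) ph r) ^+ 2).
Proof.
move=> mpsi mph iph HN ig1 int_rg psi_ph.
have ip2 : integ mu D (fun r => ph r ^+ 2 * r).
  apply: (integ_le (g := fun=> N ^+ 2 * rad)) => //; last exact: integ_cst_oo.
    by apply: measurable_funM => //; exact: measurable_funX.
  move=> r Dr; have h := HN r Dr; have r0 := ltW (Dr0 Dr).
  rewrite normrM normrX (ger0_norm r0); apply: ler_pM => //.
    by rewrite lerXn2r// nnegrE// (le_trans _ h).
  by move: Dr; rewrite /= in_itv/= => /andP[_ /ltW].
have mgp := integ_measurable ig1.
have [iA iB EAB] := triangle_fubini_integ ig1 iph.
have [iC iF ECF] := triangle_fubini_integ iph iph.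
have mt := measurable_tail1 mph.
have Eae : {ae mu, forall r, D r -> G r * psi r = - (G r * \int[mu]_(t in `]r, rad[) ph t)}.
  by apply: ae_impl psi_ph => r H Dr; rewrite (H Dr) mulrN.
have iAN := integN mD iA.
have i1 : integ mu D (fun r => G r * psi r).
  apply: ae_eq_integ mD _ _ iAN; first exact: measurable_funM.
  by apply: ae_impl Eae => r H Dr; rewrite H.
split; first exact: i1.
transitivity (\int[mu]_(r in D) (- (G r * \int[mu]_(t in `]r, rad[) ph t))).
  exact: (ae_eq_Rint mD (integ_measurable i1) (integ_measurable iAN) Eae).
rewrite (RintN mD iA) EAB; congr (- _).
transitivity (\int[mu]_(t in D) (ph t ^+ 2 * t + 2 * (ph t * \int[mu]_(s in `]0, t[) ph s))).
  by apply: eq_Rintegral => t /set_mem Dt; rewrite (int_rg _ Dt) mulrDr mulrA expr2 mulrAC mulrCA.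
rewrite (RintegralD mD ip2 (integZ 2 mD iF)).
congr (_ + _); rewrite (RintegralZl 2 mD iF) mulr_natl mulr2n -{1}ECF -(RintegralD mD iC iF).
rewrite expr2 -(RintegralZl _ mD iph); apply: eq_Rintegral => r.
rewrite inE /= in_itv/= => /andP[/ltW r0 /ltW rR].
by rewrite -mulrDr mulrC (Rint_split r0 rR iph) addrC.
Qed.

Section Mode.
Variables (p psi om : R -> R).
Hypotheses (mp : measurable_fun D p) (mpsi : measurable_fun D psi)
  (mom : measurable_fun D om).
Hypotheses (ip : integ mu D (fun r => p r ^+ 2 * r))
  (ipsi : integ mu D (fun r => psi r ^+ 2 * r))
  (iom : integ mu D (fun r => om r ^+ 2 * r)).
Let g r := lam ^+ 2 * psi r - om r.
Hypothesis psi_tail : {ae mu, forall r, D r -> psi r = - \int[mu]_(t in `]r, rad[) p t}.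
Hypothesis p_ode : {ae mu, forall r, D r -> r ^+ 3 * p r = \int[mu]_(s in `]0, r[) (s ^+ 3 * g s)}.

Let mg : measurable_fun D g.
Proof. by apply: measurable_funB => //; exact: measurable_funM. Qed.

Let ig : integ mu D (fun r => g r ^+ 2 * r).
Proof.
have ib := integD mD (integZ (2 * lam ^+ 4) mD ipsi) (integZ 2 mD iom).
apply: (integ_le mD _ _ ib).
  by apply: measurable_funM => //; exact: measurable_funX.
move=> r /Dr0/ltW r0; rewrite ger0_norm; last by rewrite mulr_ge0// sqr_ge0.
have -> : 2 * lam ^+ 4 * (psi r ^+ 2 * r) + 2 * (om r ^+ 2 * r) =
  (2 * (lam ^+ 2 * psi r) ^+ 2 + 2 * (- om r) ^+ 2) * r by ring.
by apply: ler_wpM2r => //; exact: sqrD_le.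
Qed.

Let ph r := (r^-1) ^+ 3 * \int[mu]_(s in `]0, r[) (s ^+ 3 * g s).

Let mph : measurable_fun D ph.
Proof.
apply: measurable_funM.
  exact: measurable_invX.
by apply: measurable_primitive1; exact: measurable_funM.
Qed.

Let ig3 := L2_radial_moment 2 mg ig.
Let ig1 : integ mu D (fun r => r * g r).
Proof. exact: (L2_radial_moment 0 mg ig). Qed.

Let ph_bounded : exists2 N, 0 <= N & forall t, D t ->
  `|ph t| <= N /\ (`|(t^-1) ^+ 3|%:E * \int[mu]_(r in `]0%R, t[) `|r ^+ 3 * g r|%:E <= N%:E)%E.
Proof.
have [N [_ N0] HN] := moment_bound 2 mg ig; exists N => // t Dt.
have t0 := Dr0 Dt; have tR : t <= rad.
  by move: Dt; rewrite /= in_itv/= => /andP[_ /ltW].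
have i3 := integ_sub0 tR ig3.
have E1 : `|(t^-1) ^+ 3| * \int[mu]_(s in `]0, t[) `|s ^+ 3 * g s| <= N.
  have tn : 0 <= (t^-1) ^+ 3 by rewrite exprn_ge0// invr_ge0 ltW.
  by rewrite (ger0_norm tn) exprVn mulrC ler_pdivrMr ?exprn_gt0//; exact: HN.
split; last by rewrite -EFin_Rint//; exact: integ_norm.
apply: le_trans E1; rewrite normrM ler_wpM2l//.
exact: le_normr_Rintegral.
Qed.

Let iph : integ mu D ph.
Proof.
have [N N0 HN] := ph_bounded.
apply: (integ_le (g := fun=> N)) => //; last exact: integ_cst_oo.
by move=> r Dr; have [] := HN r Dr.
Qed.

Let int_rg t : D t ->
  \int[mu]_(s in `]0, t[) (s * g s) = t * ph t + 2 * \int[mu]_(s in `]0, t[) ph s.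
Proof.
move=> Dt; have t0 := Dr0 Dt; have tR : t <= rad.
  by move: Dt; rewrite /= in_itv/= => /andP[_ /ltW].
have [N N0 HN] := ph_bounded.
have sub : `]0, t[ `<=` D by apply: subset_itvl; rewrite bnd_simp.
have i3 := integ_sub0 tR ig3; have i1 := integ_sub0 tR ig1.
have HB s : 0 < s < t -> (`|(s^-1) ^+ 3|%:E * \int[mu]_(r in `]0%R, s[) `|r ^+ 3 * g r|%:E <= N%:E)%E.
  by move=> st; have [] := HN s; first by apply: sub; rewrite /= in_itv.
have [_ _ E1] := @triangle_fubini _ 0 t (fun s => s ^+ 3 * g s) (fun s => (s^-1) ^+ 3)
  (fun=> N) (integ_measurable i3) (measurable_invX _ (lexx 0)) (integ_cst_oo _ _ _) HB.
have E2 : \int[mu]_(s in `]0, t[) ph s = \int[mu]_(s in `]0, t[)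
    (2^-1 * (s * g s) - 2^-1 * (t^-1) ^+ 2 * (s ^+ 3 * g s)).
  rewrite -[LHS]E1; apply: eq_Rintegral => s; rewrite inE /= in_itv/= => /andP[s0 st].
  have dF (x : R) : 0 < x -> is_derive x 1 (fun y => - 2^-1 * (y^-1) ^+ 2) ((x^-1) ^+ 3).
    move=> x0; have dI := is_derive_invX 1 x0.
    have := is_deriveZ (- 2^-1 : R) dI => /is_derive_eq; apply.
    by rewrite /GRing.scale/=; field; rewrite gt_eqF.
  rewrite (FTC_pos s0 (ltW st) dF (fun x => @continuous_invX R 3 x)).
  by field; rewrite gt_eqF//= gt_eqF.
have mI : measurable (`]0, t[%classic : set (measurableTypeR R)) by exact: measurable_itv.
rewrite E2 (RintegralB mI (integZ _ mI i1) (integZ _ mI i3)).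
rewrite (RintegralZl _ mI i1) (RintegralZl _ mI i3) /ph.
by field; rewrite gt_eqF.
Qed.

Let p_ph : {ae mu, forall r, D r -> p r = ph r}.
Proof.
apply: ae_impl p_ode => r H Dr; rewrite /ph -H// mulrA -exprMn mulVf ?expr1n ?mul1r//.
by rewrite gt_eqF// Dr0.
Qed.

Let psi_ph : {ae mu, forall r, D r -> psi r = - \int[mu]_(t in `]r, rad[) ph t}.
Proof.
apply: ae_impl psi_tail => r H Dr; rewrite H//; congr (- _).
have sub : `]r, rad[ `<=` D by apply: subset_itvr; rewrite bnd_simp ltW// Dr0.
apply: ae_eq_Rint => //; [exact: measurable_funS mp|exact: measurable_funS mph|].
by apply: ae_impl p_ph => t K /sub/K.
Qed.

Let int_gpsi : integ mu D (fun r => r * g r * psi r) /\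
  \int[mu]_(r in D) (r * g r * psi r) =
  - (\int[mu]_(r in D) (ph r ^+ 2 * r) + (\int[mu]_(r in D) ph r) ^+ 2).
Proof.
have [N N0 HN] := ph_bounded.
apply: (energy_identity mpsi mph iph _ ig1 int_rg psi_ph) => r Dr.
by have [h _] := HN r Dr; exact: h.
Qed.

Lemma radial_energy :
  2 * lam ^+ 2 * \int[mu]_(r in D) (p r ^+ 2 * r) +
  lam ^+ 4 * \int[mu]_(r in D) (psi r ^+ 2 * r) <= \int[mu]_(r in D) (om r ^+ 2 * r).
Proof.
have [i1 E1] := int_gpsi.
have iZ : integ mu D (fun r => om r * psi r * r).
  have := integB mD (integZ (lam ^+ 2) mD ipsi) i1.
  by apply: eq_integ mD => r _; rewrite /g; ring.
have EX : \int[mu]_(r in D) (p r ^+ 2 * r) = \int[mu]_(r in D) (ph r ^+ 2 * r).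
  apply: ae_eq_Rint => //; first exact: integ_measurable ip.
    by apply: measurable_funM => //; exact: measurable_funX.
  by apply: ae_impl p_ph => r H Dr; rewrite H.
have E2 : \int[mu]_(r in D) (r * g r * psi r) =
    lam ^+ 2 * \int[mu]_(r in D) (psi r ^+ 2 * r) - \int[mu]_(r in D) (om r * psi r * r).
  rewrite -RintegralZl// -RintegralB//; last exact: integZ.
  by apply: eq_Rintegral => r _; rewrite /g; ring.
have iY := integZ (lam ^+ 4) mD ipsi.
have H : 2 * lam ^+ 2 * \int[mu]_(r in D) (om r * psi r * r) <=
    \int[mu]_(r in D) (om r ^+ 2 * r) + lam ^+ 4 * \int[mu]_(r in D) (psi r ^+ 2 * r).
  rewrite -!RintegralZl// -RintegralD//; apply: le_Rintegral => //.
  - exact: integZ.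
  - exact: integD.
  - move=> r /Dr0/ltW r0; rewrite !mulrA -mulrDl ler_wpM2r//.
    rewrite -subr_ge0 (_ : _ - _ = (om r - lam ^+ 2 * psi r) ^+ 2) ?sqr_ge0//; ring.
move: E2; rewrite E1 -EX => E2.
have S0 := sqr_ge0 (\int[mu]_(r in D) ph r).
have X0 : 2 * lam ^+ 2 * (\int[mu]_(r in D) (p r ^+ 2 * r) + (\int[mu]_(r in D) ph r) ^+ 2) =
  2 * lam ^+ 2 * (\int[mu]_(r in D) (om r * psi r * r) - lam ^+ 2 * \int[mu]_(r in D) (psi r ^+ 2 * r)).
  by congr (_ * _); rewrite -[LHS]opprK E2 opprB.
have l0 : 0 <= 2 * lam ^+ 2 * (\int[mu]_(r in D) ph r) ^+ 2.
  by rewrite mulr_ge0// mulr_ge0// sqr_ge0.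
move: H X0 l0; set X := \int[mu]_(r in D) (p r ^+ 2 * r).
set Y := \int[mu]_(r in D) (psi r ^+ 2 * r); set Z := \int[mu]_(r in D) (om r * psi r * r).
set W := \int[mu]_(r in D) (om r ^+ 2 * r); set S := \int[mu]_(r in D) ph r.
rewrite (_ : lam ^+ 4 = lam ^+ 2 * lam ^+ 2); last by ring.
move=> H X0 l0; rewrite -subr_ge0.
rewrite (_ : _ - _ = (W + lam ^+ 2 * lam ^+ 2 * Y - 2 * lam ^+ 2 * Z) +
  2 * lam ^+ 2 * S ^+ 2 + (2 * lam ^+ 2 * (Z - lam ^+ 2 * Y) - 2 * lam ^+ 2 * (X + S ^+ 2))); last by ring.
by rewrite X0 subrr addr0 addr_ge0// subr_ge0.
Qed.

End Mode.

End RadialEnergy.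

(** * Sine coefficients of weak solutions *)

Section ModeEquation.
Context {R : realType}.
Variables (rad a : R).
Hypotheses (a0 : 0 < a) (rad0 : 0 < rad).
Local Notation mu := (@lebesgue_measure R).
Local Notation leb2 := (mu \x mu)%E.
Local Notation integ m D f := (m.-integrable D (EFin \o f)).
Local Notation D := (`]0, rad[%classic : set (measurableTypeR R)).
Local Notation E := (`](- a), a[%classic : set (measurableTypeR R)).
Implicit Types u v : R * R -> R.

Let mD : measurable D. Proof. exact: measurable_itv. Qed.
Let mE : measurable E. Proof. exact: measurable_itv. Qed.
Let mDE : measurable (D `*` E). Proof. exact: measurableX. Qed.

Lemma measurable_comp_snd (A : set (measurableTypeR R)) (e : R -> R) : measurable A ->
  measurable_fun E e -> measurable_fun (A `*` E) (fun x => e x.2).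
Proof.
move=> mA me; have meT := (measurable_restrictT _ mE).1 me.
have m2 : measurable_fun setT (fun x : R * R => (e \_ E) x.2).
  by apply: measurableT_comp => //; exact: measurable_snd.
apply: eq_measurable_fun (measurable_funTS m2) => x /set_mem[_ Ex] /=.
by rewrite patchE mem_set.
Qed.

Lemma measurable_comp_fst (f : R -> R) : measurable_fun D f ->
  measurable_fun (D `*` E) (fun x => f x.1).
Proof.
move=> mf; have mfT := (measurable_restrictT _ mD).1 mf.
have m2 : measurable_fun setT (fun x : R * R => (f \_ D) x.1).
  by apply: measurableT_comp => //; exact: measurable_fst.
apply: eq_measurable_fun (measurable_funTS m2) => x /set_mem[Dx _] /=.
by rewrite patchE mem_set.
Qed.

Lemma sqr_weight_integ (c C : R) (g : R * R -> R) : 0 <= c ->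
  measurable_fun (`]c, rad[ `*` E) g ->
  (forall x, (`]c, rad[ `*` E) x -> `|g x| <= C * x.1) ->
  integ leb2 (`]c, rad[ `*` E) (fun x => g x ^+ 2 / x.1).
Proof.
move=> c0 mg gC; set A := (`]c, rad[%classic : set (measurableTypeR R)).
have mA : measurable A by exact: measurable_itv.
have mAE : measurable (A `*` E) by exact: measurableX.
have sub : A `*` E `<=` D `*` E.
  by move=> x [Ax Ex]; split => //; apply: subset_itvr Ax; rewrite bnd_simp.
have x0 x : (A `*` E) x -> 0 < x.1 by move=> /sub/rect_r0.
have mV : measurable_fun (A `*` E) (fun x : R * R => (x.1)^-1).
  have := measurable_comp_fst (@measurable_invX R 1 0 rad (lexx 0)).
  by apply: measurable_funS.
have icst : integ leb2 (A `*` E) (fun=> C ^+ 2 * rad).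
  apply: (integ_setX_lty mA mE) => //.
  rewrite (eq_integral (fun=> `|C ^+ 2 * rad|%:E * mu E)%E); last first.
    by move=> r _; rewrite integral_cst.
  have fin (x y : R) : (mu `]x, y[ < +oo)%E.
    by rewrite lebesgue_measure_itv/=; case: ifPn => _; rewrite -?EFinB ltry.
  rewrite integral_cst//; apply: lte_mul_pinfty; last exact: fin.
    exact: mule_ge0.
  by rewrite fin_numM// ge0_fin_numE// fin.
apply: (integ_le mAE _ _ icst); first by apply: measurable_funM => //; exact: measurable_funX.
move=> x Ax; have xp := x0 _ Ax.
rewrite normrM normfV (gtr0_norm xp) ler_pdivrMr// normrX.
have xR : x.1 <= rad by move: Ax => [/=]; rewrite in_itv/= => /andP[_ /ltW].
have g1 : `|g x| ^+ 2 <= (C * x.1) ^+ 2.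
  by rewrite lerXn2r ?nnegrE//; [exact: le_trans (gC x _)|exact: gC].
apply: le_trans g1 _; rewrite (_ : _ ^+ 2 = C ^+ 2 * x.1 * x.1); last by ring.
by apply: ler_wpM2r; [exact: ltW|apply: ler_wpM2l => //; exact: sqr_ge0].
Qed.

Lemma L2_mul_integ (c C : R) u (g : R * R -> R) : 0 <= c -> in_L2 rad a u ->
  measurable_fun (`]c, rad[ `*` E) g ->
  (forall x, (`]c, rad[ `*` E) x -> `|g x| <= C * x.1) ->
  integ leb2 (`]c, rad[ `*` E) (fun x => u x * g x).
Proof.
move=> c0 Lu mg gC; set A := (`]c, rad[%classic : set (measurableTypeR R)).
have mA : measurable A by exact: measurable_itv.
have mAE : measurable (A `*` E) by exact: measurableX.
have sub : A `*` E `<=` D `*` E.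
  by move=> x [Ax Ex]; split => //; apply: subset_itvr Ax; rewrite bnd_simp.
have x0 x : (A `*` E) x -> 0 < x.1 by move=> /sub/rect_r0.
apply: (@weighted_mul_integ _ _ _ leb2 (A `*` E) u g (fun x => x.1)) => //.
- by case: Lu => mu' _; exact: measurable_funS mu'.
- by apply: integrableS (in_L2_integ Lu).
- exact: sqr_weight_integ gC.
Qed.

Lemma integ_separated (h : R * R -> R) (e : R -> R) (C : R) :
  integ leb2 (D `*` E) h -> measurable_fun E e -> (forall z, E z -> `|e z| <= C) ->
  [/\ integ leb2 (D `*` E) (fun x => h x * e x.2),
     integ mu E (fun z => (\int[mu]_(r in D) h (r, z)) * e z),
     \int[leb2]_(x in D `*` E) (h x * e x.2) =
     \int[mu]_(z in E) ((\int[mu]_(r in D) h (r, z)) * e z),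
     integ mu D (fun r => \int[mu]_(z in E) (h (r, z) * e z)) &
     \int[leb2]_(x in D `*` E) (h x * e x.2) =
     \int[mu]_(r in D) \int[mu]_(z in E) (h (r, z) * e z)].
Proof.
move=> ih me eC.
have ihe : integ leb2 (D `*` E) (fun x => h x * e x.2).
  apply: (@integM_bounded _ _ _ _ _ _ _ C) => //; first exact: measurable_comp_snd.
  by move=> x [_ /eC].
have [h1 i1 E1] := fubini_setX_z mD mE ihe; have [h2 i2 E2] := fubini_setX_r mD mE ihe.
have Ez z : E z -> \int[mu]_(r in D) (h (r, z) * e z) = (\int[mu]_(r in D) h (r, z)) * e z.
  move=> Ez; under eq_Rintegral do rewrite mulrC.
  rewrite RintZl// 1?mulrC//.
  by apply: (@measurable_slice_z _ D E) => //; exact: integ_measurable ih.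
split=> //; first by apply: eq_integ mE i1 => z /set_mem; exact: Ez.
by rewrite E1; apply: eq_Rintegral => z /set_mem; exact: Ez.
Qed.

Lemma coef_tail u ur (e : R -> R) : in_L2 rad a u -> in_L2 rad a ur ->
  measurable_fun E e -> (forall z, `|e z| <= 1) ->
  {ae leb2, forall x, (D `*` E) x -> u x = - tail_int rad ur x} ->
  {ae mu, forall r, D r -> coef a e u r = - \int[mu]_(t in `]r, rad[) coef a e ur t}.
Proof.
move=> Lu Lr me e1 /(ae_prod_r) H.
apply: ae_impl H => r Hr Dr; have r0 : 0 < r by move: Dr; rewrite /= in_itv/= => /andP[].
have mA : measurable (`]r, rad[%classic : set (measurableTypeR R)) by exact: measurable_itv.
have subA : `]r, rad[ `<=` D by apply: subset_itvr; rewrite bnd_simp ltW.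
have i2 : integ leb2 (`]r, rad[ `*` E) (fun x => ur x * e x.2).
  apply: (@L2_mul_integ _ r^-1) => //; [exact: ltW|exact: measurable_comp_snd|].
  move=> x [/=]; rewrite in_itv/= => /andP[rx _] _; apply: le_trans (e1 _) _.
  by rewrite mulrC ler_pdivlMr// mul1r ltW.
have [_ j2 E2] := fubini_setX_z mA mE i2; have [_ _ E1] := fubini_setX_r mA mE i2.
have mur : measurable_fun (D `*` E) ur by case: Lr.
have tE z : E z -> tail_int rad ur (r, z) * e z = \int[mu]_(t in `]r, rad[) (ur (t, z) * e z).
  move=> Ez; under eq_Rintegral do rewrite mulrC.
  rewrite RintZl// 1?mulrC//.
  have mz : measurable_fun D (fun t => ur (t, z)) by exact: (@measurable_slice_z _ D E).
  exact: measurable_funS mz.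
have -> : \int[mu]_(t in `]r, rad[) coef a e ur t =
    \int[mu]_(z in E) (tail_int rad ur (r, z) * e z).
  rewrite /coef -E1 E2; apply: eq_Rintegral => z /set_mem Ez; by rewrite tE.
have j2' : integ mu E (fun z => tail_int rad ur (r, z) * e z).
  by apply: eq_integ mE j2 => z /set_mem Ez; rewrite tE.
rewrite -(RintN mE j2'); apply: ae_eq_Rint => //.
- apply: measurable_funM => //; apply: (@measurable_slice_r _ D E) => //; by case: Lu.
- exact: integ_measurable (integN mE j2').
- by apply: ae_impl (Hr Dr) => z Hz Ez; rewrite Hz// mulNr.
Qed.

Lemma origin_constant0 (p g : R -> R) (C : R) : measurable_fun D p -> measurable_fun D g ->
  integ mu D (fun r => p r ^+ 2 * r) -> integ mu D (fun r => g r ^+ 2 * r) ->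
  {ae mu, forall r, D r -> r ^+ 3 * p r = C + \int[mu]_(s in `]0, r[) (s ^+ 3 * g s)} ->
  C = 0.
Proof.
move=> mp mg ip ig H; have [N [_ N0] HN] := moment_bound 2 mg ig.
have i3 := L2_radial_moment rad0 2 mg ig.
pose B := \int[mu]_(r in D) (2 * (p r ^+ 2 * r + N ^+ 2 * rad)).
have iB : integ mu D (fun r => 2 * (p r ^+ 2 * r + N ^+ 2 * rad)).
  by apply: integZ => //; apply: integD => //; exact: integ_cst_oo.
have key (d : R) : 0 < d -> d < rad -> C ^+ 2 <= B * d ^+ 4.
  move=> d0 dR.
  have sub : `]0, d[ `<=` D by apply: subset_itvl; rewrite bnd_simp ltW.
  have md : measurable (`]0, d[%classic : set (measurableTypeR R)) by exact: measurable_itv.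
  have Cd : {ae mu, forall r, `]0, d[%classic r -> C ^+ 2 <= d ^+ 5 * (2 * (p r ^+ 2 * r + N ^+ 2 * rad))}.
    apply: ae_impl H => r Hr dr; have Dr := sub _ dr.
    move: dr; rewrite /= in_itv/= => /andP[r0 rd].
    have rR : r <= rad by rewrite ltW// (lt_trans rd).
    have r0' := ltW r0.
    have I1 : `|\int[mu]_(s in `]0, r[) (s ^+ 3 * g s)| <= N * r ^+ 3.
      apply: le_trans (HN r Dr); apply: le_normr_Rintegral => //.
      exact: integ_sub0 rR i3.
    have CE : C = r ^+ 3 * p r + - \int[mu]_(s in `]0, r[) (s ^+ 3 * g s).
      by rewrite Hr// addrK.
    have I2 : (\int[mu]_(s in `]0, r[) (s ^+ 3 * g s)) ^+ 2 <= (N * r ^+ 3) ^+ 2.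
      rewrite -[leLHS]real_normK ?num_real// lerXn2r// nnegrE mulr_ge0// exprn_ge0//.
    have C2 : C ^+ 2 <= r ^+ 5 * (2 * (p r ^+ 2 * r + N ^+ 2 * r)).
      rewrite CE; apply: le_trans (sqrD_le _ _) _; rewrite sqrrN.
      have -> : r ^+ 5 * (2 * (p r ^+ 2 * r + N ^+ 2 * r)) =
        2 * (r ^+ 3 * p r) ^+ 2 + 2 * (N * r ^+ 3) ^+ 2 by ring.
      by rewrite lerD2l ler_pM2l.
    apply: le_trans C2 _; apply: ler_pM.
    - exact: exprn_ge0.
    - by rewrite mulr_ge0// addr_ge0// mulr_ge0// sqr_ge0.
    - by rewrite lerXn2r// ?nnegrE// ltW.
    - by rewrite ler_pM2l// lerD2l ler_wpM2l// sqr_ge0.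
  have iBd : integ mu `]0, d[ (fun r => d ^+ 5 * (2 * (p r ^+ 2 * r + N ^+ 2 * rad))).
    by apply: integZ => //; exact: integ_sub0 (ltW dR) iB.
  have := ae_le_Rint md (integ_cst_oo 0 d (C ^+ 2)) iBd Cd.
  rewrite (Rint_cst_oo _ (ltW d0)) subr0 (RintegralZl _ md (integ_sub0 (ltW dR) iB)) => le1.
  have le2 : \int[mu]_(r in `]0, d[) (2 * (p r ^+ 2 * r + N ^+ 2 * rad)) <= B.
    rewrite -lee_fin (EFin_Rint md (integ_sub0 (ltW dR) iB)) (EFin_Rint mD iB).
    apply: ge0_subset_integral => //.
      by apply/measurable_EFinP; exact: integ_measurable iB.
    move=> r; rewrite /= in_itv/= => /andP[/ltW r0 _].
    by rewrite lee_fin mulr_ge0// addr_ge0// mulr_ge0// ?sqr_ge0// ltW.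
  rewrite -(ler_pM2r d0) (le_trans le1)//.
  rewrite (_ : B * d ^+ 4 * d = d ^+ 5 * B); last by ring.
  by apply: ler_wpM2l => //; rewrite exprn_ge0// ltW.
have B0 : 0 <= B.
  apply: Rintegral_ge0 => r; rewrite /= in_itv/= => /andP[/ltW r0 _].
  by rewrite mulr_ge0// addr_ge0// mulr_ge0// ?sqr_ge0// ltW.
apply/eqP; rewrite -sqrf_eq0; apply/eqP.
apply: (@ge0_small_eq0 _ _ B) => [|e e0]; first exact: sqr_ge0.
pose d := Num.min e (Num.min 1 (rad / 2)).
have d0 : 0 < d by rewrite !lt_min e0 ltr01 divr_gt0.
have dR : d < rad.
  apply: (@le_lt_trans _ _ (rad / 2)); first by rewrite !ge_min lexx !orbT.
  by rewrite ltr_pdivrMr// mulr2n mulrDr mulr1 ltrDl.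
apply: le_trans (key d d0 dR) _; rewrite ler_wpM2l//.
have d1 : d <= 1 by rewrite !ge_min lexx orbT.
apply: (@le_trans _ _ d); last by rewrite ge_min lexx.
by rewrite exprS; apply: ler_piMr; [exact: ltW|apply: exprn_ile1 => //; exact: ltW].
Qed.

Section Equation.
Variables om psi psir psiz : R * R -> R.
Hypotheses (Lom : in_L2 rad a om) (Lpsi : in_L2 rad a psi)
  (Lr : in_L2 rad a psir) (Lz : in_L2 rad a psiz)
  (wr : weak_deriv2 (rect rad a) [:: er] psi psir)
  (wz : weak_deriv2 (rect rad a) [:: ez] psi psiz)
  (de : distr_eq rad a om psi psir).

Lemma derive1_mulX (f : R -> R) : smooth f ->
  derive1 (fun r : R => r * f r) = fun r => f r + r * derive1 f r.
Proof.
move=> sf; rewrite (smooth_derive1M (f := id))//; last exact: Ck_smooth (@Ck_id R).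
by apply/funext => r; rewrite derive1_id mul1r.
Qed.

Lemma smooth_mulX (f : R -> R) : smooth f -> smooth (fun r : R => r * f r).
Proof. by move=> sf; apply: (smoothM (f := id)) => //; exact: Ck_smooth (@Ck_id R). Qed.

Lemma L2_test u (f g : R -> R) : in_L2 rad a u -> smooth f -> smooth g ->
  integ leb2 (D `*` E) (fun x => u x * (x.1 * (f x.1 * g x.2))).
Proof.
move=> Lu sf sg; have [C HC] := smooth_bounded 0 rad sf.
have [C' HC'] := smooth_bounded (- a) a sg.
apply: (@L2_mul_integ 0 (C * C')) => //.
  apply: measurable_funM; first by apply: measurable_funTS; exact: measurable_fst.
  by apply: measurable_funTS; apply: smooth_measurable; exact: smooth_tensor.
move=> x [/=]; rewrite !in_itv/= => /andP[x0 xR] /andP[z0 zR].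
rewrite normrM (gtr0_norm x0) mulrC ler_wpM2r ?(ltW x0)// normrM.
by apply: ler_pM => //; [apply: HC|apply: HC']; rewrite !ltW.
Qed.

Lemma test_fun_mulX (f : R -> R) : test_fun D f -> test_fun D (fun r => r * f r).
Proof.
move=> [sf [C [cC CD C0]]]; split; first exact: smooth_mulX.
by exists C; split => // x /C0 ->; rewrite mulr0.
Qed.

Let H1 (f : R -> R) x := psir x * (x.1 * (x.1 * (x.1 * derive1 f x.1))) -
  om x * (x.1 * (x.1 * (x.1 * f x.1))).
Let H2 (f : R -> R) x := psiz x * (x.1 * (x.1 * (x.1 * f x.1))).

Let weak_form (f chi : R -> R) : test_fun D f -> test_fun E chi ->
  \int[leb2]_(x in D `*` E) (H1 f x * chi x.2 + H2 f x * derive1 chi x.2) = 0.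
Proof.
move=> tf tc; have [sf _] := tf; have [sc _] := tc.
have sf1 := smooth_derive1 sf; have sc1 := smooth_derive1 sc; have sc2 := smooth_derive1 sc1.
pose q r := 3 * f r + r * derive1 f r.
have sq : smooth q.
  apply: Ck_smooth => n; apply: CkD; last exact: smooth_Ck (smooth_mulX sf1).
  by apply: CkM; [exact: Ck_cst|exact: smooth_Ck].
have sq1 := smooth_derive1 sq.
pose k r := 2 * q r + r * derive1 q r.
have sk : smooth k.
  apply: Ck_smooth => n; apply: CkD; last exact: smooth_Ck (smooth_mulX sq1).
  by apply: CkM; [exact: Ck_cst|exact: smooth_Ck].
have sXf := smooth_mulX sf; have sXXf := smooth_mulX sXf; have sXq := smooth_mulX sq.
have sXf1 := smooth_mulX sf1; have sXXf1 := smooth_mulX sXf1.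
pose phi r := r * (r * (r * f r)).
have tp : test_fun D phi by do 3 apply: test_fun_mulX.
have sp : smooth phi by case: tp.
have dp : derive1 phi = fun r => r * (r * q r).
  rewrite /phi derive1_mulX// derive1_mulX// derive1_mulX//.
  by apply/funext => r; rewrite /q; ring.
have ddp : derive1 (derive1 phi) = fun r => r * k r.
  rewrite dp derive1_mulX// derive1_mulX//.
  by apply/funext => r; rewrite /k; ring.
have oD : open (`]0, rad[%classic : set R) by exact: interval_open.
have oE : open (`](- a), a[%classic : set R) by exact: interval_open.
have tp1 : test_fun D (derive1 phi) by exact: test_fun_derive1.
have tc1 : test_fun E (derive1 chi) by exact: test_fun_derive1.
have [sp1 _] := tp1.
have [_ _ Wr] := wr; have [_ _ Wz] := wz.
have Er := Wr _ (test_fun_tensor tp1 tc).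
have Ez := Wz _ (test_fun_tensor tp tc1).
have Ed := de (test_fun_tensor tp tc).
have ia := L2_test Lpsi sk sc.
have ib := L2_test Lr sXf sc.
have ic := L2_test Lpsi sXXf sc2.
have id_ := L2_test Lom sXXf sc.
have ie := L2_test Lr sXq sc.
have if_ := L2_test Lz sXXf sc1.
have E1 : iter_deriv [:: er] (fun y : R * R => derive1 phi y.1 * chi y.2) =
    fun y => y.1 * k y.1 * chi y.2.
  by have := derive_tensor_er sp1 sc; rewrite ddp.
have E2 : iter_deriv [:: ez] (fun y : R * R => phi y.1 * derive1 chi y.2) =
    fun y => phi y.1 * derive1 (derive1 chi) y.2.
  exact: derive_tensor_ez sp sc1.
have E3 : iter_deriv [:: er; er] (fun y : R * R => phi y.1 * chi y.2) =
    fun y => y.1 * k y.1 * chi y.2.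
  by rewrite -E1 -(derive_tensor_er sp sc).
have E4 : iter_deriv [:: ez; ez] (fun y : R * R => phi y.1 * chi y.2) =
    fun y => phi y.1 * derive1 (derive1 chi) y.2.
  by rewrite -E2 -(derive_tensor_ez sp sc).
rewrite E1 dp in Er; rewrite E2 in Ez; rewrite E3 E4 in Ed.
pose A := \int[leb2]_(x in D `*` E) (psi x * (x.1 * (k x.1 * chi x.2))).
pose B := \int[leb2]_(x in D `*` E) (psir x * (x.1 * (x.1 * f x.1 * chi x.2))).
pose C := \int[leb2]_(x in D `*` E) (psi x * (x.1 * (x.1 * (x.1 * f x.1) * derive1 (derive1 chi) x.2))).
pose O := \int[leb2]_(x in D `*` E) (om x * (x.1 * (x.1 * (x.1 * f x.1) * chi x.2))).
pose P := \int[leb2]_(x in D `*` E) (psir x * (x.1 * (x.1 * q x.1 * chi x.2))).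
pose F := \int[leb2]_(x in D `*` E) (psiz x * (x.1 * (x.1 * (x.1 * f x.1) * derive1 chi x.2))).
have EA : A = - P.
  rewrite /A; transitivity (\int[mu2]_(x in rect rad a) (psi x * (x.1 * k x.1 * chi x.2))).
    by apply: eq_Rintegral => x _; rewrite !mulrA.
  rewrite Er expr1 mulN1r; congr (- _); apply: eq_Rintegral => x _; by rewrite !mulrA.
have EC : C = - F.
  rewrite /C; transitivity (\int[mu2]_(x in rect rad a) (psi x * (phi x.1 * derive1 (derive1 chi) x.2))).
    by apply: eq_Rintegral => x _; rewrite /phi !mulrA.
  rewrite Ez expr1 mulN1r; congr (- _); apply: eq_Rintegral => x _; by rewrite /phi !mulrA.
have EO : - (A + 3 * B + C) = O.
  rewrite /O; transitivity (\int[mu2]_(x in rect rad a) (om x * (phi x.1 * chi x.2))); last first.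
    by apply: eq_Rintegral => x _; rewrite /phi !mulrA.
  rewrite -Ed /A /B /C -(RintegralZl 3 mDE ib) -(RintegralD mDE ia (integZ 3 mDE ib)).
  rewrite -(RintegralD mDE (integD mDE ia (integZ 3 mDE ib)) ic).
  rewrite -(RintN mDE (integD mDE (integD mDE ia (integZ 3 mDE ib)) ic)).
  apply: eq_Rintegral => x /set_mem/rect_r0 x0; rewrite /phi; field.
  by rewrite gt_eqF.
transitivity (P - 3 * B - O + F); last by rewrite -EO EA EC; ring.
rewrite /P /B /O /F -(RintegralZl 3 mDE ib) -(RintegralB mDE ie (integZ 3 mDE ib)).
rewrite -(RintegralB mDE (integB mDE ie (integZ 3 mDE ib)) id_).
rewrite -(RintegralD mDE (integB mDE (integB mDE ie (integZ 3 mDE ib)) id_) if_).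
by apply: eq_Rintegral => x _; rewrite /H1 /H2 /q; ring.
Qed.

Variable k : nat.
Hypothesis k0 : (0 < k)%N.
Let s := sine a k.
Let c := cosine a k.
Let lam := freq a k.
Hypothesis base : {ae mu, forall r, D r -> coef a c psiz r = lam * coef a s psi r}.

Let iH1 (f : R -> R) : smooth f -> integ leb2 (D `*` E) (H1 f).
Proof.
move=> sf; have s1 : smooth (fun _ : R => 1 : R) by apply: Ck_smooth => n; exact: Ck_cst.
have sX := smooth_mulX (smooth_mulX (smooth_derive1 sf)).
have sX' := smooth_mulX (smooth_mulX sf).
have := integB mDE (L2_test Lr sX s1) (L2_test Lom sX' s1).
by apply: eq_integ mDE => x _; rewrite !mulr1.
Qed.

Let iH2 (f : R -> R) : smooth f -> integ leb2 (D `*` E) (H2 f).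
Proof.
move=> sf; have s1 : smooth (fun _ : R => 1 : R) by apply: Ck_smooth => n; exact: Ck_cst.
have sX' := smooth_mulX (smooth_mulX sf).
have := L2_test Lz sX' s1.
by apply: eq_integ mDE => x _; rewrite !mulr1.
Qed.

Let smooth_bdE (e : R -> R) : smooth e -> exists C, forall z, E z -> `|e z| <= C.
Proof.
move=> se; have [C HC] := smooth_bounded (- a) a se; exists C => z.
by rewrite /= in_itv/= => /andP[z0 zR]; apply: HC; rewrite !ltW.
Qed.

Let mE_smooth (e : R -> R) : smooth e -> measurable_fun E e.
Proof.
by move=> se; apply: measurable_funTS; apply: continuous_measurable_fun; exact: smooth_continuous.
Qed.

Let weak_form_sine (f : R -> R) : test_fun D f ->
  \int[leb2]_(x in D `*` E) (H1 f x * s x.2 + H2 f x * (lam * c x.2)) = 0.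
Proof.
move=> tf; have [sf _] := tf.
pose A z := \int[mu]_(r in D) H2 f (r, z); pose F z := \int[mu]_(r in D) H1 f (r, z).
have split_z (e1 e2 : R -> R) : smooth e1 -> smooth e2 ->
  \int[leb2]_(x in D `*` E) (H1 f x * e1 x.2 + H2 f x * e2 x.2) =
  \int[mu]_(z in E) (F z * e1 z) + \int[mu]_(z in E) (A z * e2 z) /\
  (integ mu E (fun z => F z * e1 z) /\ integ mu E (fun z => A z * e2 z)).
  move=> s1 s2; have [C1 HC1] := smooth_bdE s1; have [C2 HC2] := smooth_bdE s2.
  have [j1 j2 E1 _ _] := integ_separated (iH1 sf) (mE_smooth s1) HC1.
  have [l1 l2 E2 _ _] := integ_separated (iH2 sf) (mE_smooth s2) HC2.
  split; last by split.
  by rewrite (RintegralD mDE j1 l1) E1 E2.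
have [_ iF _] := fubini_setX_z mD mE (iH1 sf).
have [_ iA _] := fubini_setX_z mD mE (iH2 sf).
have /(weak_primitive iA iF)[C HC] : forall chi, test_fun E chi ->
    \int[mu]_(z in E) (A z * derive1 chi z + F z * chi z) = 0.
  move=> chi tc; have [sc _] := tc; rewrite -(weak_form tf tc).
  have [-> [j1 j2]] := split_z chi (derive1 chi) sc (smooth_derive1 sc).
  by rewrite (RintegralD mE j2 j1) addrC.
have ss : smooth s by exact: smooth_sine.
have slc : smooth (fun z => lam * c z).
  by rewrite /lam /c -derive1_sine; exact: smooth_derive1.
have [-> [j1 j2]] := split_z s (fun z => lam * c z) ss slc.
have [iP EP] := ibp_primitive iF ss (sine_right a0 k).
rewrite derive1_sine in iP EP.
have ilc : integ mu E (fun z => C * (lam * c z)) by apply: integZ => //; exact: smooth_integ.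
have -> : \int[mu]_(z in E) (A z * (lam * c z)) =
    \int[mu]_(z in E) (C * (lam * c z) + freq a k * cosine a k z * \int[mu]_(r in `](- a), z[) F r).
  apply: ae_eq_Rint => //; first exact: integ_measurable j2.
    exact: integ_measurable (integD mE ilc iP).
  apply: ae_impl HC => z Hz; rewrite /= in_itv/= => /Hz Hz'.
  by rewrite /A Hz' -/lam -/c; ring.
rewrite (RintegralD mE ilc iP) EP (RintegralZl _ mE (smooth_integ _ _ slc)).
by rewrite (RintegralZl _ mE (integ_cosine a k)) int_cosine// !mulr0 add0r subrr.
Qed.

Let ms : measurable_fun E s. Proof. exact: measurable_sine. Qed.
Let mc : measurable_fun E c. Proof. exact: measurable_cosine. Qed.
Let s1 z : `|s z| <= 1. Proof. exact: sine_le1. Qed.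
Let c1 z : `|c z| <= 1. Proof. exact: cosine_le1. Qed.
Let g r := lam ^+ 2 * coef a s psi r - coef a s om r.

Let m_coef u (e : R -> R) : measurable_fun E e -> in_L2 rad a u -> measurable_fun D (coef a e u).
Proof. by move=> me [mu' _]; exact: measurable_coef. Qed.

Let mg : measurable_fun D g.
Proof. by apply: measurable_funB; [apply: measurable_funM => //|]; exact: m_coef. Qed.

Let ig : integ mu D (fun r => g r ^+ 2 * r).
Proof.
have [i1 _] := coef_L2 a0 ms s1 Lpsi; have [i2 _] := coef_L2 a0 ms s1 Lom.
have ib := integD mD (integZ (2 * lam ^+ 4) mD i1) (integZ 2 mD i2).
apply: (integ_le mD _ _ ib); first by apply: measurable_funM => //; exact: measurable_funX.
move=> r; rewrite /= in_itv/= => /andP[/ltW r0 _]; rewrite ger0_norm; last by rewrite mulr_ge0// sqr_ge0.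
rewrite [leRHS](_ : _ = (2 * (lam ^+ 2 * coef a s psi r) ^+ 2 + 2 * (- coef a s om r) ^+ 2) * r); last by ring.
by apply: ler_wpM2r => //; exact: sqrD_le.
Qed.

Lemma mode_ode : {ae mu, forall r, D r ->
  r ^+ 3 * coef a s psir r = \int[mu]_(t in `]0, r[) (t ^+ 3 * g t)}.
Proof.
have [ip _] := coef_L2 a0 ms s1 Lr.
have mp := m_coef ms Lr.
have i3 := L2_radial_moment rad0 2 mp ip; have i3g := L2_radial_moment rad0 2 mg ig.
have [] := weak_primitive i3 i3g.
  move=> f tf; have [sf _] := tf; apply: etrans (weak_form_sine tf).
  have sb1 z : E z -> `|s z| <= 1 by move=> _; exact: s1.
  have cb1 z : E z -> `|lam * c z| <= `|lam| by move=> _; rewrite normrM ler_piMr.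
  have mlc : measurable_fun E (fun z => lam * c z) by exact: measurable_funM.
  have [j1 _ _ j3 E1] := integ_separated (iH1 sf) ms sb1.
  have [l1 _ _ l3 E2] := integ_separated (iH2 sf) mlc cb1.
  rewrite [RHS](RintegralD mDE j1 l1) E1 E2 -[RHS](RintegralD mD j3 l3).
  have msm (e : R -> R) : smooth e -> measurable_fun D e.
    by move=> se; apply: measurable_funTS; apply: continuous_measurable_fun; exact: smooth_continuous.
  apply: ae_eq_Rint mD _ (integ_measurable (integD mD j3 l3)) _.
    apply: measurable_funD; apply: measurable_funM.
    - exact: integ_measurable i3.
    - exact: msm (smooth_derive1 sf).
    - exact: integ_measurable i3g.
    - exact: msm.
  apply: ae_impl3 base (coef_integ ms s1 Lr) (coef_integ ms s1 Lom) => r Hb Hr Ho Dr.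
  have {}Hr := Hr Dr; have {}Ho := Ho Dr.
  have -> : \int[mu]_(z in E) (H1 f (r, z) * s z) =
      r ^+ 3 * derive1 f r * coef a s psir r - r ^+ 3 * f r * coef a s om r.
    rewrite /coef -(RintegralZl _ mE Hr) -(RintegralZl _ mE Ho).
    rewrite -(RintegralB mE (integZ _ mE Hr) (integZ _ mE Ho)).
    by apply: eq_Rintegral => z _; rewrite /H1/=; ring.
  have mz : measurable_fun E (fun z => psiz (r, z) * c z).
    apply: measurable_funM => //; apply: (@measurable_slice_r _ D E) => //; by case: Lz.
  have -> : \int[mu]_(z in E) (H2 f (r, z) * (lam * c z)) = lam * r ^+ 3 * f r * coef a c psiz r.
    rewrite /coef -(@RintZl _ _ _ mu E _ _ mE mz); apply: eq_Rintegral => z _; rewrite /H2/=; ring.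
  by rewrite (Hb Dr) /g; ring.
move=> C HC; have {}HC : {ae mu, forall r, D r ->
    r ^+ 3 * coef a s psir r = C + \int[mu]_(t in `]0, r[) (t ^+ 3 * g t)}.
  by apply: ae_impl HC => r H; rewrite /= in_itv/=; exact: H.
have C0 := origin_constant0 mp mg ip ig HC.
by apply: ae_impl HC => r H Dr; rewrite (H Dr) C0 add0r.
Qed.

End Equation.

End ModeEquation.

(** * Orthogonal series *)

Section FiniteSums.
Context d (T : measurableType d) (R : realType).
Variable mu : {measure set T -> \bar R}.
Local Notation integ D f := (mu.-integrable D (EFin \o f)).

Lemma integ_bigsum (D : set T) (f : nat -> T -> R) m n : measurable D ->
  (forall k, integ D (f k)) -> integ D (fun x => \sum_(m <= k < n) f k x).
Proof.
move=> mD fi; have [mn|nm] := leqP m n; last first.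
  apply: (@eq_integ _ _ _ mu D (fun=> 0)) => // [x _|]; first by rewrite big_geq// ltnW.
  by have := integrable0 mu D.
elim: n mn => [|n IH] mn.
  apply: (@eq_integ _ _ _ mu D (fun=> 0)) => // [x _|]; first by rewrite big_geq.
  by have := integrable0 mu D.
move: mn; rewrite leq_eqVlt => /predU1P[->|mn].
  apply: (@eq_integ _ _ _ mu D (fun=> 0)) => // [x _|]; first by rewrite big_geq.
  by have := integrable0 mu D.
apply: eq_integ mD (integD mD (IH _) (fi n)) => // x _.
by rewrite big_nat_recr.
Qed.

Lemma Rint_bigsum (D : set T) (f : nat -> T -> R) m n : measurable D ->
  (forall k, integ D (f k)) ->
  \int[mu]_(x in D) (\sum_(m <= k < n) f k x) = \sum_(m <= k < n) \int[mu]_(x in D) f k x.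
Proof.
move=> mD fi; have [mn|nm] := leqP m n; last first.
  rewrite [RHS](@big_geq _ _ _ _ _ _ _ (ltnW nm)); transitivity (\int[mu]_(x in D) (0 : R)).
    by apply: eq_Rintegral => x _; rewrite big_geq// ltnW.
  by rewrite /Rintegral integral0.
rewrite -(subnKC mn); elim: (n - m)%N => [|j IH].
  rewrite addn0 [RHS]big_geq//; transitivity (\int[mu]_(x in D) (0 : R)).
    by apply: eq_Rintegral => x _; rewrite big_geq.
  by rewrite /Rintegral integral0.
rewrite addnS [RHS]big_nat_recr ?leq_addr//= -IH -(RintegralD mD (integ_bigsum _ _ mD fi) (fi _)).
by apply: eq_Rintegral => x _; rewrite big_nat_recr ?leq_addr.
Qed.

End FiniteSums.

Section OrthogonalSeries.
Context {R : realType}.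
Variables (rad a : R).
Hypothesis a0 : 0 < a.
Local Notation mu := (@lebesgue_measure R).
Local Notation leb2 := (mu \x mu)%E.
Local Notation integ m D f := (m.-integrable D (EFin \o f)).
Local Notation D := (`]0, rad[%classic : set (measurableTypeR R)).
Local Notation E := (`](- a), a[%classic : set (measurableTypeR R)).
Implicit Types u v : R * R -> R.

Let mD : measurable D. Proof. exact: measurable_itv. Qed.
Let mE : measurable E. Proof. exact: measurable_itv. Qed.
Let mDE : measurable (D `*` E). Proof. exact: measurableX. Qed.

Variable e : nat -> R -> R.
Hypotheses (me : forall k, measurable_fun E (e k)) (e1 : forall k z, `|e k z| <= 1)
  (orth : forall j k, \int[mu]_(z in E) (e j z * e k z) = a * (j == k)%:R).

Let ie k : integ mu E (e k).
Proof. by apply: (integ_le (g := fun=> 1)) => //; exact: integ_cst_oo. Qed.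

Let iee j k : integ mu E (fun z => e j z * e k z).
Proof. by apply: (@integM_bounded _ _ _ _ _ _ _ 1). Qed.

Let iZee (c : R) j k : integ mu E (fun z => c * (e j z * e k z)).
Proof. exact: integZ. Qed.

Lemma orth_sum_sqr (c : nat -> R) m n :
  \int[mu]_(z in E) ((\sum_(m <= k < n) c k * e k z) ^+ 2) = a * \sum_(m <= k < n) c k ^+ 2.
Proof.
transitivity (\int[mu]_(z in E) \sum_(m <= j < n) \sum_(m <= k < n) (c j * c k) * (e j z * e k z)).
  apply: eq_Rintegral => z _; rewrite expr2 mulr_suml; apply: eq_bigr => j _.
  by rewrite mulr_sumr; apply: eq_bigr => k _; ring.
rewrite Rint_bigsum//; last by move=> j; exact: integ_bigsum.
rewrite mulr_sumr; apply: eq_big_nat => j /andP[mj jn].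
rewrite Rint_bigsum//.
rewrite (bigD1_seq j)/= ?mem_index_iota ?mj ?jn ?iota_uniq//.
rewrite big1 => [|k kj]; last first.
  by rewrite (RintegralZl _ mE (iee j k)) orth eq_sym (negbTE kj) !mulr0.
by rewrite addr0 (RintegralZl _ mE (iee j j)) orth eqxx mulr1 expr2 mulrC.
Qed.

Lemma orth_sum_sqr_integ (c : nat -> R) m n :
  integ mu E (fun z => (\sum_(m <= k < n) c k * e k z) ^+ 2).
Proof.
have : integ mu E (fun z => \sum_(m <= j < n) \sum_(m <= k < n) (c j * c k) * (e j z * e k z)).
  by apply: integ_bigsum => // j; exact: integ_bigsum.
apply: eq_integ => // z _; rewrite expr2 mulr_suml; apply: eq_bigr => j _.
by rewrite mulr_sumr; apply: eq_bigr => k _; ring.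
Qed.

Lemma bessel_slice (f : R -> R) n : measurable_fun E f -> integ mu E (fun z => f z ^+ 2) ->
  \sum_(0 <= k < n) (\int[mu]_(z in E) (f z * e k z)) ^+ 2 <= a * \int[mu]_(z in E) (f z ^+ 2).
Proof.
move=> mf i2.
have if1 : integ mu E f.
  apply: (integ_le _ _ _ (integD mE i2 (integ_cst_oo (- a) a 1))) => //.
  move=> z _; rewrite -[f z ^+ 2]real_normK ?num_real//.
  have := sqr_ge0 (`|f z| - 1); have := normr_ge0 (f z); rewrite !expr2; nra.
have ife k : integ mu E (fun z => f z * e k z).
  by apply: (@integM_bounded _ _ _ _ _ _ _ 1).
pose c k := a^-1 * \int[mu]_(z in E) (f z * e k z).
pose T z := \sum_(0 <= k < n) c k * e k z.
have iT2 : integ mu E (fun z => T z ^+ 2) by exact: orth_sum_sqr_integ.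
have ifT : integ mu E (fun z => f z * T z).
  have : integ mu E (fun z => \sum_(0 <= k < n) c k * (f z * e k z)).
    by apply: integ_bigsum => // k; exact: integZ.
  by apply: eq_integ => // z _; rewrite mulr_sumr; apply: eq_bigr => k _; ring.
have EfT : \int[mu]_(z in E) (f z * T z) = a * \sum_(0 <= k < n) c k ^+ 2.
  transitivity (\int[mu]_(z in E) \sum_(0 <= k < n) c k * (f z * e k z)).
    by apply: eq_Rintegral => z _; rewrite mulr_sumr; apply: eq_bigr => k _; ring.
  rewrite Rint_bigsum//; last by move=> k; exact: integZ.
  rewrite mulr_sumr; apply: eq_bigr => k _; rewrite (RintegralZl _ mE (ife k)) /c.
  by field; rewrite gt_eqF.
have := @Rintegral_ge0 _ _ _ mu E (fun z => (f z - T z) ^+ 2) (fun z _ => sqr_ge0 _).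
have -> : \int[mu]_(z in E) (f z - T z) ^+ 2 =
    \int[mu]_(z in E) (f z ^+ 2) - a * \sum_(0 <= k < n) c k ^+ 2.
  transitivity (\int[mu]_(z in E) (f z ^+ 2 - 2 * (f z * T z) + T z ^+ 2)).
    by apply: eq_Rintegral => z _; ring.
  rewrite (RintegralD mE (integB mE i2 (integZ 2 mE ifT)) iT2).
  rewrite (RintegralB mE i2 (integZ 2 mE ifT)) (RintegralZl _ mE ifT) EfT orth_sum_sqr.
  ring.
rewrite subr_ge0 => H.
have -> : \sum_(0 <= k < n) (\int[mu]_(z in E) (f z * e k z)) ^+ 2 =
    a * (a * \sum_(0 <= k < n) c k ^+ 2).
  rewrite !mulr_sumr; apply: eq_bigr => k _; rewrite /c; field; by rewrite gt_eqF.
by rewrite ler_pM2l.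
Qed.

Lemma bessel u n : in_L2 rad a u ->
  \sum_(0 <= k < n) \int[mu]_(r in D) (coef a (e k) u r ^+ 2 * r) <= a * nrm2 rad a u.
Proof.
move=> Lu; have iu := in_L2_integ Lu; have [mu' _] := Lu.
have [_ i2 E2] := fubini_setX_r mD mE iu.
have ic k : integ mu D (fun r => coef a (e k) u r ^+ 2 * r).
  by have [] := coef_L2 a0 (me k) (e1 k) Lu.
rewrite -(Rint_bigsum 0 n mD ic) /nrm2 E2 -(RintegralZl _ mD i2).
apply: ae_le_Rint (integ_bigsum 0 n mD ic) (integZ a mD i2) _ => //.
apply: ae_impl (in_L2_slice_r Lu) => r H Dr; have [i2r _] := H Dr.
have r0 : 0 <= r by move: Dr; rewrite /= in_itv/= => /andP[/ltW].
rewrite -mulr_suml.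
have -> : \int[mu]_(z in E) (u (r, z) ^+ 2 * (r, z).1) = (\int[mu]_(z in E) u (r, z) ^+ 2) * r.
  rewrite [RHS]mulrC -(RintegralZl _ mE i2r); apply: eq_Rintegral => z _; by rewrite mulrC.
rewrite mulrA ler_wpM2r// bessel_slice//.
exact: (@measurable_slice_r _ D E).
Qed.

Definition partial_sum (f : nat -> R -> R) n (x : R * R) : R :=
  \sum_(0 <= k < n) (a^-1 * f k x.1) * e k x.2.

Section Synthesis.
Variables (f : nat -> R -> R) (B : R).
Hypotheses (mf : forall k, measurable_fun D (f k))
  (if2 : forall k, integ mu D (fun r => f k r ^+ 2 * r))
  (fB : forall n, \sum_(0 <= k < n) \int[mu]_(r in D) (f k r ^+ 2 * r) <= B).

Let S := partial_sum f.

Let m_term k : measurable_fun (D `*` E) (fun x => (a^-1 * f k x.1) * e k x.2).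
Proof.
apply: measurable_funM; last exact: measurable_comp_snd.
by apply: measurable_funM => //; exact: measurable_comp_fst.
Qed.

Let m_sum m n : measurable_fun (D `*` E) (fun x => \sum_(m <= k < n) (a^-1 * f k x.1) * e k x.2).
Proof. by apply: measurable_sum => k; exact: m_term. Qed.

Let sum_L2 m n : let u x := \sum_(m <= k < n) (a^-1 * f k x.1) * e k x.2 in
  in_L2 rad a u /\ nrm2 rad a u = a^-1 * \sum_(m <= k < n) \int[mu]_(r in D) (f k r ^+ 2 * r).
Proof.
set u := (X in let u := X in _); move=> /=.
have us (r : R) : \int[mu]_(z in E) (u (r, z) ^+ 2 * r) = a^-1 * \sum_(m <= k < n) (f k r ^+ 2 * r).
  have -> : \int[mu]_(z in E) (u (r, z) ^+ 2 * r) = r * \int[mu]_(z in E) (u (r, z) ^+ 2).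
    rewrite -(RintegralZl _ mE (orth_sum_sqr_integ (fun k => a^-1 * f k r) m n)).
    by apply: eq_Rintegral => z _; rewrite mulrC.
  rewrite [X in r * X](orth_sum_sqr (fun k => a^-1 * f k r) m n) !mulr_sumr.
  by apply: eq_bigr => k _; field; rewrite gt_eqF.
have iu : integ leb2 (D `*` E) (fun x => u x ^+ 2 * x.1).
  apply: (integ_setX_lty mD mE).
    apply: measurable_funM; first by apply: measurable_funX; exact: m_sum.
    by apply: measurable_funTS; exact: measurable_fst.
  have isum := integZ a^-1 mD (integ_bigsum m n mD if2).
  have [_] := integrableP _ _ _ isum; apply: le_lt_trans.
  rewrite le_eqVlt; apply/orP; left; apply/eqP; apply: eq_integral => r /set_mem Dr.
  have r0 : 0 <= r by move: Dr; rewrite /= in_itv/= => /andP[/ltW].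
  have iur : integ mu E (fun z => u (r, z) ^+ 2 * r).
    by apply: eq_integ mE (integZ r mE (orth_sum_sqr_integ (fun k => a^-1 * f k r) m n)) => z _; rewrite mulrC.
  transitivity (\int[mu]_(z in E) (u (r, z) ^+ 2 * r)%:E)%E.
    by apply: eq_integral => z _; rewrite ger0_norm// mulr_ge0// sqr_ge0.
  rewrite -(EFin_Rint mE iur) us /= ger0_norm//.
  apply: mulr_ge0; [by rewrite invr_ge0 ltW|apply: sumr_ge0 => k _].
  by rewrite mulr_ge0// sqr_ge0.
split; first exact: (integ_in_L2 (m_sum m n) iu).
have [_ _ E2] := fubini_setX_r mD mE iu.
rewrite /nrm2 E2 -(Rint_bigsum m n mD if2) -(RintegralZl _ mD (integ_bigsum m n mD if2)).
by apply: eq_Rintegral => r _; rewrite us.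
Qed.

Lemma partial_sum_L2 n : in_L2 rad a (S n).
Proof. by have [] := sum_L2 0 n. Qed.

Let S_diff n m : (m <= n)%N ->
  (fun x => S n x - S m x) = fun x => \sum_(m <= k < n) (a^-1 * f k x.1) * e k x.2.
Proof.
by move=> mn; apply/funext => x; rewrite /S /partial_sum (@big_cat_nat _ _ _ m)//= addrAC subrr add0r.
Qed.

Let coefS k n (r : R) : (k < n)%N -> coef a (e k) (S n) r = f k r.
Proof.
move=> kn; rewrite /coef.
transitivity (\int[mu]_(z in E) \sum_(0 <= j < n) (a^-1 * f j r) * (e j z * e k z)).
  by apply: eq_Rintegral => z _; rewrite /S /partial_sum mulr_suml; apply: eq_bigr => j _; rewrite mulrA.
rewrite Rint_bigsum//.
rewrite (bigD1_seq k)/= ?mem_index_iota ?kn ?iota_uniq//.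
rewrite big1 => [|j jk]; last first.
  by rewrite (RintegralZl _ mE (iee j k)) orth (negbTE jk) !mulr0.
by rewrite addr0 (RintegralZl _ mE (iee k k)) orth eqxx mulr1 mulrAC mulVf ?mul1r// gt_eqF.
Qed.

Let B0 : 0 <= B.
Proof. by have := fB 0; rewrite big_nil. Qed.

Let cauchy_S (eps : R) : 0 < eps -> exists N, forall n m, (N <= n)%N -> (N <= m)%N ->
  (\int[leb2]_(x in (D `*` E)%classic) ((S n x - S m x)%R ^+ 2 * x.1)%:E <= eps%:E)%E.
Proof.
move=> e0.
pose T n := \sum_(0 <= k < n) \int[mu]_(r in D) (f k r ^+ 2 * r).
have I0 k : 0 <= \int[mu]_(r in D) (f k r ^+ 2 * r).
  by apply: Rintegral_ge0 => r; rewrite /= in_itv/= => /andP[/ltW r0 _]; rewrite mulr_ge0 ?sqr_ge0.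
have ndT : nondecreasing_seq T.
  by apply/nondecreasing_seqP => n; rewrite /T big_nat_recr//= lerDl.
have cT : cvgn T.
  apply: nondecreasing_is_cvgn => //; exists B => _ [n _ <-]; exact: fB.
have e2 : 0 < a * eps / 2 by rewrite divr_gt0// mulr_gt0.
have /cvgrPdist_le/(_ _ e2)[N _ HN] := cT; exists N => n m Nn Nm.
wlog mn : n m Nn Nm / (m <= n)%N => [H|].
  have [mn|/ltnW nm] := leqP m n; first exact: H.
  apply: le_trans (H m n Nm Nn nm); rewrite le_eqVlt; apply/orP; left; apply/eqP.
  by apply: eq_integral => x _; rewrite -sqrrN opprB.
have [L1 E1] := sum_L2 m n; rewrite -(S_diff mn) in L1 E1.
have := L2sqE L1; rewrite E1 /L2sq => E2.
apply: (@le_trans _ _ (a^-1 * \sum_(m <= k < n) \int[mu]_(r in D) (f k r ^+ 2 * r))%:E).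
  by rewrite -E2.
rewrite lee_fin ler_pdivrMl//.
have -> : \sum_(m <= k < n) \int[mu]_(r in D) (f k r ^+ 2 * r) = T n - T m.
  by rewrite /T [X in _ = X - _](@big_cat_nat _ _ _ m)//= addrAC subrr add0r.
have := HN n Nn; have := HN m Nm; rewrite !ler_norml => /andP[_ h1] /andP[h2 _].
rewrite -(subrKA (lim (T @ \oo))); rewrite /= in h1 h2; lra.
Qed.

Lemma orth_synthesis : exists F : R * R -> R, [/\ in_L2 rad a F,
  (forall eps : R, 0 < eps -> exists N, forall n, (N <= n)%N ->
    in_L2 rad a (fun x => S n x - F x) /\ nrm2 rad a (fun x => S n x - F x) <= eps),
  nrm2 rad a F <= 2 * a^-1 * B &
  forall k, {ae mu, forall r, D r -> coef a (e k) F r = f k r}].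
Proof.
have m1 : measurable_fun (D `*` E) (fun x : R * R => x.1).
  by apply: measurable_funTS; exact: measurable_fst.
have [F mF cF] := riesz_fischer mDE m1 (@rect_r0 R rad a)
  (fun n => let: conj m _ := partial_sum_L2 n in m) cauchy_S.
have app eps : 0 < eps -> exists N, forall n, (N <= n)%N ->
    in_L2 rad a (fun x => S n x - F x) /\ nrm2 rad a (fun x => S n x - F x) <= eps.
  move=> e0; have [N HN] := ecvg0_le cF e0; exists N => n Nn; apply: L2sq_le_nrm2 (HN n Nn).
  by apply: measurable_funB => //; have [] := partial_sum_L2 n.
have F1 n : F = fun x => 1 * S n x + (-1) * (S n x - F x) by apply/funext => x; ring.
have LF : in_L2 rad a F.
  have [N HN] := app 1 ltr01; have [L1 _] := HN N (leqnn _).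
  by rewrite (F1 N); have [] := nrm2_lin 1 (-1) (partial_sum_L2 N) L1.
exists F; split => //.
- apply/ler_addgt0Pr => eps e0.
  have e2 : 0 < eps / 2 by rewrite divr_gt0.
  have [N HN] := app _ e2; have [L1 n1] := HN N (leqnn _).
  rewrite {1}(F1 N); have [_] := nrm2_lin 1 (-1) (partial_sum_L2 N) L1.
  move=> /le_trans; apply; have [_] := sum_L2 0 N; rewrite -/(partial_sum f N) -/(S N) => ->.
  rewrite expr1n sqrrN expr1n !mulr1 -mulrA; apply: lerD.
    by rewrite ler_pM2l// ler_pM2l ?invr_gt0.
  by rewrite mulrC -ler_pdivlMr.
- move=> k.
  have [iF _] := coef_L2 a0 (me k) (e1 k) LF.
  pose h r := f k r - coef a (e k) F r.
  have mh : measurable_fun D h.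
    by apply: measurable_funB => //; apply: (@measurable_coef _ rad).
  have key eps : 0 < eps -> integ mu D (fun r => h r ^+ 2 * r) /\
      \int[mu]_(r in D) (h r ^+ 2 * r) <= 2 * a * eps.
    move=> e0; have [N HN] := app _ e0.
    have [L1 n1] := HN (maxn N k.+1) (leq_maxl _ _); set n := maxn N k.+1 in L1 n1.
    have kn : (k < n)%N by rewrite leq_max ltnSn orbT.
    have [i1 b1] := coef_L2 a0 (me k) (e1 k) L1.
    have hE : {ae mu, forall r, D r ->
        coef a (e k) (fun x => S n x - F x) r ^+ 2 * r = h r ^+ 2 * r}.
      apply: ae_impl (coef_lin 1 (-1) (me k) (e1 k) (partial_sum_L2 n) LF) => r H Dr.
      have := H Dr; rewrite (_ : (fun x => 1 * S n x + -1 * F x) = fun x => S n x - F x); last first.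
        by apply/funext => x; rewrite mul1r mulN1r.
      by move=> ->; rewrite coefS// mul1r mulN1r.
    have m2 : measurable_fun D (fun r => h r ^+ 2 * r).
      by apply: measurable_funM => //; exact: measurable_funX.
    split; first exact: ae_eq_integ mD m2 hE i1.
    rewrite -(ae_eq_Rint mD (integ_measurable i1) m2 hE); apply: le_trans b1 _.
    by rewrite ler_pM2l// mulr_gt0.
  have [ih _] := key 1 ltr01.
  have nn r : D r -> 0 <= h r ^+ 2 * r.
    by rewrite /= in_itv/= => /andP[/ltW r0 _]; rewrite mulr_ge0 ?sqr_ge0.
  have h0 : \int[mu]_(r in D) (h r ^+ 2 * r) = 0.
    apply: (@ge0_small_eq0 _ _ (2 * a)); first exact: Rintegral_ge0.
    by move=> eps /key[].
  apply: ae_impl (ge0_Rint0_ae mD ih nn h0) => r hr Dr; have /eqP := hr Dr.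
  rewrite mulf_eq0 sqrf_eq0 subr_eq0 => /orP[/eqP -> //|/eqP r0].
  by move: Dr; rewrite /= in_itv/= r0 ltxx.
Qed.
End Synthesis.

End OrthogonalSeries.

Section SineCompleteness.
Context {R : realType}.
Variables (rad a : R).
Hypothesis a0 : 0 < a.
Local Notation mu := (@lebesgue_measure R).
Local Notation leb2 := (mu \x mu)%E.
Local Notation integ m D f := (m.-integrable D (EFin \o f)).
Local Notation D := (`]0, rad[%classic : set (measurableTypeR R)).
Local Notation E := (`](- a), a[%classic : set (measurableTypeR R)).
Implicit Types u v : R * R -> R.

Let mD : measurable D. Proof. exact: measurable_itv. Qed.
Let mE : measurable E. Proof. exact: measurable_itv. Qed.
Let mDE : measurable (D `*` E). Proof. exact: measurableX. Qed.

Lemma ae_nat (P : nat -> R -> Prop) : (forall k, {ae mu, forall r, P k r}) ->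
  {ae mu, forall r, forall k, P k r}.
Proof. exact: ae_foralln. Qed.

Lemma sine_L2_eq0 u : measurable_fun (D `*` E) u ->
  {ae mu, forall r, D r -> integ mu E (fun z => u (r, z))} ->
  (forall k, {ae mu, forall r, D r -> coef a (sine a k.+1) u r = 0}) ->
  {ae leb2, forall x, (D `*` E) x -> u x = 0}.
Proof.
move=> mu' iu /ae_nat H.
have m2 : measurable_fun (D `*` E) (fun x => `|u x|) by exact: measurableT_comp.
have key : (\int[leb2]_(x in D `*` E) `|u x|%:E = 0)%E.
  rewrite (tonelli_setX_r (f := fun x => `|u x|%:E) mD mE)//; last exact/measurable_EFinP.
  rewrite -[RHS](integral0 mu D); apply: ae_eq_integral => //.
  - have K := (measurable_restrictT _ mDE).1 mu'.
    have := @measurable_fun_fubini_tonelli_F _ _ _ _ R mu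
      (fun x => `|(u \_ (D `*` E)) x|%:E) _ (fun x => normr_ge0 _).
    move=> H'; apply: eq_measurable_fun (measurable_funTS (H' _)) => [r /set_mem Dr|].
      rewrite /fubini_F [RHS]integral_mkcond; apply: eq_integral => z _.
      rewrite patch_setX_slice !patchE mem_set//.
      by case: ifP => _ //; rewrite normr0.
    by apply/measurable_EFinP; exact: measurableT_comp.
  - apply: ae_impl2 iu H => r iur Hr Dr.
    have uz := sine_complete a0 (iur Dr) _.
    rewrite -[RHS](integral0 mu E); apply: ae_eq_integral => //.
    + apply/measurable_EFinP; apply: measurableT_comp => //.
      by apply: (@measurable_slice_r _ D E).
    + apply: ae_impl (uz _) => [z Hz Ez|k k0]; first by rewrite Hz// normr0.
      by case: k k0 => // k _; exact: Hr.
have := ge0_int0_ae mDE m2 (fun x _ => normr_ge0 _) key.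
by apply: ae_impl => x Hx Dx; apply/eqP; rewrite -normr_eq0; apply/eqP; exact: Hx.
Qed.

End SineCompleteness.

Lemma test_fun_derive {R : realType} {V : normedModType R} (A : set V) (f : V -> R) (v : V) :
  test_fun A f -> test_fun A (fun x => 'D_v f x).
Proof.
move=> [sf [C [cC CA fC]]]; split; first exact: smooth_derive.
exists C; split => // x Cx.
have cl : closed C by apply: compact_closed => //; exact: norm_hausdorff.
have : \forall y \near x, f y = (cst 0 : V -> R) y.
  have : nbhs x (~` C) by apply: open_nbhs_nbhs; split => //; exact: closed_openC.
  by apply: filterS => y /fC.
have [->|v0] := eqVneq v 0.
  move=> _; have := linear0 ('d f x); rewrite -deriveE//.
  exact: sf [::] x.
by move=> /near_eq_derive => -> //; first by rewrite derive_cst.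
Qed.

(* Integrals of nonnegative functions are suprema over simple functions below,
   hence monotone without any measurability assumption. *)
Lemma ge0_le_integral_patch d (T : measurableType d) (R : realType)
    (mu : {measure set T -> \bar R}) (A B : set T) (f g : T -> \bar R) :
  (forall x, A x -> 0 <= f x)%E -> (forall x, B x -> 0 <= g x)%E ->
  (forall x, A x -> B x /\ (f x <= g x)%E) ->
  (\int[mu]_(x in A) f x <= \int[mu]_(x in B) g x)%E.
Proof.
move=> f0 g0 fg; rewrite !ge0_integralE//; apply: le_ereal_sup => _ [h/= hf <-].
exists h => //= x; apply: le_trans (hf x) _; rewrite !patchE.
case: ifPn => [/set_mem Ax|_]; first by have [Bx ?] := fg x Ax; rewrite mem_set.
by case: ifPn => [/set_mem/g0|].
Qed.

Section RectTestFunctions.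
Context {R : realType}.
Variables (rad a : R).
Hypothesis a0 : 0 < a.
Local Notation mu := (@lebesgue_measure R).
Local Notation leb2 := (mu \x mu)%E.
Local Notation integ m D f := (m.-integrable D (EFin \o f)).
Local Notation D := (`]0, rad[%classic : set (measurableTypeR R)).
Local Notation E := (`](- a), a[%classic : set (measurableTypeR R)).
Implicit Types u v : R * R -> R.

Let mD : measurable D. Proof. exact: measurable_itv. Qed.
Let mE : measurable E. Proof. exact: measurable_itv. Qed.
Let mDE : measurable (D `*` E). Proof. exact: measurableX. Qed.

Lemma open_rect : open (rect rad a).
Proof.
rewrite (_ : rect rad a = (fst @^-1` `]0, rad[%classic) `&` (snd @^-1` `](- a), a[%classic))//.
apply: openI; apply: open_comp => //; try exact: interval_open.
  by move=> x _; exact: cvg_fst.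
by move=> x _; exact: cvg_snd.
Qed.

Lemma compact_continuous_bounded (C : set (R * R)) (g : R * R -> R) : compact C ->
  (forall x, C x -> {for x, continuous g}) -> exists M, forall x, C x -> `|g x| <= M.
Proof.
move=> cC cg.
have cgC : {within C, continuous g} by apply: continuous_in_subspaceT => x /set_mem; exact: cg.
have /compact_bounded[M [_ HM]] := continuous_compact cgC cC.
exists (M + 1) => x Cx; apply: (HM (M + 1)); first by rewrite ltrDl.
by exists x.
Qed.

Lemma compact_rect_bound (C : set (R * R)) : compact C -> C `<=` rect rad a ->
  exists2 M, 0 <= M & forall x, C x -> 1 <= M * x.1.
Proof.
move=> cC CR.
have [x Cx|M HM] := @compact_continuous_bounded C (fun x => (x.1)^-1) cC.
  by apply: cvgV; [rewrite gt_eqF// (rect_r0 (CR _ Cx))|exact: cvg_fst].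
exists `|M| => // x Cx; have x0 := rect_r0 (CR _ Cx).
rewrite -ler_pdivrMr// div1r; apply: le_trans (ler_norm M); apply: le_trans (HM x Cx).
exact: ler_norm.
Qed.

Lemma test_fun_bound (phi : R * R -> R) : test_fun (rect rad a) phi ->
  exists2 C, 0 <= C & forall x, rect rad a x -> `|phi x| <= C * x.1.
Proof.
move=> [sp [C [cC CR C0]]]; have [M M0 HM] := compact_rect_bound cC CR.
have [x _|N HN] := @compact_continuous_bounded C phi cC; first exact: smooth_continuous.
exists (`|N| * M) => [|x Dx]; first by rewrite mulr_ge0.
have x0 := ltW (rect_r0 Dx).
have [Cx|/C0 ->] := pselect (C x); last by rewrite normr0 !mulr_ge0.
rewrite -mulrA -[leLHS]mulr1; apply: ler_pM => //; last exact: HM.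
by apply: le_trans (HN x Cx) (ler_norm N).
Qed.

Lemma L2_locally_integrable u : in_L2 rad a u -> locally_integrable2 (rect rad a) u.
Proof.
move=> Lu; split; [by case: Lu|exact: open_rect|] => C CR cC.
have [M M0 HM] := compact_rect_bound cC CR.
pose c := (M + 1)^-1; have M1 : 0 < M + 1 by rewrite ltr_wpDl.
have c0 : 0 < c by rewrite invr_gt0.
have i1 : integ leb2 (`]c, rad[ `*` E) (fun x => u x * 1).
  apply: (@L2_mul_integ _ _ _ c (M + 1)) => //; first exact: ltW.
  move=> x [/=]; rewrite in_itv/= => /andP[cx _] _.
  by rewrite normr1 mulrC -ler_pdivrMr// div1r ltW.
have [_] := integrableP _ _ _ i1; apply: le_lt_trans.
apply: ge0_le_integral_patch => // x Cx; rewrite /= mulr1; split => //.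
have [Dx Ex] := CR x Cx; split => //=; move: Dx; rewrite /= !in_itv/= => /andP[x0 ->].
rewrite andbT /c -div1r ltr_pdivrMr// mulrC; apply: le_lt_trans (HM x Cx) _.
by rewrite ltr_pM2r// ltrDl.
Qed.

Lemma L2_test_integ u (phi : R * R -> R) : in_L2 rad a u -> test_fun (rect rad a) phi ->
  integ leb2 (D `*` E) (fun x => u x * phi x).
Proof.
move=> Lu tp; have [C C0 HC] := test_fun_bound tp.
apply: (@L2_mul_integ _ _ _ 0 C) => //.
by apply: measurable_funTS; apply: smooth_measurable; case: tp.
Qed.

Lemma L2_test_sqr_le (phi : R * R -> R) : test_fun (rect rad a) phi ->
  exists2 K, 0 <= K & forall u, in_L2 rad a u ->
    (\int[leb2]_(x in D `*` E) (u x * phi x)) ^+ 2 <= nrm2 rad a u * K.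
Proof.
move=> tp; have [C C0 HC] := test_fun_bound tp.
have mp : measurable_fun (D `*` E) phi.
  by apply: measurable_funTS; apply: smooth_measurable; case: tp.
have m1 : measurable_fun (D `*` E) (fst : R * R -> R).
  by apply: measurable_funTS; exact: measurable_fst.
have x0 x : (D `*` E) x -> 0 < x.1 by move=> /rect_r0.
have ip : integ leb2 (D `*` E) (fun x => phi x ^+ 2 / x.1).
  exact: (sqr_weight_integ (c := 0) (lexx 0) mp HC).
exists (\int[leb2]_(x in D `*` E) (phi x ^+ 2 / x.1)) => [|u Lu].
  by apply: Rintegral_ge0 => x /x0/ltW ?; rewrite divr_ge0// sqr_ge0.
have [mu' _] := Lu.
exact: (@weighted_CS _ _ _ leb2 (D `*` E) u phi (fun x => x.1) mDE x0 mu' mp (in_L2_integ Lu) ip).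
Qed.

Lemma L2_test_limit (S T : nat -> R * R -> R) u v (phi chi : R * R -> R) (k : R) :
  test_fun (rect rad a) phi -> test_fun (rect rad a) chi ->
  in_L2 rad a u -> in_L2 rad a v ->
  (forall eps : R, 0 < eps -> exists N, forall n, (N <= n)%N ->
    in_L2 rad a (fun x => S n x - u x) /\ nrm2 rad a (fun x => S n x - u x) <= eps) ->
  (forall eps : R, 0 < eps -> exists N, forall n, (N <= n)%N ->
    in_L2 rad a (fun x => T n x - v x) /\ nrm2 rad a (fun x => T n x - v x) <= eps) ->
  (forall n, \int[leb2]_(x in D `*` E) (S n x * phi x) = k * \int[leb2]_(x in D `*` E) (T n x * chi x)) ->
  \int[leb2]_(x in D `*` E) (u x * phi x) = k * \int[leb2]_(x in D `*` E) (v x * chi x).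
Proof.
move=> tp tc Lu Lv HS HT ST.
have [K1 K10 HK1] := L2_test_sqr_le tp; have [K2 K20 HK2] := L2_test_sqr_le tc.
set I := \int[leb2]_(x in D `*` E) (u x * phi x).
set J := \int[leb2]_(x in D `*` E) (v x * chi x).
apply/eqP; rewrite -subr_eq0 -sqrf_eq0; apply/eqP.
apply: (@ge0_small_eq0 _ _ (2 * K1 + 2 * (k ^+ 2 * K2))) => [|eps e0]; first exact: sqr_ge0.
have [N1 H1] := HS _ e0; have [N2 H2] := HT _ e0; pose n := maxn N1 N2.
have [L1 n1] := H1 n (leq_maxl _ _); have [L2 n2] := H2 n (leq_maxr _ _).
have iS := L2_test_integ L1 tp; have iu := L2_test_integ Lu tp.
have iT := L2_test_integ L2 tc; have iv := L2_test_integ Lv tc.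
have EI : \int[leb2]_(x in D `*` E) (S n x * phi x) =
    I + \int[leb2]_(x in D `*` E) ((S n x - u x) * phi x).
  by rewrite -(RintegralD mDE iu iS); apply: eq_Rintegral => x _; ring.
have EJ : \int[leb2]_(x in D `*` E) (T n x * chi x) =
    J + \int[leb2]_(x in D `*` E) ((T n x - v x) * chi x).
  by rewrite -(RintegralD mDE iv iT); apply: eq_Rintegral => x _; ring.
have EE := ST n; rewrite EI EJ in EE.
have hA := HK1 _ L1; have hB := HK2 _ L2.
set A := \int[leb2]_(x in D `*` E) ((S n x - u x) * phi x) in EE hA.
set B := \int[leb2]_(x in D `*` E) ((T n x - v x) * chi x) in EE hB.
have -> : I - k * J = k * B + - A.
  by apply/eqP; rewrite -subr_eq0; apply/eqP; transitivity (I + A - k * (J + B)); [ring|rewrite EE subrr].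
apply: le_trans (sqrD_le _ _) _; rewrite sqrrN exprMn.
have hA' := le_trans hA (ler_wpM2r K10 n1).
have hB' := ler_wpM2l (sqr_ge0 k) (le_trans hB (ler_wpM2r K20 n2)).
clear -hA' hB'; lra.
Qed.

Lemma in_L2_tensor (h f : R -> R) : measurable_fun D h ->
  integ mu D (fun r => h r ^+ 2 * r) -> smooth f -> in_L2 rad a (fun x => h x.1 * f x.2).
Proof.
move=> mh ih sf; have [C HC] := smooth_bounded (- a) a sf.
have mf : measurable_fun E f.
  by apply: measurable_funTS; apply: continuous_measurable_fun; exact: smooth_continuous.
have m1 : measurable_fun (D `*` E) (fun x => f x.2 ^+ 2).
  by apply: measurable_funX; exact: measurable_comp_snd.
have m2 : measurable_fun (D `*` E) (fun x => h x.1 ^+ 2 * x.1).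
  apply: (@measurable_comp_fst _ rad a (fun r => h r ^+ 2 * r)).
  exact: integ_measurable ih.
have i1 : integ leb2 (D `*` E) (fun x => h x.1 ^+ 2 * x.1).
  apply: (integ_setX_lty mD mE) => //=.
  under eq_integral do rewrite integral_cst//.
  have fin : (mu E < +oo)%E by rewrite lebesgue_measure_itv/=; case: ifPn => _; rewrite -?EFinB ltry.
  rewrite ge0_integralZr//.
  - apply: lte_mul_pinfty => //; first exact: integral_ge0.
      rewrite ge0_fin_numE; last exact: integral_ge0.
      by have [_] := integrableP _ _ _ ih.
  - by apply/measurable_EFinP; apply: measurableT_comp => //; exact: integ_measurable ih.
apply: integ_in_L2.
  by apply: measurable_funM; [exact: measurable_comp_fst|exact: measurable_comp_snd].
have : integ leb2 (D `*` E) (fun x => h x.1 ^+ 2 * x.1 * f x.2 ^+ 2).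
  apply: (@integM_bounded _ _ _ _ _ _ _ (C ^+ 2)) => // x [_ /=].
  rewrite in_itv/= => /andP[/ltW z0 /ltW z1]; rewrite normrX lerXn2r// ?nnegrE//.
    by apply: le_trans (HC x.2 _); rewrite ?z0.
  by apply: HC; rewrite z0.
by apply: eq_integ => // x _; ring.
Qed.

(* Both sides are integrated in z first, where [f] is smooth and the test
   function vanishes at both ends. *)
Lemma tensor_ibp (h f : R -> R) (phi : R * R -> R) : measurable_fun D h ->
  integ mu D (fun r => h r ^+ 2 * r) -> smooth f -> test_fun (rect rad a) phi ->
  \int[leb2]_(x in D `*` E) (h x.1 * f x.2 * 'D_ez phi x) =
  - \int[leb2]_(x in D `*` E) (h x.1 * derive1 f x.2 * phi x).
Proof.
move=> mh ih sf tp.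
have tz := test_fun_derive ez tp; have [sp [C [cC CR phi0]]] := tp.
have sfb g : smooth g -> in_L2 rad a (fun x => h x.1 * g x.2).
  by move=> sg; exact: in_L2_tensor.
have i1 := L2_test_integ (sfb _ sf) tz.
have i2 := L2_test_integ (sfb _ (smooth_derive1 sf)) tp.
have [_ _ E1] := fubini_setX_r mD mE i1; have [_ _ E2] := fubini_setX_r mD mE i2.
have [_ j2 _] := fubini_setX_r mD mE i2.
rewrite E1 E2 -(RintN mD j2); apply: eq_Rintegral => r _.
have spr := smooth_slice_z r sp.
have aa : - a <= a by rewrite ge0_cp// ltW.
have p0 z : ~ E z -> phi (r, z) = 0 by move=> nE; apply: phi0 => /CR[].
have := smooth_FTC (smoothM sf spr) aa.
rewrite smooth_derive1M// derive1_slice_z p0 ?p0 ?mulr0 ?subrr; last 2 first.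
- by rewrite /= in_itv/= ltxx.
- by rewrite /= in_itv/= ltxx andbF.
have k1 : integ mu E (fun z => derive1 f z * phi (r, z)).
  by apply: smooth_integ; apply: smoothM => //; exact: smooth_derive1.
have k2 : integ mu E (fun z => f z * 'D_ez phi (r, z)).
  by apply: smooth_integ; apply: smoothM => //; rewrite -derive1_slice_z; exact: smooth_derive1.
rewrite (RintegralD mE k1 k2) => /eqP; rewrite addr_eq0 => /eqP EE.
transitivity (h r * \int[mu]_(z in E) (f z * 'D_ez phi (r, z))).
  by rewrite -(RintegralZl _ mE k2); apply: eq_Rintegral => z _; rewrite /= mulrA.
transitivity (- (h r * \int[mu]_(z in E) (derive1 f z * phi (r, z)))); last first.
  by rewrite -(RintegralZl _ mE k1); congr (- _); apply: eq_Rintegral => z _; rewrite /= mulrA.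
by rewrite EE mulrN opprK.
Qed.

End RectTestFunctions.

(** * Regularity in the axial direction *)

Section HeadIntegral.
Context {R : realType}.
Variables (rad a : R).
Hypothesis rad0 : 0 < rad.
Local Notation mu := (@lebesgue_measure R).
Local Notation leb2 := (mu \x mu)%E.
Local Notation integ m D f := (m.-integrable D (EFin \o f)).
Local Notation D := (`]0, rad[%classic : set (measurableTypeR R)).
Local Notation E := (`](- a), a[%classic : set (measurableTypeR R)).
Implicit Types u v w : R * R -> R.

Let mD : measurable D. Proof. exact: measurable_itv. Qed.
Let mE : measurable E. Proof. exact: measurable_itv. Qed.
Let mDE : measurable (D `*` E). Proof. exact: measurableX. Qed.

Definition head_int w (x : R * R) : R := \int[mu]_(t in `]0, x.1[) w (t, x.2).

Lemma measurable_head_int w : measurable_fun (D `*` E) w ->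
  measurable_fun (D `*` E) (head_int w).
Proof.
move=> /(measurable_restrictT _ mDE) mw.
apply: eq_measurable_fun (measurable_funTS (measurable_primitive mw)) => x /set_mem[Dx Ex].
apply: eq_Rintegral => t /set_mem; rewrite /= in_itv/= => /andP[t0 tx].
rewrite patchE mem_set//; split => //=; rewrite in_itv/= t0/=.
by apply: lt_trans tx _; move: Dx; rewrite /= in_itv/= => /andP[].
Qed.

Lemma head_coef w (e : R -> R) (r : R) : in_L2 rad a w ->
  measurable_fun E e -> (forall z, `|e z| <= 1) -> D r ->
  let W x := x.1 ^+ 3 * w x in
  integ mu E (fun z => head_int W (r, z) * e z) /\
  coef a e (head_int W) r = \int[mu]_(t in `]0, r[) (t ^+ 3 * coef a e w t).
Proof.
move=> Lw me e1 Dr W; have [mw _] := Lw.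
have [r0 rR] : 0 < r /\ r < rad by move: Dr; rewrite /= in_itv/= => /andP[].
set A := (`]0, r[%classic : set (measurableTypeR R)).
have mA : measurable A by exact: measurable_itv.
have sub : A `<=` D by apply: subset_itvl; rewrite bnd_simp ltW.
have i1 : integ leb2 (D `*` E) (fun x => w x * (x.1 ^+ 3 * e x.2)).
  apply: (@L2_mul_integ _ _ _ 0 (rad ^+ 2)) => //.
    apply: measurable_funM; last exact: measurable_comp_snd.
    by apply: measurable_funX; apply: measurable_funTS; exact: measurable_fst.
  move=> x [/=]; rewrite in_itv/= => /andP[/ltW x0 /ltW xR] _.
  rewrite normrM normrX (ger0_norm x0) exprSr -mulrA; apply: ler_pM.
  - exact: exprn_ge0.
  - by rewrite mulr_ge0.
  - by rewrite lerXn2r// nnegrE ltW.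
  - by rewrite ler_piMr.
have i2 : integ leb2 (A `*` E) (fun x => w x * (x.1 ^+ 3 * e x.2)).
  apply: integrableS i1 => //; first exact: measurableX.
  by move=> x [/sub Ax Ex].
have [_ j2 E2] := fubini_setX_z mA mE i2; have [_ _ E1] := fubini_setX_r mA mE i2.
have Hz z : E z -> \int[mu]_(t in A) (w (t, z) * (t ^+ 3 * e z)) = head_int W (r, z) * e z.
  move=> Ez; rewrite /head_int mulrC.
  have mz : measurable_fun A (fun t => W (t, z)).
    rewrite /W /=; apply: measurable_funM; first exact: measurable_funX.
    have mz : measurable_fun D (fun t => w (t, z)) by exact: (@measurable_slice_z _ D E).
    exact: measurable_funS mz.
  rewrite -(@RintZl _ _ _ mu A _ _ mA mz).
  by apply: eq_Rintegral => t _; rewrite /W/=; ring.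
have j2' : integ mu E (fun z => head_int W (r, z) * e z).
  by apply: eq_integ mE j2 => z /set_mem Ez; rewrite -Hz.
split => //; rewrite /coef.
transitivity (\int[mu]_(z in E) \int[mu]_(t in A) (w (t, z) * (t ^+ 3 * e z))).
  by apply: eq_Rintegral => z /set_mem Ez; rewrite Hz.
rewrite -E2 E1; apply: eq_Rintegral => t /set_mem At.
have mz : measurable_fun E (fun z => w (t, z) * e z).
  apply: measurable_funM => //; apply: (@measurable_slice_r _ D E) => //; exact: sub.
rewrite -(@RintZl _ _ _ mu E _ _ mE mz).
by apply: eq_Rintegral => z _ /=; ring.
Qed.

End HeadIntegral.

Section Regularity.
Context {R : realType}.
Variables (rad a : R).
Hypotheses (a0 : 0 < a) (rad0 : 0 < rad).
Local Notation mu := (@lebesgue_measure R).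
Local Notation leb2 := (mu \x mu)%E.
Local Notation integ m D f := (m.-integrable D (EFin \o f)).
Local Notation D := (`]0, rad[%classic : set (measurableTypeR R)).
Local Notation E := (`](- a), a[%classic : set (measurableTypeR R)).
Implicit Types u v : R * R -> R.

Let mD : measurable D. Proof. exact: measurable_itv. Qed.
Let mE : measurable E. Proof. exact: measurable_itv. Qed.
Let mDE : measurable (D `*` E). Proof. exact: measurableX. Qed.

Variables om omr omz psi psir psiz : R * R -> R.
Hypotheses (H1om : in_H1 rad a om omr omz)
  (trom : zero_trace rad a (L2sq_S2 rad a) om omr omz)
  (ws : weak_solution rad a om psi psir psiz).

Let Lom : in_L2 rad a om. Proof. by case: H1om. Qed.
Let Lomz : in_L2 rad a omz. Proof. by case: H1om. Qed.
Let Lpsi : in_L2 rad a psi. Proof. by case: ws => -[]. Qed.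
Let Lpsir : in_L2 rad a psir. Proof. by case: ws => -[]. Qed.
Let Lpsiz : in_L2 rad a psiz. Proof. by case: ws => -[]. Qed.

Let s k := sine a k.+1.
Let c k := cosine a k.+1.
Let lam k := freq a k.+1.
Let ms k : measurable_fun E (s k). Proof. exact: measurable_sine. Qed.
Let mc k : measurable_fun E (c k). Proof. exact: measurable_cosine. Qed.
Let s1 k z : `|s k z| <= 1. Proof. exact: sine_le1. Qed.
Let c1 k z : `|c k z| <= 1. Proof. exact: cosine_le1. Qed.
Let orths j k : \int[mu]_(z in E) (s j z * s k z) = a * (j == k)%:R.
Proof. by rewrite sine_orth. Qed.
Let orthc j k : \int[mu]_(z in E) (c j z * c k z) = a * (j == k)%:R.
Proof. by rewrite cosine_orth. Qed.

Let psi_tail : {ae leb2, forall x, (D `*` E) x -> psi x = - tail_int rad psir x}.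
Proof. by case: ws => H tr _; exact: lateral_trace_tail H tr. Qed.

Let p k := coef a (s k) psir.
Let ph k r := - \int[mu]_(t in `]r, rad[) p k t.

Let m_coef u (e : R -> R) : measurable_fun E e -> in_L2 rad a u -> measurable_fun D (coef a e u).
Proof. by move=> me [mu' _]; exact: measurable_coef. Qed.

Let mp k : measurable_fun D (p k). Proof. exact: m_coef. Qed.
Let ip k : integ mu D (fun r => p k r ^+ 2 * r).
Proof. by have [] := coef_L2 a0 (ms k) (@s1 k) Lpsir. Qed.

Let mph k : measurable_fun D (ph k).
Proof. exact: measurable_funN (measurable_tail1 (mp k)). Qed.

Let psi_ph k : {ae mu, forall r, D r -> coef a (s k) psi r = ph k r}.
Proof.
have H := coef_tail Lpsi Lpsir (ms k) (@s1 k) psi_tail.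
exact: H.
Qed.

Let iph k : integ mu D (fun r => ph k r ^+ 2 * r).
Proof.
have [i1 _] := coef_L2 a0 (ms k) (@s1 k) Lpsi.
apply: ae_eq_integ mD _ _ i1.
  by apply: measurable_funM => //; exact: (measurable_funX _ (mph k)).
by apply: ae_impl (psi_ph k) => r H Dr; rewrite H.
Qed.

Let base_psi k : {ae mu, forall r, D r -> coef a (c k) psiz r = lam k * coef a (s k) psi r}.
Proof.
case: ws => H [w [sw cw bw]] _; apply: (base_trace_coef a0 _ H).
exists w; split => //; apply: ge0_ecvg0 => [n|e e0]; first exact: L2sq_S2_ge0.
have [N HN] := ecvg0_le bw e0; exists N => n /HN; apply: le_trans.
by rewrite /L2sq_S leeDr// L2sq_S1_ge0.
Qed.

Let ode k : {ae mu, forall r, D r -> r ^+ 3 * p k r =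
  \int[mu]_(t in `]0, r[) (t ^+ 3 * (lam k ^+ 2 * coef a (s k) psi t - coef a (s k) om t))}.
Proof.
have [[_ _ _ wr wz] _ de] := ws.
exact: (mode_ode a0 rad0 Lom Lpsi Lpsir Lpsiz wr wz de (ltn0Sn k) (base_psi k)).
Qed.

Let W k := \int[mu]_(r in D) (coef a (s k) om r ^+ 2 * r).

Let energy k : 2 * lam k ^+ 2 * \int[mu]_(r in D) (p k r ^+ 2 * r) +
  lam k ^+ 4 * \int[mu]_(r in D) (ph k r ^+ 2 * r) <= W k.
Proof.
have [i1 _] := coef_L2 a0 (ms k) (@s1 k) Lpsi.
have [i2 _] := coef_L2 a0 (ms k) (@s1 k) Lom.
have H := radial_energy rad0 (mp k) (m_coef (ms k) Lpsi) (m_coef (ms k) Lom) (ip k) i1 i2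
  (psi_ph k) (ode k).
have <- : \int[mu]_(r in D) (coef a (s k) psi r ^+ 2 * r) = \int[mu]_(r in D) (ph k r ^+ 2 * r).
  apply: ae_eq_Rint mD (integ_measurable i1) (integ_measurable (iph k)) _.
  by apply: ae_impl (psi_ph k) => r H' Dr; rewrite H'.
exact: H.
Qed.

Let Wz k : lam k ^+ 2 * W k = \int[mu]_(r in D) (coef a (c k) omz r ^+ 2 * r).
Proof.
have [i2 _] := coef_L2 a0 (ms k) (@s1 k) Lom.
have [i3 _] := coef_L2 a0 (mc k) (@c1 k) Lomz.
rewrite -(RintegralZl _ mD i2).
apply: ae_eq_Rint mD (integ_measurable (integZ _ mD i2)) (integ_measurable i3) _.
have HH := base_trace_coef a0 k.+1 H1om trom.
apply: ae_impl HH => r H Dr.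
have HE := H Dr; rewrite -/(c k) -/(s k) -/(lam k) in HE.
by rewrite HE; ring.
Qed.

Let sumW n : \sum_(0 <= k < n) W k <= a * nrm2 rad a om.
Proof. exact: (bessel a0 ms s1 orths n Lom). Qed.

Let sumWz n : \sum_(0 <= k < n) (lam k ^+ 2 * W k) <= a * nrm2 rad a omz.
Proof.
apply: le_trans (bessel a0 mc c1 orthc n Lomz).
by apply: ler_sum => k _; rewrite Wz.
Qed.

Let P0 k : 0 <= \int[mu]_(r in D) (p k r ^+ 2 * r).
Proof. by apply: Rintegral_ge0 => r; rewrite /= in_itv/= => /andP[/ltW ? _]; rewrite mulr_ge0 ?sqr_ge0. Qed.

Let Ph0 k : 0 <= \int[mu]_(r in D) (ph k r ^+ 2 * r).
Proof. by apply: Rintegral_ge0 => r; rewrite /= in_itv/= => /andP[/ltW ? _]; rewrite mulr_ge0 ?sqr_ge0. Qed.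

Let scaled (f : R -> R) (k : R) : integ mu D (fun r => f r ^+ 2 * r) -> measurable_fun D f ->
  [/\ measurable_fun D (fun r => k * f r), integ mu D (fun r => (k * f r) ^+ 2 * r) &
    \int[mu]_(r in D) ((k * f r) ^+ 2 * r) = k ^+ 2 * \int[mu]_(r in D) (f r ^+ 2 * r)].
Proof.
move=> i1 m1; have E1 r : (k * f r) ^+ 2 * r = k ^+ 2 * (f r ^+ 2 * r) by rewrite exprMn mulrA.
split; first exact: measurable_funM.
- by apply: eq_integ mD (integZ (k ^+ 2) mD i1) => r _; rewrite E1.
- by rewrite -(RintegralZl _ mD i1); apply: eq_Rintegral => r _; rewrite E1.
Qed.

Let f1 k r := - lam k ^+ 2 * ph k r.
Let f2 k r := - lam k ^+ 3 * ph k r.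
Let f3 k r := - lam k ^+ 2 * p k r.

Definition L2_lim (S : nat -> R * R -> R) F :=
  forall eps : R, 0 < eps -> exists N, forall n, (N <= n)%N ->
    in_L2 rad a (fun x => S n x - F x) /\ nrm2 rad a (fun x => S n x - F x) <= eps.

Let a2 (N : R) : 2 * a^-1 * (a * N) = 2 * N.
Proof. by field; rewrite gt_eqF. Qed.

Let synth1 : exists F, [/\ in_L2 rad a F, L2_lim (partial_sum a s f1) F,
  nrm2 rad a F <= 2 * nrm2 rad a om & forall k, {ae mu, forall r, D r -> coef a (s k) F r = f1 k r}].
Proof.
have H k := scaled (- lam k ^+ 2) (iph k) (mph k).
rewrite -(a2 (nrm2 rad a om)); apply: (orth_synthesis a0 ms s1 orths) => [k|k|n].
- by have [] := H k.
- by have [] := H k.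
- apply: le_trans (sumW n); apply: ler_sum => k _; have [_ _ ->] := H k.
  apply: le_trans (energy k); rewrite sqrrN -exprM lerDr.
  by apply: mulr_ge0; [apply: mulr_ge0 => //; exact: sqr_ge0|exact: P0].
Qed.

Let synth2 : exists F, [/\ in_L2 rad a F, L2_lim (partial_sum a c f2) F &
  nrm2 rad a F <= 2 * nrm2 rad a omz].
Proof.
have H k := scaled (- lam k ^+ 3) (iph k) (mph k).
rewrite -(a2 (nrm2 rad a omz)).
have [|||F [h1 h2 h3 _]] := @orth_synthesis _ rad a a0 c mc c1 orthc f2 (a * nrm2 rad a omz); last by exists F.
- by move=> k; have [] := H k.
- by move=> k; have [] := H k.
- move=> n; apply: le_trans (sumWz n); apply: ler_sum => k _; have [_ _ ->] := H k.
  rewrite sqrrN -exprM (_ : lam k ^+ (3 * 2) = lam k ^+ 2 * lam k ^+ 4); last by ring.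
  rewrite -mulrA ler_wpM2l ?sqr_ge0//; apply: le_trans (energy k).
  by rewrite lerDr mulr_ge0// mulr_ge0// sqr_ge0.
Qed.

Let synth3 : exists F, [/\ in_L2 rad a F, L2_lim (partial_sum a s f3) F &
  nrm2 rad a F <= 2 * nrm2 rad a omz].
Proof.
have H k := scaled (- lam k ^+ 2) (ip k) (mp k).
rewrite -(a2 (nrm2 rad a omz)).
have [|||F [h1 h2 h3 _]] := @orth_synthesis _ rad a a0 s ms s1 orths f3 (a * nrm2 rad a omz); last by exists F.
- by move=> k; have [] := H k.
- by move=> k; have [] := H k.
- move=> n; apply: le_trans (sumWz n); apply: ler_sum => k _; have [_ _ ->] := H k.
  rewrite sqrrN (_ : (lam k ^+ 2) ^+ 2 = lam k ^+ 2 * lam k ^+ 2); last by ring.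
  rewrite -mulrA ler_wpM2l ?sqr_ge0//; apply: le_trans (energy k).
  apply: (@le_trans _ _ (2 * lam k ^+ 2 * \int[mu]_(r in D) (p k r ^+ 2 * r))).
    by rewrite -mulrA mulr_natl mulr2n lerDl mulr_ge0// sqr_ge0.
  rewrite lerDl; apply: mulr_ge0 (Ph0 k).
  by rewrite (_ : _ ^+ 4 = (lam k ^+ 2) ^+ 2) ?sqr_ge0// -exprM.
Qed.

Let S0_lim : L2_lim (partial_sum a s ph) psi.
Proof.
have [|||F [LF limF _ coefF]] := @orth_synthesis _ rad a a0 s ms s1 orths ph (a * nrm2 rad a psi).
- exact: mph.
- exact: iph.
- move=> n; apply: le_trans (bessel a0 ms s1 orths n Lpsi); apply: ler_sum => k _.
  have [i1 _] := coef_L2 a0 (ms k) (@s1 k) Lpsi.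
  rewrite (ae_eq_Rint mD (integ_measurable i1) (integ_measurable (iph k)))//.
  by apply: ae_impl (psi_ph k) => r H' Dr; rewrite H'.
have [Ld _] := nrm2_lin 1 (-1) LF Lpsi.
have Fpsi : {ae leb2, forall x, (D `*` E) x -> 1 * F x + -1 * psi x = 0}.
  apply: (sine_L2_eq0 a0 (u := fun x => 1 * F x + -1 * psi x)); first by case: Ld.
    by apply: ae_impl (in_L2_slice_r Ld) => r H Dr; have [] := H Dr.
  move=> k; apply: ae_impl3 (coef_lin 1 (-1) (ms k) (@s1 k) LF Lpsi) (coefF k) (psi_ph k) => r H1 H2 H3 Dr.
  by rewrite H1// -/(s k) H2// H3// mul1r mulN1r subrr.
move=> eps e0; have [N HN] := limF eps e0; exists N => n Nn; have [L1 n1] := HN n Nn.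
have mS : measurable_fun (D `*` E) (fun x => partial_sum a s ph n x - psi x).
  have -> : (fun x => partial_sum a s ph n x - psi x) =
      fun x => (partial_sum a s ph n x - F x) + (F x - psi x) by apply/funext => x; ring.
  by apply: measurable_funD; [case: L1|apply: measurable_funB; [case: LF|case: Lpsi]].
have m2 : measurable_fun (D `*` E) (fun x => (partial_sum a s ph n x - psi x) ^+ 2 * x.1).
  apply: measurable_funM; first exact: (measurable_funX _ mS).
  by apply: measurable_funTS; exact: measurable_fst.
have i1 := in_L2_integ L1.
have EE : {ae leb2, forall x, (D `*` E) x ->
    (partial_sum a s ph n x - F x) ^+ 2 * x.1 = (partial_sum a s ph n x - psi x) ^+ 2 * x.1}.
  apply: ae_impl Fpsi => x H Dx; have /eqP := H Dx.
  by rewrite mul1r mulN1r subr_eq0 => /eqP ->.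
split; first exact: integ_in_L2 mS (ae_eq_integ mDE m2 EE i1).
by rewrite /nrm2 -(ae_eq_Rint mDE (integ_measurable i1) m2 EE).
Qed.

Let partial_sum_ibp (e e' : nat -> R -> R) (m : nat -> R) (g : nat -> R -> R) n (phi : R * R -> R) :
  (forall k, smooth (e k)) -> (forall k, smooth (e' k)) ->
  (forall k, derive1 (e k) = fun z => m k * e' k z) ->
  (forall k, measurable_fun D (g k)) -> (forall k, integ mu D (fun r => g k r ^+ 2 * r)) ->
  test_fun (rect rad a) phi ->
  \int[leb2]_(x in D `*` E) (partial_sum a e g n x * 'D_ez phi x) =
  - \int[leb2]_(x in D `*` E) (partial_sum a e' (fun k r => m k * g k r) n x * phi x).
Proof.
move=> se se' de mg ig tp; have tz := test_fun_derive ez tp.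
have H k := scaled a^-1 (ig k) (mg k).
have mh k : measurable_fun D (fun r => a^-1 * g k r) by have [] := H k.
have ih k : integ mu D (fun r => (a^-1 * g k r) ^+ 2 * r) by have [] := H k.
have H' k := scaled (m k) (ih k) (mh k).
have mh' k : measurable_fun D (fun r => m k * (a^-1 * g k r)) by have [] := H' k.
have ih' k : integ mu D (fun r => (m k * (a^-1 * g k r)) ^+ 2 * r) by have [] := H' k.
have i1 k := L2_test_integ (in_L2_tensor a (mh k) (ih k) (se k)) tz.
have i2 k := L2_test_integ (in_L2_tensor a (mh' k) (ih' k) (se' k)) tp.
transitivity (\int[leb2]_(x in D `*` E) (\sum_(0 <= k < n) a^-1 * g k x.1 * e k x.2 * 'D_ez phi x)).
  by apply: eq_Rintegral => x _; rewrite /partial_sum mulr_suml.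
rewrite (Rint_bigsum 0 n mDE i1).
transitivity (- \int[leb2]_(x in D `*` E) (\sum_(0 <= k < n) m k * (a^-1 * g k x.1) * e' k x.2 * phi x)); last first.
  congr (- _); apply: eq_Rintegral => x _; rewrite /partial_sum mulr_suml.
  by apply: eq_bigr => k _; ring.
rewrite (Rint_bigsum 0 n mDE i2) -sumrN; apply: eq_bigr => k _.
rewrite (tensor_ibp a0 (mh k) (ih k) (se k) tp) de; congr (- _).
by apply: eq_Rintegral => x _; ring.
Qed.

Let ss k : smooth (s k). Proof. exact: smooth_sine. Qed.
Let sc k : smooth (c k). Proof. exact: smooth_cosine. Qed.
Let ds k : derive1 (s k) = fun z => lam k * c k z. Proof. exact: derive1_sine. Qed.
Let dc k : derive1 (c k) = fun z => - lam k * s k z. Proof. exact: derive1_cosine. Qed.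

Let weak_zz F : in_L2 rad a F -> L2_lim (partial_sum a s f1) F ->
  weak_deriv2 (rect rad a) [:: ez; ez] psi F.
Proof.
move=> LF limF; split; [exact: L2_locally_integrable|exact: L2_locally_integrable|move=> phi tp].
rewrite /= expr2 mulrNN mulr1; have tz := test_fun_derive ez tp.
apply: (L2_test_limit (test_fun_derive ez tz) tp Lpsi LF S0_lim limF) => n.
have H k := scaled (lam k) (iph k) (mph k).
rewrite (partial_sum_ibp _ ss sc ds mph iph tz).
rewrite (partial_sum_ibp _ sc ss dc _ _ tp) => [|k|k]; [|by have [] := H k|by have [] := H k].
rewrite opprK mul1r; apply: eq_Rintegral => x _; congr (_ * _); apply: eq_bigr => k _.
by rewrite /f1; ring.
Qed.

Let weak_zzz F : in_L2 rad a F -> L2_lim (partial_sum a c f2) F ->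
  weak_deriv2 (rect rad a) [:: ez; ez; ez] psi F.
Proof.
move=> LF limF; split; [exact: L2_locally_integrable|exact: L2_locally_integrable|move=> phi tp].
have tz := test_fun_derive ez tp; have tzz := test_fun_derive ez tz.
apply: (L2_test_limit (test_fun_derive ez tzz) tp Lpsi LF S0_lim limF) => n.
have H k := scaled (lam k) (iph k) (mph k).
have H1 k : measurable_fun D (fun r => lam k * ph k r) by have [] := H k.
have H2 k : integ mu D (fun r => (lam k * ph k r) ^+ 2 * r) by have [] := H k.
have H' k := scaled (- lam k) (H2 k) (H1 k).
rewrite (partial_sum_ibp _ ss sc ds mph iph tzz).
rewrite (partial_sum_ibp _ sc ss dc H1 H2 tz).
rewrite (partial_sum_ibp _ ss sc ds _ _ tp) => [|k|k]; [|by have [] := H' k|by have [] := H' k].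
rewrite opprK /= exprS sqrrN expr1n mulr1 mulN1r; congr (- _).
apply: eq_Rintegral => x _; congr (_ * _); apply: eq_bigr => k _.
by rewrite /f2; ring.
Qed.

Let p_integ k (r : R) : D r -> integ mu `]r, rad[ (p k).
Proof.
rewrite /= in_itv/= => /andP[r0 rR].
have i1 := L2_radial_moment rad0 0 (mp k) (ip k).
have i2 : integ mu `]r, rad[ (fun t => t ^+ 1 * p k t).
  by apply: integ_oo_sub i1 => //; exact: ltW.
have mr : measurable (`]r, rad[%classic : set (measurableTypeR R)) by exact: measurable_itv.
have m1 : measurable_fun `]r, rad[ (fun t : R => (t^-1) ^+ 1) := measurable_invX 1 (ltW r0).
have H3 : integ mu `]r, rad[ (fun t => t ^+ 1 * p k t * (t^-1) ^+ 1).
  apply: (integM_bounded (C := r^-1)) => // t; rewrite /= in_itv/= => /andP[rt tR].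
  have t0 := lt_trans r0 rt.
  by rewrite expr1 ger0_norm ?invr_ge0 ?(ltW t0)// lef_pV2 ?posrE// ltW.
apply: eq_integ mr H3 => t; rewrite inE /= in_itv/= => /andP[rt tR].
by rewrite !expr1 mulrAC mulfV ?mul1r// gt_eqF// (lt_trans r0).
Qed.

Let zz_tail F1 F3 : in_L2 rad a F1 -> L2_lim (partial_sum a s f1) F1 ->
  in_L2 rad a F3 -> L2_lim (partial_sum a s f3) F3 ->
  {ae leb2, forall x, (D `*` E) x -> F1 x = - tail_int rad F3 x}.
Proof.
move=> L1 lim1 L3 lim3; apply: (radial_closure0 rad0 L1 L3) => e e0.
have e2 : 0 < e / 2 by rewrite divr_gt0.
have [N1 H1] := lim1 _ e2; have [N3 H3] := lim3 _ e2; pose n := maxn N1 N3.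
have [J1 n1] := H1 n (leq_maxl _ _); have [J3 n3] := H3 n (leq_maxr _ _).
have sym u v : in_L2 rad a (fun x => u x - v x) ->
    in_L2 rad a (fun x => v x - u x) /\ nrm2 rad a (fun x => v x - u x) = nrm2 rad a (fun x => u x - v x).
  move=> L; split.
    have [L' _] := nrm2_lin (-1) 0 L L; rewrite (_ : (fun x => v x - u x) = fun x => -1 * (u x - v x) + 0 * (u x - v x))//.
    by apply/funext => x; ring.
  by apply: eq_Rintegral => x _; rewrite -sqrrN opprB.
have [K1 E1] := sym _ _ J1; have [K3 E3] := sym _ _ J3.
exists (fun x => F1 x - partial_sum a s f1 n x), (fun x => F3 x - partial_sum a s f3 n x), (fun=> 0).
split => //.
- by rewrite E1 E3 (splitr e) lerD.
- by have := integ_cst_oo (- a) a (0 ^+ 2).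
- by under eq_Rintegral do rewrite expr0n/=; rewrite /Rintegral integral0 ltW.
apply: ae_impl (in_L2_slice_z L3) => z H Ez r Dr.
have mz : measurable_fun D (fun t => F3 (t, z)) by apply: (@measurable_slice_z _ D E) => //; case: L3.
have [iF _] := tail_int_slice rad0 mz (H Ez) Dr.
have mr : measurable (`]r, rad[%classic : set (measurableTypeR R)) by exact: measurable_itv.
have it k : integ mu `]r, rad[ (fun t => a^-1 * - lam k ^+ 2 * s k z * p k t) := integZ _ mr (p_integ k Dr).
have EP : (fun t => partial_sum a s f3 n (t, z)) = fun t => \sum_(0 <= k < n) a^-1 * - lam k ^+ 2 * s k z * p k t.
  by apply/funext => t; apply: eq_bigr => k _; rewrite /f3/=; ring.
have iP : integ mu `]r, rad[ (fun t => partial_sum a s f3 n (t, z)).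
  by rewrite EP; exact: integ_bigsum.
have -> : tail_int rad (fun x => F3 x - partial_sum a s f3 n x) (r, z) =
    tail_int rad F3 (r, z) - \int[mu]_(t in `]r, rad[) partial_sum a s f3 n (t, z).
  exact: RintegralB.
have -> : \int[mu]_(t in `]r, rad[) partial_sum a s f3 n (t, z) = - partial_sum a s f1 n (r, z).
  rewrite EP (Rint_bigsum 0 n mr it) -sumrN; apply: eq_bigr => k _.
  by rewrite (RintegralZl _ mr (p_integ k Dr)) /f1 /ph/=; ring.
by ring.
Qed.

Let weak_zzr F1 F3 : in_L2 rad a F1 -> weak_deriv2 (rect rad a) [:: ez; ez] psi F1 ->
  in_L2 rad a F3 -> {ae leb2, forall x, (D `*` E) x -> F1 x = - tail_int rad F3 x} ->
  weak_deriv2 (rect rad a) [:: ez; ez; er] psi F3.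
Proof.
move=> L1 [_ _ W1] L3 tl; split; [exact: L2_locally_integrable|exact: L2_locally_integrable|move=> phi tp].
have tr := test_fun_derive er tp; have := W1 _ tr; rewrite /= => ->.
rewrite expr2 mulrNN mulr1 mul1r exprS sqrrN expr1n mulr1 mulN1r.
have [C C0 HC] := test_fun_bound tp.
have [sp [K [cK KR phi0]]] := tp.
have i1 := L2_test_integ L1 tr; have i3 := L2_test_integ L3 tp.
have [j1 k1 E1] := fubini_setX_z mD mE i1; have [j3 k3 E3] := fubini_setX_z mD mE i3.
rewrite [LHS]E1 [in RHS]E3 -(RintN mE k3).
apply: ae_eq_Rint mE (integ_measurable k1) (integ_measurable (integN mE k3)) _.
apply: ae_impl2 (ae_prod_z tl) (in_L2_slice_z L3) => z Htl H3 Ez.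
have m3 : measurable_fun D (fun t => F3 (t, z)) by apply: (@measurable_slice_z _ D E) => //; case: L3.
have m1 : measurable_fun D (fun t => F1 (t, z)) by apply: (@measurable_slice_z _ D E) => //; case: L1.
have i3z := L2_radial_moment rad0 0 m3 (H3 Ez).
have spz := smooth_slice_r z sp.
have sd : smooth (fun r => 'D_er phi (r, z)) by rewrite -derive1_slice_r; exact: smooth_derive1.
have md : measurable_fun D (fun r => 'D_er phi (r, z)).
  by apply: measurable_funTS; apply: continuous_measurable_fun; exact: smooth_continuous.
have [M HM] := smooth_bounded 0 rad sd.
have iB : integ mu D (fun t => `|M| * `|t ^+ 1 * F3 (t, z)|) := integZ _ mD (integ_norm mD i3z).
have HB (t : R) : 0 < t < rad -> (`|F3 (t, z)|%:E * \int[mu]_(r in `]0%R, t[) `|'D_er phi (r, z)|%:E <=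
    (`|M| * `|t ^+ 1 * F3 (t, z)|)%:E)%E.
  move=> /andP[t0 tR]; have t0' := ltW t0.
  apply: (@le_trans _ _ (`|F3 (t, z)|%:E * (`|M| * t)%:E)%E); last first.
    by rewrite -EFinM lee_fin expr1 normrM (ger0_norm t0') le_eqVlt; apply/orP; left; apply/eqP; ring.
  apply: lee_pmul => //; first exact: integral_ge0.
  rewrite (_ : `|M| * t = \int[mu]_(r in `]0, t[) `|M|); last by rewrite Rint_cst_oo// subr0.
  rewrite EFin_Rint//; last exact: integ_cst_oo.
  apply: ge0_le_integral => //.
  - apply/measurable_EFinP; apply: measurableT_comp => //; apply: measurable_funS md => //.
    by apply: subset_itvl; rewrite bnd_simp ltW.
  - move=> r; rewrite /= in_itv/= => /andP[r0 rt]; rewrite lee_fin; apply: le_trans (ler_norm M).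
    by apply: HM; rewrite (ltW r0) (ltW (lt_trans rt tR)).
have [q1 q2 E4] := triangle_fubini md m3 iB HB.
transitivity (- \int[mu]_(r in D) ('D_er phi (r, z) * \int[mu]_(t in `]r, rad[) F3 (t, z))).
  rewrite -(RintN mD q1).
  apply: ae_eq_Rint mD _ (integ_measurable (integN mD q1)) _; first exact: measurable_funM.
  apply: ae_impl (Htl Ez) => r Hr Dr; rewrite (Hr Dr) /tail_int/=; ring.
rewrite E4; congr (- _); apply: eq_Rintegral => t; rewrite inE /= in_itv/= => /andP[t0 tR].
have FT := smooth_FTC spz (ltW t0); rewrite derive1_slice_r in FT.
have p00 : phi (0, z) = 0 by apply: phi0 => /KR[]; rewrite /= in_itv/= ltxx.
by rewrite FT p00 subr0.
Qed.

Lemma regularity : exists F1 F2 F3 : R * R -> R,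
  [/\ [/\ in_L2 rad a F1, in_L2 rad a F2 & in_L2 rad a F3],
    [/\ weak_deriv2 (rect rad a) [:: ez; ez] psi F1,
      weak_deriv2 (rect rad a) [:: ez; ez; ez] psi F2 &
      weak_deriv2 (rect rad a) [:: ez; ez; er] psi F3],
    [/\ nrm2 rad a F1 <= 2 * nrm2 rad a om, nrm2 rad a F2 <= 2 * nrm2 rad a omz &
      nrm2 rad a F3 <= 2 * nrm2 rad a omz] &
    [/\ {ae leb2, forall x, (D `*` E) x -> psi x = - tail_int rad psir x},
      {ae leb2, forall x, (D `*` E) x -> F1 x = - tail_int rad F3 x} &
      {ae leb2, forall x, (D `*` E) x -> x.1 ^+ 3 * psir x =
        - head_int (fun x => x.1 ^+ 3 * (F1 x + om x)) x}]].
Proof.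
have [F1 [L1 lim1 n1 c_1]] := synth1; have [F2 [L2 lim2 n2]] := synth2.
have [F3 [L3 lim3 n3]] := synth3.
have tl := zz_tail L1 lim1 L3 lim3; have w1 := weak_zz L1 lim1.
exists F1, F2, F3; split => //.
  split => //; first exact: weak_zzz.
  exact: weak_zzr w1 L3 tl.
split=> //.
have [LG _] := nrm2_lin 1 1 L1 Lom.
rewrite (_ : (fun x => 1 * F1 x + 1 * om x) = fun x => F1 x + om x) in LG; last first.
  by apply/funext => x; rewrite !mul1r.
pose G x := x.1 ^+ 3 * (F1 x + om x).
pose u x := x.1 ^+ 3 * psir x + head_int G x.
have m3 : measurable_fun (D `*` E) (fun x : R * R => x.1 ^+ 3).
  by apply: measurable_funX; apply: measurable_funTS; exact: measurable_fst.
have mG : measurable_fun (D `*` E) G by apply: measurable_funM => //; case: LG.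
have mu' : measurable_fun (D `*` E) u.
  apply: measurable_funD; last exact: measurable_head_int.
  by apply: measurable_funM => //; case: Lpsir.
have one1 (z : R) : `|(fun=> 1 : R) z| <= 1 by rewrite normr1.
have mone : measurable_fun E (fun=> 1 : R) by exact: measurable_cst.
have u0 : {ae leb2, forall x, (D `*` E) x -> u x = 0}.
  apply: (sine_L2_eq0 a0) => // [|k].
    apply: ae_impl (in_L2_slice_r Lpsir) => r H Dr; have [_ i1] := H Dr.
    have [i2 _] := head_coef rad0 LG mone one1 Dr.
    apply: eq_integ mE (integD mE (integZ (r ^+ 3) mE i1) i2) => z _.
    by rewrite /u mulr1.
  have H1 := coef_lin 1 1 (ms k) (@s1 k) L1 Lom.
  have Hg : {ae mu, forall t, D t -> coef a (s k) (fun x => F1 x + om x) t =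
      - (lam k ^+ 2 * coef a (s k) psi t - coef a (s k) om t)}.
    apply: ae_impl3 H1 (c_1 k) (psi_ph k) => t h1 h2 h3 Dt.
    have := h1 Dt; rewrite (_ : (fun x => 1 * F1 x + 1 * om x) = fun x => F1 x + om x); last first.
      by apply/funext => x; rewrite !mul1r.
    by move=> ->; rewrite h2// h3// /f1; ring.
  apply: ae_impl2 (ode k) (coef_integ (ms k) (@s1 k) Lpsir) => r Ho Hi Dr.
  have [i2 E2] := head_coef rad0 LG (ms k) (@s1 k) Dr.
  have -> : coef a (sine a k.+1) u r = r ^+ 3 * p k r + coef a (s k) (head_int G) r.
    rewrite /p /coef -(RintegralZl _ mE (Hi Dr)) -(RintegralD mE (integZ _ mE (Hi Dr)) i2).
    by apply: eq_Rintegral => z _; rewrite /u/= mulrDl mulrA.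
  rewrite (Ho Dr) E2; apply/eqP; rewrite addr_eq0; apply/eqP.
  have sub : `]0, r[ `<=` D.
    by apply: subset_itvl; rewrite bnd_simp; move: Dr; rewrite /= in_itv/= => /andP[_ /ltW].
  have mr : measurable (`]0, r[%classic : set (measurableTypeR R)) by exact: measurable_itv.
  have mX : measurable_fun `]0, r[ (fun t => t ^+ 3 * coef a (s k) (fun x => F1 x + om x) t).
    apply: measurable_funM => //; apply: measurable_funS (m_coef (ms k) LG) => //.
  rewrite -mulN1r -(@RintZl _ _ _ mu `]0, r[ _ _ mr mX).
  apply: ae_eq_Rint mr _ _ _.
  - apply: measurable_funM => //; apply: (@measurable_funS _ _ _ _ D) => //.
    apply: measurable_funB; first apply: measurable_funM => //; exact: m_coef.
  - exact: measurable_funM.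
  - by apply: ae_impl Hg => t Ht /sub Dt; rewrite Ht//; ring.
by apply: ae_impl u0 => x Hx Dx; apply/eqP; rewrite -addr_eq0; apply/eqP; exact: Hx.
Qed.

End Regularity.

(** * The corrected stream function on a radial slice *)

Section WeakChain.
Context {R : realType}.
Local Notation mu := (@lebesgue_measure R).
Local Notation integ m D f := (m.-integrable D (EFin \o f)).

Lemma integ_locally (c d : R) (f : R -> R) :
  integ mu `]c, d[ f -> locally_integrable `]c, d[ f.
Proof.
move=> fi; split; [exact: integ_measurable fi|exact: interval_open|move=> L LI cL].
have mI : measurable (`]c, d[%classic : set (measurableTypeR R)) by exact: measurable_itv.
have mL : measurable (L : set (measurableTypeR R)) by exact: compact_measurable.
by have /integrableP[_] := integrableS mI mL LI fi.
Qed.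

Lemma weak_deriv1_chain (c d : R) (n : nat) (u : R -> R) (V : nat -> R -> R) :
  measurable_fun `]c, d[ u -> (forall i, (i <= n)%N -> integ mu `]c, d[ (V i)) ->
  {ae mu, forall r : R, `]c, d[%classic r -> u r = V 0%N r} ->
  (forall i, (i < n)%N ->
    {ae mu, forall r : R, `]c, d[%classic r -> V i r = \int[mu]_(s in `]c, r[) V i.+1 s}) ->
  forall i, (i <= n)%N -> weak_deriv1 `]c, d[%classic i u (V i).
Proof.
move=> mu_ iV uV Vprim i0 i0n.
have mI : measurable (`]c, d[%classic : set (measurableTypeR R)) by exact: measurable_itv.
have msm (f : R -> R) : smooth f -> measurable_fun (`]c, d[%classic : set (measurableTypeR R)) f.
  by move=> sf; apply: measurable_funTS; apply: continuous_measurable_fun; exact: smooth_continuous.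
have uV' : {ae mu, forall r : R, `]c, d[%classic r -> V 0%N r = u r}.
  by apply: ae_impl uV => r H /H.
have iu : integ mu `]c, d[ u := ae_eq_integ mI mu_ uV' (iV 0%N (leq0n n)).
split; [exact: integ_locally iu|exact: integ_locally (iV _ i0n)|].
elim: i0 i0n => [|i IH] i_n phi tphi.
  rewrite mul1r; have mphi := msm _ tphi.1; apply: (@ae_eq_Rint _ _ _ mu) => //.
  - exact: measurable_funM.
  - exact: measurable_funM (integ_measurable (iV 0%N i_n)) mphi.
  - by apply: ae_impl uV => r H Ir; rewrite (H Ir).
have tphi' : test_fun `]c, d[ (derive1 phi) by apply: test_fun_derive1 tphi; exact: interval_open.
have Eiter : iter_deriv (nseq i.+1 (1 : R)) phi = iter_deriv (nseq i (1 : R)) (derive1 phi).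
  have -> : derive1 phi = 'D_1 phi by apply/funext => x; rewrite derive1E.
  by rewrite -addn1 nseqD /iter_deriv foldr_cat.
have phid : phi d = 0.
  have [L [_ LI L0]] := tphi.2; apply: L0 => /LI; by rewrite /= in_itv/= ltxx andbF.
have [_ E2] := ibp_primitive (iV _ i_n) tphi.1 phid.
have mV := measurable_primitive1 (integ_measurable (iV _ i_n)).
have m1 := msm _ (smooth_derive1 tphi.1).
rewrite Eiter (IH (ltnW i_n) _ tphi') exprSr -mulrA mulN1r -E2; congr (_ * _).
apply: (@ae_eq_Rint _ _ _ mu) => //.
- exact: measurable_funM (integ_measurable (iV _ (ltnW i_n))) m1.
- exact: measurable_funM m1 mV.
- by apply: ae_impl (Vprim _ i_n) => r H Ir; rewrite (H Ir) mulrC.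
Qed.

Lemma continuous_tail (d : R) (p : R -> R) : 0 < d -> integ mu `]0, d[ p ->
  {within `[0, d[, continuous (fun r : R => - \int[mu]_(t in `]r, d[) p t)}.
Proof.
move=> d0 ip.
have mp := integ_measurable ip.
have icc : integ mu `[0, d] p.
  have mcc : measurable_fun `[0, d] p := measurable_fun_itv_cc mp.
  apply/integrableP; split; first exact/measurable_EFinP.
  have /integrableP[_] := ip; rewrite /= integral_itv_bndo_bndc; last first.
    by apply/measurable_EFinP; apply: measurableT_comp.
  rewrite integral_itv_obnd_cbnd//; apply/measurable_EFinP; apply: measurableT_comp => //.
  exact: measurable_fun_itv_oc mp.
have cont := parameterized_integral_continuous (ltW d0) icc.
have sub : (`[0, d[%classic : set R) `<=` `[0, d]%classic by apply: subset_itvl; rewrite bnd_simp.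
have c1 := continuous_subspaceW sub cont.
have E (r : R) : r \in `[0, d[%classic -> - (\int[mu]_(t in `]r, d[) p t) =
    parameterized_integral mu 0 r p - \int[mu]_(t in `]0, d[) p t.
  rewrite inE /= in_itv/= => /andP[r0 rd]; rewrite /parameterized_integral.
  rewrite -Rint_oo_cc; last by exact: integ_measurable (integ_oo_sub (lexx 0) (ltW rd) ip).
  by rewrite (Rint_split r0 (ltW rd) ip) opprD addNKr.
have c2 : {within `[0, d[, continuous (fun r => parameterized_integral mu 0 r p - \int[mu]_(t in `]0, d[) p t)}.
  by move=> x; apply: cvgB; [exact: c1|exact: cvg_cst].
by apply: subspace_eq_continuous c2 => r Hr; exact/esym/E.
Qed.

End WeakChain.

Section SliceDefinitions.
Context {R : realType}.
Local Notation mu := (@lebesgue_measure R).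
Variables (K G Gr : R -> R).

Definition kernel_deriv (s : R) : R := derive1 K s * (s^-1) ^+ 4 - 4 * K s * (s^-1) ^+ 5.

Definition slice_moment (r : R) : R := \int[mu]_(s in `]0, r[) (s ^+ 4 * Gr s).

Definition slice_deriv2 (r : R) : R :=
  K r * (4^-1 * G r + 3 / 4 * ((r^-1) ^+ 4 * slice_moment r)).

(* The [i]-th derivative, [i <= 3], of the corrected stream function on one slice. *)
Definition slice_deriv (i : nat) : R -> R :=
  match i with
  | 0 => fun r => \int[mu]_(t in `]0, r[) \int[mu]_(s in `]0, t[) slice_deriv2 s
  | 1 => fun r => \int[mu]_(s in `]0, r[) slice_deriv2 s
  | 2 => slice_deriv2
  | _ => fun r => 4^-1 * (derive1 K r * G r) + K r * Gr r
                  + 3 / 4 * (kernel_deriv r * slice_moment r)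
  end.

End SliceDefinitions.

Section Slice.
Context {R : realType}.
Variables (rad C : R) (K : R -> R).
Hypotheses (rad0 : 0 < rad) (C0 : 0 <= C).
Local Notation mu := (@lebesgue_measure R).
Local Notation integ m D f := (m.-integrable D (EFin \o f)).
Local Notation D := (`]0, rad[%classic : set (measurableTypeR R)).

Let mD : measurable D. Proof. exact: measurable_itv. Qed.
Let mI (c d : R) : measurable (`]c, d[%classic : set (measurableTypeR R)).
Proof. exact: measurable_itv. Qed.
Let D_lt (r : R) : D r -> 0 < r /\ r < rad. Proof. by rewrite /= in_itv/= => /andP[]. Qed.
Let subD (t : R) : D t -> `]0, t[ `<=` D.
Proof. by move=> /D_lt[_ tR]; apply: subset_itvl; rewrite bnd_simp ltW. Qed.
Let sub_integ (t : R) f : D t -> integ mu D f -> integ mu `]0, t[ f.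
Proof. by move=> /D_lt[_ /ltW tR]; exact: integ_sub0. Qed.

Let m_pow (c d : R) n : measurable_fun (`]c, d[ : set (measurableTypeR R)) (fun r : R => r ^+ n).
Proof. by apply: measurable_funX; exact: measurable_id. Qed.

Lemma Rint_pow (n : nat) (t : R) : 0 < t ->
  \int[mu]_(s in `]0, t[) s ^+ n = n.+1%:R^-1 * t ^+ n.+1.
Proof.
move=> t0; have dX (x : R) : is_derive x 1 (fun y : R => n.+1%:R^-1 * y ^+ n.+1) (x ^+ n).
  have dI := is_deriveX n.+1 (is_derive_id x (1 : R)).
  have := is_deriveZ (n.+1%:R^-1 : R) dI => /is_derive_eq.
  rewrite (_ : _ \*: _ = fun y : R => n.+1%:R^-1 * y ^+ n.+1); last first.
    by apply/funext => y; rewrite /GRing.scale/= exprfctE.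
  apply; rewrite /GRing.scale/= mulr1 mulrA mulVf ?mul1r// pnatr_eq0//.
have cX m (x : R) : {for x, continuous (fun y : R => y ^+ m)} by exact: exprn_continuous.
have cF (x : R) : {for x, continuous (fun y : R => n.+1%:R^-1 * y ^+ n.+1)}.
  by apply: differentiable_continuous; apply/derivable1_diffP; case: (dX x).
rewrite (@FTC_oo _ (fun y : R => n.+1%:R^-1 * y ^+ n.+1) (fun y => y ^+ n) 0 t).
- by rewrite expr0n/= mulr0 subr0.
- exact: ltW.
- by apply: continuous_in_subspaceT => x _; exact: cX.
- split.
  + by move=> x _; case: (dX x).
  + by apply: cvg_at_right_filter; exact: cF.
  + by apply: cvg_at_left_filter; exact: cF.
- by move=> x _; rewrite derive1E; case: (dX x).
Qed.

Lemma iterated_primitive (r : R) (f : R -> R) : 0 < r -> integ mu `]0, r[ f ->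
  \int[mu]_(t in `]0, r[) \int[mu]_(s in `]0, t[) f s = \int[mu]_(s in `]0, r[) ((r - s) * f s).
Proof.
move=> r0 fi; have [_ _ E1] := triangle_fubini_integ fi (integ_cst_oo 0 r 1).
under eq_Rintegral do rewrite -[\int[mu]_(s in _) f s]mul1r.
rewrite -E1; apply: eq_Rintegral => s; rewrite inE /= in_itv/= => /andP[s0 sr].
by rewrite (Rint_cst_oo _ (ltW sr)) mul1r mulrC.
Qed.

Local Notation K1 := (derive1 K).
Hypotheses (dK : forall r : R, 0 < r -> is_derive r 1 K (K1 r))
  (cK1 : forall r : R, 0 < r -> {for r, continuous K1})
  (bK : forall r : R, D r -> `|K r| <= C * r ^+ 2) (bK1 : forall r : R, D r -> `|K1 r| <= C * r).

Let cK (r : R) : 0 < r -> {for r, continuous K}.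
Proof.
by move=> r0; apply: differentiable_continuous; apply/derivable1_diffP; case: (dK r0).
Qed.

Lemma measurable_continuous_pos (f : R -> R) (c d : R) : 0 <= c -> (forall r, 0 < r -> {for r, continuous f}) ->
  measurable_fun `]c, d[ f.
Proof.
move=> c0 cf; apply: open_continuous_measurable_fun; first exact: interval_open.
move=> x; rewrite inE /= in_itv/= => /andP[cx _]; exact/cf/(le_lt_trans c0).
Qed.

Let mK : measurable_fun D K. Proof. exact: measurable_continuous_pos. Qed.
Let mK1 : measurable_fun D K1. Proof. exact: measurable_continuous_pos. Qed.

Let iK1 (t : R) : D t -> integ mu `]0, t[ K1.
Proof.
move=> Dt; apply: (sub_integ Dt); apply: (integ_le (g := fun=> C * rad)) => //.
  move=> r Dr; apply: le_trans (bK1 Dr) _; have [_ rR] := D_lt Dr.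
  by rewrite ler_wpM2l// ltW.
exact: integ_cst_oo.
Qed.

Let int_K1 (t : R) : D t -> \int[mu]_(s in `]0, t[) K1 s = K t.
Proof.
move=> Dt; have [t0 tR] := D_lt Dt; apply/eqP; rewrite -subr_eq0 -normr_eq0; apply/eqP.
apply: (ge0_small_eq0 (C := 2 * C * rad)) => // e e0.
pose d := Num.min e (t / 2); have d0 : 0 < d by rewrite lt_min e0 divr_gt0.
have dt : d < t by rewrite gt_min ltr_pdivrMr// ltr_pMr// ltr1n orbT.
have de : d <= e by rewrite ge_min lexx.
have Dd : D d by rewrite /= in_itv/= d0 (lt_trans dt).
have [_ dR] := D_lt Dd.
have Crad0 : 0 <= C * rad by rewrite mulr_ge0// ltW.
rewrite (Rint_split (ltW d0) (ltW dt) (iK1 Dt)) (FTC_pos d0 (ltW dt) dK cK1).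
have -> : \int[mu]_(s in `]0, d[) K1 s + (K t - K d) - K t = \int[mu]_(s in `]0, d[) K1 s - K d.
  by rewrite -addrA [K t - _ - _]addrAC subrr sub0r.
have k1 : `|\int[mu]_(s in `]0, d[) K1 s| <= C * rad * d.
  apply: le_trans (le_normr_Rintegral (mI 0 d) (iK1 Dd)) _.
  have -> : C * rad * d = \int[mu]_(s in `]0, d[) (C * rad) by rewrite Rint_cst_oo ?subr0// ltW.
  apply: le_Rintegral => //; first exact: integ_norm (mI 0 d) (iK1 Dd).
    exact: integ_cst_oo.
  move=> s /(subD Dd) Ds; apply: le_trans (bK1 Ds) _; have [_ sR] := D_lt Ds.
  by rewrite ler_wpM2l// ltW.
have k2 : `|K d| <= C * rad * d.
  apply: le_trans (bK Dd) _; rewrite expr2 mulrA ler_wpM2r ?(ltW d0)//.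
  by rewrite ler_wpM2l// ltW.
apply: le_trans (ler_normB _ _) _; apply: le_trans (lerD k1 k2) _.
rewrite (_ : _ + _ = 2 * C * rad * d); last by ring.
by rewrite ler_wpM2l// -mulrA mulr_ge0.
Qed.

Section Source.
Variables (G Gr : R -> R) (b : R).
Hypotheses (mG : measurable_fun D G) (mGr : measurable_fun D Gr)
  (iG : integ mu D (fun r => G r ^+ 2 * r)) (iGr : integ mu D (fun r => Gr r ^+ 2 * r)).
Let Gh r := b - \int[mu]_(t in `]r, rad[) Gr t.
Hypothesis G_tail : {ae mu, forall r, D r -> G r = Gh r}.

Local Notation M := (slice_moment Gr).

Let iX n : integ mu D (fun r => r ^+ n.+1 * Gr r) := L2_radial_moment rad0 n mGr iGr.
Let iXG n : integ mu D (fun r => r ^+ n.+1 * G r) := L2_radial_moment rad0 n mG iG.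

Let iGr_in (s : R) : 0 < s -> integ mu `]s, rad[ Gr.
Proof.
move=> s0; have := iX 0.
move=> /(integ_oo_sub (ltW s0) (lexx rad)) i2.
have m1 : measurable_fun `]s, rad[ (fun t : R => (t^-1) ^+ 1) := measurable_invX 1 (ltW s0).
have H3 : integ mu `]s, rad[ (fun t => t ^+ 1 * Gr t * (t^-1) ^+ 1).
  apply: (integM_bounded (C := s^-1)) => // t; rewrite /= in_itv/= => /andP[st tR].
  have t0 := lt_trans s0 st.
  by rewrite expr1 ger0_norm ?invr_ge0 ?(ltW t0)// lef_pV2 ?posrE// ltW.
apply: eq_integ (mI _ _) H3 => t; rewrite inE /= in_itv/= => /andP[st tR].
by rewrite !expr1 mulrAC mulfV ?mul1r// gt_eqF// (lt_trans s0).
Qed.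

Let Gh_split (s r : R) : 0 < s -> s < r -> r < rad -> Gh s = Gh r - \int[mu]_(t in `]s, r[) Gr t.
Proof.
move=> s0 sr rR; rewrite /Gh (Rint_split (ltW sr) (ltW rR) (iGr_in s0)) opprD addrA.
by rewrite addrAC.
Qed.

(* [Gh] and [M] are known only as integrals, so integration by parts is Fubini on a triangle. *)
Let source_parts (u U : R -> R) (c : R) (r : R) : D r -> measurable_fun D u ->
  integ mu `]0, r[ u ->
  (forall t, D t -> \int[mu]_(s in `]0, t[) u s = U t) ->
  (forall t, D t -> (\int[mu]_(s in `]0%R, t[) `|u s|%:E <= (c * t)%:E)%E) ->
  [/\ integ mu `]0, r[ (fun s => u s * Gh s), integ mu `]0, r[ (fun s => U s * Gr s) &
    \int[mu]_(s in `]0, r[) (u s * Gh s) = U r * Gh r - \int[mu]_(s in `]0, r[) (U s * Gr s)].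
Proof.
move=> Dr mu' iu UE uc; have [r0 rR] := D_lt Dr; have sub := subD Dr.
have iB : integ mu `]0, r[ (fun t => c * `|t ^+ 1 * Gr t|).
  exact: integZ (mI _ _) (integ_norm (mI _ _) (sub_integ Dr (iX 0))).
have HB (t : R) : 0 < t < r ->
    (`|Gr t|%:E * \int[mu]_(s in `]0%R, t[) `|u s|%:E <= (c * `|t ^+ 1 * Gr t|)%:E)%E.
  move=> /andP[t0 tr]; have Dt : D t by rewrite /= in_itv/= t0 (lt_trans tr).
  apply: (@le_trans _ _ (`|Gr t|%:E * (c * t)%:E)%E); first by rewrite lee_wpmul2l// uc.
  rewrite -EFinM lee_fin expr1 normrM (gtr0_norm t0) le_eqVlt; apply/orP; left; apply/eqP; ring.
have [q1 q2 E1] := triangle_fubini (measurable_funS mD sub mu') (measurable_funS mD sub mGr) iB HB.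
have UG (s : R) : s \in `]0, r[%classic -> Gr s * \int[mu]_(t in `]0, s[) u t = U s * Gr s.
  by rewrite inE => /sub Ds; rewrite UE// mulrC.
have q3 : integ mu `]0, r[ (fun s => U s * Gr s) by exact: (@eq_integ _ _ _ mu _ _ _ UG (mI 0 r) q2).
have EG (s : R) : s \in `]0, r[%classic ->
    Gh r * u s - u s * \int[mu]_(t in `]s, r[) Gr t = u s * Gh s.
  rewrite inE /= in_itv/= => /andP[s0 sr]; rewrite (Gh_split s0 sr rR); ring.
have iZ := integZ (Gh r) (mI 0 r) iu.
split => //; first exact: (@eq_integ _ _ _ mu _ _ _ EG (mI 0 r) (integB (mI 0 r) iZ q1)).
rewrite -(eq_Rintegral mu EG) (RintegralB (mI 0 r) iZ q1) (RintegralZl _ (mI 0 r) iu).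
by rewrite E1 (eq_Rintegral mu UG) UE// mulrC.
Qed.

Section Moment.
Variable N : R.
Hypotheses (N0 : 0 <= N) (bM : forall t, D t -> \int[mu]_(s in `]0, t[) `|s ^+ 4 * Gr s| <= N * t ^+ 4).

Let iM (t : R) : D t -> integ mu `]0, t[ (fun s => s ^+ 4 * Gr s).
Proof. by move=> Dt; exact: sub_integ Dt (iX 3). Qed.

Let absM (t : R) : D t -> `|M t| <= N * t ^+ 4.
Proof. by move=> Dt; apply: le_trans (le_normr_Rintegral (mI 0 t) (iM Dt)) (bM Dt). Qed.

Let moment_parts (v W : R -> R) (c r : R) : D r ->
  (forall t : R, 0 < t -> is_derive t 1 W (v t)) -> (forall t : R, 0 < t -> {for t, continuous v}) ->
  (forall t : R, D t -> `|v t| * t ^+ 4 <= c) ->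
  [/\ integ mu `]0, r[ (fun t => v t * M t), integ mu `]0, r[ (fun s => W s * (s ^+ 4 * Gr s)) &
    \int[mu]_(t in `]0, r[) (v t * M t) =
    W r * M r - \int[mu]_(s in `]0, r[) (W s * (s ^+ 4 * Gr s))].
Proof.
move=> Dr dW cv bv; have [r0 rR] := D_lt Dr; have sub := subD Dr.
have iB : integ mu `]0, r[ (fun=> N * c) by exact: integ_cst_oo.
have HB (t : R) : 0 < t < r ->
    (`|v t|%:E * \int[mu]_(s in `]0%R, t[) `|s ^+ 4 * Gr s|%:E <= (N * c)%:E)%E.
  move=> /andP[t0 tr]; have Dt : D t by rewrite /= in_itv/= t0 (lt_trans tr).
  rewrite -(EFin_Rint (mI 0 t) (integ_norm (mI 0 t) (iM Dt))) -EFinM lee_fin.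
  apply: le_trans (_ : `|v t| * (N * t ^+ 4) <= _); first by rewrite ler_wpM2l// bM.
  by rewrite mulrCA ler_wpM2l// bv.
have [q1 q2 E1] := triangle_fubini (integ_measurable (iM Dr)) (measurable_continuous_pos (lexx 0) cv) iB HB.
have EW (s : R) : s \in `]0, r[%classic ->
    W r * (s ^+ 4 * Gr s) - s ^+ 4 * Gr s * \int[mu]_(t in `]s, r[) v t = W s * (s ^+ 4 * Gr s).
  rewrite inE /= in_itv/= => /andP[s0 sr]; rewrite (FTC_pos s0 (ltW sr) dW cv); ring.
have iZ := integZ (W r) (mI 0 r) (iM Dr).
split; [exact: q2|exact: (@eq_integ _ _ _ mu _ _ _ EW (mI 0 r) (integB (mI 0 r) iZ q1))|].
rewrite -(eq_Rintegral mu EW) (RintegralB (mI 0 r) iZ q1) (RintegralZl _ (mI 0 r) (iM Dr)) E1.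
by rewrite opprB addrC; exact/esym/subrK.
Qed.

Let int_Gh (r : R) : D r ->
  [/\ integ mu `]0, r[ Gh, integ mu `]0, r[ (fun s => s * Gr s) &
   \int[mu]_(s in `]0, r[) Gh s = r * Gh r - \int[mu]_(s in `]0, r[) (s * Gr s)].
Proof.
move=> Dr; have H := @source_parts (fun=> 1) id 1 r Dr (measurable_cst _) (integ_cst_oo 0 r 1).
have [||i1 i2 E1] := H.
- by move=> t /D_lt[t0 _]; rewrite Rint_cst_oo ?mul1r ?subr0// ltW.
- move=> t /D_lt[t0 _]; rewrite -(EFin_Rint (mI 0 t)); last exact: integ_norm (mI 0 t) (integ_cst_oo 0 t 1).
  by rewrite normr1 Rint_cst_oo ?subr0 ?mul1r// ltW.
have E2 (s : R) : s \in `]0, r[%classic -> 1 * Gh s = Gh s by rewrite mul1r.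
split => //; first exact: (@eq_integ _ _ _ mu _ _ _ E2 (mI 0 r) i1).
by rewrite -(eq_Rintegral mu E2).
Qed.

Let int_s3Gh (r : R) : D r ->
   \int[mu]_(s in `]0, r[) (s ^+ 3 * Gh s) = 4^-1 * r ^+ 4 * Gh r - 4^-1 * M r.
Proof.
move=> Dr; have [r0 rR] := D_lt Dr.
have ip (t : R) : integ mu `]0, t[ (fun s => s ^+ 3).
  have [t0|t0] := leP t 0; first by rewrite set_itv_ge ?bnd_simp -?leNgt//; exact: integrable_set0.
  apply: (integ_le (g := fun=> t ^+ 3)) => //.
    move=> s; rewrite /= in_itv/= => /andP[s0 st].
    by rewrite ger0_norm ?exprn_ge0 ?(ltW s0)// lerXn2r ?nnegrE ?(ltW s0) ?(ltW t0) ?(ltW st).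
  exact: integ_cst_oo.
have [||_ i2 ->] := @source_parts (fun s => s ^+ 3) (fun s => 4^-1 * s ^+ 4) (rad ^+ 3) r Dr
    (@m_pow 0 rad 3) (ip r).
- by move=> t /D_lt[t0 _]; rewrite Rint_pow.
- move=> t Dt; have [t0 tR] := D_lt Dt.
  rewrite -(EFin_Rint (mI 0 t)); last exact: integ_norm (mI 0 t) (ip t).
  rewrite lee_fin; have -> : rad ^+ 3 * t = \int[mu]_(s in `]0, t[) (rad ^+ 3).
    by rewrite Rint_cst_oo ?subr0// ltW.
  apply: le_Rintegral => //; first exact: integ_norm (mI 0 t) (ip t).
    exact: integ_cst_oo.
  move=> s; rewrite /= in_itv/= => /andP[s0 st].
  by rewrite ger0_norm ?exprn_ge0 ?(ltW s0)// lerXn2r// ?nnegrE ?ltW// (lt_trans st).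
congr (_ - _); rewrite -(RintegralZl _ (mI 0 r) (iM Dr)).
by apply: eq_Rintegral => s _; rewrite mulrA.
Qed.

Let int_K1Gh (r : R) : D r ->
  [/\ integ mu `]0, r[ (fun s => K1 s * Gh s), integ mu `]0, r[ (fun s => K s * Gr s) &
   \int[mu]_(s in `]0, r[) (K1 s * Gh s) = K r * Gh r - \int[mu]_(s in `]0, r[) (K s * Gr s)].
Proof.
move=> Dr; apply: (@source_parts K1 K (C * rad) r Dr mK1 (iK1 Dr) int_K1).
move=> t Dt; have [t0 tR] := D_lt Dt.
rewrite -(EFin_Rint (mI 0 t)); last exact: integ_norm (mI 0 t) (iK1 Dt).
rewrite lee_fin; have -> : C * rad * t = \int[mu]_(s in `]0, t[) (C * rad).
  by rewrite Rint_cst_oo ?subr0// ltW.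
apply: le_Rintegral => //; first exact: integ_norm (mI 0 t) (iK1 Dt).
  exact: integ_cst_oo.
move=> s /(subD Dt) Ds; apply: le_trans (bK1 Ds) _; have [_ sR] := D_lt Ds.
by rewrite ler_wpM2l// ltW.
Qed.

Let int_M (r : R) : D r ->
  integ mu `]0, r[ (fun t => (t^-1) ^+ 4 * M t) /\
  \int[mu]_(t in `]0, r[) ((t^-1) ^+ 4 * M t) =
    3^-1 * (\int[mu]_(s in `]0, r[) (s * Gr s) - (r^-1) ^+ 3 * M r).
Proof.
move=> Dr; have [_ iS _] := int_Gh Dr.
have [|||i1 i2 E1] := @moment_parts (fun t => (t^-1) ^+ 4) (fun t => - 3^-1 * (t^-1) ^+ 3) 1 r Dr.
- move=> t t0; have := is_deriveZ (- 3^-1 : R) (is_derive_invX 2 t0) => /is_derive_eq; apply.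
  by rewrite /GRing.scale/= mulrA mulrNN mulVf ?mul1r// pnatr_eq0.
- by move=> t; exact: continuous_invX.
- move=> t /D_lt[t0 _]; rewrite ger0_norm; last by rewrite exprn_ge0// invr_ge0 ltW.
  by rewrite -exprMn mulVf ?expr1n// gt_eqF.
split=> //; rewrite E1.
have -> : \int[mu]_(s in `]0, r[) (- 3^-1 * (s^-1) ^+ 3 * (s ^+ 4 * Gr s)) =
    \int[mu]_(s in `]0, r[) (- 3^-1 * (s * Gr s)).
  apply: eq_Rintegral => s; rewrite inE /= in_itv/= => /andP[s0 _].
  by field; rewrite gt_eqF.
by rewrite (RintegralZl _ (mI 0 r) iS); ring.
Qed.

Let kk_bound (t : R) : D t -> `|kernel_deriv K t| * t ^+ 4 <= 5 * C * t.
Proof.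
move=> Dt; have [t0 tR] := D_lt Dt; have tn0 : t != 0 by rewrite gt_eqF.
have -> : `|kernel_deriv K t| * t ^+ 4 = `|K1 t - 4 * (K t * t^-1)|.
  rewrite -[t ^+ 4](@gtr0_norm _ (t ^+ 4)) ?exprn_gt0// -normrM /kernel_deriv; congr `|_|.
  by field.
apply: le_trans (ler_normB _ _) _; rewrite 2!normrM normfV (gtr0_norm t0) ger0_norm//.
have h : `|K t| * t^-1 <= C * t by rewrite ler_pdivrMr// -mulrA -expr2 bK.
have := bK1 Dt; lra.
Qed.

Let int_kkM (r : R) : D r ->
  integ mu `]0, r[ (fun t => kernel_deriv K t * M t) /\
  \int[mu]_(t in `]0, r[) (kernel_deriv K t * M t) =
    K r * (r^-1) ^+ 4 * M r - \int[mu]_(s in `]0, r[) (K s * Gr s).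
Proof.
move=> Dr.
have [|||i1 i2 E1] := @moment_parts (kernel_deriv K) (fun t => K t * (t^-1) ^+ 4) (5 * C * rad) r Dr.
- move=> t t0; have := is_deriveM (dK t0) (is_derive_invX 3 t0) => /is_derive_eq; apply.
  by rewrite /GRing.scale/= /kernel_deriv; ring.
- move=> t t0; apply: continuousB.
    by apply: continuousM; [exact: cK1|exact: continuous_invX].
  apply: continuousM; last exact: continuous_invX.
  by apply: continuousM; [exact: cst_continuous|exact: cK].
- move=> t Dt; apply: le_trans (kk_bound Dt) _; have [_ tR] := D_lt Dt.
  by rewrite ler_wpM2l ?mulr_ge0// ltW.
split=> //; rewrite E1; congr (_ - _).
apply: eq_Rintegral => s; rewrite inE /= in_itv/= => /andP[s0 _].
by field; rewrite gt_eqF.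
Qed.

Local Notation V := (slice_deriv K G Gr).
Let mM : measurable_fun D M.
Proof. exact: measurable_primitive1 (integ_measurable (iX 3)). Qed.

Let mI4 : measurable_fun D (fun r : R => (r^-1) ^+ 4).
Proof. by apply: measurable_invX; exact: lexx. Qed.

Let mMI : measurable_fun D (fun r => (r^-1) ^+ 4 * M r).
Proof. exact: measurable_funM mI4 mM. Qed.

Let mkk : measurable_fun D (kernel_deriv K).
Proof.
apply: measurable_funB; apply: measurable_funM => //; last by apply: measurable_invX; exact: lexx.
by apply: measurable_funM => //; exact: measurable_cst.
Qed.

Let mGh : measurable_fun D Gh.
Proof.
apply: measurable_funB; first exact: measurable_cst.
exact: measurable_tail1.
Qed.

Let Ih r := 4^-1 * Gh r + 3 / 4 * ((r^-1) ^+ 4 * M r).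

Let mIh : measurable_fun D Ih.
Proof.
by apply: measurable_funD; apply: measurable_funM => //; exact: measurable_cst.
Qed.

Let int_Ih (r : R) : D r -> integ mu `]0, r[ Ih /\
  \int[mu]_(s in `]0, r[) Ih s = 4^-1 * (r * Gh r) - 4^-1 * ((r^-1) ^+ 3 * M r).
Proof.
move=> Dr; have [i1 _ E1] := int_Gh Dr; have [i2 E2] := int_M Dr.
have j1 := integZ (4^-1) (mI 0 r) i1; have j2 := integZ (3 / 4) (mI 0 r) i2.
split; first exact: (integD (mI 0 r) j1 j2).
rewrite (RintegralD (mI 0 r) j1 j2) (RintegralZl _ (mI 0 r) i1) (RintegralZl _ (mI 0 r) i2) E1 E2.
set S := Rintegral _ _ _; field.
by rewrite gt_eqF//; case: (D_lt Dr).
Qed.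

Let mV2 : measurable_fun D (V 2).
Proof.
apply: measurable_funM => //; apply: measurable_funD; apply: measurable_funM => //; exact: measurable_cst.
Qed.

Let mV1 : measurable_fun D (V 1). Proof. exact: measurable_primitive1 mV2. Qed.
Let mV0 : measurable_fun D (V 0). Proof. exact: measurable_primitive1 mV1. Qed.

Let mV3 : measurable_fun D (V 3).
Proof.
have mc (k : R) (f : R -> R) : measurable_fun D f -> measurable_fun D (fun r => k * f r).
  by move=> mf; exact: measurable_funM (measurable_cst k) mf.
apply: measurable_funD (mc _ _ (measurable_funM mkk mM)).
exact: measurable_funD (mc _ _ (measurable_funM mK1 mG)) (measurable_funM mK mGr).
Qed.

Let V2_primitive : {ae mu, forall r, D r -> V 2 r = \int[mu]_(s in `]0, r[) V 3 s}.
Proof.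
apply: ae_impl G_tail => r Gr_r Dr.
have [j1 j2 E1] := int_K1Gh Dr; have [j3 E3] := int_kkM Dr.
have i1 := integZ (4^-1) (mI 0 r) j1; have i3 := integZ (3 / 4) (mI 0 r) j3.
have sub := subD Dr.
transitivity (\int[mu]_(s in `]0, r[) (4^-1 * (K1 s * Gh s) + K s * Gr s + 3 / 4 * (kernel_deriv K s * M s))).
  rewrite (RintegralD (mI 0 r) (integD (mI 0 r) i1 j2) i3) (RintegralD (mI 0 r) i1 j2).
  rewrite (RintegralZl _ (mI 0 r) j1) (RintegralZl _ (mI 0 r) j3) E1 E3 /= /slice_deriv2 (Gr_r Dr).
  set S := Rintegral _ _ _; field.
  by rewrite gt_eqF//; case: (D_lt Dr).
apply: (@ae_eq_Rint _ _ _ mu) => //.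
- exact: integ_measurable (integD (mI 0 r) (integD (mI 0 r) i1 j2) i3).
- exact: measurable_funS mD sub mV3.
- by apply: ae_impl G_tail => s Gs /sub Ds; rewrite /= (Gs Ds).
Qed.

Variable A : R.
Hypotheses (A0 : 0 <= A) (bA : forall t, D t -> \int[mu]_(s in `]0, t[) `|s ^+ 1 * G s| <= A * t ^+ 1).

Let bV2 (r : R) : D r -> `|V 2 r| <= C * r ^+ 2 * (`|G r| + N).
Proof.
move=> Dr; have [r0 rR] := D_lt Dr; rewrite normrM; apply: ler_pM => //; first exact: bK.
have h : `|(r^-1) ^+ 4 * M r| <= N.
  rewrite normrM ger0_norm; last by rewrite exprn_ge0// invr_ge0 ltW.
  by rewrite exprVn mulrC ler_pdivrMr ?exprn_gt0// absM.
have k1 : `|4^-1 * G r| = 4^-1 * `|G r| by rewrite normrM ger0_norm.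
have k2 : `|3 / 4 * ((r^-1) ^+ 4 * M r)| = 3 / 4 * `|(r^-1) ^+ 4 * M r| by rewrite normrM ger0_norm.
apply: le_trans (ler_normD _ _) _; rewrite k1 k2.
have := normr_ge0 (G r); have := normr_ge0 ((r^-1) ^+ 4 * M r); lra.
Qed.

Let iV2 : integ mu D (V 2).
Proof.
have i1 := integ_norm mD (iXG 0).
have i2 := integD mD (integZ (C * rad) mD i1) (integ_cst_oo 0 rad (C * rad ^+ 2 * N)).
apply: (integ_le mD mV2 _ i2).
  move=> r Dr; apply: le_trans (bV2 Dr) _; have [r0 rR] := D_lt Dr.
  rewrite mulrDr; apply: lerD.
    rewrite expr1 normrM (gtr0_norm r0) expr2 -!mulrA ler_wpM2l// ler_wpM2r// ?mulr_ge0//; exact: ltW.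
  by rewrite ler_wpM2r// ler_wpM2l// lerXn2r ?nnegrE ?(ltW r0) ?(ltW rad0) ?(ltW rR).
Qed.

Let bV1 (r : R) : D r -> `|V 1 r| <= C * r ^+ 2 * (A + N * rad).
Proof.
move=> Dr; have [r0 rR] := D_lt Dr; have sub := subD Dr.
have i2 := sub_integ Dr iV2; have i1 := integ_norm (mI 0 r) (sub_integ Dr (iXG 0)).
have i3 := integZ (C * r) (mI 0 r) i1; have i4 := integ_cst_oo 0 r (C * r ^+ 2 * N).
apply: le_trans (le_normr_Rintegral (mI 0 r) i2) _.
apply: (@le_trans _ _ (\int[mu]_(s in `]0, r[) (C * r * `|s ^+ 1 * G s| + C * r ^+ 2 * N))).
  apply: le_Rintegral => //; first exact: integ_norm (mI 0 r) i2.
    exact: integD (mI 0 r) i3 i4.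
  move=> s Hs; have Ds := sub _ Hs; move: Hs; rewrite /= in_itv/= => /andP[s0 sr].
  apply: le_trans (bV2 Ds) _; rewrite mulrDr; apply: lerD.
    rewrite expr1 normrM (gtr0_norm s0) expr2 -!mulrA ler_wpM2l// ler_wpM2r// ?mulr_ge0//; exact: ltW.
  by rewrite ler_wpM2r// ler_wpM2l// lerXn2r ?nnegrE ?(ltW r0) ?(ltW s0) ?(ltW sr).
rewrite (RintegralD (mI 0 r) i3 i4) (RintegralZl _ (mI 0 r) i1) (Rint_cst_oo _ (ltW r0)) subr0.
rewrite mulrDr; apply: lerD; last first.
  by rewrite [leRHS]mulrA ler_wpM2l ?mulr_ge0 ?sqr_ge0// ltW.
rewrite expr2 -!mulrA ler_wpM2l// ler_wpM2l ?(ltW r0)//.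
by have := bA Dr; rewrite expr1 mulrC.
Qed.

Let bV0 (r : R) : D r -> `|V 0 r| <= C * r ^+ 3 * (A + N * rad).
Proof.
move=> Dr; have [r0 rR] := D_lt Dr; have sub := subD Dr.
have AN0 : 0 <= A + N * rad by rewrite addr_ge0// mulr_ge0// ltW.
have b1 (s : R) : `]0, r[%classic s -> `|V 1 s| <= C * r ^+ 2 * (A + N * rad).
  move=> Hs; have Ds := sub _ Hs; move: Hs; rewrite /= in_itv/= => /andP[s0 sr].
  apply: le_trans (bV1 Ds) _; rewrite ler_wpM2r// ler_wpM2l// lerXn2r ?nnegrE ?(ltW r0) ?(ltW s0) ?(ltW sr)//.
have ic := integ_cst_oo 0 r (C * r ^+ 2 * (A + N * rad)).
have i1 : integ mu `]0, r[ (V 1) := integ_le (mI 0 r) (measurable_funS mD sub mV1) b1 ic.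
apply: le_trans (le_normr_Rintegral (mI 0 r) i1) _.
apply: (@le_trans _ _ (\int[mu]_(s in `]0, r[) (C * r ^+ 2 * (A + N * rad)))).
  exact: le_Rintegral (mI 0 r) (integ_norm (mI 0 r) i1) ic b1.
rewrite (Rint_cst_oo _ (ltW r0)) subr0 le_eqVlt; apply/orP; left; apply/eqP; ring.
Qed.

Let bV3 (r : R) : D r -> `|V 3 r| <= C * (r * `|G r| + rad * (r * `|Gr r|) + 4 * r * N).
Proof.
move=> Dr; have [r0 rR] := D_lt Dr.
have h1 : `|K1 r * G r| <= C * r * `|G r| by rewrite normrM ler_wpM2r// bK1.
have h2 : `|K r * Gr r| <= C * (rad * (r * `|Gr r|)).
  rewrite normrM !mulrA ler_wpM2r//; apply: le_trans (bK Dr) _.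
  by rewrite expr2 mulrA ler_wpM2r ?(ltW r0)// ler_wpM2l// ltW.
have h3 : `|kernel_deriv K r * M r| <= 5 * C * r * N.
  rewrite normrM; apply: (@le_trans _ _ (`|kernel_deriv K r| * (N * r ^+ 4))).
    by rewrite ler_wpM2l// absM.
  by rewrite [N * _]mulrC mulrA ler_wpM2r// kk_bound.
apply: le_trans (ler_normD _ _) _.
apply: (@le_trans _ _ (4^-1 * (C * r * `|G r|) + C * (rad * (r * `|Gr r|)) + 3 / 4 * (5 * C * r * N))).
  apply: lerD; last by rewrite normrM ger0_norm// ler_wpM2l.
  apply: le_trans (ler_normD _ _) _; apply: lerD => //.
  by rewrite normrM ger0_norm// ler_wpM2l.
have n1 : 0 <= C * r * `|G r| by rewrite !mulr_ge0// ltW.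
have n2 : 0 <= C * r * N by rewrite !mulr_ge0// ltW.
lra.
Qed.

Lemma integ_slice_deriv i : (i <= 3)%N -> integ mu D (V i).
Proof.
have AN0 : 0 <= A + N * rad by rewrite addr_ge0// mulr_ge0// ltW.
case: i => [|[|[|[|//]]]] _; last first.
- have i1 := integ_norm mD (iXG 0); have i2 := integ_norm mD (iX 0).
  have i3 := integD mD (integD mD (integZ C mD i1) (integZ (C * rad) mD i2)) (integ_cst_oo 0 rad (4 * C * rad * N)).
  apply: (integ_le mD mV3 _ i3) => r Dr; apply: le_trans (bV3 Dr) _; have [r0 rR] := D_lt Dr.
  rewrite !expr1 !normrM !(gtr0_norm r0).
  have n2 : 0 <= (rad - r) * (C * N) by rewrite !mulr_ge0// subr_ge0 ltW.
  move: n2; rewrite -subr_ge0; set a := `|G r|; set b' := `|Gr r| => n2.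
  rewrite -subr_ge0 (_ : _ - _ = 4 * ((rad - r) * (C * N))); last by ring.
  by rewrite mulr_ge0// -[X in 0 <= X]subr0.
- exact: iV2.
- apply: (integ_le mD mV1 _ (integ_cst_oo 0 rad (C * rad ^+ 2 * (A + N * rad)))) => r Dr.
  have [r0 rR] := D_lt Dr; apply: le_trans (bV1 Dr) _.
  by rewrite ler_wpM2r// ler_wpM2l// lerXn2r ?nnegrE ?(ltW r0) ?(ltW rad0) ?(ltW rR).
- apply: (integ_le mD mV0 _ (integ_cst_oo 0 rad (C * rad ^+ 3 * (A + N * rad)))) => r Dr.
  have [r0 rR] := D_lt Dr; apply: le_trans (bV0 Dr) _.
  by rewrite ler_wpM2r// ler_wpM2l// lerXn2r ?nnegrE ?(ltW r0) ?(ltW rad0) ?(ltW rR).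
Qed.

Lemma slice_deriv_bound i (r : R) : (i <= 3)%N -> D r ->
  V i r ^+ 2 * r ^ (2 * (i%:Z - 3)) * r <=
  48 * C ^+ 2 * (1 + rad) ^+ 5 * (A ^+ 2 + N ^+ 2 + (G r ^+ 2 * r + Gr r ^+ 2 * r)).
Proof.
move=> i3 Dr; have [r0 rR] := D_lt Dr; have rn0 : r != 0 by rewrite gt_eqF.
have AN0 : 0 <= A + N * rad by rewrite addr_ge0// mulr_ge0// ltW.
set T := 1 + rad; have T1 : 1 <= T by rewrite lerDl ltW.
have rT : r <= T by rewrite /T; lra.
have radT : rad <= T by rewrite /T; lra.
have T0 : 0 <= T by lra.
set g := `|G r|; set h := `|Gr r|.
have g0 : 0 <= g := normr_ge0 _; have h0 : 0 <= h := normr_ge0 _.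
rewrite -[G r ^+ 2]real_normK ?num_real// -[Gr r ^+ 2]real_normK ?num_real// -/g -/h.
set S := A ^+ 2 + N ^+ 2 + (g ^+ 2 * r + h ^+ 2 * r).
have gr0 : 0 <= g ^+ 2 * r by rewrite mulr_ge0 ?sqr_ge0// ltW.
have hr0 : 0 <= h ^+ 2 * r by rewrite mulr_ge0 ?sqr_ge0// ltW.
have A20 := sqr_ge0 A; have N20 := sqr_ge0 N.
have S0 : 0 <= S by rewrite !addr_ge0.
have C20 := sqr_ge0 C.
have leT m k (x : R) : (m <= k)%N -> 0 <= x -> T ^+ m * x <= T ^+ k * x.
  by move=> mk x0; rewrite ler_wpM2r// ler_weXn2l.
have sq (x y : R) : `|x| <= y -> x ^+ 2 <= y ^+ 2.
  move=> xy; rewrite -[x ^+ 2]real_normK ?num_real// lerXn2r ?nnegrE//.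
  exact: le_trans (normr_ge0 x) xy.
have low (x : R) n : `|x| <= C * r ^+ n * (A + N * rad) -> x ^+ 2 * (r^-1) ^+ (2 * n) * r <=
    48 * C ^+ 2 * T ^+ 5 * S.
  move=> /sq xb; apply: (@le_trans _ _ (C ^+ 2 * (A + N * rad) ^+ 2 * r)).
    rewrite ler_wpM2r ?(ltW r0)// mulnC exprM -exprMn.
    have -> : C ^+ 2 * (A + N * rad) ^+ 2 = (C * r ^+ n * (A + N * rad)) ^+ 2 * ((r^-1) ^+ n) ^+ 2.
      rewrite -!exprMn; congr (_ ^+ 2).
      by rewrite [C * _ * (_ + _)]mulrAC exprVn mulfK ?expf_neq0.
    by rewrite exprMn ler_wpM2r ?sqr_ge0.
  apply: (@le_trans _ _ (C ^+ 2 * (2 * T ^+ 2 * S) * T)); last first.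
    rewrite (_ : _ * T = 2 * C ^+ 2 * (T ^+ 3 * S)); last by ring.
    rewrite (_ : 48 * _ * _ * _ = 48 * C ^+ 2 * (T ^+ 5 * S)); last by ring.
    apply: ler_pM; rewrite ?mulr_ge0 ?exprn_ge0//; first by rewrite ler_wpM2r// ler_nat.
    exact: leT.
  apply: ler_pM; rewrite ?mulr_ge0 ?sqr_ge0 ?(ltW r0)//.
  rewrite ler_wpM2l//; apply: le_trans (sqrD_le _ _) _.
  have r2 : rad ^+ 2 <= T ^+ 2 by rewrite lerXn2r ?nnegrE// ltW.
  have t2 : 1 <= T ^+ 2 by rewrite exprn_ege1.
  have e1 : A ^+ 2 <= T ^+ 2 * A ^+ 2 by rewrite ler_peMl.
  have e2 : rad ^+ 2 * N ^+ 2 <= T ^+ 2 * N ^+ 2 by rewrite ler_wpM2r.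
  have e3 : 0 <= T ^+ 2 * (g ^+ 2 * r + h ^+ 2 * r) by rewrite mulr_ge0 ?exprn_ge0// addr_ge0.
  rewrite exprMn /S; lra.
case: i i3 => [|[|[|[|//]]]] _.
- have -> : r ^ (2 * (0%:Z - 3)) = (r^-1) ^+ (2 * 3) by rewrite exprVn.
  exact: low (bV0 Dr).
- have -> : r ^ (2 * (1%:Z - 3)) = (r^-1) ^+ (2 * 2) by rewrite exprVn.
  exact: low (bV1 Dr).
- have -> : r ^ (2 * (2%:Z - 3)) = (r^-1) ^+ 2 by rewrite exprVn.
  apply: (@le_trans _ _ (C ^+ 2 * (r ^+ 2 * (2 * (g ^+ 2 * r) + 2 * (N ^+ 2 * r))))).
    have -> : C ^+ 2 * (r ^+ 2 * (2 * (g ^+ 2 * r) + 2 * (N ^+ 2 * r))) =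
      C ^+ 2 * (r ^+ 2) ^+ 2 * (2 * g ^+ 2 + 2 * N ^+ 2) * (r^-1) ^+ 2 * r by field.
    rewrite ler_wpM2r ?(ltW r0)// ler_wpM2r ?sqr_ge0//; apply: le_trans (sq _ _ (bV2 Dr)) _.
    rewrite (_ : _ ^+ 2 = C ^+ 2 * (r ^+ 2) ^+ 2 * (g + N) ^+ 2); last by rewrite /g; ring.
    have D2 := sqrD_le g N; have C4 : 0 <= C ^+ 2 * (r ^+ 2) ^+ 2 by rewrite mulr_ge0 ?sqr_ge0.
    exact: ler_wpM2l C4 _ _ D2.
  have q1 : N ^+ 2 * r <= T * N ^+ 2 by rewrite mulrC ler_wpM2r.
  have q2 : g ^+ 2 * r <= T * (g ^+ 2 * r) by rewrite ler_peMl.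
  have q3 : 0 <= T * A ^+ 2 by rewrite mulr_ge0.
  have q4 : 0 <= T * (h ^+ 2 * r) by rewrite mulr_ge0.
  have q5 : 0 <= T * N ^+ 2 by rewrite mulr_ge0.
  have q6 : 0 <= T * (g ^+ 2 * r) by rewrite mulr_ge0.
  rewrite (_ : 48 * _ * _ * _ = C ^+ 2 * (T ^+ 2 * (48 * (T ^+ 3 * S)))); last by ring.
  rewrite ler_wpM2l//; apply: ler_pM; rewrite ?sqr_ge0 ?addr_ge0 ?mulr_ge0 ?(ltW r0)//.
    by rewrite lerXn2r ?nnegrE ?(ltW r0).
  apply: (@le_trans _ _ (48 * (T * S))); first by rewrite /S; lra.
  by rewrite ler_wpM2l//; exact: (leT 1%N).
- have -> : r ^ (2 * (3%:Z - 3)) = 1 by [].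
  rewrite mulr1; apply: (@le_trans _ _ ((C * (r * g + rad * (r * h) + 4 * r * N)) ^+ 2 * r)).
    by rewrite ler_wpM2r ?(ltW r0)//; exact: sq (bV3 Dr).
  apply: (@le_trans _ _ (C ^+ 2 * (r ^+ 2 * (3 * (g ^+ 2 * r) + 3 * (rad ^+ 2 * (h ^+ 2 * r)) + 48 * (N ^+ 2 * r))))).
    rewrite (_ : _ * r = C ^+ 2 * (r ^+ 2 * ((g + rad * h + 4 * N) ^+ 2 * r))); last by ring.
    rewrite ler_wpM2l// ler_wpM2l ?sqr_ge0//.
    rewrite (_ : 3 * _ + _ + _ = (3 * g ^+ 2 + 3 * (rad * h) ^+ 2 + 3 * (4 * N) ^+ 2) * r); last by ring.
    rewrite ler_wpM2r ?(ltW r0)//; set x := rad * h; set y := 4 * N.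
    rewrite -subr_ge0 (_ : _ - _ = (g - x) ^+ 2 + (g - y) ^+ 2 + (x - y) ^+ 2); last by ring.
    by rewrite !addr_ge0 ?sqr_ge0.
  have q1 : N ^+ 2 * r <= T ^+ 2 * N ^+ 2.
    by rewrite mulrC ler_wpM2r//; apply: le_trans rT _; rewrite expr2 ler_peMl.
  have t2 : 1 <= T ^+ 2 by rewrite exprn_ege1.
  have q2 : g ^+ 2 * r <= T ^+ 2 * (g ^+ 2 * r) by rewrite ler_peMl.
  have q3 : 0 <= T ^+ 2 * A ^+ 2 by rewrite mulr_ge0// exprn_ge0.
  have q4 : rad ^+ 2 * (h ^+ 2 * r) <= T ^+ 2 * (h ^+ 2 * r).
    by rewrite ler_wpM2r// lerXn2r ?nnegrE// ltW.
  have q5 : 0 <= T ^+ 2 * (g ^+ 2 * r) by rewrite mulr_ge0// exprn_ge0.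
  have q7 : 0 <= T ^+ 2 * N ^+ 2 by rewrite mulr_ge0// exprn_ge0.
  have q6 : 0 <= T ^+ 2 * (h ^+ 2 * r) by rewrite mulr_ge0// exprn_ge0.
  rewrite (_ : 48 * _ * _ * _ = C ^+ 2 * (T ^+ 2 * (48 * (T ^+ 3 * S)))); last by ring.
  rewrite ler_wpM2l//; apply: ler_pM; rewrite ?sqr_ge0 ?addr_ge0 ?mulr_ge0 ?sqr_ge0 ?(ltW r0) ?(ltW rad0)//.
    by rewrite lerXn2r ?nnegrE ?(ltW r0).
  apply: (@le_trans _ _ (48 * (T ^+ 2 * S))); first by rewrite /S; lra.
  by rewrite ler_wpM2l//; exact: leT.
Qed.

Section Solution.
Variables p psi : R -> R.
Hypotheses (mp : measurable_fun D p) (mpsi : measurable_fun D psi).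
Hypothesis p_ode : {ae mu, forall r, D r -> r ^+ 3 * p r = - \int[mu]_(s in `]0, r[) (s ^+ 3 * G s)}.
Hypothesis psi_tail : {ae mu, forall r, D r -> psi r = - \int[mu]_(t in `]r, rad[) p t}.

Let I r := 3 / r * p r + G r.
Let psi0 := - \int[mu]_(t in D) p t.
Let w r := psi r - psi0 - - \int[mu]_(s in `]0, r[) ((r - s) * I s * (1 + K s)).

Let p_Ih : {ae mu, forall r, D r -> [/\ G r = Gh r,
  p r = 4^-1 * ((r^-1) ^+ 3 * M r) - 4^-1 * (r * G r), I r = Ih r &
  p r = - \int[mu]_(s in `]0, r[) Ih s]}.
Proof.
apply: ae_impl2 G_tail p_ode => r HG Hp Dr; have [r0 rR] := D_lt Dr.
have rn0 : r != 0 by rewrite gt_eqF.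
have E1 : \int[mu]_(s in `]0, r[) (s ^+ 3 * G s) = 4^-1 * r ^+ 4 * Gh r - 4^-1 * M r.
  rewrite -(int_s3Gh Dr); have sub := subD Dr.
  apply: (@ae_eq_Rint _ _ _ mu) => //.
  - exact: measurable_funS mD sub (measurable_funM (@m_pow 0 rad 3) mG).
  - exact: measurable_funS mD sub (measurable_funM (@m_pow 0 rad 3) mGh).
  - by apply: ae_impl G_tail => s Gs /sub Ds; rewrite (Gs Ds).
have E2 : p r = 4^-1 * ((r^-1) ^+ 3 * M r) - 4^-1 * (r * G r).
  apply: (mulfI (_ : r ^+ 3 != 0)); first by rewrite expf_neq0.
  by rewrite (Hp Dr) E1 (HG Dr); field.
have [_ E3] := int_Ih Dr.
split; [exact: HG|exact: E2| |by rewrite E2 E3 (HG Dr) opprB].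
by rewrite /I /Ih E2 (HG Dr); field.
Qed.

Lemma slice_ip : integ mu D p.
Proof.
have i1 : integ mu D (fun r => `|r ^+ 1 * G r| + N * rad).
  exact: integD mD (integ_norm mD (iXG 0)) (integ_cst_oo 0 rad (N * rad)).
apply: (ae_integ_le mD mp i1); apply: ae_impl p_Ih => r H Dr.
have [r0 rR] := D_lt Dr; have [_ -> _ _] := H Dr; have bMr := absM Dr.
have h : `|(r^-1) ^+ 3 * M r| <= N * rad.
  rewrite normrM ger0_norm; last by rewrite exprn_ge0// invr_ge0 ltW.
  apply: (@le_trans _ _ (N * r)); last by rewrite ler_wpM2l// ltW.
  rewrite exprVn mulrC ler_pdivrMr ?exprn_gt0//; apply: le_trans bMr _.
  by rewrite -mulrA -exprS.
apply: le_trans (ler_normB _ _) _; rewrite expr1 2!normrM !normrM ger0_norm// -!normrM.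
have := normr_ge0 (r * G r); rewrite !normrM; have := normr_ge0 (r ^-1 ^+ 3 * M r); rewrite !normrM => n1 n2.
rewrite !normrM in h; lra.
Qed.

Let mI' : measurable_fun D I.
Proof.
apply: measurable_funD mG; apply: measurable_funM mp.
apply: measurable_funM; first exact: measurable_cst.
have : measurable_fun D (fun y : R => (y^-1) ^+ 1) by apply: measurable_invX; exact: lexx.
by apply: eq_measurable_fun => y _; rewrite expr1.
Qed.

Lemma slice_iI (r : R) : D r -> integ mu `]0, r[ I.
Proof.
move=> Dr; have [i1 _] := int_Ih Dr; have sub := subD Dr.
apply: (@ae_eq_integ _ _ _ mu _ _ _ (mI 0 r) (measurable_funS mD sub mI') _ i1).
by apply: ae_impl p_Ih => s Hs /sub Ds; have [_ _ -> _] := Hs Ds.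
Qed.

Lemma slice_ieta (r : R) : D r -> integ mu `]0, r[ (fun s => (r - s) * I s * (1 + K s)).
Proof.
move=> Dr; have sub := subD Dr; have [r0 rR] := D_lt Dr.
have m1 : measurable_fun `]0, r[ (fun s => (r - s) * (1 + K s)).
  apply: measurable_funM.
    by apply: measurable_funB; [exact: measurable_cst|exact: measurable_id].
  by apply: measurable_funD (measurable_funS mD sub mK); exact: measurable_cst.
have i1 := integM_bounded (C := rad * (1 + C * rad ^+ 2)) (mI 0 r) (slice_iI Dr) m1.
apply: (@eq_integ _ _ _ mu _ (fun s => I s * ((r - s) * (1 + K s)))) => //.
  by move=> s _; rewrite mulrCA mulrA.
apply: i1 => s; rewrite /= in_itv/= => /andP[s0 sr]; have sR := lt_trans sr rR.
rewrite normrM; apply: ler_pM => //.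
  by rewrite ger0_norm ?subr_ge0 ?(ltW sr)//; lra.
apply: le_trans (ler_normD _ _) _; rewrite normr1 lerD2l.
have Ds : D s by rewrite /= in_itv/= s0.
apply: le_trans (bK Ds) _; rewrite ler_wpM2l// lerXn2r ?nnegrE ?(ltW s0) ?(ltW rad0) ?(ltW sR)//.
Qed.

Let w_V0 : {ae mu, forall r, D r -> w r = V 0 r}.
Proof.
apply: ae_impl psi_tail => r Hpsi Dr; have sub := subD Dr; have [r0 rR] := D_lt Dr.
have [iIh _] := int_Ih Dr.
have mIhr := measurable_funS mD sub mIh.
have iV2r := sub_integ Dr iV2.
have mrs : measurable_fun `]0, r[ (fun s : R => r - s).
  by apply: measurable_funB; [exact: measurable_cst|exact: measurable_id].
have brs (s : R) : `]0, r[%classic s -> `|r - s| <= r.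
  rewrite /= in_itv/= => /andP[s0 sr]; rewrite ger0_norm ?subr_ge0 ?(ltW sr)//.
  by rewrite gerBl ltW.
have iA : integ mu `]0, r[ (fun s => (r - s) * Ih s).
  apply: (@eq_integ _ _ _ mu _ (fun s => Ih s * (r - s))) => //; first by move=> s _; rewrite mulrC.
  exact: integM_bounded (mI 0 r) iIh mrs brs.
have iB : integ mu `]0, r[ (fun s => (r - s) * V 2 s).
  apply: (@eq_integ _ _ _ mu _ (fun s => V 2 s * (r - s))) => //; first by move=> s _; rewrite mulrC.
  exact: integM_bounded (mI 0 r) iV2r mrs brs.
have E1 : psi r - psi0 = - \int[mu]_(s in `]0, r[) ((r - s) * Ih s).
  rewrite (Hpsi Dr) /psi0 opprK (Rint_split (ltW r0) (ltW rR) slice_ip) addrC addrK.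
  rewrite -(iterated_primitive r0 iIh).
  have mm := measurable_primitive1 mIhr.
  have -> : \int[mu]_(t in `]0, r[) p t = \int[mu]_(t in `]0, r[) (- 1 * \int[mu]_(s in `]0, t[) Ih s).
    apply: (@ae_eq_Rint _ _ _ mu) => //.
    - exact: measurable_funS mD sub mp.
    - exact: measurable_funM (measurable_cst _) mm.
    - by apply: ae_impl p_Ih => s Hs /sub Ds; have [_ _ _ ->] := Hs Ds; rewrite mulN1r.
  by rewrite (@RintZl _ _ _ mu _ _ _ (mI 0 r) mm) mulN1r.
have E2 : \int[mu]_(s in `]0, r[) ((r - s) * I s * (1 + K s)) =
    \int[mu]_(s in `]0, r[) ((r - s) * Ih s) + \int[mu]_(s in `]0, r[) ((r - s) * V 2 s).
  rewrite -(RintegralD (mI 0 r) iA iB); apply: (@ae_eq_Rint _ _ _ mu) => //.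
  - exact: integ_measurable (slice_ieta Dr).
  - exact: integ_measurable (integD (mI 0 r) iA iB).
  - apply: ae_impl p_Ih => s Hs /sub Ds; have [E _ -> _] := Hs Ds.
    by rewrite /= /slice_deriv2 E /Ih; ring.
by rewrite /w E1 E2 opprK addKr /= (iterated_primitive r0 iV2r).
Qed.

Let mw : measurable_fun D w.
Proof.
have mJ (f : R -> R) : measurable_fun D f -> measurable_fun D (fun s => f s * I s * (1 + K s)).
  move=> mf; apply: measurable_funM; first exact: measurable_funM mf mI'.
  by apply: measurable_funD mK; exact: measurable_cst.
have m1 := measurable_primitive1 (mJ _ (measurable_cst (1 : R))).
have m2 := measurable_primitive1 (mJ _ (@measurable_id _ _ D)).
have mh : measurable_fun D (fun r : R => psi r - psi0 - - (r * \int[mu]_(s in `]0, r[) (1 * I s * (1 + K s))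
    - \int[mu]_(s in `]0, r[) (s * I s * (1 + K s)))).
  apply: measurable_funB; first by apply: measurable_funB mpsi _; exact: measurable_cst.
  apply: measurableT_comp => //; apply: measurable_funB m2.
  exact: measurable_funM (@measurable_id _ _ D) m1.
apply: eq_measurable_fun mh => r; rewrite inE => Dr; congr (_ - - _).
have sub := subD Dr; have [r0 rR] := D_lt Dr.
have i1 : integ mu `]0, r[ (fun s => 1 * I s * (1 + K s)).
  have b1 (s : R) : `]0, r[%classic s -> `|1 + K s| <= 1 + C * rad ^+ 2.
    move=> /sub Ds; have [s0 sR] := D_lt Ds.
    apply: le_trans (ler_normD _ _) _; rewrite normr1 lerD2l; apply: le_trans (bK Ds) _.
    by rewrite ler_wpM2l// lerXn2r ?nnegrE ?(ltW s0) ?(ltW rad0) ?(ltW sR).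
  have m3 : measurable_fun `]0, r[ (fun s => 1 + K s).
    by apply: measurable_funD (measurable_funS mD sub mK); exact: measurable_cst.
  apply: (@eq_integ _ _ _ mu _ (fun s => I s * (1 + K s))) => //; first by move=> s _; rewrite mul1r.
  exact: integM_bounded (mI 0 r) (slice_iI Dr) m3 b1.
have i2 : integ mu `]0, r[ (fun s => r * (1 * I s * (1 + K s))) := integZ r (mI 0 r) i1.
have i3 : integ mu `]0, r[ (fun s => s * I s * (1 + K s)).
  apply: (@eq_integ _ _ _ mu _ (fun s => r * (1 * I s * (1 + K s)) - (r - s) * I s * (1 + K s))) => //.
    by move=> s _; ring.
  exact: integB (mI 0 r) i2 (slice_ieta Dr).
rewrite -(RintegralZl _ (mI 0 r) i1) -(RintegralB (mI 0 r) i2 i3); apply: eq_Rintegral => s _; ring.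
Qed.

Lemma slice_weak_deriv i : (i <= 3)%N -> weak_deriv1 D i w (V i).
Proof.
move: i; apply: (weak_deriv1_chain mw integ_slice_deriv w_V0).
case=> [|[|[|//]]] _; [|  |exact: V2_primitive].
- by apply/nearW => r Dr.
- by apply/nearW => r Dr.
Qed.

End Solution.

End Moment.

End Source.

Lemma slice_estimate (G Gr p psi : R -> R) (b : R) :
  measurable_fun D G -> measurable_fun D Gr -> measurable_fun D p -> measurable_fun D psi ->
  integ mu D (fun r => G r ^+ 2 * r) -> integ mu D (fun r => Gr r ^+ 2 * r) ->
  {ae mu, forall r, D r -> G r = b - \int[mu]_(t in `]r, rad[) Gr t} ->
  {ae mu, forall r, D r -> r ^+ 3 * p r = - \int[mu]_(s in `]0, r[) (s ^+ 3 * G s)} ->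
  {ae mu, forall r, D r -> psi r = - \int[mu]_(t in `]r, rad[) p t} ->
  [/\ integ mu D p,
    forall r, D r -> integ mu `]0, r[ (fun s => (r - s) * (3 / s * p s + G s) * (1 + K s)),
    forall i, (i <= 3)%N -> weak_deriv1 D i (fun r => psi r - - (\int[mu]_(t in D) p t) -
      - \int[mu]_(s in `]0, r[) ((r - s) * (3 / s * p s + G s) * (1 + K s))) (slice_deriv K G Gr i) &
    forall i r, (i <= 3)%N -> D r -> slice_deriv K G Gr i r ^+ 2 * r ^ (2 * (i%:Z - 3)) * r <=
      48 * C ^+ 2 * (1 + rad) ^+ 5 * (\int[mu]_(s in D) (G s ^+ 2 * s) +
        \int[mu]_(s in D) (Gr s ^+ 2 * s) + (G r ^+ 2 * r + Gr r ^+ 2 * r))].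
Proof.
move=> mG mGr mp mpsi iG iGr HG Hp Hpsi.
have [N [N2 N0] bM] := moment_bound 3 mGr iGr.
have [A [A2 A0] bA] := moment_bound 0 mG iG.
split.
- exact: (@slice_ip G Gr b mG mGr iG iGr HG N N0 bM p mp Hp).
- exact: (@slice_ieta G Gr b mG mGr iGr HG N N0 bM p mp Hp).
- exact: (@slice_weak_deriv G Gr b mG mGr iG iGr HG N N0 bM A A0 bA p psi mp mpsi Hp Hpsi).
- move=> i r i3 Dr; rewrite -A2 -N2.
  exact: (@slice_deriv_bound G Gr mG mGr iG iGr N N0 bM A A0 bA i r i3 Dr).
Qed.

End Slice.

(** * Corrector bounds and the integrated estimate *)

Section Corrector.
Context {R : realType}.

Lemma bounded_near_zero_itv (f : R -> R) (l d : R) : 0 < d ->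
  (forall r : R, 0 < r -> {for r, continuous f}) -> f r @[r --> 0^'+] --> l ->
  exists2 M, 0 <= M & forall r, 0 < r <= d -> `|f r| <= M.
Proof.
move=> d0 cf fl; pose g (r : R) := if 0 < r then f r else l.
have gf (r : R) : 0 < r -> \forall s \near r, f s = g s.
  by move=> r0; near=> s; rewrite /g ifT//; near: s; exact: lt_nbhsr.
have cg : {within `[0, d], continuous g}.
  apply/(continuous_within_itvP _ d0); split.
  - move=> r; rewrite in_itv/= => /andP[r0 _].
    apply: (cvg_trans (near_eq_cvg (gf r r0))).
    by rewrite /g r0; exact: cf.
  - rewrite {2}/g ltxx; apply: cvg_trans fl; apply: near_eq_cvg.
    by near=> s; rewrite /g ifT//; near: s; exact: nbhs_right_gt.
  - apply: cvg_at_left_filter; apply: (cvg_trans (near_eq_cvg (gf d d0))).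
    by rewrite /g d0; exact: cf.
have cn : {within `[0, d], continuous (fun r => `|g r|)}.
  by move=> r; apply: cvg_norm; exact: cg.
have [c _ Hc] := EVT_max (ltW d0) cn.
exists `|g c| => // r /andP[r0 rd].
by have := Hc r; rewrite /g r0; apply; rewrite in_itv/= (ltW r0).
Unshelve. all: by end_near.
Qed.

(* The mean value theorem on [r, 2 r] gives points arbitrarily close to 0 where the
   derivative is small, and a bounded second derivative propagates the smallness. *)
Lemma quadratic_corrector_bounds (K : R -> R) (c0 rad : R) : 0 < rad ->
  smooth_halfline K -> K r / r ^+ 2 @[r --> 0^'+] --> c0 ->
  exists C, [/\ 0 <= C,
    forall r : R, 0 < r -> is_derive r 1 K (derive1 K r),
    forall r : R, 0 < r -> {for r, continuous (derive1 K)},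
    forall r : R, 0 < r < rad -> `|K r| <= C * r ^+ 2 &
    forall r : R, 0 < r < rad -> `|derive1 K r| <= C * r].
Proof.
move=> rad0 [_ sK] Kc0.
have dK n (r : R) : 0 < r -> is_derive r 1 (derive1n n K) (derive1n n.+1 K r).
  move=> r0; have := (sK n).1 r r0 => /derivableP.
  by rewrite -derive1E.
have cK n (r : R) : 0 < r -> {for r, continuous (derive1n n K)}.
  by move=> r0; apply: differentiable_continuous; apply/derivable1_diffP; exact: (sK n).1.
have cq (r : R) : 0 < r -> {for r, continuous (fun r => K r / r ^+ 2)}.
  move=> r0; apply: cvgM; first exact: (cK 0).
  apply: cvgV; first by rewrite expf_neq0// gt_eqF.
  exact: exprn_continuous.
have [C C0 HC] := bounded_near_zero_itv rad0 cq Kc0.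
have [l2 Hl2] := (sK 2).2.
have [M M0 HM] := bounded_near_zero_itv rad0 (cK 2) Hl2.
have bK (r : R) : 0 < r < rad -> `|K r| <= C * r ^+ 2.
  move=> /andP[r0 rr]; have := HC r; rewrite r0 (ltW rr) => /(_ isT).
  by rewrite normrM normfV [X in _ / X]gtr0_norm ?exprn_gt0// ler_pdivrMr ?exprn_gt0.
have mvt n (s t : R) : 0 < s -> s < t -> exists2 x, s < x < t &
    derive1n n K t - derive1n n K s = derive1n n.+1 K x * (t - s).
  move=> s0 st; have := @MVT _ (derive1n n K) (derive1n n.+1 K) s t st.
  case.
  - by move=> x; rewrite in_itv/= => /andP[sx _]; apply: dK; exact: lt_trans s0 sx.
  - apply: continuous_in_subspaceT => x; rewrite inE /= in_itv/= => /andP[sx _].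
    by apply: cK; exact: lt_le_trans s0 sx.
  - by move=> x; rewrite in_itv/= => xst E; exists x.
exists (5 * C + M); split.
- by rewrite addr_ge0// mulr_ge0.
- exact: (dK 0).
- exact: (cK 1).
- move=> r rr; apply: le_trans (bK r rr) _; rewrite ler_wpM2r ?sqr_ge0//; lra.
- move=> r /andP[r0 rr]; have h0 : 0 < r / 2 by rewrite divr_gt0.
  have hr : r / 2 < r by rewrite ltr_pdivrMr// ltr_pMr// ltr1n.
  have [x /andP[hx xr] E] := mvt 0%N _ _ h0 hr.
  have x0 := lt_trans h0 hx.
  have b1 : `|derive1 K x| * (r / 2) <= C * r ^+ 2 + C * (r / 2) ^+ 2.
    have e : r / 2 = `|r - r / 2| by rewrite gtr0_norm ?subr_gt0//; field.
    rewrite [X in _ * X <= _]e -normrM -E; apply: le_trans (ler_normB _ _) _.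
    by apply: lerD; apply: bK; rewrite ?r0 ?h0//= (lt_trans hr).
  have b1' : `|derive1 K x| <= 5 / 2 * C * r.
    rewrite -(ler_pM2r h0); apply: le_trans b1 _.
    lra.
  have [y /andP[xy yr] E2] := mvt 1%N _ _ x0 xr.
  have b2 : `|derive1 K r - derive1 K x| <= M * r.
    rewrite [_ - _]E2 normrM [`|r - x|]gtr0_norm ?subr_gt0//.
    have yM : `|derive1n 2 K y| <= M by apply: HM; rewrite (lt_trans x0 xy)/= ltW// (lt_trans yr).
    by apply: ler_pM yM _; rewrite ?subr_ge0 ?(ltW xr)//; lra.
  have t : `|derive1 K r| <= `|derive1 K x| + `|derive1 K r - derive1 K x|.
    by rewrite -{1}(subrK (derive1 K x) (derive1 K r)) addrC ler_normD.
  have Cr : 0 <= C * r by rewrite mulr_ge0// ltW.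
  lra.
Qed.

End Corrector.

Section Assembly.
Context {R : realType}.
Variables (rad a : R).
Hypothesis rad0 : 0 < rad.
Local Notation mu := (@lebesgue_measure R).
Local Notation leb2 := (mu \x mu)%E.
Local Notation integ m D f := (m.-integrable D (EFin \o f)).
Local Notation D := (`]0, rad[%classic : set (measurableTypeR R)).
Local Notation E := (`](- a), a[%classic : set (measurableTypeR R)).
Let mD : measurable D. Proof. exact: measurable_itv. Qed.
Let mE : measurable E. Proof. exact: measurable_itv. Qed.
Let mDE : measurable (D `*` E). Proof. exact: measurableX. Qed.

Lemma measurable_tonelli_slice (f : R * R -> R) : measurable_fun (D `*` E) f ->
  (forall x, (D `*` E) x -> 0 <= f x) ->
  measurable_fun E (fun z => \int[mu]_(r in D) (f (r, z))%:E)%E.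
Proof.
move=> mf f0; have mp := (measurable_restrictT _ mDE).1 mf.
have := @measurable_fun_fubini_tonelli_G _ _ _ _ R mu
  (fun x => `|(f \_ (D `*` E)) x|%:E) _ (fun x => normr_ge0 _).
move=> H; apply: eq_measurable_fun (measurable_funTS (H _)) => [z /set_mem Ez|].
  rewrite /fubini_G [RHS]integral_mkcond; apply: eq_integral => r _.
  rewrite patch_setX_slice !patchE; case: ifPn => rD; last by rewrite normr0.
  by rewrite mem_set// ger0_norm// f0//; split => //; exact: set_mem rD.
by apply/measurable_EFinP; exact: measurableT_comp.
Qed.

Section SliceDeriv.
Variables (K : R -> R) (G Gr : R * R -> R).
Hypotheses (mK : measurable_fun D K) (mK1 : measurable_fun D (derive1 K))
  (mG : measurable_fun (D `*` E) G) (mGr : measurable_fun (D `*` E) Gr).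

Definition slice_deriv_field i (x : R * R) : R :=
  slice_deriv K (fun s => G (s, x.2)) (fun s => Gr (s, x.2)) i x.1.

Let mfst (f : R -> R) : measurable_fun D f -> measurable_fun (D `*` E) (fun x => f x.1).
Proof. exact: measurable_comp_fst. Qed.

Let minv n : measurable_fun D (fun r : R => (r^-1) ^+ n).
Proof. by apply: measurable_invX; exact: lexx. Qed.

Lemma measurable_slice_deriv_field i : (i <= 3)%N ->
  measurable_fun (D `*` E) (slice_deriv_field i).
Proof.
have mM : measurable_fun (D `*` E) (head_int (fun x => x.1 ^+ 4 * Gr x)).
  apply: measurable_head_int; apply: measurable_funM mGr.
  apply: (mfst (f := fun r => r ^+ 4)).
  by apply: measurable_funX; exact: measurable_id.
have mc (k : R) (f : R * R -> R) : measurable_fun (D `*` E) f -> measurable_fun (D `*` E) (fun x => k * f x).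
  by move=> mf; exact: measurable_funM (measurable_cst k) mf.
pose W2 (x : R * R) := K x.1 * (4^-1 * G x + 3 / 4 * ((x.1^-1) ^+ 4 * head_int (fun x => x.1 ^+ 4 * Gr x) x)).
have mW2 : measurable_fun (D `*` E) W2.
  apply: measurable_funM (mfst mK) _; apply: measurable_funD (mc _ _ mG) (mc _ _ _).
  exact: measurable_funM (mfst (minv 4)) mM.
case: i => [|[|[|[|//]]]] _.
- exact: measurable_head_int (measurable_head_int mW2).
- exact: measurable_head_int mW2.
- by apply: eq_measurable_fun mW2 => -[r z].
- have mkk : measurable_fun D (kernel_deriv K).
    apply: measurable_funB; first exact: measurable_funM mK1 (minv 4).
    apply: measurable_funM _ (minv 5).
    exact: measurable_funM (measurable_cst (4 : R)) mK.
  have m3 : measurable_fun (D `*` E) (fun x => 4^-1 * (derive1 K x.1 * G x) + K x.1 * Gr x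
      + 3 / 4 * (kernel_deriv K x.1 * head_int (fun x => x.1 ^+ 4 * Gr x) x)).
    apply: measurable_funD (mc _ _ (measurable_funM (mfst mkk) mM)).
    exact: measurable_funD (mc _ _ (measurable_funM (mfst mK1) mG)) (measurable_funM (mfst mK) mGr).
  by apply: eq_measurable_fun m3 => -[r z].
Qed.

End SliceDeriv.

Lemma measurable_exprz (m : int) : measurable_fun D (fun r : R => r ^ m).
Proof.
case: m => n; first by apply: measurable_funX; exact: measurable_id.
have h : measurable_fun D (fun r : R => (r^-1) ^+ n.+1) by apply: measurable_invX; exact: lexx.
by apply: eq_measurable_fun h => r _; rewrite exprVn.
Qed.

Let H30_integrand (V : nat -> R * R -> R) i (x : R * R) : R :=
  (V i x) ^+ 2 * x.1 ^ (2 * (i%:Z - 3)) * x.1.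

Let H30_integrand_ge0 V i x : (D `*` E) x -> 0 <= H30_integrand V i x.
Proof.
move=> [Dx _]; move: Dx; rewrite /= in_itv/= => /andP[x0 _].
by apply: mulr_ge0 (ltW x0); apply: mulr_ge0 (sqr_ge0 _) (exprz_ge0 _ (ltW x0)).
Qed.

Let measurable_H30_integrand V i : measurable_fun (D `*` E) (V i) ->
  measurable_fun (D `*` E) (H30_integrand V i).
Proof.
move=> mV; apply: measurable_funM.
  apply: measurable_funM; first exact: measurable_funX.
  exact: (measurable_comp_fst (f := fun r => r ^ (2 * (i%:Z - 3))) (measurable_exprz _)).
by apply: (measurable_comp_fst (f := id)); exact: measurable_id.
Qed.

Lemma integral_H30sq_le (V : nat -> R * R -> R) (Q : R) (g : R * R -> R) :
  0 <= Q -> (forall i, (i <= 3)%N -> measurable_fun (D `*` E) (V i)) ->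
  integ leb2 (D `*` E) g -> (forall x, (D `*` E) x -> 0 <= g x) ->
  {ae mu, forall z, E z -> forall i r, (i <= 3)%N -> D r ->
    (V i (r, z)) ^+ 2 * r ^ (2 * (i%:Z - 3)) * r <=
    Q * (\int[mu]_(s in D) g (s, z) + g (r, z))} ->
  (\int[mu]_(z in E) H30sq rad (fun i r => V i (r, z)) <=
   (4 * Q * (rad + 1) * \int[leb2]_(x in D `*` E) g x)%:E)%E.
Proof.
move=> Q0 mV ig g0 bV; have [gz igz ->] := fubini_setX_z mD mE ig.
have mH i : (i <= 3)%N -> measurable_fun (D `*` E) (H30_integrand V i).
  by move=> i3; exact: measurable_H30_integrand (mV i i3).
have iB := integZ (4 * Q * (rad + 1)) mE igz.
rewrite -(RintegralZl _ mE igz) (EFin_Rint mE iB).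
have Sg0 z : E z -> 0 <= \int[mu]_(r in D) g (r, z).
  by move=> Ez; apply: Rintegral_ge0 => r Dr; exact: g0.
apply: ae_ge0_le_integral => //.
- move=> z Ez; apply: sume_ge0 => i _; apply: integral_ge0 => r Dr; rewrite lee_fin.
  exact: (@H30_integrand_ge0 V i (r, z)).
- apply: emeasurable_sum => i _; apply: (measurable_tonelli_slice (f := H30_integrand V i)).
    by apply: mH; rewrite -ltnS.
  by move=> x; exact: H30_integrand_ge0.
  by [].
- by move=> z Ez; rewrite lee_fin !mulr_ge0 ?Sg0// addr_ge0// ltW.
- exact/measurable_EFinP/integ_measurable/iB.
- apply: ae_impl2 bV gz => z H1 H2 Ez; have ib := H2 Ez; have bz := H1 Ez.
  set S := \int[mu]_(s in D) g (s, z).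
  have i1 := integD mD (integ_cst_oo 0 rad S) ib; have i2 := integZ Q mD i1.
  have term (i : 'I_4) : (\int[mu]_(r in D) (V i (r, z) ^+ 2 * r ^ (2 * (i%:Z - 3)) * r)%:E <=
      (Q * ((rad + 1) * S))%:E)%E.
    apply: (@le_trans _ _ (\int[mu]_(r in D) (Q * (S + g (r, z)))%:E)%E).
      apply: ge0_le_integral => //.
      - by move=> r Dr; rewrite lee_fin; exact: (@H30_integrand_ge0 V i (r, z)).
      - apply/measurable_EFinP; have := mH i; rewrite -ltnS => /(_ (ltn_ord i)) mHi.
        exact: (measurable_slice_z mD mE mHi Ez).
      - exact/measurable_EFinP/integ_measurable/i2.
      - by move=> r Dr; rewrite lee_fin; apply: bz => //; rewrite -ltnS.
    rewrite -(EFin_Rint mD i2) lee_fin (RintegralZl _ mD i1) (RintegralD mD (integ_cst_oo 0 rad S) ib).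
    rewrite (Rint_cst_oo _ (ltW rad0)) subr0 -/S le_eqVlt; apply/orP; left; apply/eqP; ring.
  apply: le_trans (lee_sum _ (fun i _ => term i)) _.
  rewrite sumEFin lee_fin sumr_const card_ord -mulr_natl le_eqVlt; apply/orP; left; apply/eqP; ring.
Qed.

End Assembly.

Theorem theorem4 (R : realType) (a rad : R) (ha : 0 < a) (hrad : 0 < rad)
    (K : R -> R) (c0 : R)
    (hKsmooth : smooth_halfline K)
    (hKsupp : exists M : R, forall r : R, M <= r -> K r = 0)
    (hK0 : K r / r ^+ 2 @[r --> 0^'+] --> c0) :
  exists c : R,
    forall omega omegar omegaz psi psir psiz : R * R -> R,
      in_H1 rad a omega omegar omegaz ->
      zero_trace rad a (L2sq_S2 rad a) omega omegar omegaz ->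
      weak_solution rad a omega psi psir psiz ->
      exists (psizz psizzz psizzr : R * R -> R) (psi0 : R -> R)
             (V : nat -> R * R -> R),
        [/\ weak_deriv2 (rect rad a) [:: ez; ez] psi psizz,
            weak_deriv2 (rect rad a) [:: ez; ez; ez] psi psizzz &
            weak_deriv2 (rect rad a) [:: ez; ez; er] psi psizzr] /\
        [/\ axis_restriction rad a psi psi0,
            eta_well_defined rad a K omega psir psizz,
            weak_r_derivs3 rad a
              (fun x => psi x - psi0 x.2 - eta_fun K omega psir psizz x) V &
            (\int[mu1]_(z in `](- a)%R, a[) H30sq rad (fun i r => V i (r, z))
             + (L2sq rad a psizzz + L2sq rad a psizzr + L2sq rad a psizz)
             <= c%:E * H1sq rad a omega omegar omegaz)%E].
Proof.
have [C [C0 dK cK1 bK bK1]] := quadratic_corrector_bounds hrad hKsmooth hK0.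
pose Q := 48 * C ^+ 2 * (1 + rad) ^+ 5; pose P := 4 * Q * (rad + 1).
have R1 : 0 <= rad + 1 by rewrite addr_ge0// ltW.
have Q0 : 0 <= Q.
  by apply: mulr_ge0; [exact: mulr_ge0 (ler0n _ _) (sqr_ge0 C)|rewrite addrC; exact: exprn_ge0].
have P0 : 0 <= P by apply: mulr_ge0 R1; exact: mulr_ge0 (ler0n _ _) Q0.
exists (6 * P + 4) => om omr omz psi psir psiz H1om trom ws.
have [F1 [F2 [F3 [[L1 L2 L3] [W1 W2 W3] [N1 N2 N3] [T1 T2 T3]]]]] := regularity ha hrad H1om trom ws.
have [b Tom] := H1_radial_tail hrad H1om trom (@L2sq_S2_ge0 R rad a).
have [Lom Lomr Lomz _ _] := H1om; have [[Lpsi Lpsir _ _ _] _ _] := ws.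
pose mu := @lebesgue_measure R.
pose D : set (measurableTypeR R) := `]0, rad[%classic.
pose E : set (measurableTypeR R) := `](- a), a[%classic.
have mD : measurable D by exact: measurable_itv.
have mE : measurable E by exact: measurable_itv.
have mDE : measurable (D `*` E) by exact: measurableX.
have D_lt (r : R) : D r -> 0 < r < rad by rewrite /D /= in_itv.
pose G x := 1 * F1 x + 1 * om x; pose Gr x := 1 * F3 x + 1 * omr x.
have [LG NG] := nrm2_lin 1 1 L1 Lom; have [LGr NGr] := nrm2_lin 1 1 L3 Lomr.
rewrite -/G -/Gr in LG NG LGr NGr.
have mslice (u : R * R -> R) z : measurable_fun (D `*` E) u -> E z -> measurable_fun D (fun r => u (r, z)).
  by move=> mu_ Ez; exact: measurable_slice_z mD mE mu_ Ez.
pose V := slice_deriv_field K G Gr; pose psi0 z := - \int[mu]_(t in D) psir (t, z).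
have good : {ae mu, forall z, E z -> [/\ mu.-integrable D (EFin \o (fun t => psir (t, z))),
    {ae mu, forall r, D r -> psi (r, z) = - \int[mu]_(t in `]r, rad[) psir (t, z)},
    forall r, D r -> mu.-integrable `]0, r[ (EFin \o eta_integrand K om psir F1 r z),
    forall i, (i <= 3)%N -> weak_deriv1 D i
      (fun r => psi (r, z) - psi0 z - eta_fun K om psir F1 (r, z)) (fun r => V i (r, z)) &
    forall i r, (i <= 3)%N -> D r -> V i (r, z) ^+ 2 * r ^ (2 * (i%:Z - 3)) * r <=
      Q * (\int[mu]_(s in D) (G (s, z) ^+ 2 * s) + \int[mu]_(s in D) (Gr (s, z) ^+ 2 * s) +
        (G (r, z) ^+ 2 * r + Gr (r, z) ^+ 2 * r))]}.
  have S1 := ae_impl2 (fun z A B => conj A B) (in_L2_slice_z LG) (in_L2_slice_z LGr).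
  have S2 := ae_impl2 (fun z A B => conj A B) (in_L2_slice_z L3) (in_L2_slice_z Lomr).
  have S3 := ae_impl2 (fun z A B => conj A B) Tom (ae_prod_z T1).
  have S4 := ae_impl2 (fun z A B => conj A B) (ae_prod_z T2) (ae_prod_z T3).
  have S5 := ae_impl2 (fun z A B => conj A B) S1 S2.
  apply: ae_impl3 S3 S4 S5 => z [B1 B2] [B3 B4] [[B5 B6] [B7 B8]] Ez.
  have Gtail : {ae mu, forall r, D r -> G (r, z) = b z - \int[mu]_(t in `]r, rad[) Gr (t, z)}.
    apply: ae_impl2 (B1 Ez) (B3 Ez) => r E1 E3 Dr.
    have [i3 _] := tail_int_slice hrad (mslice _ _ L3.1 Ez) (B7 Ez) Dr.
    have [ir _] := tail_int_slice hrad (mslice _ _ Lomr.1 Ez) (B8 Ez) Dr.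
    have mI : measurable (`]r, rad[%classic : set (measurableTypeR R)) by exact: measurable_itv.
    have E0 : \int[mu]_(t in `]r, rad[) Gr (t, z) = tail_int rad F3 (r, z) + tail_int rad omr (r, z).
      rewrite -(RintegralD mI i3 ir); apply: eq_Rintegral => t _.
      by rewrite /Gr !mul1r.
    by rewrite E0 /G !mul1r (E1 Dr) (E3 _) //; ring.
  have Hp : {ae mu, forall r, D r -> r ^+ 3 * psir (r, z) = - \int[mu]_(s in `]0, r[) (s ^+ 3 * G (s, z))}.
    apply: ae_impl (B4 Ez) => r E4 Dr; rewrite (E4 Dr); congr (- _).
    by apply: eq_Rintegral => s _; rewrite /G !mul1r.
  have [q1 q2 q3 q4] := slice_estimate hrad C0 dK cK1 (fun r Dr => bK r (D_lt r Dr))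
    (fun r Dr => bK1 r (D_lt r Dr)) (mslice _ _ LG.1 Ez) (mslice _ _ LGr.1 Ez)
    (mslice _ _ Lpsir.1 Ez) (mslice _ _ Lpsi.1 Ez) (B5 Ez) (B6 Ez) Gtail Hp (B2 Ez).
  have EI r : eta_integrand K om psir F1 r z =
      fun s => (r - s) * (3 / s * psir (s, z) + G (s, z)) * (1 + K s).
    by apply/funext => s; rewrite /eta_integrand /G !mul1r addrA.
  split; [exact: q1|exact: B2 Ez| | |exact: q4].
  - by move=> r Dr; rewrite EI; exact: q2.
  - move=> i i3; rewrite [X in weak_deriv1 _ _ X _](_ : _ = fun r => psi (r, z) - psi0 z -
        - \int[mu]_(s in `]0, r[) ((r - s) * (3 / s * psir (s, z) + G (s, z)) * (1 + K s))).
      exact: q3.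
    by apply/funext => r; rewrite /eta_fun EI.
exists F1, F2, F3, psi0, V; split; first by split.
have KD : measurable_fun D K.
  apply: measurable_continuous_pos => // r r0.
  by apply: differentiable_continuous; apply/derivable1_diffP; case: (dK r r0).
have K1D : measurable_fun D (derive1 K) by exact: measurable_continuous_pos.
have mV i : (i <= 3)%N -> measurable_fun (D `*` E) (V i).
  by move=> i3; exact: (measurable_slice_deriv_field KD K1D LG.1 LGr.1 i3).
split.
- apply: ae_impl good => z H Ez; have [q1 q2 _ _ _] := H Ez.
  exists (fun r => - \int[mu]_(t in `]r, rad[) psir (t, z)); split => //.
    exact: continuous_tail hrad q1.
  by apply: ae_impl q2 => r Hr Dr; rewrite Hr.
- by apply: ae_impl good => z H Ez r rr; have [_ _ q _ _] := H Ez; apply: q; rewrite /D /= in_itv.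
- split; first exact: mV.
  by apply: ae_impl good => z H Ez; have [_ _ _ q _] := H Ez.
have iG := in_L2_integ LG; have iGr := in_L2_integ LGr.
have ig := integD mDE iG iGr.
have g0 x : (D `*` E) x -> 0 <= G x ^+ 2 * x.1 + Gr x ^+ 2 * x.1.
  by move=> [/D_lt/andP[/ltW x0 _] _]; apply: addr_ge0; apply: mulr_ge0 x0; exact: sqr_ge0.
have h1 := integral_H30sq_le hrad Q0 mV ig g0.
have h2 : {ae mu, forall z, E z -> forall i r, (i <= 3)%N -> D r ->
    (V i (r, z)) ^+ 2 * r ^ (2 * (i%:Z - 3)) * r <=
    Q * (\int[mu]_(s in D) (G (s, z) ^+ 2 * s + Gr (s, z) ^+ 2 * s) + (G (r, z) ^+ 2 * r + Gr (r, z) ^+ 2 * r))}.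
  apply: ae_impl3 good (in_L2_slice_z LG) (in_L2_slice_z LGr) => z H HG HGr Ez i r i3 Dr.
  by have [_ _ _ _ q] := H Ez; rewrite (RintegralD mD (HG Ez) (HGr Ez)); exact: q.
have {h1 h2} := h1 h2; rewrite (RintegralD mDE iG iGr) -/(nrm2 rad a G) -/(nrm2 rad a Gr) => h.
rewrite /H1sq (L2sqE L1) (L2sqE L2) (L2sqE L3) (L2sqE Lom) (L2sqE Lomr) (L2sqE Lomz).
rewrite -!EFinD -EFinM; apply: le_trans (leeD2r _ h) _; rewrite -EFinD lee_fin -/P.
have o0 : 0 <= nrm2 rad a om by exact: nrm2_ge0.
have r0 : 0 <= nrm2 rad a omr by exact: nrm2_ge0.
have z0 : 0 <= nrm2 rad a omz by exact: nrm2_ge0.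
move: o0 r0 z0 N1 N2 N3 NG NGr.
move: (nrm2 rad a om) (nrm2 rad a omr) (nrm2 rad a omz) (nrm2 rad a F1) (nrm2 rad a F2)
  (nrm2 rad a F3) (nrm2 rad a G) (nrm2 rad a Gr) => n nr nz n1 n2 n3 g gr o0 r0 z0 N1 N2 N3 NG NGr.
have k : g + gr <= 6 * (n + nr + nz) by clear -o0 r0 z0 N1 N3 NG NGr; lra.
have {}k := ler_wpM2l P0 k; clear -o0 r0 z0 N1 N2 N3 k; lra.
Qed.
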